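(* Up to homothety, the flat metric and the Simanca metric are the only radial projectively induced Kähler metrics with $a_1=a_3=0$. That is: (i) the flat metric on $\mathbb{C}^n$ (for every $n\ge1$) and the Simanca metric $g_S$ on $\mathbb{C}^2\setminus\{0\}$ are radial, projectively induced, and satisfy $a_1=a_3=0$; (ii) conversely, if $U\subset\mathbb{C}^n$ is a connected open set and $g$ is a radial, projectively induced Kähler metric on $U$ whose first and third Tian–Yau–Zelditch coefficients vanish identically, $a_1=a_3=0$, then either $g$ is flat, or $n=2$ and $g$ is, up to homothety, the Simanca metric, i.e. $0\notin U$ and there are constants $c,\alpha>0$ such that $c\,g$ is the restriction to $U$ of the pull-back of $g_S$ under $z\mapsto\alpha z$.
   Context: A Kähler metric $g$ on a connected open set $U\subset\mathbb{C}^n$ with coordinates $z=(z_1,\dots,z_n)$ is called radial if it admits a (smooth) Kähler potential $\Phi:U\to\mathbb{R}$ depending only on $|z|^2=|z_1|^2+\cdots+|z_n|^2$. Its Kähler form is $\omega=\frac{i}{2}\partial\bar\partial\Phi$ and $g_{i\bar j}=\frac{\partial^2\Phi}{\partial z_i\partial\bar z_j}$ (positive definite Hermitian matrix). The flat metric on $\mathbb{C}^n$ is the one with potential $|z|^2$. The Simanca metric $g_S$ is the Kähler metric on $\mathbb{C}^2\setminus\{0\}$ with Kähler potential $|z|^2+\log|z|^2$. A Kähler metric $g$ on a complex manifold $M$ is projectively induced if there exists a Kähler (isometric and holomorphic) immersion of $(M,g)$ into the complex projective space $(\mathbb{C}P^N,g_{FS})$ for some $N\le+\infty$, where $g_{FS}$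 is the Fubini–Study metric, whose Kähler form in homogeneous coordinates is $\omega_{FS}=\frac{i}{2}\partial\bar\partial\log(|Z_0|^2+\cdots+|Z_N|^2)$; for $N=\infty$, $\mathbb{C}P^\infty$ is the projective space of $\ell^2(\mathbb{C})$. Conventions for a Kähler metric $g=(g_{i\bar j})$ (summation over repeated indices): $g^{j\bar i}$ is the inverse matrix, $g_{k\bar i}g^{j\bar i}=\delta_{kj}$; the curvature tensor is $R_{i\bar jk\bar l}=\frac{\partial^2 g_{i\bar l}}{\partial z_k\partial\bar z_j}-g^{q\bar p}\frac{\partial g_{i\bar p}}{\partial z_k}\frac{\partial g_{q\bar l}}{\partial\bar z_j}$; the Ricci tensor is $\mathrm{Ric}_{i\bar j}=-\frac{\partial^2\log\det(g_{k\bar l})}{\partial z_i\partial\bar z_j}$; the scalar curvature is $\rho=g^{i\bar j}\mathrm{Ric}_{i\bar j}$; the Laplacian on functions is $\Delta f=g^{i\bar j}\frac{\partial^2 f}{\partial z_i\partial\bar z_j}$. Let $\mathrm{Ric}_{i\bar j,k}=\nabla_k\mathrm{Ric}_{i\bar j}$ and $\mathrm{Ric}_{i\bar j,k\bar l}=\nabla_{\bar l}\nabla_k\mathrm{Ric}_{i\bar j}$ denote covariant derivatives in the directions $\partial/\partial z_k$ and $\partial/\partial\bar z_l$. The following scalar functions are defined by their values at an arbitrary point, written in holomorphic coordinates for which $g_{i\bar j}=\delta_{ij}$ at that point (all indices summed from $1$ to $n$): $|R|^2=\sum|R_{i\bar jk\bar l}|^2$, $|\mathrm{Ric}|^2=\sum|\mathrm{Ric}_{i\bar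 j}|^2$, $|D'\rho|^2=\sum|\partial\rho/\partial z_i|^2$, $|D'\mathrm{Ric}|^2=\sum|\mathrm{Ric}_{i\bar j,k}|^2$, $\sigma_3(\mathrm{Ric})=\sum\mathrm{Ric}_{i\bar j}\mathrm{Ric}_{j\bar k}\mathrm{Ric}_{k\bar i}$, $R(\mathrm{Ric},\mathrm{Ric})=\sum R_{i\bar jk\bar l}\mathrm{Ric}_{j\bar i}\mathrm{Ric}_{l\bar k}$, $\mathrm{Ric}(R,R)=\sum\mathrm{Ric}_{i\bar j}R_{j\bar kp\bar q}R_{k\bar iq\bar p}$, $\mathrm{div}\,\mathrm{div}(\rho\,\mathrm{Ric})=2|D'\rho|^2+\sum\mathrm{Ric}_{i\bar j}\frac{\partial^2\rho}{\partial z_j\partial\bar z_i}+\rho\Delta\rho$, $\mathrm{div}\,\mathrm{div}(R,\mathrm{Ric})=-\sum\mathrm{Ric}_{i\bar j}\frac{\partial^2\rho}{\partial z_j\partial\bar z_i}-2|D'\mathrm{Ric}|^2+\sum\mathrm{Ric}_{i\bar j,k\bar l}R_{j\bar il\bar k}-R(\mathrm{Ric},\mathrm{Ric})-\sigma_3(\mathrm{Ric})$. The first and third Tian–Yau–Zelditch coefficients of $g$ are the functions (defined for any Kähler metric, regardless of the existence of the asymptotic expansion of the distortion function) $a_1=\tfrac12\rho$ and $$a_3=\tfrac18\Delta\Delta\rho+\tfrac1{24}\mathrm{div}\,\mathrm{div}(R,\mathrm{Ric})-\tfrac16\mathrm{div}\,\mathrm{div}(\rho\,\mathrm{Ric})+\tfrac1{48}\Delta\big(|R|^2-4|\mathrm{Ric}|^2+8\rho^2\big)+\tfrac1{48}\rho\big(\rho^2-4|\mathrm{Ric}|^2+|R|^2\big)+\tfrac1{24}\big(\sigma_3(\mathrm{Ric})-\mathrm{Ric}(R,R)-R(\mathrm{Ric},\mathrm{Ric})\big).$$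 *)

(* Defs.v *)
From HB Require Import structures.
From mathcomp Require Import all_boot all_order all_algebra complex.
From mathcomp Require Import all_classical all_reals all_analysis.

Set Implicit Arguments.
Unset Strict Implicit.
Unset Printing Implicit Defensive.

Import Order.TTheory GRing.Theory Num.Theory numFieldNormedType.Exports Normc.

Local Open Scope classical_set_scope.
Local Open Scope ring_scope.
Local Open Scope complex_scope.

(* The topology of C = R[i] is that of its absolute value; C^n = 'rV[R[i]]_n
   then carries the product topology. *)
HB.instance Definition _ (R : realType) := GRing.ComAlgebra.copy R[i] R[i]^o.
HB.instance Definition _ (R : realType) := Vector.copy R[i] R[i]^o.
HB.instance Definition _ (R : realType) := NormedModule.copy R[i] R[i]^o.

Section Calculus.
Context {R : realType} {n : nat}.
Local Notation C := R[i].
Local Notation Cn := 'rV[C]_n.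
Implicit Types (f : Cn -> C) (v z : Cn) (U : set Cn) (j : 'I_n).

(* |z|^2 *)
Definition sqnorm z : R := \sum_j normc (z 0 j) ^+ 2.

(* C^n is regarded as a real vector space: rderive v f z is the derivative at
   t = 0 of the function t |-> f (z + t v) of the real variable t. *)
Definition rderivable v f z : Prop :=
  derivable (fun t : R => complex.Re (f (z + t%:C *: v))) 0 1 /\
  derivable (fun t : R => complex.Im (f (z + t%:C *: v))) 0 1.

Definition rderive v f z : C :=
  derive1 (fun t : R => complex.Re (f (z + t%:C *: v))) 0 +i*
  derive1 (fun t : R => complex.Im (f (z + t%:C *: v))) 0.

(* C-infinity on the open set U: the iterated directional derivatives of all
   orders exist and are continuous. *)
Definition smooth_on U f : Prop :=
  forall (vs : seq Cn) z, U z ->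
    {for z, continuous (foldr rderive f vs)} /\
    forall v, rderivable v (foldr rderive f vs) z.

Definition ebase j : Cn := delta_mx 0 j.

(* d/dz_j = (d/dx_j - i d/dy_j) / 2 *)
Definition dz j f z : C :=
  2^-1 * (rderive (ebase j) f z - 'i%C * rderive ('i%C *: ebase j) f z).

(* d/dzbar_j = (d/dx_j + i d/dy_j) / 2 *)
Definition dzb j f z : C :=
  2^-1 * (rderive (ebase j) f z + 'i%C * rderive ('i%C *: ebase j) f z).

(* Phi |-> (d^2 Phi / dz_i dzbar_j)_{ij} *)
Definition potential_metric (Phi : Cn -> R) z : 'M[C]_n :=
  \matrix_(i, j) dz i (dzb j (fun w => (Phi w)%:C)) z.

End Calculus.

(* A Hermitian metric g is encoded by its matrix z |-> (g_{i jbar}(z))_{ij},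
   of which only the values on the open set under consideration matter. *)

Section Metrics.
Context {R : realType} {n : nat}.
Local Notation C := R[i].
Local Notation Cn := 'rV[C]_n.
Implicit Types (U : set Cn) (g : Cn -> 'M[C]_n).

(* In R[i], 0 < x means that x is real and positive.  The last clause is
   d omega = 0; its conjugate gives the other half of that equation. *)
Definition kahler_metric U g : Prop :=
  [/\ forall i j, smooth_on U (fun z => g z i j),
      forall z, U z -> g z \is hermsymmx,
      forall z (v : Cn), U z -> v != 0 ->
        0 < (v *m g z *m (v ^t Num.conj)%sesqui) 0 0
    & forall i j k z, U z ->
        dz k (fun w => g w i j) z = dz i (fun w => g w k j) z].

Definition radial U g : Prop :=
  exists Phi : Cn -> R,
    [/\ smooth_on U (fun z => (Phi z)%:C),
        exists phi : R -> R, forall z, U z -> Phi z = phi (sqnorm z)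
      & forall z, U z -> g z = potential_metric Phi z].

Definition flat_metric : Cn -> 'M[C]_n := potential_metric sqnorm.

(* This is the Simanca metric g_S when n = 2. *)
Definition simanca_metric : Cn -> 'M[C]_n :=
  potential_metric (fun z => sqnorm z + ln (sqnorm z)).

End Metrics.

(* The pull-back of the metric h under a holomorphic map F. *)
Definition pullback {R : realType} {m n : nat}
    (F : 'rV[R[i]]_n -> 'rV[R[i]]_m) (h : 'rV[R[i]]_m -> 'M[R[i]]_m)
    (z : 'rV[R[i]]_n) : 'M[R[i]]_n :=
  \matrix_(i, j) \sum_k \sum_l
    dz i (fun w => F w 0 k) z * (dz j (fun w => F w 0 l) z)^* * h (F z) k l.

Section ProjectiveSpace.
Context {R : realType}.
Local Notation C := R[i].
Implicit Types (v : nat -> C) (N : option nat).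

Definition l2 v : Prop := cvgn (series (fun k => normc (v k) ^+ 2)).

Definition l2normsq v : R := limn (series (fun k => normc (v k) ^+ 2)).

(* The space of homogeneous coordinates of CP^N: l^2(C) when N = None stands
   for N = oo, and C^(m+1), embedded in l^2(C) as the sequences that vanish
   beyond the index m, when N = Some m. *)
Definition homogeneous N v : Prop :=
  l2 v /\ (if N is Some m then forall k, (m < k)%N -> v k = 0 else True).

Definition cline v : set (nat -> C) :=
  [set w | exists c : C, w = (fun k => c * v k)].

Definition CP N : set (set (nat -> C)) :=
  [set L | exists v, [/\ homogeneous N v, v <> (fun=> 0) & L = cline v]].

Section Immersions.
Context {n : nat}.
Local Notation Cn := 'rV[C]_n.
Implicit Types (U V : set Cn) (f : Cn -> nat -> C) (F : Cn -> set (nat -> C)).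

(* Complex Frechet differentiability of f : V -> l^2(C); d j is the partial
   derivative df/dz_j. *)
Definition l2_holomorphic V f : Prop :=
  (forall z, V z -> l2 (f z)) /\
  forall z, V z -> exists d : 'I_n -> nat -> C,
    (forall j, l2 (d j)) /\
    forall e : R, 0 < e -> \forall h \near (0 : Cn),
      Num.sqrt (l2normsq (fun k =>
        f (z + h) k - f z k - \sum_j h 0 j * d j k))
      <= e * Num.sqrt (sqnorm h).

(* f is a lift on V of F : V -> CP^N to homogeneous coordinates. *)
Definition holomorphic_lift N V F f : Prop :=
  (forall z, V z ->
    [/\ homogeneous N (f z), f z <> (fun=> 0) & F z = cline (f z)]) /\
  l2_holomorphic V f.

Definition fubini_study_potential v : R := ln (l2normsq v).

(* F : U -> CP^N is holomorphic if it has holomorphic lifts f near every point;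
   the matrix of F^* g_FS is then that of the potential log |f|^2.  A map with
   F^* g_FS = g is an immersion, as g is positive definite. *)
Definition kahler_immersion N U (g : Cn -> 'M[C]_n) F : Prop :=
  (forall z, U z -> CP N (F z)) /\
  forall p, U p -> exists V f,
    [/\ open V, V p, V `<=` U, holomorphic_lift N V F f
      & forall z, V z ->
          g z = potential_metric (fun w => fubini_study_potential (f w)) z].

Definition projectively_induced U (g : Cn -> 'M[C]_n) : Prop :=
  exists N F, kahler_immersion N U g F.

End Immersions.
End ProjectiveSpace.

Section Curvature.
Context {R : realType} {n : nat}.
Local Notation C := R[i].
Local Notation Cn := 'rV[C]_n.
Variable g : Cn -> 'M[C]_n.
Implicit Types (z : Cn) (f : Cn -> C) (i j k l p q a b c d : 'I_n).

(* ginv z j i = g^{j ibar}, where g_{k ibar} g^{j ibar} = delta_{kj}. *)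
Definition ginv z : 'M[C]_n := (invmx (g z))^T.

(* R_{i jbar k lbar} *)
Definition riem i j k l z : C :=
  dz k (dzb j (fun w => g w i l)) z
  - \sum_q \sum_p ginv z q p * dz k (fun w => g w i p) z
                             * dzb j (fun w => g w q l) z.

Definition flat_on (U : set Cn) : Prop :=
  forall z, U z -> forall i j k l, riem i j k l z = 0.

(* The determinant of a positive definite Hermitian matrix is real. *)
Definition logdet z : C := (ln (complex.Re (\det (g z))))%:C.

(* Ric_{i jbar} *)
Definition ric i j z : C := - dz i (dzb j logdet) z.

Definition scal z : C := \sum_i \sum_j ginv z i j * ric i j z.

Definition lap f z : C := \sum_i \sum_j ginv z i j * dz i (dzb j f) z.

(* Gamma^p_{ki} = g^{p qbar} d_k g_{i qbar}; on a Kahler manifold the only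
   other nonzero Christoffel symbols are the conjugates of these. *)
Definition christoffel p k i z : C :=
  \sum_q ginv z p q * dz k (fun w => g w i q) z.

(* Ric_{i jbar, k} *)
Definition dric i j k z : C :=
  dz k (ric i j) z - \sum_p christoffel p k i z * ric p j z.

(* Ric_{i jbar, k lbar} *)
Definition ddric i j k l z : C :=
  dzb l (dric i j k) z - \sum_q (christoffel q l j z)^* * dric i q k z.

(* The scalars below are full contractions of tensors: contracting an unbarred
   index i with a barred index jbar means multiplying by g^{i jbar} and summing,
   which reduces to setting i = j in coordinates with g_{i jbar} = delta_{ij}.
   mixed2 and mixed4 raise the barred indices,
     T_i^j = g^{j abar} T_{i abar},
     T_i^j_k^l = g^{j abar} g^{l bbar} T_{i abar k bbar},
   after which the formulas valid in such coordinates hold verbatim. *)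
Definition mixed2 z (T : 'I_n -> 'I_n -> C) i j : C :=
  \sum_a ginv z j a * T i a.

Definition mixed4 z (T : 'I_n -> 'I_n -> 'I_n -> 'I_n -> C) i j k l : C :=
  \sum_a \sum_b ginv z j a * ginv z l b * T i a k b.

(* |R|^2 *)
Definition riem_normsq z : C :=
  \sum_i \sum_j \sum_k \sum_l \sum_a \sum_b \sum_c \sum_d
    ginv z i a * ginv z b j * ginv z k c * ginv z d l
    * (riem i j k l z * (riem a b c d z)^*).

(* |Ric|^2 *)
Definition ric_normsq z : C :=
  \sum_i \sum_j \sum_a \sum_b
    ginv z i a * ginv z b j * (ric i j z * (ric a b z)^*).

(* |D' rho|^2 *)
Definition dscal_normsq z : C :=
  \sum_i \sum_a ginv z i a * (dz i scal z * (dz a scal z)^*).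

(* |D' Ric|^2 *)
Definition dric_normsq z : C :=
  \sum_i \sum_j \sum_k \sum_a \sum_b \sum_c
    ginv z i a * ginv z b j * ginv z k c * (dric i j k z * (dric a b c z)^*).

Section OrthonormalPoint.
Variables (z : Cn) (gz1 : g z = 1%:M).

Lemma ginv_orthonormal : ginv z = 1%:M.
Proof. by rewrite /ginv gz1 invmx1 trmx1. Qed.

Let sum_ginvl j (f : 'I_n -> C) : \sum_a ginv z j a * f a = f j.
Proof.
rewrite ginv_orthonormal (bigD1 j) //= big1 => [|a /negPf aj].
  by rewrite mxE eqxx mul1r addr0.
by rewrite mxE eq_sym aj mul0r.
Qed.

Let sum_ginvr j (f : 'I_n -> C) : \sum_a ginv z a j * f a = f j.
Proof.
rewrite -[RHS]sum_ginvl ginv_orthonormal; apply: eq_bigr => a _.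
by rewrite !mxE eq_sym.
Qed.

Lemma mixed2_orthonormal T i j : mixed2 z T i j = T i j.
Proof. exact: sum_ginvl. Qed.

Lemma mixed4_orthonormal T i j k l : mixed4 z T i j k l = T i j k l.
Proof.
rewrite /mixed4 -[RHS](sum_ginvl j (fun a => T i a k l)).
apply: eq_bigr => a _; rewrite -(sum_ginvl l (T i a k)) mulr_sumr.
by apply: eq_bigr => b _; rewrite mulrA.
Qed.

Let contract2 (T : 'I_n -> 'I_n -> C) i j :
  \sum_a \sum_b ginv z i a * ginv z b j * T a b = T i j.
Proof.
rewrite -[RHS](sum_ginvl i (T^~ j)); apply: eq_bigr => a _.
by rewrite -(sum_ginvr j) mulr_sumr; apply: eq_bigr => b _; rewrite !mulrA.
Qed.

Lemma riem_normsq_orthonormal : riem_normsq z =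
  \sum_i \sum_j \sum_k \sum_l `|riem i j k l z| ^+ 2.
Proof.
apply: eq_bigr => i _; apply: eq_bigr => j _.
apply: eq_bigr => k _; apply: eq_bigr => l _; rewrite sqr_normc.
rewrite -[RHS](contract2 (fun a b => riem i j k l z * (riem a b k l z)^*)).
apply: eq_bigr => a _; apply: eq_bigr => b _.
rewrite -[X in _ = _ * X]
  (contract2 (fun c d => riem i j k l z * (riem a b c d z)^*)).
rewrite mulr_sumr; apply: eq_bigr => c _; rewrite mulr_sumr.
by apply: eq_bigr => d _; rewrite !mulrA.
Qed.

Lemma ric_normsq_orthonormal :
  ric_normsq z = \sum_i \sum_j `|ric i j z| ^+ 2.
Proof.
apply: eq_bigr => i _; apply: eq_bigr => j _; rewrite sqr_normc.
exact: (contract2 (fun a b => ric i j z * (ric a b z)^*)).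
Qed.

Lemma dscal_normsq_orthonormal :
  dscal_normsq z = \sum_i `|dz i scal z| ^+ 2.
Proof.
apply: eq_bigr => i _; rewrite sqr_normc.
exact: (sum_ginvl i (fun a => dz i scal z * (dz a scal z)^*)).
Qed.

Lemma dric_normsq_orthonormal :
  dric_normsq z = \sum_i \sum_j \sum_k `|dric i j k z| ^+ 2.
Proof.
apply: eq_bigr => i _; apply: eq_bigr => j _; apply: eq_bigr => k _.
rewrite sqr_normc.
rewrite -[RHS](contract2 (fun a b => dric i j k z * (dric a b k z)^*)).
apply: eq_bigr => a _; apply: eq_bigr => b _.
rewrite -[X in _ = _ * X]
  (sum_ginvl k (fun c => dric i j k z * (dric a b c z)^*)).
by rewrite mulr_sumr; apply: eq_bigr => c _; rewrite !mulrA.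
Qed.

End OrthonormalPoint.

Definition riem_mixed z := mixed4 z (fun i j k l => riem i j k l z).
Definition ric_mixed z := mixed2 z (fun i j => ric i j z).
Definition ddric_mixed z := mixed4 z (fun i j k l => ddric i j k l z).
Definition hess_scal_mixed z := mixed2 z (fun i j => dz i (dzb j scal) z).

(* sigma_3(Ric) *)
Definition sigma3 z : C :=
  \sum_i \sum_j \sum_k ric_mixed z i j * ric_mixed z j k * ric_mixed z k i.

(* R(Ric, Ric) *)
Definition R_Ric_Ric z : C :=
  \sum_i \sum_j \sum_k \sum_l
    riem_mixed z i j k l * ric_mixed z j i * ric_mixed z l k.

(* Ric(R, R) *)
Definition Ric_R_R z : C :=
  \sum_i \sum_j \sum_k \sum_p \sum_q
    ric_mixed z i j * riem_mixed z j k p q * riem_mixed z k i q p.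

(* Ric_{i jbar} d^2 rho / dz_j dzbar_i *)
Definition ric_hess_scal z : C :=
  \sum_i \sum_j ric_mixed z i j * hess_scal_mixed z j i.

(* div div (rho Ric) *)
Definition divdiv_scal_Ric z : C :=
  2 * dscal_normsq z + ric_hess_scal z + scal z * lap scal z.

(* div div (R, Ric) *)
Definition divdiv_R_Ric z : C :=
  - ric_hess_scal z - 2 * dric_normsq z
  + \sum_i \sum_j \sum_k \sum_l ddric_mixed z i j k l * riem_mixed z j i l k
  - R_Ric_Ric z - sigma3 z.

Definition TYZ1 z : C := 2^-1 * scal z.

Definition TYZ3 z : C :=
  8^-1 * lap (lap scal) z
  + 24^-1 * divdiv_R_Ric z
  - 6^-1 * divdiv_scal_Ric z
  + 48^-1 * lap (fun w => riem_normsq w - 4 * ric_normsq w + 8 * scal w ^+ 2) z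
  + 48^-1 * (scal z * (scal z ^+ 2 - 4 * ric_normsq z + riem_normsq z))
  + 24^-1 * (sigma3 z - Ric_R_R z - R_Ric_Ric z).

End Curvature.

(* Main.v *)
Require Import Defs.
From mathcomp Require Import all_boot all_order all_algebra complex.
From mathcomp Require Import all_classical all_reals all_analysis.
From mathcomp Require Import ring lra.

(* A radial metric has g_ij = (y/x) delta_ij + (chi/x^2) zbar_i z_j with x = |z|^2, y = x Phi'(x) and
   chi = x^2 Phi''(x), and its curvature is a combination of the projections onto the line of z and onto
   its orthogonal complement.  Vanishing scalar curvature gives two first integrals, whence
   chi = A y^(2-n) + B y^(1-n); a_3 is then a polynomial in 1/y, and a_3 = 0 forces B = 0, and A = 0
   unless n = 2.  (If n = 1, vanishing scalar curvature is flatness.)  For n = 2 this leaves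
   y = c x - A: flat if A = 0, homothetic to Simanca if A < 0.

   The case A > 0 is excluded by Calabi's criterion on a complex line through p orthogonal to p.
   There the potential is c s - A log (x_0 + s), s = |zeta|^2, up to a harmonic function, so that some
   holomorphic l^2-valued F has |F|^2 = e^(c s) (x_0 + s)^-A.  The derivatives (d dbar)^m |F|^2 = |F^(m)|^2
   at 0 are nonnegative, hence so are all Taylor coefficients of e^(c s) (x_0 + s)^-A; but then they
   decay faster than geometrically, and so do those of (x_0 + s)^-A, which has radius of convergence x_0.

   Conversely e^(|z|^2) and |z|^2 e^(|z|^2) are sums of squared moduli of monomials, which gives the
   immersions of the flat and of the Simanca metric. *)

Set Implicit Arguments.
Unset Strict Implicit.
Unset Printing Implicit Defensive.

Import Order.TTheory GRing.Theory Num.Theory numFieldNormedType.Exports Normc.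

Local Open Scope classical_set_scope.
Local Open Scope ring_scope.
Local Open Scope complex_scope.

(* Num.conj rather than conjc in both scopes *)
Local Notation "x ^*" := (Num.conj x) : complex_scope.

(** * Calculus on complex space *)

(** U may be a small open set, so nothing global such as completeness is available, and the
    exclusion of A > 0 has to come from local signs of Taylor coefficients. A holomorphic map into
    l^2 is given as merely once Frechet differentiable, while that argument differentiates it
    arbitrarily often, and already the matrix of the Fubini-Study form needs a second derivative.
    Hence a Cauchy theory is developed, and it is carried over from scalar to l^2-valued functions
    by estimates for finite linear combinations of the components that are uniform in their number.

    The curvature computation, with n symbolic, becomes rational once y is taken as the variable: x
    d/dx = (y + chi) d/dy, and with primes for d/dy the curvature has the coefficients chi / y^2,
    (chi / y)' and chi''.

    The profile lives on positive radii only. If U contains the origin, continuity of g there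
    decides: it extends flatness to 0 when A = 0, and it is violated when A is not 0. *)

Section ComplexBasics.
Context {R : realType}.
Local Notation C := R[i].
Implicit Types (x y : C) (a b : R).

Lemma ReD x y : complex.Re (x + y) = complex.Re x + complex.Re y.
Proof. by case: x; case: y. Qed.
Lemma ImD x y : complex.Im (x + y) = complex.Im x + complex.Im y.
Proof. by case: x; case: y. Qed.
Lemma ReN x : complex.Re (- x) = - complex.Re x.
Proof. by case: x. Qed.
Lemma ImN x : complex.Im (- x) = - complex.Im x.
Proof. by case: x. Qed.
Lemma ReM x y : complex.Re (x * y) =
  complex.Re x * complex.Re y - complex.Im x * complex.Im y.
Proof. by case: x; case: y. Qed.
Lemma ImM x y : complex.Im (x * y) =
  complex.Re x * complex.Im y + complex.Im x * complex.Re y.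
Proof. by case: x; case: y. Qed.
Lemma ReJ x : complex.Re (x^*) = complex.Re x.
Proof. by case: x. Qed.
Lemma ImJ x : complex.Im (x^*) = - complex.Im x.
Proof. by case: x. Qed.

Lemma eqC x y : complex.Re x = complex.Re y -> complex.Im x = complex.Im y -> x = y.
Proof. by case: x; case: y => a b c d /= -> ->. Qed.

Lemma conjRC a : (a%:C)^* = a%:C.
Proof. by apply: eqC; rewrite ?ReJ ?ImJ /= ?oppr0. Qed.

Lemma conjcI : ('i%C : C)^* = - 'i%C.
Proof. by apply: eqC; rewrite ?ReJ ?ImJ /= ?oppr0. Qed.

Lemma conjc2V : (2^-1 : C)^* = 2^-1.
Proof. by rewrite fmorphV rmorph_nat. Qed.

Lemma normcC x : `|x| = (normc x)%:C.
Proof. by rewrite normc_def; case: x. Qed.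

Lemma normc_ge0 x : 0 <= normc x.
Proof. by case: x => a b; exact: sqrtr_ge0. Qed.

Lemma normc_sqr x : normc x ^+ 2 = complex.Re x ^+ 2 + complex.Im x ^+ 2.
Proof. by case: x => a b /=; rewrite sqr_sqrtr // addr_ge0 // sqr_ge0. Qed.

Lemma normc_sqrC x : (normc x ^+ 2)%:C = x * x^*.
Proof. by rewrite rmorphXn /= -normcC; exact: sqr_normc. Qed.

Lemma normc_real a : normc (a%:C) = `|a|.
Proof. by rewrite /= expr0n addr0 sqrtr_sqr. Qed.

Lemma normcD x y : normc (x + y) <= normc x + normc y.
Proof. exact: le_normcD. Qed.

Lemma normc_oppr x : normc (- x) = normc x.
Proof. exact: (@normcN R x). Qed.

Lemma normcB x y : normc (x - y) = normc (y - x).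
Proof. by rewrite -normc_oppr opprB. Qed.

Lemma normc_conj x : normc (x^*) = normc x.
Proof. by apply/eqP; rewrite -(@eqrXn2 _ 2) ?normc_ge0 // !normc_sqr ReJ ImJ sqrrN. Qed.

Lemma rcD a b : (a + b)%:C = a%:C + b%:C :> C. Proof. exact: rmorphD. Qed.
Lemma rcB a b : (a - b)%:C = a%:C - b%:C :> C. Proof. exact: rmorphB. Qed.
Lemma rcM a b : (a * b)%:C = a%:C * b%:C :> C. Proof. exact: rmorphM. Qed.
Lemma rcN a : (- a)%:C = - a%:C :> C. Proof. exact: rmorphN. Qed.
Lemma rcV a : (a^-1)%:C = (a%:C)^-1 :> C. Proof. exact: fmorphV. Qed.
Lemma rcX a m : (a ^+ m)%:C = a%:C ^+ m :> C. Proof. exact: rmorphXn. Qed.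
Lemma rc_nat m : (m%:R)%:C = m%:R :> C. Proof. exact: rmorph_nat. Qed.
Lemma rc0 : (0 : R)%:C = 0 :> C. Proof. by []. Qed.
Lemma rc1 : (1 : R)%:C = 1 :> C. Proof. by []. Qed.
Lemma rc_eq0 a : (a%:C == 0 :> C) = (a == 0). Proof. exact: fmorph_eq0. Qed.
Lemma rc_sum (I : Type) (r : seq I) (P : pred I) (F : I -> R) :
  (\sum_(i <- r | P i) F i)%:C = \sum_(i <- r | P i) (F i)%:C :> C.
Proof. exact: rmorph_sum. Qed.

Lemma cjD x y : (x + y)^* = x^* + y^*. Proof. exact: rmorphD. Qed.
Lemma cjB x y : (x - y)^* = x^* - y^*. Proof. exact: rmorphB. Qed.
Lemma cjM x y : (x * y)^* = x^* * y^*. Proof. exact: rmorphM. Qed.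
Lemma cjN x : (- x)^* = - x^*. Proof. exact: rmorphN. Qed.
Lemma cjV x : (x^-1)^* = (x^*)^-1. Proof. exact: fmorphV. Qed.
Lemma cj_nat m : (m%:R : C)^* = m%:R. Proof. exact: rmorph_nat. Qed.
Lemma cj_sum (I : Type) (r : seq I) (P : pred I) (F : I -> C) :
  (\sum_(i <- r | P i) F i)^* = \sum_(i <- r | P i) (F i)^*.
Proof. exact: rmorph_sum. Qed.

Lemma Re_le_normc x : `|complex.Re x| <= normc x.
Proof.
rewrite -(@ler_pXn2r _ 2) ?nnegrE ?normc_ge0 ?normr_ge0 //.
by rewrite normc_sqr real_normK ?num_real // lerDl sqr_ge0.
Qed.

Lemma Im_le_normc x : `|complex.Im x| <= normc x.
Proof.
rewrite -(@ler_pXn2r _ 2) ?nnegrE ?normc_ge0 ?normr_ge0 //.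
by rewrite normc_sqr real_normK ?num_real // lerDr sqr_ge0.
Qed.

Lemma normc_le_ReIm x : normc x <= `|complex.Re x| + `|complex.Im x|.
Proof.
rewrite -(@ler_pXn2r _ 2) ?nnegrE ?normc_ge0 ?addr_ge0 ?normr_ge0 //.
rewrite normc_sqr sqrrD !real_normK ?num_real // lerD2r lerDl.
by rewrite mulrn_wge0 // mulr_ge0.
Qed.

Lemma normc_eq0 x : (normc x == 0) = (x == 0).
Proof. by apply/eqP/eqP => [/eq0_normc //|->]; rewrite normc0. Qed.

Lemma normc_gt0 x : (0 < normc x) = (x != 0).
Proof. by rewrite lt_def normc_ge0 andbT normc_eq0. Qed.

Lemma normc_sum (I : Type) (r : seq I) (P : pred I) (F : I -> C) :
  normc (\sum_(i <- r | P i) F i) <= \sum_(i <- r | P i) normc (F i).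
Proof.
elim/big_rec2: _ => [|i y1 y2 _ h]; first by rewrite normc0.
by apply: (le_trans (normcD _ _)); rewrite lerD2l.
Qed.

End ComplexBasics.

Section Topology.
Context {R : realType} {n : nat}.
Local Notation C := R[i].
Local Notation Cn := 'rV[C]_n.

Lemma ball_normc (x y : C) (e : R) : ball x e%:C y <-> normc (y - x) < e.
Proof.
have -> : ball x e%:C y = (`|x - y| < e%:C) :> Prop by [].
by rewrite normcC ltcR normcB.
Qed.

(** Radii of balls in C are elements of C; a positive one has vanishing imaginary part, so real
    radii suffice. *)
Lemma nbhsCP (x : C) (P : set C) : nbhs x P <->
  exists2 e : R, 0 < e & forall y, normc (y - x) < e -> P y.
Proof.
split=> [/nbhs_ballP[[e e']]|[e e0 eP]].
  rewrite /= ltcE /= => /andP[/eqP e'0 e0] eP.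
  exists e => // y ye; apply: eP; have -> : Complex e e' = e%:C by rewrite e'0.
  exact/ball_normc.
apply/nbhs_ballP; exists e%:C => /=; first by rewrite ltcR.
by move=> y /ball_normc; exact: eP.
Qed.

Lemma nbhsCnP (z : Cn) (P : set Cn) : nbhs z P <->
  exists2 e : R, 0 < e & forall w : Cn, (forall j, normc (w 0 j - z 0 j) < e) -> P w.
Proof.
split=> [/nbhs_ballP[[e e']]|[e e0 eP]].
  rewrite /= ltcE /= => /andP[/eqP e'0 e0] eP.
  exists e => // y ye; apply: eP; have -> : Complex e e' = e%:C by rewrite e'0.
  split=> [|i j]; first by rewrite ltcR.
  by apply/ball_normc; rewrite (ord1 i).
apply/nbhs_ballP; exists e%:C => /=; first by rewrite ltcR.
by move=> y [_ h]; apply: eP => j; exact/ball_normc.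
Qed.

Lemma openCnP (U : set Cn) : open U <-> forall z, U z ->
  exists2 e : R, 0 < e & forall w : Cn, (forall j, normc (w 0 j - z 0 j) < e) -> U w.
Proof.
rewrite openE; split=> h z /h; first by move/nbhsCnP.
by move=> ?; apply/nbhsCnP.
Qed.

Lemma continuousCnP (f : Cn -> C) (z : Cn) : {for z, continuous f} <->
  forall e : R, 0 < e -> exists2 d : R, 0 < d &
    forall w : Cn, (forall j, normc (w 0 j - z 0 j) < d) -> normc (f w - f z) < e.
Proof.
split=> [cf e e0|cf P /= /nbhsCP[e e0 eP]].
  have /nbhsCnP// : nbhs z [set w | normc (f w - f z) < e].
  by apply: (cf [set y | normc (y - f z) < e]); apply/nbhsCP; exists e.
have [d d0 dP] := cf _ e0; apply/nbhsCnP; exists d => // w /dP; exact: eP.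
Qed.

Lemma continuousCn_sqP (f : Cn -> R) (z : Cn) : {for z, continuous f} <->
  forall e : R, 0 < e -> exists2 d : R, 0 < d &
    forall w : Cn, (forall j, normc (w 0 j - z 0 j) < d) -> `|f w - f z| < e.
Proof.
split=> [cf e e0|cf P /= /nbhs_ballP[e e0 eP]].
  have /nbhsCnP// : nbhs z [set w | `|f w - f z| < e].
  by apply: (cf [set y | `|y - f z| < e]); apply/nbhs_ballP; exists e => // y; rewrite /ball /= distrC.
have [d d0 dP] := cf _ e0; apply/nbhsCnP; exists d => // w /dP h; apply: eP.
by rewrite /ball /= distrC.
Qed.

End Topology.

Section RealDerive.
Context {R : realType}.
Implicit Types f g : R -> R.

(** Bounding the error by e * |h| avoids the difference quotient, so the increment h = 0 is no
    special case. *)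
Lemma is_derive1P f (x d : R) : is_derive x 1 f d <->
  forall e : R, 0 < e -> exists2 t : R, 0 < t &
    forall h : R, `|h| < t -> `|f (x + h) - f x - d * h| <= e * `|h|.
Proof.
split.
  move=> [df <-] e e0.
  have : (fun h => h^-1 *: ((f \o shift x) (h *: (1:R)) - f x)) @ 0^' --> 'D_1 f x by exact: df.
  move=> /cvgrPdist_le /(_ _ e0); rewrite near_withinE => /nbhs_ballP[t /= t0 tP].
  exists t => // h ht; have [->|h0] := eqVneq h 0.
    by rewrite addr0 subrr mulr0 subr0 normr0 mulr0.
  have := tP h; rewrite /ball /= sub0r normrN => /(_ ht h0).
  rewrite /shift /= -(@ler_pM2r _ `|h|) ?normr_gt0 // -normrM.
  rewrite -[h%:A]/(h * 1) mulr1 (addrC h) -[_ *: _]/(h^-1 * _) mulrBl mulrAC mulVf //.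
  by rewrite mul1r distrC.
move=> H.
have dd : (fun h => h^-1 *: ((f \o shift x) (h *: (1:R)) - f x)) @ 0^' --> d.
  apply/cvgrPdist_le => e e0; rewrite near_withinE; have [t t0 tP] := H _ e0.
  apply/nbhs_ballP; exists t => // h; rewrite /ball /= sub0r normrN => ht h0.
  have hT := tP h ht; rewrite /shift /= -(@ler_pM2r _ `|h|) ?normr_gt0 // -normrM.
  rewrite -[h%:A]/(h * 1) mulr1 (addrC h) -[_ *: _]/(h^-1 * _) mulrBl mulrAC mulVf //.
  by rewrite mul1r distrC.
apply: DeriveDef; last exact: cvg_lim dd.
by apply/cvg_ex; exists d.
Qed.

Lemma is_derive_near f g (x d : R) : (exists2 t : R, 0 < t & forall h : R, `|h| < t -> f (x + h) = g (x + h)) ->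
  is_derive x 1 g d -> is_derive x 1 f d.
Proof.
move=> [t t0 tP] /is_derive1P H; apply/is_derive1P => e e0.
have [s s0 sP] := H _ e0; exists (Num.min s t); first by rewrite lt_min s0.
move=> h; rewrite lt_min => /andP[hs ht].
rewrite tP // -[in f x](addr0 x) tP ?normr0 // addr0; exact: sP.
Qed.

Lemma is_derive_unique f (x d d' : R) : is_derive x 1 f d -> is_derive x 1 f d' -> d = d'.
Proof. by move=> [_ <-] [_ <-]. Qed.

Lemma is_derive_mul f g (x a b : R) : is_derive x 1 f a -> is_derive x 1 g b ->
  is_derive x 1 (fun t => f t * g t) (a * g x + f x * b).
Proof.
move=> fa gb; apply: (is_derive_eq (@is_deriveM _ _ f g x 1 a b fa gb)).
by rewrite addrC /GRing.scale /= (mulrC (g x)).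
Qed.

Lemma is_derive_add f g (x a b : R) : is_derive x 1 f a -> is_derive x 1 g b ->
  is_derive x 1 (fun t => f t + g t) (a + b).
Proof. by move=> fa gb; exact: (@is_deriveD _ _ _ f g). Qed.

Lemma is_derive_opp f (x a : R) : is_derive x 1 f a ->
  is_derive x 1 (fun t => - f t) (- a).
Proof. by move=> fa; exact: (@is_deriveN _ _ _ f). Qed.

Lemma is_derive_const (x a : R) : is_derive x 1 (fun _ : R => a) (0 : R).
Proof. exact: is_derive_cst. Qed.

Lemma is_derive_comp f g (x a b : R) : is_derive (g x) 1 f a -> is_derive x 1 g b ->
  is_derive x 1 (fun t => f (g t)) (a * b).
Proof. by move=> fa gb; exact: (@is_derive1_comp _ f g). Qed.

Lemma is_derive_inv f (x a : R) : f x != 0 -> is_derive x 1 f a ->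
  is_derive x 1 (fun t => (f t)^-1) (- a / f x ^+ 2).
Proof.
move=> f0 fa.
apply: (is_derive_eq (@is_derive_comp (fun t => t^-1) f x _ _ _ fa)).
  exact: is_deriveV.
by rewrite -[_%:A]/(_ * 1) mulr1 !mulNr (mulrC a).
Qed.

End RealDerive.

Section DirectionalDerivative.
Context {R : realType} {n : nat}.
Local Notation C := R[i].
Local Notation Cn := 'rV[C]_n.
Implicit Types (f g : Cn -> C) (v z : Cn) (U : set Cn) (j k : 'I_n).

(** A relational form that carries existence and value of the derivative through the rules of
    calculus at once. *)
Definition is_rderive v f z (d : C) : Prop :=
  is_derive (0 : R) 1 (fun t : R => complex.Re (f (z + t%:C *: v))) (complex.Re d) /\
  is_derive (0 : R) 1 (fun t : R => complex.Im (f (z + t%:C *: v))) (complex.Im d).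

Lemma is_rderiveE v f z d : is_rderive v f z d -> rderive v f z = d.
Proof.
move=> [[_ h1] [_ h2]]; rewrite /rderive !derive1E h1 h2.
by case: d {h1 h2}.
Qed.

Lemma is_rderive_rderivable v f z d : is_rderive v f z d -> rderivable v f z.
Proof. by move=> [[h1 _] [h2 _]]; split; [exact: h1|exact: h2]. Qed.

Lemma rderivableP v f z : rderivable v f z -> is_rderive v f z (rderive v f z).
Proof.
move=> [h1 h2]; rewrite /rderive !derive1E.
split; [exact: DeriveDef h1 (erefl _)|exact: DeriveDef h2 (erefl _)].
Qed.

Lemma addr_scale0 z v : z + (0 : R)%:C *: v = z.
Proof. by rewrite scale0r addr0. Qed.

Lemma is_rderiveP v f z d : is_rderive v f z d <->
  forall e : R, 0 < e -> exists2 t : R, 0 < t & forall h : R, `|h| < t ->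
    normc (f (z + h%:C *: v) - f z - d * h%:C) <= e * `|h|.
Proof.
have reE h : complex.Re (f (z + h%:C *: v) - f z - d * h%:C) =
  complex.Re (f (z + (0 + h)%:C *: v)) - complex.Re (f (z + (0 : R)%:C *: v)) - complex.Re d * h.
  by rewrite add0r addr_scale0 !ReD !ReN ReM /= mulr0 subr0.
have imE h : complex.Im (f (z + h%:C *: v) - f z - d * h%:C) =
  complex.Im (f (z + (0 + h)%:C *: v)) - complex.Im (f (z + (0 : R)%:C *: v)) - complex.Im d * h.
  by rewrite add0r addr_scale0 !ImD !ImN ImM /= mulr0 add0r.
split.
  move=> [/is_derive1P h1 /is_derive1P h2] e e0.
  have [|t1 t10 t1P] := h1 (e / 2); first by rewrite divr_gt0.
  have [|t2 t20 t2P] := h2 (e / 2); first by rewrite divr_gt0.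
  exists (Num.min t1 t2); first by rewrite lt_min t10.
  move=> h; rewrite lt_min => /andP[ht1 ht2].
  apply: (le_trans (normc_le_ReIm _)); rewrite [e]splitr mulrDl reE imE.
  by apply: lerD; [exact: t1P|exact: t2P].
move=> H; split; apply/is_derive1P => e e0; have [t t0 tP] := H _ e0; exists t => // h ht;
  apply: le_trans (tP h ht).
  by rewrite -reE Re_le_normc.
by rewrite -imE Im_le_normc.
Qed.

Lemma is_rderive_ext v f g z d (e : R) : 0 < e ->
  (forall w : Cn, (forall j, normc (w 0 j - z 0 j) < e) -> f w = g w) ->
  is_rderive v g z d -> is_rderive v f z d.
Proof.
move=> e0 fg H.
have [t t0 tP] : exists2 t : R, 0 < t & forall h : R, `|h| < t -> f (z + h%:C *: v) = g (z + h%:C *: v).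
  (* M exceeds every |v_j|, so |h| < e / M keeps z + h v within e of z in each coordinate. *)
  pose M := 1 + \sum_j normc (v 0 j).
  have M0 : 0 < M by rewrite ltr_pwDl // sumr_ge0 // => j _; rewrite normc_ge0.
  exists (e / M) => [|h hM]; first by rewrite divr_gt0.
  apply: fg => j; rewrite !mxE [X in normc X](_ : _ = h%:C * v 0 j); last by ring.
  rewrite normcM normc_real.
  have vM : normc (v 0 j) < M.
    rewrite /M (bigD1 j) //= addrCA ltrDl ltr_pwDl // sumr_ge0 // => i _.
    exact: normc_ge0.
  rewrite -(@divfK _ M (lt0r_neq0 M0) e); apply: le_lt_trans (_ : `|h| * M < _).
    by rewrite ler_wpM2l // ltW.
  by rewrite ltr_pM2r.
case: H => h1 h2; split.
  by apply: is_derive_near h1; exists t => // h ht; rewrite add0r tP.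
by apply: is_derive_near h2; exists t => // h ht; rewrite add0r tP.
Qed.

Lemma is_rderive_open v U f g z d : open U -> U z -> (forall w, U w -> f w = g w) ->
  is_rderive v g z d -> is_rderive v f z d.
Proof.
move=> /openCnP oU /oU[e e0 eU] fg; apply: (is_rderive_ext e0) => w /eU; exact: fg.
Qed.

Lemma is_rderiveD v f g z a b : is_rderive v f z a -> is_rderive v g z b ->
  is_rderive v (fun w => f w + g w) z (a + b).
Proof.
move=> [f1 f2] [g1 g2]; split; rewrite (ReD, ImD); under eq_fun do rewrite (ReD, ImD);
  exact: is_derive_add.
Qed.

Lemma is_rderiveN v f z a : is_rderive v f z a ->
  is_rderive v (fun w => - f w) z (- a).
Proof.
move=> [f1 f2]; split; rewrite (ReN, ImN); under eq_fun do rewrite (ReN, ImN);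
  exact: is_derive_opp.
Qed.

Lemma is_rderiveM v f g z a b : is_rderive v f z a -> is_rderive v g z b ->
  is_rderive v (fun w => f w * g w) z (a * g z + f z * b).
Proof.
move=> [f1 f2] [g1 g2]; split.
  under eq_fun do rewrite ReM.
  apply: (is_derive_eq (is_derive_add (is_derive_mul f1 g1) (is_derive_opp (is_derive_mul f2 g2)))).
  by rewrite !addr_scale0 ReD !ReM; ring.
under eq_fun do rewrite ImM.
apply: (is_derive_eq (is_derive_add (is_derive_mul f1 g2) (is_derive_mul f2 g1))).
by rewrite !addr_scale0 ImD !ImM; ring.
Qed.

Lemma is_rderiveJ v f z a : is_rderive v f z a ->
  is_rderive v (fun w => (f w)^*) z (a^*).
Proof.
move=> [f1 f2]; split.
  by rewrite ReJ; under eq_fun do rewrite ReJ.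
by rewrite ImJ; under eq_fun do rewrite ImJ; exact: is_derive_opp.
Qed.

Lemma is_rderive_cst v (c : C) z : is_rderive v (fun=> c) z 0.
Proof. by split; exact: is_derive_const. Qed.

Lemma is_rderive_coord v j z : is_rderive v (fun w => w 0 j) z (v 0 j).
Proof.
have H (a b : R) : is_derive (0 : R) 1 (fun t : R => a + t * b) b.
  have idb : is_derive (0 : R) 1 (fun t : R => t * b) (1 * b + 0 * 0).
    exact: (@is_derive_mul _ (fun t => t) (fun=> b) 0 1 0 (is_derive_id (0 : R) (1 : R)) (is_derive_const 0 b)).
  apply: (is_derive_eq (is_derive_add (is_derive_const 0 a) idb)).
  by rewrite add0r mul1r mulr0 addr0.
split.
  have -> : (fun t : R => complex.Re ((z + t%:C *: v) 0 j)) =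
    (fun t : R => complex.Re (z 0 j) + t * complex.Re (v 0 j)).
    by apply/funext => t; rewrite !mxE ReD ReM /= mul0r subr0.
  exact: H.
have -> : (fun t : R => complex.Im ((z + t%:C *: v) 0 j)) =
  (fun t : R => complex.Im (z 0 j) + t * complex.Im (v 0 j)).
  by apply/funext => t; rewrite !mxE ImD ImM /= mul0r addr0.
exact: H.
Qed.

Lemma is_rderive_sum v (I : Type) (r : seq I) (P : pred I) (F : I -> Cn -> C) z (d : I -> C) :
  (forall i, P i -> is_rderive v (F i) z (d i)) ->
  is_rderive v (fun w => \sum_(i <- r | P i) F i w) z (\sum_(i <- r | P i) d i).
Proof.
move=> H; elim: r => [|i r IH].
  by rewrite big_nil; under eq_fun do rewrite big_nil; exact: is_rderive_cst.
rewrite big_cons; under eq_fun do rewrite big_cons.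
by case: ifPn => // Pi; apply: is_rderiveD => //; exact: H.
Qed.

Lemma is_rderive_comp v (u : Cn -> R) (s : R -> R) z (d : C) (ds : R) :
  is_rderive v (fun w => (u w)%:C) z d -> is_derive (u z) 1 s ds ->
  is_rderive v (fun w => (s (u w))%:C) z (ds%:C * d).
Proof.
move=> [u1 u2] s1; split.
  rewrite ReM /= mul0r subr0.
  apply: (@is_derive_comp _ s (fun t => u (z + t%:C *: v)) 0) => //.
  by rewrite addr_scale0.
(* The imaginary part of the real function u is constantly 0, so d is real. *)
have -> : complex.Im (ds%:C * d) = 0.
  rewrite ImM /= mul0r addr0.
  by have -> : complex.Im d = 0 := is_derive_unique u2 (is_derive_const 0 0); rewrite mulr0.
exact: is_derive_const.
Qed.

Lemma sqnormC z : (sqnorm z)%:C = \sum_j z 0 j * (z 0 j)^* :> C.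
Proof.
by rewrite /sqnorm rmorph_sum /=; apply: eq_bigr => j _; exact: normc_sqrC.
Qed.

Lemma is_rderive_sqnorm v z : is_rderive v (fun w => (sqnorm w)%:C) z
  (\sum_j (v 0 j * (z 0 j)^* + z 0 j * (v 0 j)^*)).
Proof.
under eq_fun do rewrite sqnormC.
apply: is_rderive_sum => j _; apply: is_rderiveM; first exact: is_rderive_coord.
by apply: is_rderiveJ; exact: is_rderive_coord.
Qed.

Lemma is_rderive_inv v f z a : f z != 0 -> is_rderive v f z a ->
  is_rderive v (fun w => (f w)^-1) z (- a / f z ^+ 2).
Proof.
move=> fz0 fa.
(* Writing 1 / f as the conjugate of f over |f|^2 reduces the claim to the inverse of a real
   function. Where f vanishes both sides are 0 by convention. *)
have nE : (fun w => (f w)^-1) = (fun w => (f w)^* * (((normc (f w)) ^+ 2)^-1)%:C).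
  apply/funext => w; have [->|fw0] := eqVneq (f w) 0; first by rewrite invr0 rmorph0 mul0r.
  rewrite fmorphV /= normc_sqrC invfM mulrC mulfVK //.
  by rewrite fmorph_eq0.
have n2 : is_rderive v (fun w => (normc (f w) ^+ 2)%:C) z (a * (f z)^* + f z * a^*).
  under eq_fun do rewrite normc_sqrC.
  by apply: is_rderiveM => //; exact: is_rderiveJ.
have fz2 : normc (f z) ^+ 2 != 0 by rewrite expf_neq0 // normc_eq0.
have dV : is_derive (normc (f z) ^+ 2) 1 (fun t : R => t^-1) (- 1 / (normc (f z) ^+ 2) ^+ 2).
  exact: (@is_derive_inv _ (fun t => t) _ 1 fz2 (is_derive_id (_ : R) (1 : R))).
rewrite nE; have := is_rderiveM (is_rderiveJ fa) (is_rderive_comp n2 dV).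
set l := _ + _; set r := (- a / _); suff -> : l = r by [].
have fj0 : (f z)^* != 0 by rewrite fmorph_eq0.
have NE := normc_sqrC (f z); rewrite {}/l {}/r.
move: (normc (f z) ^+ 2) NE => N NE.
rewrite rmorphM /= !fmorphV /= rmorphXn /= NE rmorphN1.
by field; rewrite fz0 fj0.
Qed.

End DirectionalDerivative.

(** The derivatives are generalized first, so that [ring] sees them as atoms. *)
Ltac rderive_ring := repeat match goal with
  |- context [rderive ?v ?f ?z] => generalize (rderive v f z); intro end; ring.

Section Wirtinger.
Context {R : realType} {n : nat}.
Local Notation C := R[i].
Local Notation Cn := 'rV[C]_n.
Implicit Types (f g : Cn -> C) (v z : Cn) (U : set Cn) (i j k : 'I_n).

(* A sealed predicate, so that unification never unfolds it. *)
Variant wdiff f z : Prop := Wdiff of (forall v, rderivable v f z).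

Lemma wdiffE f z v : wdiff f z -> is_rderive v f z (rderive v f z).
Proof. by move=> [] /(_ v)/rderivableP. Qed.

Lemma wdiffI f z (d : Cn -> C) : (forall v, is_rderive v f z (d v)) -> wdiff f z.
Proof. by move=> H; split=> v; exact: is_rderive_rderivable (H v). Qed.

Lemma wdiffD f g z : wdiff f z -> wdiff g z -> wdiff (fun w => f w + g w) z.
Proof. by move=> df dg; apply: wdiffI => v; apply: is_rderiveD; exact: wdiffE. Qed.
Lemma wdiffN f z : wdiff f z -> wdiff (fun w => - f w) z.
Proof. by move=> df; apply: wdiffI => v; apply: is_rderiveN; exact: wdiffE. Qed.
Lemma wdiffM f g z : wdiff f z -> wdiff g z -> wdiff (fun w => f w * g w) z.
Proof. by move=> df dg; apply: wdiffI => v; apply: is_rderiveM; exact: wdiffE. Qed.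
Lemma wdiffJ f z : wdiff f z -> wdiff (fun w => (f w)^*) z.
Proof. by move=> df; apply: wdiffI => v; apply: is_rderiveJ; exact: wdiffE. Qed.
Lemma wdiff_cst (c : C) z : wdiff (fun=> c) z.
Proof. by apply: wdiffI => v; exact: is_rderive_cst. Qed.
Lemma wdiff_coord j z : wdiff (fun w => w 0 j) z.
Proof. by apply: wdiffI => v; exact: is_rderive_coord. Qed.
Lemma wdiff_conj j z : wdiff (fun w => (w 0 j)^*) z.
Proof. by apply: wdiffJ; exact: wdiff_coord. Qed.
Lemma wdiff_inv f z : f z != 0 -> wdiff f z -> wdiff (fun w => (f w)^-1) z.
Proof. by move=> f0 df; apply: wdiffI => v; apply: is_rderive_inv => //; exact: wdiffE. Qed.
Lemma wdiff_open U f g z : open U -> U z -> (forall w, U w -> f w = g w) ->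
  wdiff g z -> wdiff f z.
Proof.
by move=> oU Uz fg dg; apply: wdiffI => v; apply: (is_rderive_open oU Uz fg); exact: wdiffE.
Qed.

Lemma is_dz j f z a b : is_rderive (ebase j) f z a -> is_rderive ('i%C *: ebase j) f z b ->
  dz j f z = 2^-1 * (a - 'i%C * b).
Proof. by move=> /is_rderiveE fa /is_rderiveE fb; rewrite /dz fa fb. Qed.
Lemma is_dzb j f z a b : is_rderive (ebase j) f z a -> is_rderive ('i%C *: ebase j) f z b ->
  dzb j f z = 2^-1 * (a + 'i%C * b).
Proof. by move=> /is_rderiveE fa /is_rderiveE fb; rewrite /dzb fa fb. Qed.

(** [rderive] is total, so at points where the derivative does not exist its value must still be
    seen to depend on the germ only. *)
Lemma rderive_open v U f g z : open U -> U z -> (forall w, U w -> f w = g w) ->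
  rderive v f z = rderive v g z.
Proof.
move=> oU Uz fg; have [h|h] := pselect (rderivable v g z).
  by apply: is_rderiveE; apply: (is_rderive_open oU Uz fg); exact/rderivableP.
have near_eq (t : R -> R) (s : R -> R) : (forall x, x \in [set: R] -> True) ->
   (\forall x \near (0 : R), t x = s x) -> derive1 t 0 = derive1 s 0.
  by move=> _ h'; rewrite !derive1E; exact: near_eq_derive.
have nr : \forall x \near (0 : R), f (z + x%:C *: v) = g (z + x%:C *: v).
  have H w : U w -> f w = g w by exact: fg.
  move/openCnP: oU => /(_ _ Uz)[e e0 eU].
  pose M := 1 + \sum_j normc (v 0 j).
  have M0 : 0 < M by rewrite ltr_pwDl // sumr_ge0 // => j _; rewrite normc_ge0.
  apply/nbhs_ballP; exists (e / M) => /=; first by rewrite divr_gt0.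
  move=> x; rewrite /ball /= sub0r normrN => xM; apply: H; apply: eU => j.
  rewrite !mxE [X in normc X](_ : _ = x%:C * v 0 j); last by ring.
  rewrite normcM normc_real.
  have vM : normc (v 0 j) < M.
    rewrite /M (bigD1 j) //= addrCA ltrDl ltr_pwDl // sumr_ge0 // => i _.
    exact: normc_ge0.
  rewrite -(@divfK _ M (lt0r_neq0 M0) e); apply: le_lt_trans (_ : `|x| * M < _).
    by rewrite ler_wpM2l // ltW.
  by rewrite ltr_pM2r.
rewrite /rderive; congr (_ +i* _); apply: near_eq => //; near=> x; congr (_ _);
 by near: x.
Unshelve. all: by end_near. Qed.

Lemma dz_open j U f g z : open U -> U z -> (forall w, U w -> f w = g w) ->
  dz j f z = dz j g z.
Proof. by move=> oU Uz fg; rewrite /dz !(rderive_open _ oU Uz fg). Qed.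
Lemma dzb_open j U f g z : open U -> U z -> (forall w, U w -> f w = g w) ->
  dzb j f z = dzb j g z.
Proof. by move=> oU Uz fg; rewrite /dzb !(rderive_open _ oU Uz fg). Qed.

Lemma dzD j f g z : wdiff f z -> wdiff g z ->
  dz j (fun w => f w + g w) z = dz j f z + dz j g z.
Proof.
move=> df dg; rewrite (is_dz (is_rderiveD (wdiffE _ df) (wdiffE _ dg))
  (is_rderiveD (wdiffE _ df) (wdiffE _ dg))) /dz; rderive_ring.
Qed.
Lemma dzbD j f g z : wdiff f z -> wdiff g z ->
  dzb j (fun w => f w + g w) z = dzb j f z + dzb j g z.
Proof.
move=> df dg; rewrite (is_dzb (is_rderiveD (wdiffE _ df) (wdiffE _ dg))
  (is_rderiveD (wdiffE _ df) (wdiffE _ dg))) /dzb; rderive_ring.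
Qed.
Lemma dzM j f g z : wdiff f z -> wdiff g z ->
  dz j (fun w => f w * g w) z = dz j f z * g z + f z * dz j g z.
Proof.
move=> df dg; rewrite (is_dz (is_rderiveM (wdiffE _ df) (wdiffE _ dg))
  (is_rderiveM (wdiffE _ df) (wdiffE _ dg))) /dz; rderive_ring.
Qed.
Lemma dzbM j f g z : wdiff f z -> wdiff g z ->
  dzb j (fun w => f w * g w) z = dzb j f z * g z + f z * dzb j g z.
Proof.
move=> df dg; rewrite (is_dzb (is_rderiveM (wdiffE _ df) (wdiffE _ dg))
  (is_rderiveM (wdiffE _ df) (wdiffE _ dg))) /dzb; rderive_ring.
Qed.
Lemma dz_cst j (c : C) z : dz j (fun=> c) z = 0.
Proof. by rewrite (is_dz (is_rderive_cst _ _ _) (is_rderive_cst _ _ _)) mulr0 subrr mulr0. Qed.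
Lemma dzb_cst j (c : C) z : dzb j (fun=> c) z = 0.
Proof. by rewrite (is_dzb (is_rderive_cst _ _ _) (is_rderive_cst _ _ _)) mulr0 addr0 mulr0. Qed.
Lemma dzZ j (c : C) f z : wdiff f z -> dz j (fun w => c * f w) z = c * dz j f z.
Proof. by move=> df; rewrite dzM ?dz_cst ?mul0r ?add0r //; exact: wdiff_cst. Qed.
Lemma dzZr j (c : C) f z : wdiff f z -> dz j (fun w => f w * c) z = dz j f z * c.
Proof. by move=> df; rewrite dzM ?dz_cst ?mulr0 ?addr0 //; exact: wdiff_cst. Qed.
Lemma dzbZr j (c : C) f z : wdiff f z -> dzb j (fun w => f w * c) z = dzb j f z * c.
Proof. by move=> df; rewrite dzbM ?dzb_cst ?mulr0 ?addr0 //; exact: wdiff_cst. Qed.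

Lemma dzJ j f z : wdiff f z -> dz j (fun w => (f w)^*) z = (dzb j f z)^*.
Proof.
move=> df; rewrite (is_dz (is_rderiveJ (wdiffE _ df)) (is_rderiveJ (wdiffE _ df))) /dzb.
by rewrite rmorphM rmorphD rmorphM /= conjcI conjc2V; rderive_ring.
Qed.
Lemma dzbJ j f z : wdiff f z -> dzb j (fun w => (f w)^*) z = (dz j f z)^*.
Proof.
move=> df; rewrite (is_dzb (is_rderiveJ (wdiffE _ df)) (is_rderiveJ (wdiffE _ df))) /dz.
by rewrite rmorphM rmorphB rmorphM /= conjcI conjc2V; rderive_ring.
Qed.

Lemma ebaseE j k : ebase j 0 k = (j == k)%:R :> C.
Proof. by rewrite /ebase mxE eqxx eq_sym. Qed.

Lemma dz_coord j k z : dz j (fun w => w 0 k) z = (j == k)%:R.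
Proof.
rewrite (is_dz (is_rderive_coord _ _ _) (is_rderive_coord _ _ _)) !mxE -/(_ == _) eqxx /= eq_sym.
have -> : 'i%C * ('i%C * (j == k)%:R) = - (j == k)%:R :> C by rewrite mulrA -expr2 sqr_i mulN1r.
by field.
Qed.
Lemma dzb_coord j k z : dzb j (fun w => w 0 k) z = 0.
Proof.
rewrite (is_dzb (is_rderive_coord _ _ _) (is_rderive_coord _ _ _)) !mxE eqxx /= eq_sym.
have -> : 'i%C * ('i%C * (j == k)%:R) = - (j == k)%:R :> C by rewrite mulrA -expr2 sqr_i mulN1r.
by rewrite subrr mulr0.
Qed.
Lemma dz_conj j k z : dz j (fun w => (w 0 k)^*) z = 0.
Proof. by rewrite dzJ ?dzb_coord ?rmorph0 //; exact: wdiff_coord. Qed.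
Lemma dzb_conj j k z : dzb j (fun w => (w 0 k)^*) z = (j == k)%:R.
Proof. by rewrite dzbJ ?dz_coord ?rmorph_nat //; exact: wdiff_coord. Qed.

Lemma dz_sum j (I : Type) (r : seq I) (P : pred I) (F : I -> Cn -> C) z :
  (forall a, P a -> wdiff (F a) z) ->
  dz j (fun w => \sum_(i <- r | P i) F i w) z = \sum_(i <- r | P i) dz j (F i) z.
Proof.
move=> H; rewrite (is_dz (is_rderive_sum _ (fun a Pa => wdiffE _ (H a Pa)))
  (is_rderive_sum _ (fun a Pa => wdiffE _ (H a Pa)))) /dz.
by rewrite mulr_sumr -sumrB mulr_sumr.
Qed.

Lemma wdiff_comp (u : Cn -> R) (s : R -> R) z (ds : R) :
  wdiff (fun w => (u w)%:C) z -> is_derive (u z) 1 s ds ->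
  wdiff (fun w => (s (u w))%:C) z.
Proof.
by move=> du hs; apply: wdiffI => v; apply: (is_rderive_comp (wdiffE v du) hs).
Qed.
Lemma dz_comp j (u : Cn -> R) (s : R -> R) z (ds : R) :
  wdiff (fun w => (u w)%:C) z -> is_derive (u z) 1 s ds ->
  dz j (fun w => (s (u w))%:C) z = ds%:C * dz j (fun w => (u w)%:C) z.
Proof.
move=> du hs; rewrite (is_dz (is_rderive_comp (wdiffE _ du) hs) (is_rderive_comp (wdiffE _ du) hs)) /dz.
rderive_ring.
Qed.
Lemma dzb_comp j (u : Cn -> R) (s : R -> R) z (ds : R) :
  wdiff (fun w => (u w)%:C) z -> is_derive (u z) 1 s ds ->
  dzb j (fun w => (s (u w))%:C) z = ds%:C * dzb j (fun w => (u w)%:C) z.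
Proof.
move=> du hs; rewrite (is_dzb (is_rderive_comp (wdiffE _ du) hs) (is_rderive_comp (wdiffE _ du) hs)) /dzb.
rderive_ring.
Qed.

Lemma wdiff_sqnorm z : wdiff (fun w => (sqnorm w)%:C) z.
Proof. by apply: wdiffI => v; exact: is_rderive_sqnorm. Qed.
Lemma dz_sqnorm j z : dz j (fun w => (sqnorm w)%:C) z = (z 0 j)^*.
Proof.
under [fun w : Cn => _]eq_fun do rewrite sqnormC.
rewrite dz_sum => [|k _]; last by apply: wdiffM; [exact: wdiff_coord|exact: wdiff_conj].
rewrite (bigD1 j) //= big1 => [|k kj]; last first.
  by rewrite dzM ?dz_coord ?dz_conj ?mulr0 ?addr0 ?(eq_sym j) ?(negPf kj) ?mul0r //;
    [exact: wdiff_coord|exact: wdiff_conj].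
by rewrite dzM ?dz_coord ?dz_conj ?mulr0 ?addr0 ?eqxx ?mul1r //;
    [exact: wdiff_coord|exact: wdiff_conj].
Qed.
Lemma dzb_sqnorm j z : dzb j (fun w => (sqnorm w)%:C) z = z 0 j.
Proof.
have -> : (fun w => (sqnorm w)%:C) = (fun w => ((sqnorm w)%:C)^*) :> (Cn -> C).
  by apply/funext => w; rewrite conjRC.
by rewrite dzbJ ?dz_sqnorm ?conjCK //; exact: wdiff_sqnorm.
Qed.

Lemma wdiff_radial (s : R -> R) z (ds : R) : is_derive (sqnorm z) 1 s ds ->
  wdiff (fun w => (s (sqnorm w))%:C) z.
Proof. by move=> hs; apply: wdiff_comp hs; exact: wdiff_sqnorm. Qed.
Lemma dz_radial j (s : R -> R) z (ds : R) : is_derive (sqnorm z) 1 s ds ->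
  dz j (fun w => (s (sqnorm w))%:C) z = ds%:C * (z 0 j)^*.
Proof. by move=> hs; rewrite (dz_comp _ (wdiff_sqnorm z) hs) dz_sqnorm. Qed.
Lemma dzb_radial j (s : R -> R) z (ds : R) : is_derive (sqnorm z) 1 s ds ->
  dzb j (fun w => (s (sqnorm w))%:C) z = ds%:C * z 0 j.
Proof. by move=> hs; rewrite (dzb_comp _ (wdiff_sqnorm z) hs) dzb_sqnorm. Qed.

End Wirtinger.

Ltac wd := lazymatch goal with
  | |- wdiff (fun _ => ?c) _ => exact: wdiff_cst
  | |- wdiff (fun w => @Algebra.add _ (@?f w) (@?g w)) _ => apply: (@wdiffD _ _ f g); wd
  | |- wdiff (fun w => @GRing.mul _ (@?f w) (@?g w)) _ => apply: (@wdiffM _ _ f g); wd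
  | |- wdiff (fun w => @Algebra.opp _ (@?f w)) _ => apply: (@wdiffN _ _ f); wd
  | |- wdiff (fun w => @Num.conj _ (fun_of_matrix w _ ?j)) _ => exact: wdiff_conj
  | |- wdiff (fun w => fun_of_matrix w _ ?j) _ => exact: wdiff_coord
  | |- _ => solve [match goal with H : wdiff ?f ?z |- wdiff ?f ?z => exact H end]
  end.

(* The bound n on the order of differentiation is what the closure properties are
   proved by induction on. *)
Section Smooth.
Context {R : realType} {n : nat}.
Local Notation C := R[i].
Local Notation Cn := 'rV[C]_n.
Implicit Types (f g : Cn -> C) (v z : Cn) (U : set Cn) (j k : 'I_n) (m : nat).

Definition econt f z : Prop := forall e : R, 0 < e -> exists2 d : R, 0 < d &
  forall w : Cn, (forall j, normc (w 0 j - z 0 j) < d) -> normc (f w - f z) < e.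

Lemma econt2 f g z (e1 e2 : R) : econt f z -> econt g z -> 0 < e1 -> 0 < e2 ->
  exists2 d : R, 0 < d & forall w : Cn, (forall j, normc (w 0 j - z 0 j) < d) ->
    normc (f w - f z) < e1 /\ normc (g w - g z) < e2.
Proof.
move=> cf cg /cf[d1 d10 d1P] /cg[d2 d20 d2P].
exists (Num.min d1 d2); first by rewrite lt_min d10.
move=> w wd; split; [apply: d1P|apply: d2P] => j; apply: lt_le_trans (wd j) _;
  by rewrite ge_min lexx ?orbT.
Qed.

Lemma econt_open U f g z : open U -> U z -> (forall w, U w -> f w = g w) ->
  econt g z -> econt f z.
Proof.
move=> /openCnP oU Uz fg cg e e0.
have [d1 d10 d1P] := cg e e0; have [d2 d20 d2P] := oU _ Uz.
exists (Num.min d1 d2); first by rewrite lt_min d10.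
move=> w wd; rewrite !fg //; last by apply: d2P => j; apply: lt_le_trans (wd j) _; rewrite ge_min lexx orbT.
by apply: d1P => j; apply: lt_le_trans (wd j) _; rewrite ge_min lexx.
Qed.

Lemma econtD f g z : econt f z -> econt g z -> econt (fun w => f w + g w) z.
Proof.
move=> cf cg e e0; have e2 : 0 < e / 2 by rewrite divr_gt0.
have [d d0 dP] := econt2 cf cg e2 e2; exists d => // w /dP[h1 h2].
rewrite opprD addrACA; apply: le_lt_trans (normcD _ _) _.
by rewrite [e]splitr ltrD.
Qed.

Lemma econtM f g z : econt f z -> econt g z -> econt (fun w => f w * g w) z.
Proof.
move=> cf cg e e0.
pose M := 1 + normc (f z) + normc (g z).
have M0 : 0 < M by rewrite /M -addrA ltr_pwDl // addr_ge0 // normc_ge0.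
pose t := Num.min 1 (e / M).
have t0 : 0 < t by rewrite /t lt_min ltr01 divr_gt0.
have [d d0 dP] := econt2 cf cg t0 t0; exists d => // w /dP[h1 h2].
have -> : f w * g w - f z * g z = (f w - f z) * (g w - g z) + (f w - f z) * g z + f z * (g w - g z) by ring.
have tM : t * M <= e by rewrite -ler_pdivlMr // /t ge_min lexx orbT.
apply: lt_le_trans tM.
apply: le_lt_trans (normcD _ _) _; rewrite normcM.
have h3 : normc ((f w - f z) * (g w - g z)) < t.
  rewrite normcM -[ltRHS]mulr1; apply: ltr_pM => //; rewrite ?normc_ge0 //.
  by apply: lt_le_trans h2 _; rewrite /t ge_min lexx.
have -> : t * M = t + t * normc (g z) + normc (f z) * t by rewrite /M; ring.
apply: ltr_leD; last by apply: ler_wpM2l; [exact: normc_ge0|exact: ltW].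
apply: le_lt_trans (normcD _ _) _; rewrite [normc (_ * g z)]normcM.
by apply: ltr_leD => //; apply: ler_wpM2r; [exact: normc_ge0|exact: ltW].
Qed.

Lemma econtJ f z : econt f z -> econt (fun w => (f w)^*) z.
Proof.
by move=> cf e /cf[d d0 dP]; exists d => // w /dP; rewrite -rmorphB /= normc_conj.
Qed.

Lemma econt_coord j z : econt (fun w => w 0 j) z.
Proof. by move=> e e0; exists e => // w /(_ j). Qed.

Lemma econt_cst (c : C) z : econt (fun=> c) z.
Proof. by move=> e e0; exists 1 => // w _; rewrite subrr normc0. Qed.

Lemma econt_inv f z : f z != 0 -> econt f z -> econt (fun w => (f w)^-1) z.
Proof.
move=> f0 cf e e0; pose m := normc (f z).
have m0 : 0 < m by rewrite normc_gt0.
(* The bound m / 2 keeps |f w| above m / 2; then |1 / f w - 1 / f z| is at most |f w - f z| / (m^2 /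
   2). *)
have t0 : 0 < Num.min (m / 2) (e * (m ^+ 2 / 2)).
  by rewrite lt_min !(divr_gt0, mulr_gt0, exprn_gt0).
have [d d0 dP] := cf _ t0; exists d => // w /dP; rewrite lt_min => /andP[h1 h2].
have fw : m / 2 < normc (f w).
  have : m <= normc (f w) + normc (f w - f z).
    rewrite normcB; apply: le_trans (normcD _ _).
    by rewrite le_eqVlt; apply/orP; left; apply/eqP; congr normc; ring.
  by move=> h; lra.
have fw0 : f w != 0 by rewrite -normc_gt0; apply: lt_trans fw; rewrite divr_gt0.
have -> : (f w)^-1 - (f z)^-1 = (f z - f w) / (f w * f z) by field; rewrite f0 fw0.
rewrite normcM normcV normcM normcB ltr_pdivrMr; last by rewrite mulr_gt0 ?normc_gt0.
apply: lt_le_trans h2 _; rewrite ler_pM2l // -/m expr2 -mulrA mulrC mulrAC.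
by rewrite mulrAC ler_pM2r // ltW.
Qed.

Fixpoint csm m U f : Prop :=
  (forall z, U z -> econt f z) /\
  if m is m'.+1 then
    (forall z, U z -> wdiff f z) /\ forall v, csm m' U (rderive v f)
  else True.

Lemma csm_continuous m U f z : csm m U f -> U z -> econt f z.
Proof. by case: m => [|m] [h _] /h. Qed.

Lemma csm_smooth U f : (forall m, csm m U f) -> smooth_on U f.
Proof.
move=> H vs z Uz.
suff K (us : seq Cn) (h : Cn -> C) : (forall m, csm m U h) -> forall m, csm m U (foldr rderive h us).
  split; first by apply/continuousCnP; exact: csm_continuous (K vs f H 0%N) Uz.
  by move=> v; have [_ [/(_ _ Uz)[h] _]] := K vs f H 1%N; exact: h.
elim: us h => //= v us IH h Hh m; have /= := IH h Hh m.+1; by move=> [_ [_ /(_ v)]].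
Qed.

Lemma smooth_rderive U f v : smooth_on U f -> smooth_on U (rderive v f).
Proof. by move=> H vs z Uz; have := H (rcons vs v) z Uz; rewrite -cats1 foldr_cat. Qed.

Lemma smooth_wdiff U f z : smooth_on U f -> U z -> wdiff f z.
Proof. by move=> H Uz; have [_ /= h] := H [::] z Uz; split. Qed.

(** The rules of calculus identify a derivative on U only; this lets each closure property below
    replace it by its formula. *)
Lemma csm_open m U f g : open U -> (forall w, U w -> f w = g w) -> csm m U g -> csm m U f.
Proof.
move=> oU; elim: m f g => [|m IH] f g fg /= [cg H].
  by split=> [z Uz|//]; exact: econt_open oU Uz fg (cg z Uz).
split; first by move=> z Uz; exact: econt_open oU Uz fg (cg z Uz).
case: H => dg H; split; first by move=> z Uz; exact: wdiff_open oU Uz fg (dg z Uz).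
move=> v; apply: IH (H v) => w Uw; exact: rderive_open oU Uw fg.
Qed.

Lemma csm_le m U f : csm m.+1 U f -> csm m U f.
Proof.
elim: m f => [|m IH] f /= [cf [df H]]; split => //; split => // v; exact: IH.
Qed.

Lemma csmD m U f g : open U -> csm m U f -> csm m U g -> csm m U (fun w => f w + g w).
Proof.
move=> oU; elim: m f g => [|m IH] f g /= [cf Hf] [cg Hg].
  split=> [z Uz|//]; apply: econtD; [exact: cf|exact: cg].
split; first by move=> z Uz; apply: econtD; [exact: cf|exact: cg].
case: Hf Hg => df Hf [dg Hg].
split; first by move=> z Uz; apply: wdiffD; [exact: df|exact: dg].
move=> v; apply: (@csm_open _ _ _ (fun w => rderive v f w + rderive v g w)) => //; last exact: IH.
by move=> w Uw; apply: is_rderiveE; apply: is_rderiveD; apply: wdiffE; [exact: df|exact: dg].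
Qed.

Lemma csmM m U f g : open U -> csm m U f -> csm m U g -> csm m U (fun w => f w * g w).
Proof.
move=> oU; elim: m f g => [|m IH] f g Hf' Hg'.
  move: Hf' Hg' => /= [cf Hf] [cg Hg].
  split=> [z Uz|//]; apply: econtM; [exact: cf|exact: cg].
have Hfm := csm_le Hf'; have Hgm := csm_le Hg'.
move: Hf' Hg' => /= [cf Hf] [cg Hg].
split; first by move=> z Uz; apply: econtM; [exact: cf|exact: cg].
case: Hf Hg => df Hf [dg Hg].
split; first by move=> z Uz; apply: wdiffM; [exact: df|exact: dg].
move=> v; apply: (@csm_open _ _ _ (fun w => rderive v f w * g w + f w * rderive v g w)) => //; last first.
  by apply: csmD => //; exact: IH.
by move=> w Uw; apply: is_rderiveE; apply: is_rderiveM; apply: wdiffE; [exact: df|exact: dg].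
Qed.

Lemma csm_cst m U (c : C) : csm m U (fun=> c).
Proof.
elim: m c => [|m IH] c /=; split => //.
- by move=> z _; exact: econt_cst.
- by move=> z _; exact: econt_cst.
split; first by move=> z _; exact: wdiff_cst.
move=> v; rewrite (_ : rderive v _ = fun=> 0) //.
by apply/funext => z; apply: is_rderiveE; exact: is_rderive_cst.
Qed.

Lemma csmN m U f : open U -> csm m U f -> csm m U (fun w => - f w).
Proof.
move=> oU H; apply: (@csm_open _ _ _ (fun w => (- 1) * f w)) => //.
  by move=> w _; rewrite mulN1r.
by apply: csmM => //; exact: csm_cst.
Qed.

Lemma csmJ m U f : open U -> csm m U f -> csm m U (fun w => (f w)^*).
Proof.
move=> oU; elim: m f => [|m IH] f /= [cf Hf].
  split=> [z Uz|//]; apply: econtJ; exact: cf.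
split; first by move=> z Uz; apply: econtJ; exact: cf.
case: Hf => df Hf; split; first by move=> z Uz; apply: wdiffJ; exact: df.
move=> v; apply: (@csm_open _ _ _ (fun w => (rderive v f w)^*)) => //; last exact: IH.
by move=> w Uw; apply: is_rderiveE; apply: is_rderiveJ; apply: wdiffE; exact: df.
Qed.

Lemma csm_coord m U j : csm m U (fun w => w 0 j).
Proof.
case: m => [|m] /=; split => //; do ?by move=> z _; exact: econt_coord.
split; first by move=> z _; exact: wdiff_coord.
move=> v; rewrite (_ : rderive v _ = fun=> v 0 j); first exact: csm_cst.
by apply/funext => z; apply: is_rderiveE; exact: is_rderive_coord.
Qed.

Lemma csm_inv m U f : open U -> (forall z, U z -> f z != 0) -> csm m U f ->
  csm m U (fun w => (f w)^-1).
Proof.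
move=> oU f0; elim: m => [|m IH] H.
  split=> [z Uz|//]; apply: econt_inv; [exact: f0|exact: csm_continuous H Uz].
have IH' := IH (csm_le H).
move: H => /= [cf [df Hf]].
split; first by move=> z Uz; apply: econt_inv; [exact: f0|exact: cf].
split; first by move=> z Uz; apply: wdiff_inv; [exact: f0|exact: df].
move=> v; apply: (@csm_open _ _ _ (fun w => (- rderive v f w) * ((f w)^-1 * (f w)^-1))) => //.
  move=> w Uw; rewrite (is_rderiveE (is_rderive_inv (f0 _ Uw) (wdiffE v (df _ Uw)))).
  by rewrite expr2 invfM.
by apply: csmM => //; [exact: csmN|exact: csmM].
Qed.

Lemma csm_sum m U (I : Type) (r : seq I) (P : pred I) (F : I -> Cn -> C) : open U ->
  (forall a, P a -> csm m U (F a)) -> csm m U (fun w => \sum_(a <- r | P a) F a w).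
Proof.
move=> oU H; elim: r => [|a r IH].
  by under eq_fun do rewrite big_nil; exact: csm_cst.
under eq_fun do rewrite big_cons.
by case: (boolP (P a)) => // Pa; apply: csmD => //; exact: H.
Qed.

Lemma csm_sqnorm m U : open U -> csm m U (fun w => (sqnorm w)%:C).
Proof.
move=> oU; under [fun w : Cn => _]eq_fun do rewrite sqnormC.
apply: csm_sum => // j _; apply: csmM => //; first exact: csm_coord.
by apply: csmJ => //; exact: csm_coord.
Qed.

Lemma csm_ln m U (u : Cn -> R) : open U -> (forall z, U z -> 0 < u z) ->
  csm m U (fun w => (u w)%:C) -> csm m U (fun w => (ln (u w))%:C).
Proof.
move=> oU u0 H.
have lnC z : U z -> econt (fun w => (ln (u w))%:C) z.
  move=> Uz e e0.
  have /cvgrPdist_lt/(_ _ e0)/nbhs_ballP[d /= d0 dP] := continuous_ln (u0 _ Uz).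
  have [t t0 tP] := csm_continuous H Uz d0.
  exists t => // w /tP; rewrite -rmorphB normc_real distrC => /dP h.
  by move: h; rewrite distrC -normc_real rmorphB; apply.
case: m H => [|m] H /=; split => //.
have Hm := csm_le H; move: H => /= [cu [du Hu]].
have dln z : U z -> forall v, is_rderive v (fun w => (ln (u w))%:C) z ((u z)^-1%:C * rderive v (fun w => (u w)%:C) z).
  move=> Uz v; apply: is_rderive_comp; first by apply: wdiffE; exact: du.
  by apply: is_derive1_ln; exact: u0.
split; first by move=> z Uz; exact: wdiffI (dln z Uz).
move=> v; apply: (@csm_open _ _ _ (fun w => ((u w)%:C)^-1 * rderive v (fun w => (u w)%:C) w)) => //.
  by move=> w Uw; rewrite (is_rderiveE (dln w Uw v)) fmorphV.
apply: csmM => //; apply: csm_inv => // z Uz.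
by rewrite fmorph_eq0 gt_eqF // u0.
Qed.

End Smooth.

(** * Radial metrics and their curvature *)

Section RadialTensors.
Context {R : realType} {n : nat}.
Local Notation C := R[i].
Local Notation Cn := 'rV[C]_n.
Variables (z : Cn) (z0 : sqnorm z != 0).
Implicit Types (i j k l : 'I_n) (p q a b : R).
Local Notation x := (sqnorm z).

(* The orthogonal projection onto the complex line through z is zbar_i z_j / |z|^2;
   [rmat p q] acts as q on that line and as p on its orthogonal complement. *)
Definition prj i j : C := (z 0 i)^* * z 0 j / x%:C.
Definition dlt i j : C := (i == j)%:R.
Definition rmat p q i j : C := p%:C * (dlt i j - prj i j) + q%:C * prj i j.
Definition rtr p q : R := (n%:R - 1) * p + q.

Let xC0 : x%:C != 0 :> C. Proof. by rewrite fmorph_eq0. Qed.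

Lemma prj_tr : \sum_i prj i i = 1.
Proof.
rewrite -mulr_suml; under eq_bigr do rewrite mulrC.
by rewrite -sqnormC divff.
Qed.

Lemma prj_mul i k : \sum_j prj i j * prj j k = prj i k.
Proof.
rewrite /prj.
transitivity (\sum_j (z 0 j * (z 0 j)^*) * ((z 0 i)^* * z 0 k / x%:C / x%:C)).
  apply: eq_bigr => j _; move: (z 0 i)^* (z 0 j)^* (z 0 k) (z 0 j) (x%:C)^-1 => *; ring.
rewrite -mulr_suml -sqnormC; move: ((z 0 i)^* * z 0 k) => t.
by field.
Qed.

Lemma prjJ i j : (prj i j)^* = prj j i.
Proof. by rewrite /prj !cjM cjV conjCK conjRC (mulrC (z 0 i)). Qed.

Lemma dltC i j : dlt i j = dlt j i.
Proof. by rewrite /dlt eq_sym. Qed.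

Lemma dltJ i j : (dlt i j)^* = dlt j i.
Proof. by rewrite /dlt cj_nat eq_sym. Qed.

Lemma sum_delta i (f : 'I_n -> C) : \sum_j dlt i j * f j = f i.
Proof.
rewrite (bigD1 i) //= big1 /dlt => [|j ji]; first by rewrite eqxx mul1r addr0.
by rewrite eq_sym (negPf ji) mul0r.
Qed.

(** The two projections are complementary, so such matrices multiply eigenvalue by eigenvalue. *)
Lemma rmatM p q a b i k : \sum_j rmat p q i j * rmat a b j k = rmat (p * a) (q * b) i k.
Proof.
transitivity (\sum_j ((p * a)%:C * (dlt i j * dlt j k) +
   ((q - p)%:C * a%:C) * (prj i j * dlt j k) + (p%:C * (b - a)%:C) * (dlt i j * prj j k)
   + (q - p)%:C * (b - a)%:C * (prj i j * prj j k))).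
  apply: eq_bigr => j _; rewrite /rmat !rcB !rcM.
  move: (prj i j) (prj j k) (dlt i j) (dlt j k) p%:C q%:C a%:C b%:C => *; ring.
rewrite !big_split /= -!mulr_sumr prj_mul !sum_delta.
have -> : \sum_j prj i j * dlt j k = prj i k.
  by under eq_bigr do rewrite mulrC dltC; rewrite sum_delta.
rewrite /rmat !rcB !rcM.
move: (prj i k) (dlt i k) p%:C q%:C a%:C b%:C => *; ring.
Qed.

Lemma rmat_tr p q : \sum_i rmat p q i i = (rtr p q)%:C.
Proof.
rewrite /rmat big_split /= -!mulr_sumr sumrB prj_tr.
under eq_bigr do rewrite /dlt eqxx.
rewrite sumr_const card_ord /rtr rcD rcM rcB rc1 rc_nat.
by rewrite mulr1 mulrC.
Qed.

Lemma rmatJ p q i j : (rmat p q i j)^* = rmat p q j i.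
Proof. by rewrite /rmat cjD cjM cjB dltJ prjJ conjRC cjM conjRC prjJ. Qed.

Lemma rmatD p q a b i j : rmat p q i j + rmat a b i j = rmat (p + a) (q + b) i j.
Proof. by rewrite /rmat !rcD !mulrDl addrACA. Qed.

Lemma rmatZ c p q i j : c%:C * rmat p q i j = rmat (c * p) (c * q) i j.
Proof. by rewrite /rmat !rcM mulrDr !mulrA. Qed.

Lemma rmatN p q i j : - rmat p q i j = rmat (- p) (- q) i j.
Proof. by rewrite /rmat !rcN !mulNr opprD. Qed.

Lemma rmatB p q a b i j : rmat p q i j - rmat a b i j = rmat (p - a) (q - b) i j.
Proof. by rewrite rmatN rmatD. Qed.

Lemma rmat_delta i j : dlt i j = rmat 1 1 i j.
Proof. by rewrite /rmat rmorph1 !mul1r subrK. Qed.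

Lemma rmat_zz i j : (z 0 i)^* * z 0 j = rmat 0 x i j.
Proof. by rewrite /rmat rmorph0 mul0r add0r /prj; move: ((z 0 i)^* * z 0 j) => t; field. Qed.

Lemma rmat_lin p q i j : p%:C * dlt i j + q%:C * ((z 0 i)^* * z 0 j) = rmat p (p + q * x) i j.
Proof. by rewrite rmat_zz rmat_delta !rmatZ rmatD mulr0 addr0 !mulr1. Qed.

(* With the symmetries in (i, k) and in (j, l) of a curvature tensor. *)
Definition tens4 (al be ga : R) i j k l : C :=
  al%:C * (rmat 1 0 i j * rmat 1 0 k l + rmat 1 0 i l * rmat 1 0 k j)
  + be%:C * (rmat 1 0 i j * rmat 0 1 k l + rmat 0 1 i j * rmat 1 0 k l
           + rmat 1 0 i l * rmat 0 1 k j + rmat 0 1 i l * rmat 1 0 k j)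
  + ga%:C * (rmat 0 1 i j * rmat 0 1 k l).

Lemma rmat01 i j : rmat 0 1 i j = prj i j.
Proof. by rewrite /rmat rmorph0 rmorph1 mul0r add0r mul1r. Qed.

(** Rank one. For this reason the last coefficient of [tens4] needs a single product where the
    others need a symmetrization. *)
Lemma prj_swap i j k l : prj i j * prj k l = prj i l * prj k j.
Proof. by rewrite /prj; move: (z 0 i)^* (z 0 j) (z 0 k)^* (z 0 l) (x%:C)^-1 => *; ring. Qed.

Lemma tens4_sym13 al be ga i j k l : tens4 al be ga i j k l = tens4 al be ga k j i l.
Proof.
rewrite /tens4 !rmat01 (prj_swap k j i l) (mulrC (prj k l)).
move: (prj i j) (prj k l) (prj i l) (prj k j) (rmat 1 0 i j) (rmat 1 0 k l) (rmat 1 0 i l) (rmat 1 0 k j) al%:C be%:C ga%:C => *; ring.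
Qed.

Lemma tens4_sym24 al be ga i j k l : tens4 al be ga i j k l = tens4 al be ga i l k j.
Proof.
rewrite /tens4 !rmat01 (prj_swap i l k j).
move: (prj i j) (prj k l) (prj i l) (prj k j) (rmat 1 0 i j) (rmat 1 0 k l) (rmat 1 0 i l) (rmat 1 0 k j) al%:C be%:C ga%:C => *; ring.
Qed.

Lemma tens4J al be ga i j k l : (tens4 al be ga i j k l)^* = tens4 al be ga j i l k.
Proof.
have E (a b c x1 x2 x3 x4 y1 y2 y3 y4 : C) :
  (a * (x1 * x2 + x3 * x4) + b * (x1 * y2 + y1 * x2 + x3 * y4 + y3 * x4) + c * (y1 * y2))^* =
  a^* * (x1^* * x2^* + x3^* * x4^*) + b^* * (x1^* * y2^* + y1^* * x2^* + x3^* * y4^* + y3^* * x4^*)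
  + c^* * (y1^* * y2^*) by rewrite !(cjD, cjM).
rewrite /tens4 E !rmatJ !conjRC.
move: (rmat 0 1 j i) (rmat 0 1 l k) (rmat 0 1 l i) (rmat 0 1 j k) (rmat 1 0 j i) (rmat 1 0 l k) (rmat 1 0 l i) (rmat 1 0 j k) al%:C be%:C ga%:C => *; ring.
Qed.

(** The indices r and s close up to a trace, and k remains as a matrix product. *)
Lemma contr_direct p q p' q' a b a' b' j i :
  \sum_k \sum_r \sum_s rmat p q j k * rmat p' q' r s * (rmat a b k i * rmat a' b' s r)
  = (rtr (p' * a') (q' * b'))%:C * rmat (p * a) (q * b) j i.
Proof.
rewrite -rmatM -rmat_tr big_distrlr /= exchange_big /=.
apply: eq_bigr => k _; apply: eq_bigr => r _; rewrite -rmatM mulr_suml.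
apply: eq_bigr => s _; move: (rmat p q j k) (rmat p' q' r s) (rmat a b k i) (rmat a' b' s r) => *; ring.
Qed.

(** Here the indices j, k, r, s, i form one chain, so no trace appears. *)
Lemma contr_cross p q p' q' a b a' b' j i :
  \sum_k \sum_r \sum_s rmat p q j k * rmat p' q' r s * (rmat a b k r * rmat a' b' s i)
  = rmat (p * a * p' * a') (q * b * q' * b') j i.
Proof.
rewrite -(rmatM (p * a * p')) exchange_big [RHS](eq_bigr (fun s => \sum_k \sum_r rmat p q j k * rmat p' q' r s * (rmat a b k r * rmat a' b' s i))).
  rewrite [RHS]exchange_big /=.
  under [RHS]eq_bigr do rewrite exchange_big /=.
  by rewrite exchange_big.
move=> s _; rewrite -rmatM mulr_suml exchange_big /=; apply: eq_bigr => r _.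
rewrite -rmatM !mulr_suml; apply: eq_bigr => k _.
move: (rmat p q j k) (rmat p' q' r s) (rmat a b k r) (rmat a' b' s i) => *; ring.
Qed.

(** The factor n in front of [al] is the trace n - 1 over the complement of z plus 1 from the
    crossed product. *)
Lemma contr3 p q p' q' al be ga j i :
  \sum_k \sum_r \sum_s rmat p q j k * rmat p' q' r s * tens4 al be ga k i s r
  = rmat (n%:R * al * p * p' + be * p * q') ((n%:R - 1) * be * q * p' + ga * q * q') j i.
Proof.
transitivity (
  al%:C * ((\sum_k \sum_r \sum_s rmat p q j k * rmat p' q' r s * (rmat 1 0 k i * rmat 1 0 s r))
         + (\sum_k \sum_r \sum_s rmat p q j k * rmat p' q' r s * (rmat 1 0 k r * rmat 1 0 s i)))
  + be%:C * ((\sum_k \sum_r \sum_s rmat p q j k * rmat p' q' r s * (rmat 1 0 k i * rmat 0 1 s r))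
         + (\sum_k \sum_r \sum_s rmat p q j k * rmat p' q' r s * (rmat 0 1 k i * rmat 1 0 s r))
         + (\sum_k \sum_r \sum_s rmat p q j k * rmat p' q' r s * (rmat 1 0 k r * rmat 0 1 s i))
         + (\sum_k \sum_r \sum_s rmat p q j k * rmat p' q' r s * (rmat 0 1 k r * rmat 1 0 s i)))
  + ga%:C * (\sum_k \sum_r \sum_s rmat p q j k * rmat p' q' r s * (rmat 0 1 k i * rmat 0 1 s r))).
  rewrite -!big_split /= !mulr_sumr -!big_split /=; apply: eq_bigr => k _.
  rewrite -!big_split /= !mulr_sumr -!big_split /=; apply: eq_bigr => r _.
  rewrite -!big_split /= !mulr_sumr -!big_split /=; apply: eq_bigr => s _.
  rewrite /tens4.
  move: (rmat p q j k) (rmat p' q' r s) (rmat 1 0 k i) (rmat 1 0 s r) (rmat 1 0 k r) (rmat 1 0 s i) (rmat 0 1 k i) (rmat 0 1 s r) (rmat 0 1 k r) (rmat 0 1 s i) al%:C be%:C ga%:C => *; ring.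
rewrite !contr_direct !contr_cross !(rmatZ, rmatD).
by congr rmat; rewrite /rtr; ring.
Qed.

Lemma contr4 p q p' q' al be ga :
  \sum_i \sum_j \sum_k \sum_l rmat p q i j * rmat p' q' k l * tens4 al be ga j i l k
  = ((n%:R - 1) * (n%:R * al * p * p' + be * p * q') + ((n%:R - 1) * be * q * p' + ga * q * q'))%:C.
Proof. by under eq_bigr do rewrite contr3; rewrite rmat_tr. Qed.

(** The second half is the first with j and l exchanged; the radial term, invariant under that
    exchange, is divided equally. Contraction with another curvature-like tensor is then twice the
    contraction with one half, which [contr3] and [contr4] compute. *)
Lemma tens4_pair al be ga i j k l : tens4 al be ga i j k l =
  (rmat al be i j * rmat 1 0 k l + rmat be (ga / 2) i j * rmat 0 1 k l)
  + (rmat al be i l * rmat 1 0 k j + rmat be (ga / 2) i l * rmat 0 1 k j).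
Proof.
have E u v i1 j1 : rmat u v i1 j1 = u%:C * rmat 1 0 i1 j1 + v%:C * rmat 0 1 i1 j1.
  by rewrite !rmatZ rmatD !mulr1 !mulr0 addr0 add0r.
rewrite (E al be i j) (E be (ga / 2) i j) (E al be i l) (E be (ga / 2) i l) /tens4.
rewrite !(rmat01 i l, rmat01 k j).
have := prj_swap i l k j; rewrite !rmat01.
have -> : ga%:C = (ga / 2)%:C + (ga / 2)%:C :> C by rewrite -rmorphD /= -splitr.
move: (rmat 1 0 i j) (rmat 1 0 k l) (rmat 1 0 i l) (rmat 1 0 k j) (prj i j) (prj k l) (prj i l) (prj k j) al%:C be%:C (ga / 2)%:C => A B D E' P1 P2 P3 P4 a b c H.
transitivity (a * (A * B + D * E') + b * (A * P2 + P1 * B + D * P4 + P3 * E') + (c * (P1 * P2) + c * (P1 * P2))); first by ring.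
by rewrite -{2}H; ring.
Qed.

Lemma contr_pair al be ga al' be' ga' :
  \sum_i \sum_j \sum_k \sum_l tens4 al be ga i j k l * tens4 al' be' ga' j i l k
  = (2 * n%:R * (n%:R - 1) * al * al' + 4 * (n%:R - 1) * be * be' + ga * ga')%:C.
Proof.
transitivity (\sum_i \sum_j \sum_k \sum_l rmat al be i j * rmat 1 0 k l * tens4 al' be' ga' j i l k
 + \sum_i \sum_j \sum_k \sum_l rmat be (ga / 2) i j * rmat 0 1 k l * tens4 al' be' ga' j i l k
 + (\sum_i \sum_j \sum_k \sum_l rmat al be i j * rmat 1 0 k l * tens4 al' be' ga' j i l k
 + \sum_i \sum_j \sum_k \sum_l rmat be (ga / 2) i j * rmat 0 1 k l * tens4 al' be' ga' j i l k)); last first.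
  by rewrite !contr4 -!rcD; congr (_%:C); field.
pose T i j k l := rmat al be i j * rmat 1 0 k l * tens4 al' be' ga' j i l k + rmat be (ga / 2) i j * rmat 0 1 k l * tens4 al' be' ga' j i l k.
transitivity (\sum_i \sum_j \sum_k \sum_l T i j k l + \sum_i \sum_j \sum_k \sum_l T i l k j).
  rewrite -big_split; apply: eq_bigr => i _; rewrite -big_split; apply: eq_bigr => j _.
  rewrite -big_split; apply: eq_bigr => k _; rewrite -big_split; apply: eq_bigr => l _.
  rewrite tens4_pair /T (tens4_sym13 al' be' ga' l i j k) (tens4_sym24 al' be' ga' j i l k).
  by rewrite !mulrDl.
have -> : \sum_i \sum_j \sum_k \sum_l T i l k j = \sum_i \sum_j \sum_k \sum_l T i j k l.
  apply: eq_bigr => i _; rewrite exchange_big /= [RHS]exchange_big /=.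
  by apply: eq_bigr => k _; rewrite exchange_big.
congr (_ + _); rewrite -!big_split /=; apply: eq_bigr => i _; rewrite -!big_split /=; apply: eq_bigr => j _;
 rewrite -!big_split /=; apply: eq_bigr => k _; rewrite -!big_split /=; exact: eq_bigr.
Qed.

(** The contraction pattern of Ric(R, R). *)
Lemma contr5 p q al be ga :
  \sum_i \sum_j \sum_k \sum_r \sum_s
    rmat p q i j * tens4 al be ga j k r s * tens4 al be ga k i s r
  = ((n%:R - 1) * (p * (2 * n%:R * al ^+ 2 + 2 * be ^+ 2))
     + q * (2 * (n%:R - 1) * be ^+ 2 + ga ^+ 2))%:C.
Proof.
have E j i : \sum_k \sum_r \sum_s tens4 al be ga j k r s * tens4 al be ga k i s r =
    rmat (2 * n%:R * al ^+ 2 + 2 * be ^+ 2) (2 * (n%:R - 1) * be ^+ 2 + ga ^+ 2) j i.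
  transitivity ((\sum_k \sum_r \sum_s rmat al be j k * rmat 1 0 r s * tens4 al be ga k i s r
   + \sum_k \sum_r \sum_s rmat be (ga / 2) j k * rmat 0 1 r s * tens4 al be ga k i s r)
   + (\sum_k \sum_r \sum_s rmat al be j k * rmat 1 0 r s * tens4 al be ga k i s r
   + \sum_k \sum_r \sum_s rmat be (ga / 2) j k * rmat 0 1 r s * tens4 al be ga k i s r)); last first.
    by rewrite !contr3 !rmatD; congr rmat; field.
  pose T k r s := rmat al be j k * rmat 1 0 r s * tens4 al be ga k i s r + rmat be (ga / 2) j k * rmat 0 1 r s * tens4 al be ga k i s r.
  transitivity (\sum_k \sum_r \sum_s T k r s + \sum_k \sum_r \sum_s T s r k).
    rewrite -big_split; apply: eq_bigr => k _; rewrite -big_split; apply: eq_bigr => r _.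
    rewrite -big_split; apply: eq_bigr => s _.
    by rewrite tens4_pair /T (tens4_sym13 al be ga s i k r) !mulrDl.
  have -> : \sum_k \sum_r \sum_s T s r k = \sum_k \sum_r \sum_s T k r s.
    rewrite exchange_big /= [RHS]exchange_big /=.
    by apply: eq_bigr => k _; rewrite exchange_big.
  congr (_ + _); rewrite -!big_split /=; apply: eq_bigr => k _; rewrite -!big_split /=;
    apply: eq_bigr => r _; rewrite -!big_split /=; exact: eq_bigr.
transitivity (\sum_i \sum_j rmat p q i j * rmat (2 * n%:R * al ^+ 2 + 2 * be ^+ 2) (2 * (n%:R - 1) * be ^+ 2 + ga ^+ 2) j i).
  apply: eq_bigr => i _; apply: eq_bigr => j _; rewrite -E mulr_sumr.
  apply: eq_bigr => k _; rewrite mulr_sumr; apply: eq_bigr => r _; rewrite mulr_sumr.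
  by apply: eq_bigr => s _; rewrite mulrA.
by under eq_bigr do rewrite rmatM; rewrite rmat_tr /rtr; congr (_%:C); ring.
Qed.

End RadialTensors.

Section RadialDerivatives.
Context {R : realType} {n : nat}.
Local Notation C := R[i].
Local Notation Cn := 'rV[C]_n.
Implicit Types (z w : Cn) (i j k l : 'I_n).

Lemma dz_rad2 i j k z (p q : R -> R) (p' q' : R) : is_derive (sqnorm z) 1 p p' -> is_derive (sqnorm z) 1 q q' ->
  dz k (fun w => (p (sqnorm w))%:C * dlt i j + (q (sqnorm w))%:C * ((w 0 i)^* * w 0 j)) z =
  (z 0 k)^* * (p'%:C * dlt i j + q'%:C * ((z 0 i)^* * z 0 j)) + (q (sqnorm z))%:C * ((z 0 i)^* * dlt k j).
Proof.
move=> hp hq.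
have wp := wdiff_radial hp; have wq := wdiff_radial hq.
rewrite dzD; [|wd|wd]; rewrite dzZr; [|wd]; rewrite (dz_radial _ hp) dzM; [|wd|wd].
rewrite (dz_radial _ hq) dzM; [|wd|wd].
rewrite dz_conj dz_coord -/(dlt k j).
move: (z 0 i)^* (z 0 k)^* (z 0 j) (dlt i j) (dlt k j) p'%:C q'%:C (q (sqnorm z))%:C => *; ring.
Qed.

Lemma dzb_rad2 i j k z (p q : R -> R) (p' q' : R) : is_derive (sqnorm z) 1 p p' -> is_derive (sqnorm z) 1 q q' ->
  dzb k (fun w => (p (sqnorm w))%:C * dlt i j + (q (sqnorm w))%:C * ((w 0 i)^* * w 0 j)) z =
  z 0 k * (p'%:C * dlt i j + q'%:C * ((z 0 i)^* * z 0 j)) + (q (sqnorm z))%:C * (dlt i k * z 0 j).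
Proof.
move=> hp hq.
have wp := wdiff_radial hp; have wq := wdiff_radial hq.
rewrite dzbD; [|wd|wd]; rewrite dzbZr; [|wd]; rewrite (dzb_radial _ hp) dzbM; [|wd|wd].
rewrite (dzb_radial _ hq) dzbM; [|wd|wd].
rewrite dzb_conj dzb_coord -/(dlt k i) (dltC k i).
move: (z 0 i)^* (z 0 k) (z 0 j) (dlt i j) (dlt i k) p'%:C q'%:C (q (sqnorm z))%:C => *; ring.
Qed.

Lemma ddbar_radial (W : set Cn) (f : Cn -> C) (s s' : R -> R) (s'' : R) i j z : open W -> W z ->
  (forall w, W w -> f w = (s (sqnorm w))%:C) ->
  (forall w, W w -> is_derive (sqnorm w) 1 s (s' (sqnorm w))) ->
  is_derive (sqnorm z) 1 s' s'' ->
  dz i (dzb j f) z = (s' (sqnorm z))%:C * dlt i j + s''%:C * ((z 0 i)^* * z 0 j).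
Proof.
move=> oW Wz fs ds ds'.
rewrite (dz_open _ oW Wz (g := fun w => (s' (sqnorm w))%:C * w 0 j)); last first.
  by move=> w Ww; rewrite (dzb_open _ oW Ww fs) (dzb_radial _ (ds w Ww)).
rewrite dzM; [|exact: wdiff_radial ds'|exact: wdiff_coord].
rewrite (dz_radial _ ds') dz_coord -/(dlt i j).
move: (z 0 i)^* (z 0 j) (dlt i j) s''%:C (s' (sqnorm z))%:C => *; ring.
Qed.

(* third derivatives of radial potentials *)
Definition rad3 (u v : R) z i j k : C :=
  u%:C * ((z 0 k)^* * dlt i j + (z 0 i)^* * dlt k j) + v%:C * ((z 0 k)^* * ((z 0 i)^* * z 0 j)).

Lemma dz_rad2s i j k z (p q : R -> R) (q' : R) : is_derive (sqnorm z) 1 p (q (sqnorm z)) -> is_derive (sqnorm z) 1 q q' ->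
  dz k (fun w => (p (sqnorm w))%:C * dlt i j + (q (sqnorm w))%:C * ((w 0 i)^* * w 0 j)) z =
  rad3 (q (sqnorm z)) q' z i j k.
Proof.
move=> hp hq; rewrite (dz_rad2 _ _ _ hp hq) /rad3.
move: (z 0 i)^* (z 0 k)^* (z 0 j) (dlt i j) (dlt k j) q'%:C (q (sqnorm z))%:C => *; ring.
Qed.

Lemma rad3J z i j k (u v : R) : (rad3 u v z i j k)^* =
  u%:C * (z 0 k * dlt j i + z 0 i * dlt j k) + v%:C * (z 0 k * ((z 0 j)^* * z 0 i)).
Proof.
have E (a b c1 c2 c3 c4 c5 c6 c7 : C) : (a * (c1 * c2 + c3 * c4) + b * (c5 * (c6 * c7)))^* =
  a^* * (c1^* * c2^* + c3^* * c4^*) + b^* * (c5^* * (c6^* * c7^*)) by rewrite !(cjD, cjM).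
rewrite /rad3 E !conjCK !dltJ !conjRC.
by rewrite [(z 0 j)^* * _]mulrC.
Qed.

Lemma dzb_rad2s i j k z (p q : R -> R) (q' : R) : is_derive (sqnorm z) 1 p (q (sqnorm z)) -> is_derive (sqnorm z) 1 q q' ->
  dzb k (fun w => (p (sqnorm w))%:C * dlt i j + (q (sqnorm w))%:C * ((w 0 i)^* * w 0 j)) z =
  (rad3 (q (sqnorm z)) q' z j i k)^*.
Proof.
move=> hp hq; rewrite (dzb_rad2 _ _ _ hp hq) rad3J.
move: (z 0 i)^* (z 0 k) (z 0 j) (dlt i j) (dlt i k) q'%:C (q (sqnorm z))%:C => *; ring.
Qed.

(** The v-term is symmetric in i and k, so half of it goes to each summand. In this form the inverse
    metric can be applied through [rmatM]. *)
Lemma rad3_rmat z i j k (u v : R) : sqnorm z != 0 -> rad3 u v z i j k =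
  (z 0 k)^* * rmat z u (u + v / 2 * sqnorm z) i j + (z 0 i)^* * rmat z u (u + v / 2 * sqnorm z) k j.
Proof.
move=> z0; rewrite -!rmat_lin // /rad3.
have -> : v%:C = (v / 2)%:C + (v / 2)%:C :> C by rewrite -rcD -splitr.
move: (z 0 i)^* (z 0 k)^* (z 0 j) (dlt i j) (dlt k j) u%:C (v / 2)%:C => *; ring.
Qed.

Lemma wdiff_rad3 i j k z (u v : R -> R) (u' v' : R) : is_derive (sqnorm z) 1 u u' -> is_derive (sqnorm z) 1 v v' ->
  wdiff (fun w => rad3 (u (sqnorm w)) (v (sqnorm w)) w i j k) z.
Proof.
move=> hu hv; have wu := wdiff_radial hu; have wv := wdiff_radial hv; rewrite /rad3; wd.
Qed.

Lemma dzb_rad3 i j k l z (u v : R -> R) (u' v' : R) : is_derive (sqnorm z) 1 u u' -> is_derive (sqnorm z) 1 v v' ->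
  dzb l (fun w => rad3 (u (sqnorm w)) (v (sqnorm w)) w i j k) z =
  (u (sqnorm z))%:C * (dlt k l * dlt i j + dlt i l * dlt k j)
  + z 0 l * rad3 u' v' z i j k
  + (v (sqnorm z))%:C * (dlt k l * ((z 0 i)^* * z 0 j) + dlt i l * ((z 0 k)^* * z 0 j)).
Proof.
move=> hu hv.
have wu := wdiff_radial hu; have wv := wdiff_radial hv.
rewrite /rad3 dzbD; [|wd|wd]; rewrite dzbM; [|wd|wd].
rewrite dzbD; [|wd|wd]; rewrite !dzbZr; [|wd|wd].
rewrite [X in _ + X]dzbM; [|wd|wd]; rewrite dzbM; [|wd|wd].
rewrite dzbM; [|wd|wd].
rewrite !dzb_conj dzb_coord -!/(dlt _ _) (dzb_radial _ hu) (dzb_radial _ hv) (dltC l k) (dltC l i).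
move: (z 0 i)^* (z 0 k)^* (z 0 j) (z 0 l) (dlt i j) (dlt k j) (dlt k l) (dlt i l) u'%:C v'%:C (u (sqnorm z))%:C (v (sqnorm z))%:C => *; ring.
Qed.

(** That the derivative of p is q expresses closedness of the form: it makes the first derivatives
    symmetric in the unbarred indices, and the second ones of the shape [tens4]. *)
Lemma ddbar_rad2 (W : set Cn) (f : Cn -> C) (p q q' : R -> R) i j k l z (q'' : R) : open W -> W z ->
  (forall w, W w -> f w = (p (sqnorm w))%:C * dlt i l + (q (sqnorm w))%:C * ((w 0 i)^* * w 0 l)) ->
  (forall w, W w -> is_derive (sqnorm w) 1 p (q (sqnorm w))) ->
  (forall w, W w -> is_derive (sqnorm w) 1 q (q' (sqnorm w))) ->
  is_derive (sqnorm z) 1 q' q'' -> sqnorm z != 0 ->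
  let x := sqnorm z in
  dz k (dzb j f) z = tens4 z (q x) (q x + q' x * x) (2 * q x + 4 * q' x * x + q'' * x ^+ 2) i j k l.
Proof.
move=> oW Wz fE dp dq dq' z0 x.
(* The matrix is Hermitian, so its dzbar-derivative is the conjugate of a dz-derivative, and
   [dzb_rad3] also serves for the second step. *)
rewrite (dz_open _ oW Wz (g := fun w => (rad3 (q (sqnorm w)) (q' (sqnorm w)) w l i j)^*)); last first.
  by move=> w Ww; rewrite (dzb_open _ oW Ww fE) (dzb_rad2s _ _ _ (dp w Ww) (dq w Ww)).
rewrite dzJ; last exact: wdiff_rad3 (dq z Wz) dq'.
rewrite (dzb_rad3 _ _ _ _ (dq z Wz) dq').
have E (a b c1 c2 c3 c4 c5 c6 c7 c9 : C) : (a * (c1 * c2 + c3 * c4) + c9 * b + c5 * (c1 * c6 + c3 * c7))^* =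
  a^* * (c1^* * c2^* + c3^* * c4^*) + c9^* * b^* + c5^* * (c1^* * c6^* + c3^* * c7^*) by rewrite !(cjD, cjM).
have F (a b : C) : (a^* * b)^* = a * b^* by rewrite cjM conjCK.
rewrite E rad3J !F !dltJ !conjRC /tens4.
have e0 (a1 b1 : 'I_n) : rmat z 0 1 a1 b1 = (x^-1)%:C * ((z 0 a1)^* * z 0 b1).
  by rewrite rmat01 // /prj rcV; move: ((z 0 a1)^* * z 0 b1) (x%:C)^-1 => *; ring.
have e1 (a1 b1 : 'I_n) : rmat z 1 0 a1 b1 = dlt a1 b1 - (x^-1)%:C * ((z 0 a1)^* * z 0 b1).
  by rewrite -e0 (rmat_delta z) // rmatB // subr0 subrr.
rewrite !e0 !e1 -/x [(_ + q'' * _)%:C]rcD [(2 * _ + _)%:C]rcD [(q x + _)%:C]rcD !rcM rcV (rc_nat 2) (rc_nat 4).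
have xC : x%:C != 0 :> C by rewrite rc_eq0.

move: (z 0 i)^* (z 0 k)^* (z 0 j) (z 0 l) (dlt i j) (dlt k l) (dlt i l) (dlt k j) (q x)%:C (q' x)%:C q''%:C x%:C xC => *.
by field.
Qed.

End RadialDerivatives.

Section Determinant.
Variables (F : fieldType) (n : nat).

(** The matrix determinant lemma: multiplying the block matrix M by one unipotent block matrix, from
    the right and from the left, makes it block triangular in two ways. *)
Lemma det_rank1 (u : 'cV[F]_n) (v : 'rV[F]_n) :
  \det (1%:M + u *m v) = 1 + (v *m u) 0 0.
Proof.
pose M := block_mx (1%:M : 'M[F]_1) (- v) u (1%:M : 'M[F]_n).
have E1 : M *m block_mx (1%:M : 'M[F]_1) v 0 (1%:M : 'M[F]_n) = block_mx 1%:M 0 u (u *m v + 1%:M).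
  by rewrite /M mulmx_block !mulmx1 !mulmx0 !mul1mx !addr0 addrN.
have E2 : block_mx (1%:M : 'M[F]_1) v 0 (1%:M : 'M[F]_n) *m M = block_mx (1%:M + v *m u) 0 u 1%:M.
  by rewrite /M mulmx_block !mulmx1 !mul0mx !mul1mx !add0r addNr.
have D1 : \det M = \det (1%:M + u *m v).
  have := congr1 determinant E1; rewrite det_mulmx det_ublock det_lblock !det1 !mulr1 mul1r.
  by rewrite addrC.
have D2 : \det M = 1 + (v *m u) 0 0.
  have := congr1 determinant E2; rewrite det_mulmx det_ublock det_lblock !det1 !mul1r mulr1.
  by move=> ->; rewrite det_mx11 !mxE.
by rewrite -D1 D2.
Qed.

End Determinant.

Section RadialMatrices.
Context {R : realType} {n : nat}.
Local Notation C := R[i].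
Local Notation Cn := 'rV[C]_n.
Variables (z : Cn) (z0 : sqnorm z != 0).
Implicit Types (i j k l : 'I_n) (p q a b : R).

Definition rmx p q : 'M[C]_n := \matrix_(i, j) rmat z p q i j.

Lemma rmxM p q a b : rmx p q *m rmx a b = rmx (p * a) (q * b).
Proof. by apply/matrixP => i j; rewrite !mxE -rmatM //; apply: eq_bigr => k _; rewrite !mxE. Qed.

Lemma rmx1 : rmx 1 1 = 1%:M.
Proof. by apply/matrixP => i j; rewrite !mxE -rmat_delta //. Qed.

Lemma rmxV p q : p != 0 -> q != 0 -> invmx (rmx p q) = rmx p^-1 q^-1.
Proof.
move=> p0 q0.
have E : rmx p q *m rmx p^-1 q^-1 = 1%:M by rewrite rmxM !divff // rmx1.
have [u _] := mulmx1_unit E.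
by rewrite -[LHS]mulmx1 -E mulmxA mulVmx // mul1mx.
Qed.

Lemma det_rmx p q : (0 < n)%N -> p != 0 -> \det (rmx p q) = (p ^+ n.-1 * q)%:C.
Proof.
move=> n0 p0.
pose u : 'cV[C]_n := \col_i ((((q - p) / p / sqnorm z)%:C) * (z 0 i)^*).
have xC : (sqnorm z)%:C != 0 :> C by rewrite rc_eq0.
have pC : p%:C != 0 :> C by rewrite rc_eq0.
have -> : rmx p q = p%:C *: (1%:M + u *m z).
  apply/matrixP => i j; rewrite !mxE big_ord1 !mxE -/(dlt i j) /rmat /prj !rcM rcB !rcV.
  by move: (dlt i j) (z 0 i)^* (z 0 j) p%:C q%:C (sqnorm z)%:C xC pC => *; field; apply/andP.
rewrite detZ det_rank1 mxE.
under eq_bigr do rewrite !mxE mulrCA.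
rewrite -mulr_sumr -sqnormC -(@rc1 R) -rcM -rcD -rcX -rcM; congr (_%:C).
by rewrite -{1}(prednK n0) exprS; field; rewrite z0 p0.
Qed.

(** N will be [ginv], whose definition contains a transpose; hence the exchanged indices in the
    hypothesis. *)
Lemma mixed_direct (N : 'I_n -> 'I_n -> C) p q p' q' a b i j k l :
  (forall s t, N s t = rmat z a b t s) ->
  \sum_s \sum_t N j s * N l t * (rmat z p q i s * rmat z p' q' k t) =
  rmat z (p * a) (q * b) i j * rmat z (p' * a) (q' * b) k l.
Proof.
move=> NE; rewrite -!rmatM // big_distrlr /=; apply: eq_bigr => s _; apply: eq_bigr => t _.
rewrite !NE; move: (rmat _ _ _ _ _) (rmat _ _ _ _ _) (rmat _ _ _ _ _) (rmat _ _ _ _ _) => *; ring.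
Qed.

Lemma mixed_cross (N : 'I_n -> 'I_n -> C) p q p' q' a b i j k l :
  (forall s t, N s t = rmat z a b t s) ->
  \sum_s \sum_t N j s * N l t * (rmat z p q i t * rmat z p' q' k s) =
  rmat z (p * a) (q * b) i l * rmat z (p' * a) (q' * b) k j.
Proof.
move=> NE; rewrite -(@mixed_direct N p q p' q' a b i l k j NE) exchange_big /=.
apply: eq_bigr => s _; apply: eq_bigr => t _.
move: (rmat _ _ _ _ _) (rmat _ _ _ _ _) (N _ _) (N _ _) => *; ring.
Qed.

Lemma mixed_tens4 (N : 'I_n -> 'I_n -> C) al be ga a b i j k l :
  (forall s t, N s t = rmat z a b t s) ->
  \sum_s \sum_t N j s * N l t * tens4 z al be ga i s k t =
  tens4 z (al * a ^+ 2) (be * (a * b)) (ga * b ^+ 2) i j k l.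
Proof.
move=> NE.
pose S p q p' q' := \sum_s \sum_t N j s * N l t * (rmat z p q i s * rmat z p' q' k t).
pose S' p q p' q' := \sum_s \sum_t N j s * N l t * (rmat z p q i t * rmat z p' q' k s).
transitivity (al%:C * (S 1 0 1 0 + S' 1 0 1 0) + be%:C * (S 1 0 0 1 + S 0 1 1 0 + S' 1 0 0 1 + S' 0 1 1 0)
  + ga%:C * S 0 1 0 1).
  rewrite /S /S' -!big_split /= !mulr_sumr -!big_split /=; apply: eq_bigr => s _.
  rewrite -!big_split /= !mulr_sumr -!big_split /=; apply: eq_bigr => t _; rewrite /tens4.
  move: (N j s) (N l t) (rmat z 1 0 i s) (rmat z 0 1 i s) (rmat z 1 0 k t) (rmat z 0 1 k t)
    (rmat z 1 0 i t) (rmat z 0 1 i t) (rmat z 1 0 k s) (rmat z 0 1 k s) al%:C be%:C ga%:C => *; ring.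
rewrite /S /S' !(mixed_direct _ _ _ _ _ _ _ _ NE) !(mixed_cross _ _ _ _ _ _ _ _ NE) !mul1r !mul0r.
have e1 u v : rmat z a 0 u v = a%:C * rmat z 1 0 u v by rewrite rmatZ mulr1 mulr0.
have e2 u v : rmat z 0 b u v = b%:C * rmat z 0 1 u v by rewrite rmatZ mulr1 mulr0.
rewrite !e1 !e2 /tens4 !rcM.
move: (rmat z 1 0 i j) (rmat z 0 1 i j) (rmat z 1 0 k l) (rmat z 0 1 k l)
    (rmat z 1 0 i l) (rmat z 0 1 i l) (rmat z 1 0 k j) (rmat z 0 1 k j) al%:C be%:C ga%:C a%:C b%:C => *; ring.
Qed.

End RadialMatrices.

Lemma is_derive_exp {R : realType} (f : R -> R) (x a : R) k : is_derive x 1 f a ->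
  is_derive x 1 (fun t => f t ^+ k) (k%:R * f x ^+ k.-1 * a).
Proof.
move=> fa; elim: k => [|k IH]; first by rewrite !mul0r; exact: is_derive_const.
under eq_fun do rewrite exprS.
apply: (is_derive_eq (is_derive_mul fa IH)) => /=.
by case: k {IH} => [|k] /=; rewrite ?expr0 -?natr1 ?exprS; ring.
Qed.

(** Derives along the syntax and leaves the value as an existential variable, to be compared with
    the expected one through [is_derive_eq]. *)
Ltac der := lazymatch goal with
  | |- is_derive _ _ (fun _ => ?c) _ => exact: is_derive_const
  | |- is_derive _ _ (fun t => t) _ => exact: is_derive_id
  | |- is_derive _ _ (fun t => @Algebra.add _ (@?f t) (@?g t)) _ => eapply (@is_derive_add _ f g); der
  | |- is_derive _ _ (fun t => @GRing.mul _ (@?f t) (@?g t)) _ => eapply (@is_derive_mul _ f g); der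
  | |- is_derive _ _ (fun t => @Algebra.opp _ (@?f t)) _ => eapply (@is_derive_opp _ f); der
  | |- is_derive _ _ (fun t => @GRing.exp _ (@?f t) ?k) _ => eapply (@is_derive_exp _ f); der
  | |- is_derive _ _ (fun t => @GRing.inv _ (@?f t)) _ =>
      eapply (@is_derive_inv _ f); [by rewrite ?expf_neq0 | der]
  | |- _ => eauto
  end.

(** * Curvature and a_3 of a radial metric in terms of y and chi *)

Section Profile.
Context {R : realType}.
Variables (n : nat) (D : set R) (y chi chi1 chi2 M M1 M2 M3 : R -> R).
Hypothesis D_gt0 : forall t, D t -> 0 < t.
Hypothesis y_gt0 : forall t, D t -> 0 < y t.
(** With s = log t, y and psi are the first and second derivatives of the potential in s. Since
    dy/dt = psi / t, a hypothesis of the form F' = F1 psi / t says that F1 is the derivative of F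
    with respect to y; so chi1, chi2 and M1, M2, M3 are derivatives in y. *)
Definition psi t := y t + chi t.
Hypothesis psi_gt0 : forall t, D t -> 0 < psi t.
Hypothesis dy : forall t, D t -> is_derive t 1 y (psi t / t).
Hypothesis dchi : forall t, D t -> is_derive t 1 chi (chi1 t * psi t / t).
Hypothesis dchi1 : forall t, D t -> is_derive t 1 chi1 (chi2 t * psi t / t).
Hypothesis dM : forall t, D t -> is_derive t 1 M (M1 t * psi t / t).
Hypothesis dM1 : forall t, D t -> is_derive t 1 M1 (M2 t * psi t / t).
Hypothesis dM2 : forall t, D t -> is_derive t 1 M2 (M3 t * psi t / t).

Let t0 t : D t -> t != 0. Proof. by move=> /D_gt0; rewrite lt0r => /andP[]. Qed.
Let y0 t : D t -> y t != 0. Proof. by move=> /y_gt0; rewrite lt0r => /andP[]. Qed.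
Let psi0 t : D t -> psi t != 0. Proof. by move=> /psi_gt0; rewrite lt0r => /andP[]. Qed.

(** [pfa] is the derivative of the potential, and each of [pfb], [pfc], [pfd] the t-derivative of
    its predecessor; [pfp], [pfq], [pfr] are the same for the Ricci tensor. The covariant derivative
    of Ric is [rad3 pfu pfv], with the eigenvalues [pfu] on the complement of z and [pfe] = pfu +
    pfv t / 2 on z. *)
Definition pfa t := y t / t.
Definition pfb t := chi t / t ^+ 2.
Definition pfc t := (chi1 t * psi t - 2 * chi t) / t ^+ 3.
Definition pfd t := ((chi2 t * psi t + chi1 t * (1 + chi1 t)) * psi t - 5 * chi1 t * psi t
  + 6 * chi t) / t ^+ 4.
Definition pfp t := M t / t.
Definition pfq t := (M1 t * psi t - M t) / t ^+ 2.
Definition pfr t := (M2 t * psi t ^+ 2 + M1 t * chi1 t * psi t - 2 * M1 t * psi t + 2 * M t) / t ^+ 3.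
Definition pfu t := psi t * (M1 t - M t / y t) / t ^+ 2.
Definition pfe t := psi t ^+ 2 * M2 t / t ^+ 2 / 2.
Definition pfv t := 2 * (pfe t - pfu t) / t.
Definition pfu' t := ((1 + chi1 t) * psi t * (M1 t - M t / y t)
  + psi t ^+ 2 * (M2 t - M1 t / y t + M t / y t ^+ 2) - 2 * psi t * (M1 t - M t / y t)) / t ^+ 3.
Definition pfe' t := (2 * psi t ^+ 2 * (1 + chi1 t) * M2 t + psi t ^+ 3 * M3 t - 2 * psi t ^+ 2 * M2 t)
  / (2 * t ^+ 3).
Definition pfv' t := 2 * (pfe' t - pfu' t) / t - 2 * (pfe t - pfu t) / t ^+ 2.

Lemma d_psi t : D t -> is_derive t 1 psi ((1 + chi1 t) * psi t / t).
Proof.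
move=> Dt; apply: is_derive_eq; first by apply: is_derive_add; [exact: dy|exact: dchi].
by field; exact: t0.
Qed.

Ltac der_pf := move=> Dt; have := t0 Dt; have := y0 Dt; have := psi0 Dt;
  have := dy Dt; have := dchi Dt; have := dchi1 Dt; have := dM Dt; have := dM1 Dt; have := dM2 Dt;
  have := d_psi Dt; move=> *; eapply is_derive_eq; [der|].

Lemma d_pfa t : D t -> is_derive t 1 pfa (pfb t).
Proof. rewrite /pfa; der_pf; rewrite /pfb /psi; field; by rewrite ?(t0 Dt) ?(y0 Dt). Qed.
Lemma d_pfb t : D t -> is_derive t 1 pfb (pfc t).
Proof. rewrite /pfb; der_pf; rewrite /pfc; field; by rewrite ?(t0 Dt) ?(y0 Dt). Qed.
Lemma d_pfc t : D t -> is_derive t 1 pfc (pfd t).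
Proof. rewrite /pfc; der_pf; rewrite /pfd; field; by rewrite ?(t0 Dt) ?(y0 Dt). Qed.
Lemma d_pfp t : D t -> is_derive t 1 pfp (pfq t).
Proof. rewrite /pfp; der_pf; rewrite /pfq; field; by rewrite ?(t0 Dt) ?(y0 Dt). Qed.
Lemma d_pfq t : D t -> is_derive t 1 pfq (pfr t).
Proof. rewrite /pfq; der_pf; rewrite /pfr; field; by rewrite ?(t0 Dt) ?(y0 Dt). Qed.
Lemma d_pfu t : D t -> is_derive t 1 pfu (pfu' t).
Proof. rewrite /pfu; der_pf; rewrite /pfu'; field; by rewrite ?(t0 Dt) ?(y0 Dt). Qed.
Lemma d_pfe t : D t -> is_derive t 1 pfe (pfe' t).
Proof. rewrite /pfe; der_pf; rewrite /pfe'; field; by rewrite ?(t0 Dt) ?(y0 Dt). Qed.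
Lemma d_pfv t : D t -> is_derive t 1 pfv (pfv' t).
Proof.
move=> Dt; have := d_pfe Dt; have := d_pfu Dt; have := t0 Dt => *.
rewrite /pfv; eapply is_derive_eq; first by der.
rewrite /pfv'; move: (pfe' t) (pfu' t) (pfe t) (pfu t) => *; field; exact: t0.
Qed.

Section Metric.
Local Notation C := R[i].
Local Notation Cn := 'rV[C]_n.
Variables (W : set Cn) (g : Cn -> 'M[C]_n).
Hypothesis n_gt0 : (0 < n)%N.
Hypothesis oW : open W.
Hypothesis WD : forall w, W w -> D (sqnorm w).
Hypothesis gE : forall w i j, W w ->
  g w i j = (pfa (sqnorm w))%:C * dlt i j + (pfb (sqnorm w))%:C * ((w 0 i)^* * w 0 j).
Hypothesis ME : forall t, D t -> M t = - ((n%:R - 1) * chi t / y t + chi1 t).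
Implicit Types (w z : Cn) (i j k l : 'I_n).
Local Notation x w := (sqnorm w).

Let x0 w : W w -> x w != 0. Proof. by move=> /WD/t0. Qed.

Lemma metric_rmx w : W w -> g w = rmx w (y (x w) / x w) (psi (x w) / x w).
Proof.
move=> Ww; apply/matrixP => i j; rewrite gE // mxE rmat_lin ?x0 //.
congr rmat; rewrite /pfa /pfb /psi; field; exact: x0.
Qed.

Lemma metric_ginv w i j : W w -> ginv g w i j = rmat w (x w / y (x w)) (x w / psi (x w)) j i.
Proof.
move=> Ww; have Dx := WD Ww.
rewrite /ginv metric_rmx // rmxV ?mxE ?invf_div //; first exact: x0.
- by rewrite mulf_neq0 ?invr_neq0 ?y0 ?x0.
- by rewrite mulf_neq0 ?invr_neq0 ?psi0 ?x0.
Qed.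

Lemma metric_dz w i j k : W w -> dz k (fun w => g w i j) w = rad3 (pfb (x w)) (pfc (x w)) w i j k.
Proof.
move=> Ww; rewrite (dz_open _ oW Ww (fun w Ww => gE i j Ww)).
exact: dz_rad2s (d_pfa (WD Ww)) (d_pfb (WD Ww)).
Qed.

Lemma metric_dzb w i j k : W w ->
  dzb k (fun w => g w i j) w = (rad3 (pfb (x w)) (pfc (x w)) w j i k)^*.
Proof.
move=> Ww; rewrite (dzb_open _ oW Ww (fun w Ww => gE i j Ww)).
exact: dzb_rad2s (d_pfa (WD Ww)) (d_pfb (WD Ww)).
Qed.

(* Gamma^p_ki = zbar_k G_ip + zbar_i G_kp, where G acts as pg1 on the complement of z and as pg2 on z *)
Definition pg1 t := pfb t * t / y t.
Definition pg2 t := (pfb t + pfc t / 2 * t) * t / psi t.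

Lemma metric_christoffel w p k i : W w -> christoffel g p k i w =
  (w 0 k)^* * rmat w (pg1 (x w)) (pg2 (x w)) i p + (w 0 i)^* * rmat w (pg1 (x w)) (pg2 (x w)) k p.
Proof.
move=> Ww; rewrite /christoffel /pg1 /pg2.
under eq_bigr do rewrite metric_ginv // metric_dz // rad3_rmat ?x0 // mulrDr !(mulrCA (rmat _ _ _ _ _)).
rewrite big_split /= -!mulr_sumr; congr (_ * _ + _ * _).
  by under eq_bigr do rewrite mulrC; rewrite rmatM ?x0 // !mulrA.
by under eq_bigr do rewrite mulrC; rewrite rmatM ?x0 // !mulrA.
Qed.

Lemma metric_riem w i j k l : W w -> let t := x w in
  let h1 := pfb t ^+ 2 * t / y t in let h2 := (pfb t + pfc t / 2 * t) ^+ 2 * t / psi t in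
  riem g i j k l w = tens4 w (pfb t) (pfb t + pfc t * t - h1 * t)
    (2 * pfb t + 4 * pfc t * t + pfd t * t ^+ 2 - 4 * h2 * t) i j k l.
Proof.
move=> Ww t h1 h2; have w0 := x0 Ww.
rewrite /riem (ddbar_rad2 (q' := pfc) (q'' := pfd t) _ _ oW Ww (fun w Ww => gE i l Ww)
  (fun w Ww => d_pfa (WD Ww)) (fun w Ww => d_pfb (WD Ww)) (d_pfc (WD Ww)) w0) -/t.
have -> : \sum_q \sum_p ginv g w q p * dz k (fun w => g w i p) w * dzb j (fun w => g w q l) w =
  (w 0 k)^* * w 0 j * rmat w h1 h2 i l + (w 0 k)^* * w 0 l * rmat w h1 h2 i j
  + (w 0 i)^* * w 0 j * rmat w h1 h2 k l + (w 0 i)^* * w 0 l * rmat w h1 h2 k j.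
  transitivity (\sum_q christoffel g q k i w * dzb j (fun w => g w q l) w).
    by apply: eq_bigr => q _; rewrite mulr_suml.
  transitivity (\sum_q ((w 0 k)^* * w 0 j * (rmat w (pg1 t) (pg2 t) i q * rmat w (pfb t) (pfb t + pfc t / 2 * t) q l)
    + (w 0 k)^* * w 0 l * (rmat w (pg1 t) (pg2 t) i q * rmat w (pfb t) (pfb t + pfc t / 2 * t) q j)
    + (w 0 i)^* * w 0 j * (rmat w (pg1 t) (pg2 t) k q * rmat w (pfb t) (pfb t + pfc t / 2 * t) q l)
    + (w 0 i)^* * w 0 l * (rmat w (pg1 t) (pg2 t) k q * rmat w (pfb t) (pfb t + pfc t / 2 * t) q j))).
    apply: eq_bigr => q _; rewrite metric_christoffel // metric_dzb // rad3_rmat // -/t.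
    rewrite cjD !cjM !conjCK !rmatJ.
    move: (w 0 i)^* (w 0 k)^* (w 0 j) (w 0 l) (rmat w (pg1 t) (pg2 t) i q) (rmat w (pg1 t) (pg2 t) k q)
      (rmat w (pfb t) (pfb t + pfc t / 2 * t) q l) (rmat w (pfb t) (pfb t + pfc t / 2 * t) q j) => *; ring.
  rewrite !big_split /= -!mulr_sumr !rmatM //.
  have -> : pg1 t * pfb t = h1 by rewrite /pg1 /h1; ring.
  have -> : pg2 t * (pfb t + pfc t / 2 * t) = h2 by rewrite /pg2 /h2; ring.
  by [].
have zz (a b : 'I_n) : (w 0 a)^* * w 0 b = t%:C * rmat w 0 1 a b.
  by rewrite rmat_zz // rmatZ mulr0 mulr1.
have E (a b : 'I_n) : rmat w h1 h2 a b = h1%:C * rmat w 1 0 a b + h2%:C * rmat w 0 1 a b.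
  by rewrite !rmatZ rmatD !mulr1 !mulr0 addr0 add0r.
rewrite !zz !E /tens4.
(* By rank one the purely radial products of all four terms coincide; each contributes h2 t, which
   explains the factor 4 in the last coefficient. *)
have P := prj_swap w i j k l; rewrite -!rmat01 in P.
rewrite [(_ - h1 * t)%:C]rcB [(_ - 4 * h2 * t)%:C]rcB (rcM h1) !(rcM _ t) (rcM 4) (rc_nat 4).
have P2 : rmat w 0 1 k j * rmat w 0 1 i l = rmat w 0 1 i j * rmat w 0 1 k l by rewrite mulrC -P.
have P3 : rmat w 0 1 k l * rmat w 0 1 i j = rmat w 0 1 i j * rmat w 0 1 k l by rewrite mulrC.
move: (rmat w 1 0 i j) (rmat w 0 1 i j) (rmat w 1 0 k l) (rmat w 0 1 k l) (rmat w 1 0 i l) (rmat w 0 1 i l)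
 (rmat w 1 0 k j) (rmat w 0 1 k j) (pfb t)%:C (pfb t + pfc t * t)%:C
 (2 * pfb t + 4 * pfc t * t + pfd t * t ^+ 2)%:C h1%:C h2%:C t%:C P P2 P3 =>
 A1 B1 A2 B2 A3 B3 A4 B4 a b c d e f P P2 P3.
have -> : f * B4 * (d * A3 + e * B3) = f * d * (B4 * A3) + f * e * (B1 * B2) by rewrite -P2; ring.
have -> : f * B3 * (d * A4 + e * B4) = f * d * (B3 * A4) + f * e * (B1 * B2) by rewrite -P2; ring.
ring.
Qed.

(** Up to raising of indices, the curvature has the coefficients chi / y^2 on the complement of z,
    d/dy (chi / y) for the mixed directions and d^2 chi / dy^2 on the line of z. *)
Definition al t := chi t / y t ^+ 2.
Definition be t := chi1 t / y t - chi t / y t ^+ 2.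

Lemma riem_coefs t : D t ->
  [/\ pfb t * (t / y t) ^+ 2 = al t,
   (pfb t + pfc t * t - pfb t ^+ 2 * t / y t * t) * (t / y t * (t / psi t)) = be t
   & (2 * pfb t + 4 * pfc t * t + pfd t * t ^+ 2 - 4 * ((pfb t + pfc t / 2 * t) ^+ 2 * t / psi t) * t)
     * (t / psi t) ^+ 2 = chi2 t].
Proof.
move=> Dt; have := y0 Dt; have := psi0 Dt; have := t0 Dt.
rewrite /al /be /pfb /pfc /pfd /psi.
move: (y t) (chi t) (chi1 t) (chi2 t) => Y X X1 X2 tn pn yn.
by split; field; rewrite ?tn ?pn ?yn.
Qed.

Lemma metric_riem_mixed w i j k l : W w ->
  riem_mixed g w i j k l = tens4 w (al (x w)) (be (x w)) (chi2 (x w)) i j k l.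
Proof.
move=> Ww; have Dx := WD Ww; have w0 := x0 Ww; rewrite /riem_mixed /mixed4.
under eq_bigr do under eq_bigr do rewrite metric_riem //.
rewrite (@mixed_tens4 _ _ w w0 (ginv g w) _ _ _ _ _ i j k l (fun s t => metric_ginv s t Ww)) //.
by have [-> -> ->] := riem_coefs Dx.
Qed.

Lemma logdetE w : W w -> logdet g w =
  ((n.-1%:R * ln (y (x w) / x w) + ln (psi (x w) / x w)))%:C.
Proof.
move=> Ww; have Dx := WD Ww.
have h1 : 0 < y (x w) / x w by rewrite divr_gt0 ?y_gt0 ?D_gt0.
have h2 : 0 < psi (x w) / x w by rewrite divr_gt0 ?psi_gt0 ?D_gt0.
rewrite /logdet metric_rmx // (det_rmx (x0 Ww)) //=; last by rewrite gt_eqF.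
by rewrite lnM ?posrE ?exprn_gt0 // lnXn // mulr_natl.
Qed.

(** M is to the Ricci tensor what y is to the metric: the derivative of a potential, here - log det
    g, with respect to log t. *)
Lemma d_logdet t : D t ->
  is_derive t 1 (fun t => n.-1%:R * ln (y t / t) + ln (psi t / t)) (- pfp t).
Proof.
move=> Dt; have h1 : 0 < y t / t by rewrite divr_gt0 ?y_gt0 ?D_gt0.
have h2 : 0 < psi t / t by rewrite divr_gt0 ?psi_gt0 ?D_gt0.
have tn := t0 Dt; have yn := y0 Dt; have pn := psi0 Dt.
have d1 : is_derive t 1 (fun t => y t / t) (psi t / t * t^-1 + y t * (- 1 / t ^+ 2)).
  by have := dy Dt => *; der.
have d2 : is_derive t 1 (fun t => psi t / t) ((1 + chi1 t) * psi t / t * t^-1 + psi t * (- 1 / t ^+ 2)).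
  by have := d_psi Dt => *; der.
have l1 := @is_derive_comp _ (@ln R) (fun t => y t / t) t _ _ (is_derive1_ln h1) d1.
have l2 := @is_derive_comp _ (@ln R) (fun t => psi t / t) t _ _ (is_derive1_ln h2) d2.
eapply is_derive_eq; [by der|].
rewrite /pfp ME // -subn1 natrB //.
rewrite /psi in pn *; field; by rewrite tn yn pn.
Qed.

Lemma metric_ric w i j : W w -> ric g i j w =
  (pfp (x w))%:C * dlt i j + (pfq (x w))%:C * ((w 0 i)^* * w 0 j).
Proof.
move=> Ww; have dn : is_derive (x w) 1 (fun t => - pfp t) (- pfq (x w)).
  by apply: is_derive_opp; exact: d_pfp (WD Ww).
rewrite /ric (ddbar_radial (s := fun t => n.-1%:R * ln (y t / t) + ln (psi t / t))
  (s' := fun t => - pfp t) (s'' := - pfq (x w)) _ _ oW Ww logdetE (fun w Ww => d_logdet (WD Ww)) dn).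
by rewrite !rcN !mulNr -opprD opprK.
Qed.

Lemma metric_ric_rmat w i j : W w -> ric g i j w =
  rmat w (M (x w) / x w) (M1 (x w) * psi (x w) / x w) i j.
Proof.
move=> Ww; rewrite metric_ric // rmat_lin ?x0 //; congr rmat.
rewrite /pfp /pfq; field; exact: x0.
Qed.

Lemma metric_ric_mixed w i j : W w -> ric_mixed g w i j = rmat w (M (x w) / y (x w)) (M1 (x w)) i j.
Proof.
move=> Ww; rewrite /ric_mixed /mixed2.
under eq_bigr do rewrite metric_ginv // metric_ric_rmat // mulrC.
rewrite rmatM ?x0 //; congr rmat; field; by rewrite (x0 Ww) ?(y0 (WD Ww)) ?(psi0 (WD Ww)).
Qed.

Lemma metric_scal w : W w -> scal g w = ((n%:R - 1) * M (x w) / y (x w) + M1 (x w))%:C.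
Proof.
move=> Ww; rewrite /scal.
transitivity (\sum_i ric_mixed g w i i).
  by apply: eq_bigr => i _.
under eq_bigr do rewrite metric_ric_mixed //.
by rewrite rmat_tr ?x0 // /rtr mulrA.
Qed.

Lemma metric_dric w i j k : W w -> dric g i j k w = rad3 (pfu (x w)) (pfv (x w)) w i j k.
Proof.
move=> Ww; have w0 := x0 Ww; have Dx := WD Ww; rewrite /dric.
rewrite (dz_open _ oW Ww (fun w Ww => metric_ric i j Ww)).
rewrite (dz_rad2s _ _ _ (d_pfp Dx) (d_pfq Dx)) !rad3_rmat //.
under eq_bigr do rewrite metric_christoffel // metric_ric_rmat // mulrDl -!mulrA.
rewrite big_split /= -!mulr_sumr !rmatM //.
have E1 : pfq (x w) - pg1 (x w) * (M (x w) / x w) = pfu (x w).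
  rewrite /pfq /pg1 /pfu /pfb /psi; have := y0 Dx.
  move: (y (x w)) (chi (x w)) (M (x w)) (M1 (x w)) (x w) w0 => *; field; exact/andP.
have E2 : pfq (x w) + pfr (x w) / 2 * x w - pg2 (x w) * (M1 (x w) * (psi (x w) / x w)) =
    pfu (x w) + pfv (x w) / 2 * x w.
  have -> : pfu (x w) + pfv (x w) / 2 * x w = pfe (x w) by rewrite /pfv; field.
  rewrite /pfq /pfr /pg2 /pfe /pfb /pfc; have := psi0 Dx.
  move: (psi (x w)) (chi (x w)) (chi1 (x w)) (M2 (x w)) (M (x w)) (M1 (x w)) (x w) w0 => *; field; exact/andP.
rewrite -E2 -E1 -!rmatB.
move: (rmat _ _ _ _ _) (rmat _ _ _ _ _) (rmat _ _ _ _ _) (rmat _ _ _ _ _) (w 0 i)^* (w 0 k)^* => *; ring.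
Qed.

(** The first covariant derivative has the form zbar_k E_ij + zbar_i E_kj; differentiating it once
    more gives this half and its image under the exchange of i and k. *)
Definition ddr t w i j k l : C :=
  rmat w (pfu t) (pfu t) i j * rmat w 1 1 k l
  + rmat w (pfu' t - pfu t * pg1 t) (pfu' t + pfv' t / 2 * t - pfe t * pg2 t) i j * rmat w 0 t k l
  + rmat w 0 t i j * rmat w (pfv t - pfu t * pg1 t) (pfv t - pfe t * pg2 t) k l.

Lemma metric_ddric w i j k l : W w ->
  ddric g i j k l w = ddr (x w) w i j k l + ddr (x w) w k j i l.
Proof.
move=> Ww; have w0 := x0 Ww; have Dx := WD Ww; rewrite /ddric.
rewrite (dzb_open _ oW Ww (fun w Ww => metric_dric i j k Ww)).
rewrite (dzb_rad3 _ _ _ _ (d_pfu Dx) (d_pfv Dx)) rad3_rmat //; set t := x w.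
have eE : pfu t + pfv t / 2 * t = pfe t by rewrite /pfv; field; exact: w0.
have -> : \sum_q (christoffel g q l j w)^* * dric g i q k w =
  (w 0 k)^* * w 0 l * rmat w (pfu t * pg1 t) (pfe t * pg2 t) i j
  + (w 0 i)^* * w 0 l * rmat w (pfu t * pg1 t) (pfe t * pg2 t) k j
  + (w 0 k)^* * w 0 j * rmat w (pfu t * pg1 t) (pfe t * pg2 t) i l
  + (w 0 i)^* * w 0 j * rmat w (pfu t * pg1 t) (pfe t * pg2 t) k l.
  rewrite -!rmatM // !mulr_sumr -!big_split /=; apply: eq_bigr => q _.
  rewrite metric_christoffel // metric_dric // rad3_rmat // -/t eE cjD !cjM !conjCK !rmatJ.
  move: (w 0 i)^* (w 0 k)^* (w 0 j) (w 0 l) (rmat w (pg1 t) (pg2 t) q j) (rmat w (pg1 t) (pg2 t) q l)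
   (rmat w (pfu t) (pfe t) i q) (rmat w (pfu t) (pfe t) k q) => *; ring.
rewrite /ddr -/t -!(rmat_delta w) // -!(rmat_zz w0 _ _).
have uE a b : rmat w (pfu t) (pfu t) a b = (pfu t)%:C * dlt a b.
  by rewrite (rmat_delta w) // rmatZ !mulr1.
rewrite -!rmatB !uE.
have vE a b : rmat w (pfv t) (pfv t) a b = (pfv t)%:C * dlt a b.
  by rewrite (rmat_delta w) // rmatZ !mulr1.
rewrite !vE.
move: (w 0 i)^* (w 0 k)^* (w 0 j) (w 0 l) (rmat w (pfu t * pg1 t) (pfe t * pg2 t) i j)
  (rmat w (pfu t * pg1 t) (pfe t * pg2 t) k j) (rmat w (pfu t * pg1 t) (pfe t * pg2 t) i l)
  (rmat w (pfu t * pg1 t) (pfe t * pg2 t) k l) (rmat w (pfu' t) (pfu' t + pfv' t / 2 * t) i j)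
  (rmat w (pfu' t) (pfu' t + pfv' t / 2 * t) k j) (pfu t)%:C (pfv t)%:C (dlt i j) (dlt k l) (dlt i l) (dlt k j) => *; ring.
Qed.

(** The value of [contr4] for the curvature coefficients at t. *)
Definition pair4 (t p q p' q' : R) : R :=
  (n%:R - 1) * (n%:R * al t * p * p' + be t * p * q') + ((n%:R - 1) * be t * q * p' + chi2 t * q * q').

Definition ddric_riem t : R := let n1 := t / y t in let n2 := t / psi t in
  2 * (pair4 t (pfu t * n1) (pfu t * n2) n1 n2
  + pair4 t ((pfu' t - pfu t * pg1 t) * n1) ((pfu' t + pfv' t / 2 * t - pfe t * pg2 t) * n2) 0 (t * n2)
  + pair4 t 0 (t * n2) ((pfv t - pfu t * pg1 t) * n1) ((pfv t - pfe t * pg2 t) * n2)).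

Lemma metric_ddric_mixed w i j k l : W w -> let t := x w in let n1 := t / y t in let n2 := t / psi t in
  let DD i j k l := rmat w (pfu t * n1) (pfu t * n2) i j * rmat w n1 n2 k l
  + rmat w ((pfu' t - pfu t * pg1 t) * n1) ((pfu' t + pfv' t / 2 * t - pfe t * pg2 t) * n2) i j * rmat w 0 (t * n2) k l
  + rmat w 0 (t * n2) i j * rmat w ((pfv t - pfu t * pg1 t) * n1) ((pfv t - pfe t * pg2 t) * n2) k l in
  ddric_mixed g w i j k l = DD i j k l + DD k j i l.
Proof.
move=> Ww t n1 n2 DD; have w0 := x0 Ww; rewrite /ddric_mixed /mixed4.
under eq_bigr do under eq_bigr do rewrite metric_ddric //.
have H := fun s t => metric_ginv s t Ww.
have D1 p q p' q' := @mixed_direct _ _ w w0 (ginv g w) p q p' q' _ _ i j k l H.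
have D2 p q p' q' := @mixed_cross _ _ w w0 (ginv g w) p' q' p q _ _ i j k l H.
have E : DD i j k l + DD k j i l = \sum_a \sum_b ginv g w j a * ginv g w l b * (rmat w (pfu t) (pfu t) i a * rmat w 1 1 k b)
 + \sum_a \sum_b ginv g w j a * ginv g w l b * (rmat w (pfu' t - pfu t * pg1 t) (pfu' t + pfv' t / 2 * t - pfe t * pg2 t) i a * rmat w 0 t k b)
 + \sum_a \sum_b ginv g w j a * ginv g w l b * (rmat w 0 t i a * rmat w (pfv t - pfu t * pg1 t) (pfv t - pfe t * pg2 t) k b)
 + (\sum_a \sum_b ginv g w j a * ginv g w l b * (rmat w 1 1 i b * rmat w (pfu t) (pfu t) k a)
 + \sum_a \sum_b ginv g w j a * ginv g w l b * (rmat w 0 t i b * rmat w (pfu' t - pfu t * pg1 t) (pfu' t + pfv' t / 2 * t - pfe t * pg2 t) k a)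
 + \sum_a \sum_b ginv g w j a * ginv g w l b * (rmat w (pfv t - pfu t * pg1 t) (pfv t - pfe t * pg2 t) i b * rmat w 0 t k a)).
  rewrite !D1 !D2 -/t -/n1 -/n2 !mul1r !mul0r /DD.
  congr (_ + _); rewrite [rmat w n1 n2 i l * _]mulrC [rmat w 0 (t * n2) i l * _]mulrC; congr (_ + _ + _).
  by rewrite mulrC.
rewrite E -!big_split /=; apply: eq_bigr => a _; rewrite -!big_split /=; apply: eq_bigr => b _.
rewrite /ddr -/t -!mulrDr; congr (_ * _); congr (_ + _).
by rewrite [rmat w 1 1 i b * _]mulrC [rmat w 0 t i b * _]mulrC [_ * rmat w 0 t k a]mulrC.
Qed.

Lemma metric_ddric_riem w : W w ->
  \sum_i \sum_j \sum_k \sum_l ddric_mixed g w i j k l * riem_mixed g w j i l k = (ddric_riem (x w))%:C.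
Proof.
move=> Ww; have w0 := x0 Ww; set t := x w; pose n1 := t / y t; pose n2 := t / psi t.
pose DD i j k l := rmat w (pfu t * n1) (pfu t * n2) i j * rmat w n1 n2 k l
  + rmat w ((pfu' t - pfu t * pg1 t) * n1) ((pfu' t + pfv' t / 2 * t - pfe t * pg2 t) * n2) i j * rmat w 0 (t * n2) k l
  + rmat w 0 (t * n2) i j * rmat w ((pfv t - pfu t * pg1 t) * n1) ((pfv t - pfe t * pg2 t) * n2) k l.
pose RR i j k l := tens4 w (al t) (be t) (chi2 t) i j k l.
have DS : \sum_i \sum_j \sum_k \sum_l DD i j k l * RR j i l k = (ddric_riem t / 2)%:C.
  have P p q p' q' := @contr4 _ _ w w0 p q p' q' (al t) (be t) (chi2 t).
  have -> : (ddric_riem t / 2) = pair4 t (pfu t * n1) (pfu t * n2) n1 n2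
  + pair4 t ((pfu' t - pfu t * pg1 t) * n1) ((pfu' t + pfv' t / 2 * t - pfe t * pg2 t) * n2) 0 (t * n2)
  + pair4 t 0 (t * n2) ((pfv t - pfu t * pg1 t) * n1) ((pfv t - pfe t * pg2 t) * n2).
    by rewrite /ddric_riem -/n1 -/n2 mulrC mulKf ?pnatr_eq0.
  rewrite 2!rcD /pair4 -!P -!big_split /=; apply: eq_bigr => i _.
  rewrite -!big_split /=; apply: eq_bigr => j _; rewrite -!big_split /=; apply: eq_bigr => k _.
  by rewrite -!big_split /=; apply: eq_bigr => l _; rewrite /DD !mulrDl.
(* The exchange of i and k is absorbed by the symmetry of the curvature in its second and fourth
   index, so both halves contribute equally. *)
have DS' : \sum_i \sum_j \sum_k \sum_l DD k j i l * RR j i l k = (ddric_riem t / 2)%:C.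
  rewrite -DS [LHS](eq_bigr (fun i => \sum_k \sum_j \sum_l DD k j i l * RR j i l k)); last first.
    by move=> i _; rewrite exchange_big.
  rewrite exchange_big /=; apply: eq_bigr => i _; rewrite exchange_big /=.
  apply: eq_bigr => j _; apply: eq_bigr => k _; apply: eq_bigr => l _.
  by rewrite /RR tens4_sym24.
rewrite [ddric_riem t]splitr rcD -{1}DS -DS' -big_split /=; apply: eq_bigr => i _.
rewrite -big_split /=; apply: eq_bigr => j _; rewrite -big_split /=; apply: eq_bigr => k _.
rewrite -big_split /=; apply: eq_bigr => l _.
by rewrite metric_ddric_mixed // metric_riem_mixed // -mulrDl.
Qed.

Lemma metric_lap w (f : Cn -> C) (s s' : R -> R) (s'' : R) : W w ->
  (forall w, W w -> f w = (s (x w))%:C) ->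
  (forall w, W w -> is_derive (x w) 1 s (s' (x w))) ->
  is_derive (x w) 1 s' s'' -> let t := x w in
  lap g f w = ((n%:R - 1) * (s' t * t / y t) + (s' t + s'' * t) * t / psi t)%:C.
Proof.
move=> Ww fE ds ds' t; have w0 := x0 Ww; rewrite /lap.
transitivity (\sum_i \sum_j rmat w (s' t) (s' t + s'' * t) i j * rmat w (t / y t) (t / psi t) j i).
  apply: eq_bigr => i _; apply: eq_bigr => j _.
  by rewrite metric_ginv // (ddbar_radial _ _ oW Ww fE ds ds') rmat_lin // mulrC.
by under eq_bigr do rewrite rmatM //; rewrite rmat_tr // /rtr !mulrA.
Qed.

(** The conjugate of [mixed_tens4]: the inverse metric is Hermitian, so conjugation turns raising of
    barred indices into raising of unbarred ones. *)
Lemma tens4_raise w al' be' ga' i j k l : W w ->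
  \sum_s \sum_r ginv g w s j * ginv g w r l * tens4 w al' be' ga' s i r k =
  tens4 w (al' * (x w / y (x w)) ^+ 2) (be' * (x w / y (x w) * (x w / psi (x w)))) (ga' * (x w / psi (x w)) ^+ 2) j i l k.
Proof.
move=> Ww; have w0 := x0 Ww.
have H := @mixed_tens4 _ _ w w0 (ginv g w) al' be' ga' _ _ i j k l (fun s t => metric_ginv s t Ww).
rewrite -tens4J -H cj_sum; apply: eq_bigr => s _; rewrite cj_sum; apply: eq_bigr => r _.
by rewrite !cjM tens4J !metric_ginv // !rmatJ.
Qed.

Lemma metric_riem_normsq w : W w -> riem_normsq g w =
  (2 * n%:R * (n%:R - 1) * al (x w) ^+ 2 + 4 * (n%:R - 1) * be (x w) ^+ 2 + chi2 (x w) ^+ 2)%:C.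
Proof.
move=> Ww; have w0 := x0 Ww; have Dx := WD Ww; rewrite /riem_normsq.
have [E1 E2 E3] := riem_coefs Dx.
transitivity (\sum_i \sum_j \sum_k \sum_l riem g i j k l w *
  tens4 w (al (x w) * (x w / y (x w)) ^+ 2) (be (x w) * (x w / y (x w) * (x w / psi (x w))))
    (chi2 (x w) * (x w / psi (x w)) ^+ 2) j i l k).
  apply: eq_bigr => i _; apply: eq_bigr => j _; apply: eq_bigr => k _; apply: eq_bigr => l _.
  rewrite -(@tens4_raise w _ _ _ i j k l Ww) mulr_sumr exchange_big /=; apply: eq_bigr => b _.
  rewrite mulr_sumr.
  under eq_bigr do rewrite exchange_big /=.
  rewrite exchange_big /=; apply: eq_bigr => d _.
  rewrite -metric_riem_mixed // /riem_mixed /mixed4 !mulr_sumr; apply: eq_bigr => a _.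
  rewrite !mulr_sumr; apply: eq_bigr => c _.
  rewrite [(riem g a b c d w)^*](_ : _ = riem g b a d c w); last by rewrite !metric_riem // tens4J.
  move: (ginv g w i a) (ginv g w b j) (ginv g w k c) (ginv g w d l) (riem g i j k l w) (riem g b a d c w) => *; ring.
under eq_bigr do under eq_bigr do under eq_bigr do under eq_bigr do rewrite metric_riem //.
rewrite contr_pair //; congr (_%:C).
(* One copy of R carries no raised index and the other all four. Moving two factors of the inverse
   metric from the second to the first gives the mixed coefficients twice. *)
set a0 := pfb _ in E1 E2 E3 *; set b0 := (_ - _) in E2 *; set c0 := (X in X * _ ^+ 2 = chi2 _) in E3 *.
have -> : 2 * n%:R * (n%:R - 1) * a0 * (al (x w) * (x w / y (x w)) ^+ 2) =
  2 * n%:R * (n%:R - 1) * al (x w) * (a0 * (x w / y (x w)) ^+ 2) by ring.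
have -> : 4 * (n%:R - 1) * b0 * (be (x w) * (x w / y (x w) * (x w / psi (x w)))) =
  4 * (n%:R - 1) * be (x w) * (b0 * (x w / y (x w) * (x w / psi (x w)))) by ring.
have -> : c0 * (chi2 (x w) * (x w / psi (x w)) ^+ 2) = chi2 (x w) * (c0 * (x w / psi (x w)) ^+ 2) by ring.
by rewrite E1 E2 E3; ring.
Qed.

Lemma metric_ricJ w i j : W w -> (ric g i j w)^* = ric g j i w.
Proof. by move=> Ww; rewrite !metric_ric_rmat // rmatJ. Qed.

Lemma metric_ric_normsq w : W w ->
  ric_normsq g w = ((n%:R - 1) * (M (x w) / y (x w)) ^+ 2 + M1 (x w) ^+ 2)%:C.
Proof.
move=> Ww; have w0 := x0 Ww; have Dx := WD Ww; rewrite /ric_normsq.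
transitivity (\sum_i \sum_j rmat w (M (x w) / x w) (M1 (x w) * psi (x w) / x w) i j *
    rmat w (x w / y (x w) * (M (x w) / y (x w))) (x w / psi (x w) * M1 (x w)) j i).
  apply: eq_bigr => i _; apply: eq_bigr => j _.
  rewrite exchange_big -(@rmatM _ _ w w0 _ _ _ _ j i) mulr_sumr; apply: eq_bigr => b _ /=.
  rewrite -(metric_ginv _ _ Ww) -metric_ric_mixed // -metric_ric_rmat // /ric_mixed /mixed2.
  rewrite !mulr_sumr; apply: eq_bigr => a _; rewrite metric_ricJ //.
  move: (ginv g w i a) (ginv g w b j) (ric g i j w) (ric g b a w) => *; ring.
under eq_bigr do rewrite rmatM //; rewrite rmat_tr // /rtr; congr (_%:C).
move: (psi (x w)) (psi0 Dx) (y (x w)) (y0 Dx) (M _) (M1 _) => p p0 Y Y0 m m1; field; by rewrite Y0 p0 w0.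
Qed.

Lemma metric_dric_normsq w : W w -> let t := x w in
  dric_normsq g w = (2 * (t / psi t) * t * ((n%:R - 1) * (t / y t * pfu t) ^+ 2 + 2 * (t / psi t * pfe t) ^+ 2))%:C.
Proof.
move=> Ww t; have w0 := x0 Ww; have Dx := WD Ww; rewrite /dric_normsq.
have eE : pfu t + pfv t / 2 * t = pfe t by rewrite /pfv; field; exact: w0.
pose n1 := t / y t; pose n2 := t / psi t.
pose N i j := rmat w n1 n2 i j.
pose E i j := rmat w (pfu t) (pfe t) i j.
pose F i j := rmat w (n1 * (pfu t * n1)) (n2 * (pfe t * n2)) i j.
(* The norm of this two-term expression splits into four sums: two are |z|^2 times the trace of E F,
   the other two |z|^2 times its radial eigenvalue. *)
have dE i j k : dric g i j k w = (w 0 k)^* * E i j + (w 0 i)^* * E k j.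
  by rewrite metric_dric // rad3_rmat // eE.
have gN i j : ginv g w i j = N j i by rewrite metric_ginv.
(* z is an eigenvector of the inverse metric, with the radial eigenvalue. *)
have zN k : \sum_c w 0 c * N c k = n2%:C * w 0 k.
  rewrite -[RHS](mulrC (w 0 k)) -[w 0 k in RHS](_ : \sum_c w 0 c * prj w c k = _); last first.
    rewrite -[RHS]mulr1 -(@prj_tr _ _ w w0) mulr_sumr; apply: eq_bigr => c _.
    by rewrite /prj; move: (w 0 c) (w 0 c)^* (w 0 k) (x w)%:C^-1 => *; ring.
  rewrite mulr_suml.
  have P : \sum_c w 0 c * (dlt c k - prj w c k) = 0.
    under eq_bigr do rewrite mulrBr; rewrite sumrB.
    under eq_bigr do rewrite mulrC dltC; rewrite sum_delta; apply/eqP; rewrite subr_eq0; apply/eqP.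
    rewrite -[LHS]mulr1 -(@prj_tr _ _ w w0) mulr_sumr; apply: eq_bigr => c _.
    by rewrite /prj; move: (w 0 c) (w 0 c)^* (w 0 k) (x w)%:C^-1 => *; ring.
  transitivity (\sum_c (n1%:C * (w 0 c * (dlt c k - prj w c k)) + w 0 c * prj w c k * n2%:C)).
    apply: eq_bigr => c _; rewrite /N /rmat.
    by move: (w 0 c) (dlt c k - prj w c k) (prj w c k) => *; ring.
  by rewrite big_split /= -mulr_sumr P mulr0 add0r.
have NF i j : \sum_a \sum_b N a i * N j b * E b a = F j i.
  rewrite exchange_big /= /F -(@rmatM _ _ w w0); apply: eq_bigr => b _.
  rewrite -(@rmatM _ _ w w0) mulr_sumr; apply: eq_bigr => a _; rewrite -/(N _ _) -/(N _ _) -/(E _ _).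
  by move: (N a i) (N j b) (E b a) => *; ring.
have NF' i j : \sum_b \sum_c N c i * N j b * E b c = F j i by rewrite -NF exchange_big.
have S i j k : \sum_a \sum_b \sum_c ginv g w i a * ginv g w b j * ginv g w k c * (dric g i j k w * (dric g a b c w)^*) =
   dric g i j k w * (n2%:C * (w 0 k * F j i + w 0 i * F j k)).
  transitivity (dric g i j k w * ((\sum_a \sum_b N a i * N j b * E b a) * (\sum_c w 0 c * N c k)
    + (\sum_a w 0 a * N a i) * (\sum_b \sum_c N c k * N j b * E b c))); last first.
    by rewrite NF NF' !zN; move: (dric g i j k w) (F j i) (F j k) (w 0 i) (w 0 k) n2%:C => *; ring.
  rewrite !mulr_suml.
  transitivity (dric g i j k w * (\sum_a \sum_b \sum_c (N a i * N j b * E b a * (w 0 c * N c k)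
      + w 0 a * N a i * (N c k * N j b * E b c)))).
    rewrite mulr_sumr; apply: eq_bigr => a _; rewrite mulr_sumr; apply: eq_bigr => b _.
    rewrite mulr_sumr; apply: eq_bigr => c _; rewrite (dE a b c) !gN cjD !cjM !conjCK !rmatJ.
    rewrite -!/(E _ _).
    by move: (N a i) (N j b) (N c k) (dric g i j k w) (E b a) (E b c) (w 0 a) (w 0 c) => *; ring.
  congr (_ * _); rewrite -big_split /=; apply: eq_bigr => a _; rewrite mulr_suml mulr_sumr -big_split /=.
  by apply: eq_bigr => b _; rewrite mulr_sumr mulr_sumr -big_split.
under eq_bigr do under eq_bigr do under eq_bigr do rewrite S.
have EF i k : \sum_j E i j * F j k = rmat w (n1 ^+ 2 * pfu t ^+ 2) (n2 ^+ 2 * pfe t ^+ 2) i k.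
  by rewrite rmatM //; congr rmat; ring.
have zz i j : (w 0 i)^* * w 0 j = rmat w 0 t i j by rewrite rmat_zz.
transitivity (n2%:C * (\sum_i \sum_k (((w 0 k)^* * w 0 k) * (\sum_j E i j * F j i)
   + ((w 0 k)^* * w 0 i) * (\sum_j E i j * F j k)
   + ((w 0 i)^* * w 0 k) * (\sum_j E k j * F j i)
   + ((w 0 i)^* * w 0 i) * (\sum_j E k j * F j k)))).
  rewrite mulr_sumr; apply: eq_bigr => i _; rewrite exchange_big /= mulr_sumr; apply: eq_bigr => k _.
  rewrite !mulr_sumr -!big_split mulr_sumr /=; apply: eq_bigr => j _; rewrite dE.
  by move: (w 0 i)^* (w 0 k)^* (w 0 i) (w 0 k) (E i j) (E k j) (F j i) (F j k) => *; ring.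
pose T : R := (n%:R - 1) * (n1 * pfu t) ^+ 2 + (n2 * pfe t) ^+ 2.
have trEF : \sum_i \sum_j E i j * F j i = T%:C.
  under eq_bigr do rewrite EF; rewrite rmat_tr // /rtr /T; congr (_%:C); ring.
have tEF : \sum_i \sum_k ((w 0 k)^* * w 0 i) * (\sum_j E i j * F j k) = (t * (n2 * pfe t) ^+ 2)%:C.
  under eq_bigr do under eq_bigr do rewrite EF zz mulrC.
  under eq_bigr do rewrite rmatM //; rewrite rmat_tr // /rtr; congr (_%:C); ring.
have zt : \sum_k (w 0 k)^* * w 0 k = t%:C by under eq_bigr do rewrite mulrC; rewrite -sqnormC.
have -> : \sum_i \sum_k (((w 0 k)^* * w 0 k) * (\sum_j E i j * F j i)
   + ((w 0 k)^* * w 0 i) * (\sum_j E i j * F j k)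
   + ((w 0 i)^* * w 0 k) * (\sum_j E k j * F j i)
   + ((w 0 i)^* * w 0 i) * (\sum_j E k j * F j k)) = (t * T + t * (n2 * pfe t) ^+ 2 + t * (n2 * pfe t) ^+ 2 + t * T)%:C.
  under eq_bigr do rewrite !big_split /=; rewrite !big_split /= !rcD; congr (_ + _ + _ + _).
  - under eq_bigr do rewrite -mulr_suml zt; by rewrite -mulr_sumr trEF -rcM.
  - by rewrite tEF.
  - by rewrite -tEF exchange_big.
  - under eq_bigr do rewrite -mulr_sumr trEF; by rewrite -mulr_suml zt rcM.
by rewrite -rcM; congr (_%:C); rewrite /T /n1 /n2; ring.
Qed.

Lemma metric_sigma3 w : W w ->
  sigma3 g w = ((n%:R - 1) * (M (x w) / y (x w)) ^+ 3 + M1 (x w) ^+ 3)%:C.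
Proof.
move=> Ww; have w0 := x0 Ww; rewrite /sigma3.
transitivity (\sum_i rmat w ((M (x w) / y (x w)) ^+ 3) (M1 (x w) ^+ 3) i i); last by rewrite rmat_tr.
apply: eq_bigr => i _; rewrite exchange_big /=.
have E3 (r : R) : r ^+ 3 = r * r * r by ring.
rewrite !E3 -[RHS](@rmatM _ _ w w0); apply: eq_bigr => k _.
by rewrite -(@rmatM _ _ w w0) mulr_suml; apply: eq_bigr => j _; rewrite !metric_ric_mixed.
Qed.

Lemma metric_R_Ric_Ric w : W w -> R_Ric_Ric g w =
  (pair4 (x w) (M (x w) / y (x w)) (M1 (x w)) (M (x w) / y (x w)) (M1 (x w)))%:C.
Proof.
move=> Ww; have w0 := x0 Ww; rewrite /R_Ric_Ric /pair4 -(@contr4 _ _ w w0).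
rewrite exchange_big /=; apply: eq_bigr => j _; apply: eq_bigr => i _.
rewrite exchange_big /=; apply: eq_bigr => l _; apply: eq_bigr => k _.
rewrite metric_riem_mixed // !metric_ric_mixed //.
move: (rmat _ _ _ _ _) (rmat _ _ _ _ _) (tens4 _ _ _ _ _ _ _ _) => *; ring.
Qed.

Lemma metric_Ric_R_R w : W w -> Ric_R_R g w =
  ((n%:R - 1) * (M (x w) / y (x w) * (2 * n%:R * al (x w) ^+ 2 + 2 * be (x w) ^+ 2))
   + M1 (x w) * (2 * (n%:R - 1) * be (x w) ^+ 2 + chi2 (x w) ^+ 2))%:C.
Proof.
move=> Ww; have w0 := x0 Ww; rewrite /Ric_R_R -(@contr5 _ _ w w0).
apply: eq_bigr => i _; apply: eq_bigr => j _; apply: eq_bigr => k _.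
apply: eq_bigr => p _; apply: eq_bigr => q _.
by rewrite !metric_riem_mixed // metric_ric_mixed.
Qed.

(** The scalar |R|^2 - 4 |Ric|^2, whose Laplacian remains in a_3 when rho = 0. *)
Definition normS t := 2 * n%:R * (n%:R - 1) * al t ^+ 2 + 4 * (n%:R - 1) * be t ^+ 2 + chi2 t ^+ 2
  - 4 * ((n%:R - 1) * (M t / y t) ^+ 2 + M1 t ^+ 2).

(** With rho = 0 all terms containing rho or its derivatives vanish, sigma_3 cancels between div div
    (R, Ric) and the last bracket, and R(Ric, Ric) occurs twice with the same sign. S1 and S2 are
    derivatives of [normS] with respect to y. *)
Lemma metric_TYZ3 (S1 : R -> R) (S2 : R) w : W w ->
  (forall w, W w -> (n%:R - 1) * M (x w) / y (x w) + M1 (x w) = 0) ->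
  (forall t, D t -> is_derive t 1 normS (S1 t * psi t / t)) ->
  is_derive (x w) 1 S1 (S2 * psi (x w) / x w) ->
  let t := x w in
  TYZ3 g w = (48^-1 *
   (2 * ddric_riem t - 8 * (t / psi t) * t * ((n%:R - 1) * (t / y t * pfu t) ^+ 2 + 2 * (t / psi t * pfe t) ^+ 2)
   - 4 * pair4 t (M t / y t) (M1 t) (M t / y t) (M1 t)
   - 2 * ((n%:R - 1) * (M t / y t * (2 * n%:R * al t ^+ 2 + 2 * be t ^+ 2))
          + M1 t * (2 * (n%:R - 1) * be t ^+ 2 + chi2 t ^+ 2))
   + ((n%:R - 1) * psi t * S1 t / y t + S2 * psi t + S1 t * (1 + chi1 t))))%:C.
Proof.
move=> Ww scal0 dS dS1 t; have w0 := x0 Ww; have Dx := WD Ww.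
have s0 w' : W w' -> scal g w' = 0 by move=> Ww'; rewrite metric_scal // scal0.
have dz0 i w' : W w' -> dz i (scal g) w' = 0.
  by move=> Ww'; rewrite (dz_open _ oW Ww' s0) dz_cst.
have dzb0 i w' : W w' -> dzb i (scal g) w' = 0.
  by move=> Ww'; rewrite (dzb_open _ oW Ww' s0) dzb_cst.
have h0 i j w' : W w' -> dz i (dzb j (scal g)) w' = 0.
  by move=> Ww'; rewrite (dz_open _ oW Ww' (dzb0 j)) dz_cst.
have l0 w' : W w' -> lap g (scal g) w' = 0.
  by move=> Ww'; rewrite /lap big1 // => i _; rewrite big1 // => j _; rewrite h0 // mulr0.
have ll0 : lap g (lap g (scal g)) w = 0.
  rewrite /lap big1 // => i _; rewrite big1 // => j _.
  rewrite (dz_open (g := fun=> 0) _ oW Ww) ?dz_cst ?mulr0 // => w' Ww'.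
  by rewrite (dzb_open _ oW Ww' l0) dzb_cst.
have ds0 : dscal_normsq g w = 0.
  by rewrite /dscal_normsq big1 // => i _; rewrite big1 // => j _; rewrite dz0 // mul0r mulr0.
have rh0 : ric_hess_scal g w = 0.
  rewrite /ric_hess_scal big1 // => i _; rewrite big1 // => j _.
  by rewrite /hess_scal_mixed /mixed2 big1 ?mulr0 // => a _; rewrite h0 // mulr0.
have lS : lap g (fun w => riem_normsq g w - 4 * ric_normsq g w + 8 * scal g w ^+ 2) w =
  ((n%:R - 1) * psi t * S1 t / y t + S2 * psi t + S1 t * (1 + chi1 t))%:C.
  have f1 w' : W w' -> riem_normsq g w' - 4 * ric_normsq g w' + 8 * scal g w' ^+ 2 = (normS (x w'))%:C.
    by move=> Ww'; rewrite metric_riem_normsq // metric_ric_normsq // s0 // expr0n mulr0 addr0 -(rc_nat 4) -rcM -rcB.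
  have f2 : is_derive (x w) 1 (fun t => S1 t * psi t / t)
     ((S2 * psi t / t) * psi t / t + S1 t * ((1 + chi1 t) * psi t / t) / t - S1 t * psi t / t ^+ 2).
    have := d_psi Dx; have := w0 => *; eapply is_derive_eq; [by der|].
    by rewrite -/t; field.
  rewrite (metric_lap Ww f1 (fun w Ww => dS _ (WD Ww)) f2).
  congr (_%:C); rewrite -/t; have := psi0 Dx; have := y0 Dx; have := w0; rewrite -/t.
  move: (psi t) (y t) (S1 t) (chi1 t) => *; field; do ?[apply/andP; split] => //.
rewrite /TYZ3 ll0 /divdiv_R_Ric /divdiv_scal_Ric ds0 rh0 s0 // lS metric_ddric_riem // metric_R_Ric_Ric //.
rewrite metric_sigma3 // metric_Ric_R_R // metric_dric_normsq // -/t.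
set dr := 2 * (t / psi t) * t * _; set P := pair4 _ _ _ _ _; set sg := _ * (M t / y t) ^+ 3 + _.
set rr := _ * (M t / y t * _) + _; set L := _ + S1 t * _.
have -> : 8 * (t / psi t) * t * ((n%:R - 1) * (t / y t * pfu t) ^+ 2 + 2 * (t / psi t * pfe t) ^+ 2) = 4 * dr.
  by rewrite /dr; move: (t / psi t) (t / y t * pfu t) => *; ring.
move: (ddric_riem t) dr P sg rr L (ric_normsq g w) (riem_normsq g w) (lap g (scal g) w) => d dr P sg rr L e1 e2 e3.
rewrite !(rcM, rcD, rcB, rcN, rcV, rc_nat).
by move: d%:C dr%:C P%:C sg%:C rr%:C L%:C => *; field.
Qed.

End Metric.

End Profile.

(** * Radial metrics of vanishing scalar curvature *)

Section ScalarFlat.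
Context {R : realType}.
Variables (n : nat) (A B : R) (D : set R) (y : R -> R).
Hypothesis n_gt0 : (0 < n)%N.
(** Powers such as y^(2 - n) are written as a power of y times y^-n. With d Yn / dy = - n Yn / y,
    [Yn] can be an atom and [field] proves the identities for symbolic n. *)
Definition Yn (t : R) := (y t ^+ n)^-1.
Definition sfchi t := A * y t ^+ 2 * Yn t + B * y t * Yn t.
Definition sfchi1 t := A * (2 - n%:R) * y t * Yn t + B * (1 - n%:R) * Yn t.
Definition sfchi2 t := A * (2 - n%:R) * (1 - n%:R) * Yn t + B * n%:R * (n%:R - 1) * Yn t / y t.
Definition sfM t := - A * y t * Yn t.
Definition sfM1 t := (n%:R - 1) * A * Yn t.
Definition sfM2 t := - (n%:R * (n%:R - 1) * A * Yn t / y t).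
Definition sfM3 t := n%:R * (n%:R - 1) * (n%:R + 1) * A * Yn t / y t ^+ 2.
Local Notation psi := (psi y sfchi).
Hypothesis D_gt0 : forall t, D t -> 0 < t.
Hypothesis y_gt0 : forall t, D t -> 0 < y t.
Hypothesis psi_gt0 : forall t, D t -> 0 < psi t.
Hypothesis dy : forall t, D t -> is_derive t 1 y (psi t / t).

Let t0 t : D t -> t != 0. Proof. by move=> /D_gt0; rewrite lt0r => /andP[]. Qed.
Let y0 t : D t -> y t != 0. Proof. by move=> /y_gt0; rewrite lt0r => /andP[]. Qed.
Let psi0 t : D t -> psi t != 0. Proof. by move=> /psi_gt0; rewrite lt0r => /andP[]. Qed.

Lemma d_Yn t : D t -> is_derive t 1 Yn (- n%:R * Yn t / y t * psi t / t).
Proof.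
move=> Dt; have := dy Dt; have yt := y0 Dt; move=> *; rewrite /Yn; eapply is_derive_eq; [by der|].
rewrite -{2 3 5}(prednK n_gt0) !exprS; move: (psi t) (y t ^+ n.-1) (expf_neq0 n.-1 yt) => p q q0; field.
by rewrite yt q0 (t0 Dt).
Qed.

Ltac der_sf Dt := eapply is_derive_eq; [pose proof (dy Dt); pose proof (d_Yn Dt); pose proof (y0 Dt); der|];
  let Y0 := fresh in let T0 := fresh in pose proof (t0 Dt) as T0; pose proof (y0 Dt) as Y0;
  move: (psi _) (y _) (Yn _) T0 Y0; intros ? ? ? T0 Y0; field; rewrite ?Y0 ?T0 //.

Lemma d_sfchi t : D t -> is_derive t 1 sfchi (sfchi1 t * psi t / t).
Proof. rewrite /sfchi /sfchi1; move=> Dt; der_sf Dt. Qed.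
Lemma d_sfchi1 t : D t -> is_derive t 1 sfchi1 (sfchi2 t * psi t / t).
Proof. rewrite /sfchi1 /sfchi2; move=> Dt; der_sf Dt. Qed.
Lemma d_sfM t : D t -> is_derive t 1 sfM (sfM1 t * psi t / t).
Proof. rewrite /sfM /sfM1; move=> Dt; der_sf Dt. Qed.
Lemma d_sfM1 t : D t -> is_derive t 1 sfM1 (sfM2 t * psi t / t).
Proof. rewrite /sfM1 /sfM2; move=> Dt; der_sf Dt. Qed.
Lemma d_sfM2 t : D t -> is_derive t 1 sfM2 (sfM3 t * psi t / t).
Proof. rewrite /sfM2 /sfM3; move=> Dt; der_sf Dt. Qed.

Lemma sfM_eq t : D t -> sfM t = - ((n%:R - 1) * sfchi t / y t + sfchi1 t).
Proof.
move=> Dt; have := y0 Dt; rewrite /sfM /sfchi /sfchi1.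
by move: (y t) (Yn t) => *; field.
Qed.

Lemma sfscal t : D t -> (n%:R - 1) * sfM t / y t + sfM1 t = 0.
Proof. by move=> Dt; rewrite /sfM /sfM1; have := y0 Dt; move: (y t) (Yn t) => *; field. Qed.

Let N : R := n%:R.
(** On these profiles [normS] is Yn^2 (s0 A^2 + s1 A B / y + s2 B^2 / y^2); [S1] and [S2] are its
    first two derivatives in y. *)
Let s0 := 2 * N * (N - 1) + 4 * (N - 1) ^+ 3 + (2 - N) ^+ 2 * (1 - N) ^+ 2 - 4 * ((N - 1) + (N - 1) ^+ 2).
Let s1 := 4 * N * (N - 1) + 8 * N * (N - 1) ^+ 2 + 2 * (2 - N) * (1 - N) * N * (N - 1).
Let s2 := 2 * N * (N - 1) + 4 * (N - 1) * N ^+ 2 + N ^+ 2 * (N - 1) ^+ 2.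
Let S1 t := - Yn t ^+ 2 * (2 * N * s0 * A ^+ 2 / y t + (2 * N + 1) * s1 * A * B / y t ^+ 2
  + (2 * N + 2) * s2 * B ^+ 2 / y t ^+ 3).
Let S2 t := Yn t ^+ 2 * (2 * N * (2 * N + 1) * s0 * A ^+ 2 / y t ^+ 2
  + (2 * N + 1) * (2 * N + 2) * s1 * A * B / y t ^+ 3
  + (2 * N + 2) * (2 * N + 3) * s2 * B ^+ 2 / y t ^+ 4).

Lemma d_S1 t : D t -> is_derive t 1 S1 (S2 t * psi t / t).
Proof. rewrite /S1 /S2; move=> Dt; der_sf Dt. Qed.

Section TYZ3.
Local Notation C := R[i].
Local Notation Cn := 'rV[C]_n.
Variables (W : set Cn) (g : Cn -> 'M[C]_n).
Hypothesis oW : open W.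
Hypothesis WD : forall w, W w -> D (sqnorm w).
Hypothesis gE : forall w (i j : 'I_n), W w ->
  g w i j = (pfa y (sqnorm w))%:C * dlt i j + (pfb sfchi (sqnorm w))%:C * ((w 0 i)^* * w 0 j).

(** 48 a_3, to be taken at q = y and Y = y^-n. The pure powers of A carry the factor N - 2, which is
    why B = 0 with arbitrary A survives in dimension 2. *)
Definition sfTYZ3 (q : R) (Y : R) : R :=
  Y ^+ 2 * (2 * N ^+ 2 * (N - 1) * (N + 1) * (N - 2) * (N + 2) * A ^+ 2 / q
    + 4 * N ^+ 2 * (N - 1) * (N + 1) ^+ 2 * (N + 2) * A * B / q ^+ 2
    + 2 * N * (N - 1) * (N + 1) ^+ 2 * (N + 2) * (N + 3) * B ^+ 2 / q ^+ 3)
  + Y ^+ 3 * (2 * N ^+ 2 * (N - 1) * (N + 1) * (N - 2) * (2 * N + 1) * A ^+ 3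
    + 6 * N ^+ 3 * (N - 1) * (N + 1) * (2 * N + 1) * A ^+ 2 * B / q
    + 6 * N * (N - 1) * (N + 1) ^+ 2 * (2 * N ^+ 2 + 3 * N + 2) * A * B ^+ 2 / q ^+ 2
    + 2 * N * (N - 1) * (N + 1) ^+ 2 * (N + 2) * (2 * N + 3) * B ^+ 3 / q ^+ 3).

Lemma scalar_flat_TYZ1 w : W w -> TYZ1 g w = 0.
Proof.
move=> Ww; rewrite /TYZ1 (metric_scal D_gt0 y_gt0 psi_gt0 dy d_sfchi d_sfchi1 d_sfM d_sfM1 d_sfM2 n_gt0 oW WD gE sfM_eq Ww).
by rewrite sfscal ?rc0 ?mulr0 //; exact: WD.
Qed.

Lemma scalar_flat_TYZ3 w : W w ->
  TYZ3 g w = (48^-1 * sfTYZ3 (y (sqnorm w)) (Yn (sqnorm w)))%:C.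
Proof.
move=> Ww; have Dx := WD Ww.
have dS u (Du : D u) : is_derive u 1 (normS n y sfchi sfchi1 sfchi2 sfM sfM1) (S1 u * psi u / u).
  rewrite /normS /S1 /al /be /sfchi /sfchi1 /sfchi2 /sfM /sfM1 /s0 /s1 /s2 -/N; der_sf Du.
rewrite (metric_TYZ3 D_gt0 y_gt0 psi_gt0 dy d_sfchi d_sfchi1 d_sfM d_sfM1 d_sfM2 n_gt0 oW WD gE sfM_eq Ww
   (fun w Ww => sfscal (WD Ww)) dS (d_S1 Dx)) /=.
congr ((_ * _)%:C).
rewrite /ddric_riem /pair4 /pfv' /pfe' /pfu' /pfv /pfe /pfu /pg2 /pg1 /pfc /pfb /al /be /sfchi2 /S1 /S2 /sfTYZ3.
rewrite /sfM /sfM1 /sfM2 /sfM3 /s0 /s1 /s2 -/N.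
have := psi0 Dx; have := t0 Dx; have := y0 Dx; rewrite /psi /sfchi1 /sfchi -/N.
move: (sqnorm w) (y _) (Yn _) N => x q Y m q0 x0 p0.
field; by rewrite q0 x0 p0.
Qed.

End TYZ3.

End ScalarFlat.

(** * Holomorphic functions of one variable *)

Section ComplexDifferentiability.
Context {R : realType}.
Local Notation C := R[i].
Implicit Types (f g h phi : C -> C) (z w a b c d : C) (e t r : R).

Definition cdiff f z d : Prop := forall e, 0 < e -> exists2 t : R, 0 < t &
  forall h : C, normc h < t -> normc (f (z + h) - f z - d * h) <= e * normc h.

Lemma normcM (x y : C) : normc (x * y) = normc x * normc y.
Proof. exact: Normc.normcM. Qed.

Lemma normc0 : normc (0 : C) = 0.
Proof. by apply/eqP; rewrite normc_eq0. Qed.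

Lemma cdiff_cst c z : cdiff (fun=> c) z 0.
Proof. by move=> e e0; exists 1 => // h _; rewrite subrr mul0r subr0 normc0 mulr_ge0 ?normc_ge0 // ltW. Qed.

Lemma cdiff_id z : cdiff id z 1.
Proof. by move=> e e0; exists 1 => // h _; rewrite mul1r addrAC addrK subrr normc0 mulr_ge0 ?normc_ge0 // ltW. Qed.

Lemma cdiffD f g z a b : cdiff f z a -> cdiff g z b -> cdiff (fun w => f w + g w) z (a + b).
Proof.
move=> fa gb e e0; have [s s0 H] := fa _ (divr_gt0 e0 (ltr0n _ 2)); have [t t0 K] := gb _ (divr_gt0 e0 (ltr0n _ 2)).
exists (Num.min s t) => [|h]; first by rewrite lt_min s0 t0.
rewrite lt_min => /andP[hs ht].
have -> : f (z + h) + g (z + h) - (f z + g z) - (a + b) * h = (f (z + h) - f z - a * h) + (g (z + h) - g z - b * h) by ring.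
apply: le_trans (normcD _ _) _; rewrite [e]splitr mulrDl; apply: lerD; [exact: H|exact: K].
Qed.

Lemma cdiff_lip f z d : cdiff f z d -> exists2 t : R, 0 < t & forall h : C, normc h < t ->
  normc (f (z + h) - f z) <= (normc d + 1) * normc h.
Proof.
move=> fd; have [t t0 H] := fd 1 ltr01; exists t => // h /H; rewrite mul1r => le1.
have -> : f (z + h) - f z = (f (z + h) - f z - d * h) + d * h by ring.
by apply: le_trans (normcD _ _) _; rewrite normcM mulrDl mul1r addrC lerD.
Qed.

Lemma cdiff_cont f z d e : cdiff f z d -> 0 < e -> exists2 t : R, 0 < t & forall h : C, normc h < t ->
  normc (f (z + h) - f z) <= e.
Proof.
move=> /cdiff_lip[t t0 H] e0; have d0 : 0 < normc d + 1 by rewrite ltr_wpDl ?normc_ge0.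
exists (Num.min t (e / (normc d + 1))) => [|h]; first by rewrite lt_min t0 divr_gt0.
rewrite lt_min => /andP[ht he]; apply: le_trans (H _ ht) _.
by rewrite mulrC -ler_pdivlMr // ltW.
Qed.

Lemma cdiffM f g z a b : cdiff f z a -> cdiff g z b -> cdiff (fun w => f w * g w) z (a * g z + f z * b).
Proof.
move=> fa gb e e0.
(* Three error terms are at most q |h| times |g z|, |f z| and |a| + 1, where q = e / K. *)
pose K := normc (g z) + normc (f z) + (normc a + 1) + 1.
have K0 : 0 < K by rewrite /K; have := normc_ge0 (g z); have := normc_ge0 (f z); have := normc_ge0 a; lra.
have [q q0 eE] : exists2 q : R, 0 < q & e = q * K by exists (e / K); rewrite ?divr_gt0 // divfK // gt_eqF.
have [t1 t10 H1] := fa _ q0; have [t2 t20 H2] := gb _ q0.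
have [t3 t30 H3] := cdiff_lip fa; have [t4 t40 H4] := cdiff_cont gb q0.
exists (Num.min (Num.min t1 t2) (Num.min t3 t4)) => [|h]; first by rewrite !lt_min t10 t20 t30 t40.
rewrite !lt_min => /andP[/andP[h1 h2] /andP[h3 h4]].
have -> : f (z + h) * g (z + h) - f z * g z - (a * g z + f z * b) * h =
  (f (z + h) - f z - a * h) * g z + f z * (g (z + h) - g z - b * h) + (f (z + h) - f z) * (g (z + h) - g z) by ring.
apply: le_trans (normcD _ _) _; apply: le_trans (lerD (normcD _ _) (lexx _)) _; rewrite !normcM.
have := H1 _ h1; have := H2 _ h2; have := H3 _ h3; have := H4 _ h4.
have := normc_ge0 (g z); have := normc_ge0 (f z); have := normc_ge0 h; have := normc_ge0 a.
have := normc_ge0 (f (z + h) - f z); have := normc_ge0 (g (z + h) - g z).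
rewrite eE /K.
move: (normc (f (z + h) - f z - a * h)) (normc (g (z + h) - g z - b * h)) (normc (f (z + h) - f z)) (normc (g (z + h) - g z))
 (normc (g z)) (normc (f z)) (normc h) (normc a) => A B P Q G F H a' Q0 P0 a0 H0 F0 G0 p p2 b1 a1.
have i1 : A * G <= q * H * G by rewrite ler_wpM2r.
have i2 : F * B <= F * (q * H) by rewrite ler_wpM2l.
have i3 : P * Q <= (a' + 1) * H * q by apply: ler_pM.
have : 0 <= q * H by rewrite mulr_ge0 // ltW.
nra.
Qed.

Lemma cdiffN f z a : cdiff f z a -> cdiff (fun w => - f w) z (- a).
Proof.
move=> fa e e0; have [t t0 H] := fa e e0; exists t => // h /H.
by rewrite -normc_oppr; congr (normc _ <= _); ring.
Qed.

Lemma cdiffB f g z a b : cdiff f z a -> cdiff g z b -> cdiff (fun w => f w - g w) z (a - b).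
Proof. by move=> fa gb; apply: cdiffD => //; exact: cdiffN. Qed.

Lemma cdiff_comp f g z a b : cdiff f (g z) a -> cdiff g z b -> cdiff (fun w => f (g w)) z (a * b).
Proof.
move=> fa gb e e0.
pose K := normc a + (normc b + 1); have K0 : 0 < K by rewrite /K addrA ltr_wpDl ?addr_ge0 ?normc_ge0.
have [q q0 eE] : exists2 q : R, 0 < q & e = q * K by exists (e / K); rewrite ?divr_gt0 // divfK // gt_eqF.
have [t1 t10 H1] := fa _ q0; have [t2 t20 H2] := gb _ q0; have [t3 t30 H3] := cdiff_lip gb.
have t12 : 0 < t1 / 2 by rewrite divr_gt0.
have [t4 t40 H4] := cdiff_cont gb t12.
exists (Num.min (Num.min t2 t3) t4) => [|h]; first by rewrite !lt_min t20 t30 t40.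
rewrite !lt_min => /andP[/andP[h2 h3] h4].
pose k := g (z + h) - g z.
have kt : normc k < t1 by apply: le_lt_trans (H4 _ h4) _; rewrite ltr_pdivrMr // ltr_pMr // ltr1n.
have -> : f (g (z + h)) - f (g z) - a * b * h = (f (g z + k) - f (g z) - a * k) + a * (g (z + h) - g z - b * h).
  by rewrite /k [g z + _]addrC subrK; ring.
apply: le_trans (normcD _ _) _; rewrite normcM.
have := H1 _ kt; have := H2 _ h2; have := H3 _ h3; rewrite -/k.
have := normc_ge0 a; have := normc_ge0 h; have := normc_ge0 k; have := normc_ge0 b.
rewrite eE /K.
move: (normc (f (g z + k) - f (g z) - a * k)) (normc (k - b * h)) (normc k) (normc h) (normc a) (normc b)
 => A B k' H a' b' b0 k0 H0 a0 p1 p2 p3.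
have i1 : q * k' <= q * ((b' + 1) * H) by rewrite ler_wpM2l // ltW.
have i2 : a' * B <= a' * (q * H) by rewrite ler_wpM2l.
nra.
Qed.

Lemma cdiff_translate f z w d : cdiff f (z + w) d -> cdiff (fun u => f (u + w)) z d.
Proof.
move=> fd; rewrite -[d]mulr1; apply: (@cdiff_comp f (fun u => u + w)) => //.
rewrite -[1]addr0; apply: cdiffD; [exact: cdiff_id|exact: cdiff_cst].
Qed.

End ComplexDifferentiability.

Section Paths.
Context {R : realType}.
Local Notation C := R[i].
Implicit Types (f g h phi : C -> C) (z w a b c d : C) (e t s r : R) (A B : R -> C).

Definition cder A t d : Prop :=
  is_derive t 1 (fun s => complex.Re (A s)) (complex.Re d) /\
  is_derive t 1 (fun s => complex.Im (A s)) (complex.Im d).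

Lemma cderB A B t a b : cder A t a -> cder B t b -> cder (fun s => A s - B s) t (a - b).
Proof.
move=> [a1 a2] [b1 b2]; split.
  rewrite ReD ReN; under eq_fun do rewrite ReD ReN.
  by apply: is_derive_add => //; exact: is_derive_opp.
rewrite ImD ImN; under eq_fun do rewrite ImD ImN.
by apply: is_derive_add => //; exact: is_derive_opp.
Qed.

Lemma cder_reparam A (u : R -> R) t a (k : R) : cder A (u t) a -> is_derive t 1 u k ->
  cder (fun s => A (u s)) t (k%:C * a).
Proof.
move=> [a1 a2] ku; split.
  eapply is_derive_eq; first exact: (@is_derive_comp _ (fun s => complex.Re (A s)) u t _ _ a1 ku).
  by case: (a) => x y /=; ring.
eapply is_derive_eq; first exact: (@is_derive_comp _ (fun s => complex.Im (A s)) u t _ _ a2 ku).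
by case: (a) => x y /=; ring.
Qed.

Lemma cderP A t d : cder A t d <-> forall e, 0 < e -> exists2 r : R, 0 < r &
  forall s : R, `|s| < r -> normc (A (t + s) - A t - s%:C * d) <= e * `|s|.
Proof.
have re (x y : C) (s : R) : complex.Re (x - y - s%:C * d) = complex.Re x - complex.Re y - complex.Re d * s.
  by case: x y (d) => x1 x2 [y1 y2] [d1 d2] /=; ring.
have im (x y : C) (s : R) : complex.Im (x - y - s%:C * d) = complex.Im x - complex.Im y - complex.Im d * s.
  by case: x y (d) => x1 x2 [y1 y2] [d1 d2] /=; ring.
split=> [[/is_derive1P H /is_derive1P K] e e0|H].
  have [r r0 Hr] := H _ (divr_gt0 e0 (ltr0n _ 2)); have [r' r0' Hr'] := K _ (divr_gt0 e0 (ltr0n _ 2)).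
  exists (Num.min r r') => [|s]; first by rewrite lt_min r0 r0'.
  rewrite lt_min => /andP[s1 s2]; apply: le_trans (normc_le_ReIm _) _; rewrite re im [e]splitr mulrDl.
  by apply: lerD; [exact: Hr|exact: Hr'].
split; apply/is_derive1P => e e0; have [r r0 Hr] := H _ e0; exists r => // s /Hr; apply: le_trans.
  by rewrite -re Re_le_normc.
by rewrite -im Im_le_normc.
Qed.

Lemma cdiff_cder f A t d a : cdiff f (A t) d -> cder A t a -> cder (fun s => f (A s)) t (d * a).
Proof.
move=> fd /cderP H; apply/cderP => e e0.
pose K := normc d + (normc a + 1); have K0 : 0 < K by rewrite /K addrA ltr_wpDl ?addr_ge0 ?normc_ge0.
have [q q0 eE] : exists2 q : R, 0 < q & e = q * K by exists (e / K); rewrite ?divr_gt0 // divfK // gt_eqF.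
have [t1 t10 H1] := fd _ q0; have [t2 t20 H2] := H _ q0; have [t3 t30 H3] := H 1 ltr01.
have A1 : 0 < normc a + 1 by rewrite ltr_wpDl ?normc_ge0.
exists (Num.min (Num.min t2 t3) (t1 / (normc a + 1))) => [|s]; first by rewrite !lt_min t20 t30 divr_gt0.
rewrite !lt_min ltr_pdivlMr // => /andP[/andP[s2 s3] s1].
pose k := A (t + s) - A t.
have kl : normc k <= (normc a + 1) * `|s|.
  have -> : k = (k - s%:C * a) + s%:C * a by ring.
  apply: le_trans (normcD _ _) _; rewrite normcM normc_real mulrDl mul1r addrC [_ * `|s|]mulrC lerD //.
  by have := H3 _ s3; rewrite mul1r.
have kt : normc k < t1 by apply: le_lt_trans kl _; rewrite mulrC.
have -> : f (A (t + s)) - f (A t) - s%:C * (d * a) = (f (A t + k) - f (A t) - d * k) + d * (A (t + s) - A t - s%:C * a).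
  rewrite /k [A t + _]addrC subrK; move: (f _) (f _) s%:C => *; ring.
apply: le_trans (normcD _ _) _; rewrite normcM eE /K.
have := H1 _ kt; have := H2 _ s2; move: kl.
have := normc_ge0 a; have := normr_ge0 s; have := normc_ge0 k; have := normc_ge0 d; rewrite -/k.
move: (normc (f (A t + k) - f (A t) - d * k)) (normc (k - _)) (normc k) `|s| (normc a) (normc d)
 => A' B' k' H' a' b' b0 k0 H0 a0 p1 p2 p3.
have i1 : q * k' <= q * ((a' + 1) * H') by rewrite ler_wpM2l // ltW.
have i2 : b' * B' <= b' * (q * H') by rewrite ler_wpM2l.
nra.
Qed.

Lemma cder_affine a b t : cder (fun s => a + s%:C * b) t b.
Proof.
apply/cderP => e e0; exists 1 => // s _; rewrite rcD.
have -> : a + (t%:C + s%:C) * b - (a + t%:C * b) - s%:C * b = 0 by move: t%:C s%:C => *; ring.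
by rewrite normc0 mulr_ge0 // ltW.
Qed.

Lemma cder_id_affine_sub A t d c : cder A t d -> cder (fun s => A s - s%:C * c) t (d - c).
Proof.
move=> Ad; apply: cderB => //; have := cder_affine 0 c t.
by under eq_fun do rewrite add0r.
Qed.

(** There is no mean value equality for complex paths. With w = A 1 - A 0, the real function Re
    (conj w * A) increases by |w|^2, while its derivative is at most |w| e. *)
Lemma cder_mvt A (D : R -> C) e : (forall t, 0 <= t <= 1 -> cder A t (D t)) ->
  (forall t, 0 <= t <= 1 -> normc (D t) <= e) -> normc (A 1 - A 0) <= e.
Proof.
move=> dA De; pose w := A 1 - A 0.
rewrite -/w; have [->|w0] := eqVneq w 0; first by rewrite normc0; apply: le_trans (normc_ge0 _) (De 0 _); rewrite lexx ler01.
pose G s : R := complex.Re w * complex.Re (A s) + complex.Im w * complex.Im (A s).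
pose G' s : R := complex.Re w * complex.Re (D s) + complex.Im w * complex.Im (D s).
have dG t : 0 <= t <= 1 -> is_derive t 1 G (G' t).
  move=> /dA[h1 h2]; rewrite /G /G'.
  by eapply is_derive_eq; [der|rewrite !mul0r !add0r].
have [t t01 E] : exists2 c : R, c \in `]0, 1[%R & G 1 - G 0 = G' c * (1 - 0).
  apply: (@MVT _ G G' 0 1 ltr01) => [x|].
    by rewrite in_itv /= => /andP[/ltW x0 /ltW x1]; apply: dG; rewrite x0 x1.
  by apply: derivable_within_continuous => x; rewrite in_itv /= => /dG[].
have t1 : 0 <= t <= 1 by move: t01; rewrite in_itv /= => /andP[/ltW-> /ltW->].
have E2 : G 1 - G 0 = normc w ^+ 2 by rewrite normc_sqr /G /w !ReD !ImD !ReN !ImN; ring.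
have : G' t <= normc w * e.
  have -> : G' t = complex.Re (w^* * D t) by rewrite ReM ReJ ImJ /G'; ring.
  apply: le_trans (ler_norm _) _; apply: le_trans (Re_le_normc _) _.
  by rewrite normcM normc_conj ler_wpM2l ?normc_ge0 // De.
rewrite subr0 mulr1 in E; rewrite -E E2 expr2 ler_pM2l // normc_gt0 //.
Qed.

Definition seg a b t : C := a + t%:C * (b - a).

Lemma seg0 a b : seg a b 0 = a. Proof. by rewrite /seg mul0r addr0. Qed.
Lemma seg1 a b : seg a b 1 = b. Proof. by rewrite /seg mul1r addrC subrK. Qed.

Lemma cdiff_mvt f (f' : C -> C) a b c e : (forall t, 0 <= t <= 1 -> cdiff f (seg a b t) (f' (seg a b t))) ->
  (forall t, 0 <= t <= 1 -> normc (f' (seg a b t) - c) <= e) ->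
  normc (f b - f a - c * (b - a)) <= e * normc (b - a).
Proof.
move=> df bf.
have H := @cder_mvt (fun s => f (seg a b s) - s%:C * (c * (b - a))) (fun s => (f' (seg a b s) - c) * (b - a)) (e * normc (b - a)).
rewrite seg1 seg0 mul1r mul0r subr0 in H.
have -> : f b - f a - c * (b - a) = f b - c * (b - a) - f a by ring.
apply: H => [t t01|t t01]; last by rewrite normcM ler_wpM2r ?normc_ge0 // bf.
rewrite mulrBl; apply: cder_id_affine_sub.
exact: (cdiff_cder (df _ t01) (cder_affine a (b - a) t)).
Qed.

End Paths.

Section Goursat.
Context {R : realType}.
Local Notation C := R[i].
Implicit Types (f g h phi : C -> C) (z w a b c d j : C) (e t s r : R) (A B : R -> C).

Lemma antiderivative (u : R -> R) : continuous u ->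
  exists A : R -> R, forall t, 0 <= t <= 1 -> is_derive t 1 A (u t).
Proof.
(* Integrating over [-1, 2] makes every point of [0, 1] interior, so that the fundamental theorem
   gives two-sided derivatives at the ends as well. *)
move=> cu; pose F (x : R) := Rintegral (@lebesgue_measure R) `[(-1)%R, x] u.
exists F => t /andP[t0 t1].
have H : (@lebesgue_measure R).-integrable `[(-1)%R, 2%R] (EFin \o u).
  apply: continuous_compact_integrable; first exact: segment_compact.
  exact: continuous_subspaceT.
have t2 : t < 2 by apply: le_lt_trans t1 _; rewrite ltr1n.
have tm : -1 < t by apply: lt_le_trans t0; rewrite ltrN10.
have [d1 d2] := continuous_FTC1_closed t2 H tm (cu t).
exact: (DeriveDef d1 (etrans (esym (derive1E _ _)) d2)).
Qed.

Definition cont_at phi z : Prop := forall e, 0 < e -> exists2 r : R, 0 < r &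
  forall h : C, normc h < r -> normc (phi (z + h) - phi z) <= e.

(* j is the integral of phi over the segment from a to b *)
Definition segint phi a b j : Prop := exists2 A : R -> C,
  forall t, 0 <= t <= 1 -> cder A t (phi (seg a b t) * (b - a)) & j = A 1 - A 0.

Lemma segint_ex phi a b : (forall t, 0 <= t <= 1 -> cont_at phi (seg a b t)) -> exists j, segint phi a b j.
Proof.
(* Clamping the parameter to [0, 1] extends the integrand to a continuous function on the whole
   line. *)
move=> cphi; pose tau (t : R) := Num.max 0 (Num.min 1 t).
have tau01 t : 0 <= tau t <= 1 by rewrite /tau le_max lexx /= ge_max ler01 /= ge_min lexx.
have tauE t : 0 <= t <= 1 -> tau t = t.
  by move=> /andP[t0 t1]; rewrite /tau (min_idPr t1) (max_idPr t0).
have tau_lip t s : `|tau t - tau s| <= `|t - s|.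
  have H (x y : R) : x <= y -> 0 <= tau y - tau x <= y - x.
    by rewrite /tau => xy; case: (leP 1 x) => ?; case: (leP 1 y) => ?; rewrite ?[Num.max 0 1]max_r ?ler01 //;
      try case: (leP 0 x) => ?; try case: (leP 0 y) => ?; lra.
  case: (leP t s) => [/H/andP[h1 h2]|/ltW/H/andP[h1 h2]].
    by rewrite distrC [X in _ <= X]distrC !ger0_norm // (le_trans h1).
  by rewrite !ger0_norm // (le_trans h1).
pose u t := phi (seg a b (tau t)) * (b - a).
have cu (t e : R) : 0 < e -> exists2 r : R, 0 < r & forall s, `|t - s| < r -> normc (u s - u t) <= e.
  move=> e0; have b0 : 0 < normc (b - a) + 1 by rewrite ltr_wpDl ?normc_ge0.
  have [r r0 H] := cphi _ (tau01 t) _ (divr_gt0 e0 b0).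
  exists (r / (normc (b - a) + 1)); first by rewrite divr_gt0.
  move=> s ts; have E : seg a b (tau s) = seg a b (tau t) + (tau s - tau t)%:C * (b - a).
    by rewrite /seg rcB; ring.
  rewrite /u E -mulrBl normcM; apply: le_trans (ler_wpM2r (normc_ge0 _) (H _ _)) _.
    rewrite normcM normc_real; apply: le_lt_trans (_ : `|t - s| * (normc (b - a) + 1) < r); last by rewrite -ltr_pdivlMr.
    by rewrite ler_pM ?normc_ge0 ?lerDl // distrC tau_lip.
  by rewrite mulrAC ler_pdivrMr // ler_wpM2l ?lerDl // ltW.
have cr : continuous (fun t => complex.Re (u t)).
  move=> t; apply/cvgrPdist_le => e e0; have [r r0 H] := cu t e e0.
  apply/nbhs_ballP; exists r => // s /H; apply: le_trans.
  by rewrite distrC -ReN -ReD Re_le_normc.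
have ci : continuous (fun t => complex.Im (u t)).
  move=> t; apply/cvgrPdist_le => e e0; have [r r0 H] := cu t e e0.
  apply/nbhs_ballP; exists r => // s /H; apply: le_trans.
  by rewrite distrC -ImN -ImD Im_le_normc.
have [A HA] := antiderivative cr; have [B HB] := antiderivative ci.
exists ((A 1 +i* B 1) - (A 0 +i* B 0)); exists (fun t => A t +i* B t) => // t t01.
by have := HA _ t01; have := HB _ t01; rewrite /u (tauE _ t01).
Qed.

Lemma seg_half a b t : seg a ((a + b) / 2) t = seg a b (t / 2).
Proof. by rewrite /seg rcM rcV rc_nat; field. Qed.

Lemma seg_half2 a b t : seg ((a + b) / 2) b t = seg a b ((1 + t) / 2).
Proof. by rewrite /seg rcM rcV rc_nat rcD rc1; field. Qed.

Lemma seg_rev a b t : seg b a t = seg a b (1 - t).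
Proof. by rewrite /seg rcB rc1; ring. Qed.

Lemma segint_uniq phi a b j j' : segint phi a b j -> segint phi a b j' -> j = j'.
Proof.
move=> [A HA ->] [B HB ->].
have := @cder_mvt _ (fun t => A t - B t) (fun=> 0) 0.
rewrite normc0 => H; have : normc (A 1 - B 1 - (A 0 - B 0)) <= 0.
  by apply: H => // t t01; rewrite -(subrr (phi (seg a b t) * (b - a))); apply: cderB; [exact: HA|exact: HB].
rewrite le_eqVlt ltNge normc_ge0 orbF normc_eq0 subr_eq0 => /eqP E.
by rewrite -[A 1](subrK (B 1)) E; ring.
Qed.

(** The affine function c + d w has the primitive c w + d w^2 / 2; only the deviation of phi from it
    has to be estimated. *)
Lemma segint_near phi a b j c d e : segint phi a b j ->
  (forall t, 0 <= t <= 1 -> normc (phi (seg a b t) - c - d * seg a b t) <= e) ->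
  normc (j - (c * (b - a) + d * (b ^+ 2 - a ^+ 2) / 2)) <= e * normc (b - a).
Proof.
move=> [A HA ->] H.
pose B t := c * seg a b t + d / 2 * (seg a b t * seg a b t).
have dB t : cder B t ((c + d * seg a b t) * (b - a)).
  have -> : c + d * seg a b t = (0 * seg a b t + c * 1) + (0 * (seg a b t * seg a b t) + d / 2 * (1 * seg a b t + seg a b t * 1)) by field.
  apply: (@cdiff_cder _ (fun z => c * z + d / 2 * (z * z)) (seg a b)); last exact: cder_affine.
  apply: cdiffD; apply: cdiffM; [exact: cdiff_cst|exact: cdiff_id|exact: cdiff_cst|].
  by apply: cdiffM; exact: cdiff_id.
have -> : A 1 - A 0 - (c * (b - a) + d * (b ^+ 2 - a ^+ 2) / 2) = (A 1 - B 1) - (A 0 - B 0).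
  by rewrite /B seg0 seg1; move: (A 1) (A 0) => *; field.
apply: (@cder_mvt _ (fun t => A t - B t) (fun t => (phi (seg a b t) - c - d * seg a b t) * (b - a))) => t t01; last first.
  by rewrite normcM ler_wpM2r ?normc_ge0 // H.
have -> : (phi (seg a b t) - c - d * seg a b t) * (b - a) = phi (seg a b t) * (b - a) - (c + d * seg a b t) * (b - a) by ring.
by apply: cderB; [exact: HA|exact: dB].
Qed.

Lemma segint_split phi a b : (forall t, 0 <= t <= 1 -> cont_at phi (seg a b t)) -> exists j1 j2,
  [/\ segint phi a ((a + b) / 2) j1, segint phi ((a + b) / 2) b j2 & segint phi a b (j1 + j2)].
Proof.
move=> /segint_ex[j [A HA jE]].
exists (A (1 / 2) - A 0), (A 1 - A (1 / 2)); split.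
- exists (fun t => A (t / 2)) => [t /andP[t0 t1]|]; last by rewrite mul0r.
  have -> : phi (seg a ((a + b) / 2) t) * ((a + b) / 2 - a) = (2^-1)%:C * (phi (seg a b (t / 2)) * (b - a)).
    by rewrite seg_half rcV rc_nat; move: (phi _) => *; field.
  apply: (@cder_reparam _ A (fun t => t / 2)).
    by apply: HA; rewrite divr_ge0 //= ler_pdivrMr // mul1r (le_trans t1) // ler1n.
  by eapply is_derive_eq; [der|]; field.
- exists (fun t => A ((1 + t) / 2)) => [t /andP[t0 t1]|]; last by rewrite addr0 -[1 + 1]/(2%:R) divff ?pnatr_eq0.
  have -> : phi (seg ((a + b) / 2) b t) * (b - (a + b) / 2) = (2^-1)%:C * (phi (seg a b ((1 + t) / 2)) * (b - a)).
    by rewrite seg_half2 rcV rc_nat; move: (phi _) => *; field.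
  apply: (@cder_reparam _ A (fun t => (1 + t) / 2)).
    by apply: HA; rewrite divr_ge0 ?addr_ge0 //= ler_pdivrMr // mul1r -[2]/(1 + 1 : R) lerD2l.
  by eapply is_derive_eq; [der|]; field.
- by exists A => //; ring.
Qed.

Lemma segint_rev phi a b j : segint phi a b j -> segint phi b a (- j).
Proof.
move=> [A HA jE]; exists (fun t => A (1 - t)); last by rewrite subrr subr0 jE opprB.
move=> t /andP[t0 t1]; have -> : phi (seg b a t) * (a - b) = (-1)%:C * (phi (seg a b (1 - t)) * (b - a)).
  by rewrite seg_rev rcN rc1; move: (phi _) => *; ring.
apply: (@cder_reparam _ A (fun t => 1 - t)); first by apply: HA; rewrite subr_ge0 t1 /= lerBlDr lerDl.
by eapply is_derive_eq; [der|]; ring.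
Qed.

Definition cint phi a b : C := xget 0 [set j | segint phi a b j].

Lemma cintP phi a b : (forall t, 0 <= t <= 1 -> cont_at phi (seg a b t)) -> segint phi a b (cint phi a b).
Proof. by move=> /segint_ex[j /= Pj]; rewrite /cint; case: xgetP => [y _ //|/(_ j)]. Qed.

(** The intervals of radius 2 D / 2^n around x n are nested; the limit is the supremum of their left
    ends. *)
Lemma geometric_limit (x : nat -> R) (D : R) : (forall n, `|x n.+1 - x n| <= D / 2 ^+ n) ->
  exists l : R, forall n, `|x n - l| <= 2 * D / 2 ^+ n.
Proof.
move=> H; have D0 : 0 <= D by have := H 0%N; rewrite expr0 divr1; apply: le_trans.
pose lo n := x n - 2 * D / 2 ^+ n; pose hi n := x n + 2 * D / 2 ^+ n.
have p0 n : (0 : R) < 2 ^+ n by rewrite exprn_gt0.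
have st n : 2 * D / 2 ^+ n = D / 2 ^+ n + 2 * D / 2 ^+ n.+1.
  by rewrite exprS; field; rewrite gt_eqF.
have lo1 n : lo n <= lo n.+1 by rewrite /lo (st n); have := H n; rewrite ler_norml => /andP[]; lra.
have hi1 n : hi n.+1 <= hi n by rewrite /hi (st n); have := H n; rewrite ler_norml => /andP[]; lra.
have lom n m : (n <= m)%N -> lo n <= lo m.
  by elim: m => [|m IH]; [rewrite leqn0 => /eqP->|rewrite leq_eqVlt => /predU1P[->//|/IH/le_trans]; apply].
have him n m : (n <= m)%N -> hi m <= hi n.
  by elim: m => [|m IH]; [rewrite leqn0 => /eqP->|rewrite leq_eqVlt => /predU1P[->//|/IH h]; exact: le_trans h].
have lh n m : lo n <= hi m.
  have lhn k : lo k <= hi k.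
    have : 0 <= 2 * D / 2 ^+ k by apply: divr_ge0; [exact: mulr_ge0|exact: ltW].
    by rewrite /lo /hi; lra.
  by case: (leqP n m) => [/lom|/ltnW/him] h; [apply: le_trans h _|apply: le_trans h].
pose S := range lo.
have hs : has_sup S by split; [exists (lo 0%N), 0%N|exists (hi 0%N) => _ [n _ <-]].
exists (sup S) => n; rewrite ler_norml; apply/andP; split.
  have : sup S <= hi n by apply: ge_sup => [|_ [m _ <-]] //; exact: hs.1.
  by rewrite /hi; lra.
have : lo n <= sup S by apply: ub_le_sup; [exact: hs.2|exists n].
by rewrite /lo; lra.
Qed.

Section Triangle.
Variables (x1 x2 y1 y2 : R) (phi : C -> C).
Definition crect z : bool := (x1 <= complex.Re z <= x2) && (y1 <= complex.Im z <= y2).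
Hypothesis phi_hol : forall z, crect z -> exists d, cdiff phi z d.

Lemma crect_seg a b t : crect a -> crect b -> 0 <= t <= 1 -> crect (seg a b t).
Proof.
have E (u v : R) : u + (t * (v - u) - 0) = (1 - t) * u + t * v by ring.
have E' (u v : R) : u + (t * (v - u) + 0) = (1 - t) * u + t * v by ring.
rewrite /crect /seg; case: a b => a1 a2 [b1 b2] /= /andP[/andP[? ?] /andP[? ?]] /andP[/andP[? ?] /andP[? ?]] /andP[? ?].
rewrite !mul0r E E'; apply/andP; split; apply/andP; split; nra.
Qed.

Lemma crect_cont z : crect z -> cont_at phi z.
Proof. by move=> /phi_hol[d fd] e e0; exact: cdiff_cont fd e0. Qed.

Let J := cint phi.
Let JP a b : crect a -> crect b -> segint phi a b (J a b).
Proof. by move=> Ka Kb; apply: cintP => t t01; apply: crect_cont; exact: crect_seg. Qed.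

Let Jrev a b : crect a -> crect b -> J b a = - J a b.
Proof. by move=> Ka Kb; apply: segint_uniq (JP Kb Ka) (segint_rev (JP Ka Kb)). Qed.

Let mid a b : C := (a + b) / 2.

Let midE a b : mid a b = seg a b (2^-1).
Proof. by rewrite /mid /seg rcV rc_nat; field. Qed.

Let Kmid a b : crect a -> crect b -> crect (mid a b).
Proof. by move=> Ka Kb; rewrite midE; apply: crect_seg => //; rewrite invr_ge0 invf_le1 // ler1n ler0n. Qed.

Let Jsplit a b : crect a -> crect b -> J a b = J a (mid a b) + J (mid a b) b.
Proof.
move=> Ka Kb.
have [|j1 [j2 [h1 h2 h3]]] := @segint_split phi a b.
  by move=> t t01; apply: crect_cont; exact: crect_seg.
rewrite (segint_uniq (JP Ka Kb) h3) (segint_uniq (JP Ka (Kmid Ka Kb)) h1).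
by rewrite (segint_uniq (JP (Kmid Ka Kb) Kb) h2).
Qed.

Let T (p : C * C * C) : C := J p.1.1 p.1.2 + J p.1.2 p.2 + J p.2 p.1.1.
(** The midpoint subdivision: three corner triangles and the medial one, with equal orientation, so
    that the inner sides cancel. *)
Let t1 (p : C * C * C) : C * C * C := (p.1.1, mid p.1.1 p.1.2, mid p.2 p.1.1).
Let t2 (p : C * C * C) : C * C * C := (mid p.1.1 p.1.2, p.1.2, mid p.1.2 p.2).
Let t3 (p : C * C * C) : C * C * C := (mid p.2 p.1.1, mid p.1.2 p.2, p.2).
Let t4 (p : C * C * C) : C * C * C := (mid p.1.1 p.1.2, mid p.1.2 p.2, mid p.2 p.1.1).
Let good (D : R) (p : C * C * C) := [/\ crect p.1.1, crect p.1.2, crect p.2 &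
  [/\ normc (p.1.2 - p.1.1) <= D, normc (p.2 - p.1.2) <= D & normc (p.1.1 - p.2) <= D]].

Let Tsplit D p : good D p -> T p = T (t1 p) + T (t2 p) + T (t3 p) + T (t4 p).
Proof.
case: p => [[a b] c] [/= Ka Kb Kc _]; rewrite /T /=.
have K1 := Kmid Ka Kb; have K2 := Kmid Kb Kc; have K3 := Kmid Kc Ka.
rewrite (Jsplit Ka Kb) (Jsplit Kb Kc) (Jsplit Kc Ka) (Jrev K1 K3) (Jrev K2 K1) (Jrev K3 K2).
rewrite (Jrev (a := mid b c) (b := mid c a)) // (Jrev (a := mid c a) (b := mid a b)) //.
by rewrite (Jrev K3 K2); move: (J _ _) (J _ _) (J _ _) (J _ _) => *; ring.
Qed.

(** Selects a subtriangle whose integral is at least a quarter of the whole; if the first three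
    fail, the fourth must qualify. *)
Let nxt p := if normc (T p) <= 4 * normc (T (t1 p)) then t1 p else
  if normc (T p) <= 4 * normc (T (t2 p)) then t2 p else
  if normc (T p) <= 4 * normc (T (t3 p)) then t3 p else t4 p.

Let T_nxt D p : good D p -> normc (T p) <= 4 * normc (T (nxt p)).
Proof.
move=> gp; rewrite /nxt; do 3![case: ifP => // /negbT; rewrite -ltNge => ?].
have := normcD (T (t1 p) + T (t2 p) + T (t3 p)) (T (t4 p)).
have := normcD (T (t1 p) + T (t2 p)) (T (t3 p)).
have := normcD (T (t1 p)) (T (t2 p)).
by rewrite -(Tsplit gp); lra.
Qed.

Let good_nxt D p : good D p -> good (D / 2) (nxt p) /\ normc ((nxt p).1.1 - p.1.1) <= D.
Proof.
case: p => [[a b] c] [/= Ka Kb Kc [ab bc ca]].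
have K1 := Kmid Ka Kb; have K2 := Kmid Kb Kc; have K3 := Kmid Kc Ka.
have D0 : 0 <= D := le_trans (normc_ge0 _) ab.
have n2 : normc (2^-1 : C) = 2^-1.
  by rewrite -(rc_nat 2) -rcV normc_real ger0_norm // invr_ge0.
have hN (v u : C) : u = v / 2 -> normc v <= D -> normc u <= D / 2.
  by move=> -> vD; rewrite normcM n2 ler_wpM2r // invr_ge0.
have hN' (v u : C) : u = - v / 2 -> normc v <= D -> normc u <= D / 2.
  by move=> -> vD; rewrite normcM normc_oppr n2 ler_wpM2r // invr_ge0.
have hD (u : C) : normc u <= D / 2 -> normc u <= D by move=> /le_trans; apply; lra.
have g1 : good (D / 2) (t1 (a, b, c)).
  by split => //; rewrite /t1 /mid /=; split; [apply: (hN (b - a)) ab|apply: (hN (c - b)) bc|apply: (hN (a - c)) ca]; field.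
have g2 : good (D / 2) (t2 (a, b, c)).
  by split => //; rewrite /t2 /mid /=; split; [apply: (hN (b - a)) ab|apply: (hN (c - b)) bc|apply: (hN (a - c)) ca]; field.
have g3 : good (D / 2) (t3 (a, b, c)).
  by split => //; rewrite /t3 /mid /=; split; [apply: (hN (b - a)) ab|apply: (hN (c - b)) bc|apply: (hN (a - c)) ca]; field.
have g4 : good (D / 2) (t4 (a, b, c)).
  by split => //; rewrite /t4 /mid /=; split; [apply: (hN' (a - c)) ca|apply: (hN' (b - a)) ab|apply: (hN' (c - b)) bc]; field.
have v1 : normc (mid a b - a) <= D by apply: hD; apply: (hN (b - a)) ab; rewrite /mid; field.
have v3 : normc (mid c a - a) <= D by apply: hD; apply: (hN' (a - c)) ca; rewrite /mid; field.
by rewrite /nxt; do ![case: ifP => _]; split; rewrite //= subrr normc0.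
Qed.

Lemma goursat a b c : crect a -> crect b -> crect c -> cint phi a b + cint phi b c + cint phi c a = 0.
Proof.
move=> Ka Kb Kc; pose p n := iter n nxt (a, b, c).
pose D := normc (b - a) + normc (c - b) + normc (a - c).
have D0 : 0 <= D by rewrite !addr_ge0 ?normc_ge0.
have gp n : good (D / 2 ^+ n) (p n).
  elim: n => [|n IH]; last by rewrite exprSr invfM mulrA; exact: (good_nxt IH).1.
  rewrite expr0 divr1; split => //=.
  by have := normc_ge0 (b - a); have := normc_ge0 (c - b); have := normc_ge0 (a - c); rewrite /D; split; lra.
have Tp n : normc (T (p 0%N)) <= 4 ^+ n * normc (T (p n)).
  elim: n => [|n IH]; first by rewrite expr0 mul1r.
  apply: le_trans IH _; rewrite exprSr -mulrA ler_wpM2l ?exprn_ge0 //; exact: T_nxt (gp n).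
have vp n : normc ((p n.+1).1.1 - (p n).1.1) <= D / 2 ^+ n by exact: (good_nxt (gp n)).2.
have [l1 L1] : exists l : R, forall n, `|complex.Re (p n).1.1 - l| <= 2 * D / 2 ^+ n.
  by apply: geometric_limit => n; rewrite -ReN -ReD; apply: le_trans (Re_le_normc _) (vp n).
have [l2 L2] : exists l : R, forall n, `|complex.Im (p n).1.1 - l| <= 2 * D / 2 ^+ n.
  by apply: geometric_limit => n; rewrite -ImN -ImD; apply: le_trans (Im_le_normc _) (vp n).
pose l := l1 +i* l2.
have Ll n : normc ((p n).1.1 - l) <= 4 * D / 2 ^+ n.
  apply: le_trans (normc_le_ReIm _) _; rewrite ReD ImD ReN ImN /=.
  have -> : 4 * D / 2 ^+ n = 2 * D / 2 ^+ n + 2 * D / 2 ^+ n by field; rewrite expf_neq0.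
  by apply: lerD.
have small (x : R) (e : R) : 0 < e -> exists n : nat, x / 2 ^+ n < e.
  move=> e0; exists (Num.bound (x / e)); rewrite ltr_pdivrMr ?exprn_gt0 // mulrC -ltr_pdivrMr //.
  exact: upper_nthrootP.
have lim_le (u : nat -> R) (m l' : R) : (forall n, m <= u n) -> (forall n, `|u n - l'| <= 2 * D / 2 ^+ n) -> m <= l'.
  move=> h1 h2; apply/ler_addgt0Pr => e e0; have [n en] := small (2 * D) e e0.
  by have := h1 n; have := h2 n; rewrite ler_norml => /andP[]; lra.
have lim_ge (u : nat -> R) (m l' : R) : (forall n, u n <= m) -> (forall n, `|u n - l'| <= 2 * D / 2 ^+ n) -> l' <= m.
  move=> h1 h2; apply/ler_addgt0Pr => e e0; have [n en] := small (2 * D) e e0.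
  by have := h1 n; have := h2 n; rewrite ler_norml => /andP[]; lra.
have Kl : crect l.
  have Kn n : crect (p n).1.1 by have [] := gp n.
  rewrite /crect /=; apply/andP; split; apply/andP; split; [apply: lim_le L1|apply: lim_ge L1|apply: lim_le L2|apply: lim_ge L2];
  by move=> n; have /andP[/andP[? ?] /andP[? ?]] := Kn n.
have [d fd] := phi_hol Kl.
suff : normc (T (a, b, c)) <= 0.
  by rewrite le_eqVlt ltNge normc_ge0 orbF normc_eq0 => /eqP.
apply/ler_addgt0Pr => e e0; rewrite add0r.
(* The affine part of phi at the limit point l integrates to 0 around a triangle. The n-th one has
   sides at most dn and lies within 5 dn of l, so each of the three sides leaves an error of at most
   q (5 dn) dn; in total 4^n * 15 q dn^2 = 15 q D^2. *)
have E0 : 0 < e / (15 * D ^+ 2 + 1) by rewrite divr_gt0 // ltr_wpDl // mulr_ge0 // sqr_ge0.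
have [r r0 Hr] := fd _ E0; have [n rn] := small (5 * D) r r0.
pose dn := D / 2 ^+ n; set q := e / _ in E0 Hr.
have dn0 : 0 <= dn by rewrite divr_ge0 // exprn_ge0.
have rdn : 5 * dn < r by rewrite /dn mulrA.
have near (u v : C) : crect u -> crect v -> normc (v - u) <= dn -> normc (u - l) <= 5 * dn -> normc (v - l) <= 5 * dn ->
   normc (J u v - ((phi l - d * l) * (v - u) + d * (v ^+ 2 - u ^+ 2) / 2)) <= q * (5 * dn) * dn.
  move=> Ku Kv uv ul vl; have q5 : 0 <= q * (5 * dn) by apply: mulr_ge0; [exact: ltW|exact: mulr_ge0].
  apply: le_trans (segint_near (JP Ku Kv) _) (ler_wpM2l q5 uv) => t /andP[t0 t1'].
  have hl : normc (seg u v t - l) <= 5 * dn.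
    have -> : seg u v t - l = (1 - t)%:C * (u - l) + t%:C * (v - l) by rewrite /seg rcB rc1; ring.
    apply: le_trans (normcD _ _) _; rewrite !normcM !normc_real (ger0_norm t0) ger0_norm ?subr_ge0 //.
    by have := normc_ge0 (u - l); have := normc_ge0 (v - l); nra.
  have := Hr _ (le_lt_trans hl rdn); rewrite [l + _]addrC subrK => H.
  have -> : phi (seg u v t) - (phi l - d * l) - d * seg u v t = phi (seg u v t) - phi l - d * (seg u v t - l) by ring.
  by apply: le_trans H _; rewrite ler_wpM2l // ltW.
have [Kx Ky Kz [xy yz zx]] := gp n; have xl := Ll n.
move: Kx Ky Kz xy yz zx xl (Tp n); rewrite -/dn {2}/T.
move: (p n).1.1 (p n).1.2 (p n).2 => x y z Kx Ky Kz xy yz zx.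
have -> : 4 * D / 2 ^+ n = 4 * dn by rewrite /dn mulrA.
move=> xl; rewrite [p 0%N]/=.
have yl : normc (y - l) <= 5 * dn.
  by rewrite -(subrK x y) -addrA; apply: le_trans (normcD _ _) _; have := xy; lra.
have zl : normc (z - l) <= 5 * dn.
  by rewrite -(subrK x z) -addrA; apply: le_trans (normcD _ _) _; move: zx; rewrite normcB; lra.
have xl5 : normc (x - l) <= 5 * dn by lra.
have n1 := near x y Kx Ky xy xl5 yl; have n2 := near y z Ky Kz yz yl zl; have n3 := near z x Kz Kx zx zl xl5.
move=> Tle; apply: le_trans Tle _.
have -> : J x y + J y z + J z x = (J x y - ((phi l - d * l) * (y - x) + d * (y ^+ 2 - x ^+ 2) / 2))
   + (J y z - ((phi l - d * l) * (z - y) + d * (z ^+ 2 - y ^+ 2) / 2))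
   + (J z x - ((phi l - d * l) * (x - z) + d * (x ^+ 2 - z ^+ 2) / 2)).
  by move: (J x y) (J y z) (J z x) (phi l) => *; field.
apply: le_trans (_ : 4 ^+ n * (15 * q * dn ^+ 2) <= _).
  rewrite ler_wpM2l ?exprn_ge0 //; apply: le_trans (normcD _ _) _.
  apply: le_trans (lerD (normcD _ _) (lexx _)) _.
  by apply: le_trans (lerD (lerD n1 n2) n3) _; rewrite le_eqVlt; apply/orP; left; apply/eqP; ring.
have -> : 4 ^+ n = (2 ^+ n) ^+ 2 :> R.
  by rewrite -exprM mulnC exprM; congr (_ ^+ n); ring.
have -> : (2 ^+ n) ^+ 2 * (15 * q * dn ^+ 2) = 15 * D ^+ 2 * q.
  by rewrite /dn; have : (2 ^+ n : R) != 0 by [rewrite expf_neq0]; move: (2 ^+ n) => *; field.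
rewrite /q mulrC mulrAC ler_pdivrMr ?ltr_wpDl ?mulr_ge0 ?sqr_ge0 //.
by rewrite ler_wpM2l ?lerDl // ltW.
Qed.

(** A rectangle is convex, so integration over segments from one corner is possible, and by
    [goursat] the increments of this function are again integrals over segments. *)
Lemma primitive : exists h : C -> C, forall z,
  x1 < complex.Re z < x2 -> y1 < complex.Im z < y2 -> cdiff h z (phi z).
Proof.
exists (J (x1 +i* y1)) => z /andP[a1 a2] /andP[b1 b2].
have K0 : crect (x1 +i* y1).
  by rewrite /crect /= !lexx (ltW (lt_trans a1 a2)) (ltW (lt_trans b1 b2)).
have Kz : crect z by rewrite /crect !ltW.
move=> e e0; have [r r0 Hr] := crect_cont Kz e0.
pose m := Num.min (Num.min (complex.Re z - x1) (x2 - complex.Re z)) (Num.min (complex.Im z - y1) (y2 - complex.Im z)).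
exists (Num.min r m) => [|k]; first by rewrite !lt_min r0 !subr_gt0 a1 a2 b1 b2.
rewrite !lt_min => /andP[kr /andP[/andP[k1 k2] /andP[k3 k4]]].
have Kk : crect (z + k).
  have := Re_le_normc k; have := Im_le_normc k; rewrite !ler_norml => /andP[i1 i2] /andP[i3 i4].
  rewrite /crect ReD ImD; apply/andP; split; apply/andP; split; lra.
have G : J (x1 +i* y1) z + J z (z + k) + J (z + k) (x1 +i* y1) = 0 := goursat K0 Kz Kk.
rewrite (Jrev K0 Kk) in G.
have -> : J (x1 +i* y1) (z + k) = J (x1 +i* y1) z + J z (z + k).
  apply/eqP; rewrite -subr_eq0 -oppr_eq0 opprB; apply/eqP; rewrite -[RHS]G.
  by move: (J _ _) (J _ _) (J _ _) => *; ring.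
rewrite [J _ z + _]addrC addrK.
have := segint_near (c := phi z) (d := 0) (e := e) (JP Kz Kk).
have zk : z + k - z = k by ring.
rewrite zk !mul0r addr0; apply=> t /andP[t0 t1'].
rewrite mul0r subr0 /seg zk; apply: Hr; rewrite normcM normc_real ger0_norm //.
by apply: le_lt_trans kr; rewrite ler_piMl ?normc_ge0.
Qed.

End Triangle.

End Goursat.

Section ComplexExponential.
Context {R : realType}.
Local Notation C := R[i].
Implicit Types (z w h : C).

Definition cexp z : C := (expR (complex.Re z))%:C * (cos (complex.Im z) +i* sin (complex.Im z)).

Lemma cexpD z w : cexp (z + w) = cexp z * cexp w.
Proof.
rewrite /cexp ReD ImD expRD cosD sinD rcM.
by case: z w => a b [c d] /=; apply: eqC => /=; ring.
Qed.

Lemma cexp0 : cexp 0 = 1.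
Proof. by rewrite /cexp /= expR0 cos0 sin0 mul1r. Qed.

Lemma normc_cexp z : normc (cexp z) = expR (complex.Re z).
Proof.
rewrite /cexp normcM normc_real ger0_norm ?expR_ge0 // -[RHS]mulr1; congr (_ * _).
by apply/eqP; rewrite -(@eqrXn2 _ 2%N) ?normc_ge0 ?ler01 // normc_sqr /= expr1n cos2Dsin2.
Qed.

Lemma cexp_neq0 z : cexp z != 0.
Proof. by rewrite -normc_gt0 normc_cexp expR_gt0. Qed.

Lemma cexpN z : cexp z * cexp (- z) = 1.
Proof. by rewrite -cexpD subrr cexp0. Qed.

Lemma cexp_periodic z : cexp (z + 0 +i* (pi *+ 2)) = cexp z.
Proof. by rewrite /cexp ReD ImD /= addr0 cosD2pi sinD2pi. Qed.

Lemma cder_cexp z h (t : R) : cder (fun s : R => cexp (z + s%:C * h)) t (cexp (z + t%:C * h) * h).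
Proof.
pose a := complex.Re z; pose b := complex.Im z; pose u := complex.Re h; pose v := complex.Im h.
have E s : cexp (z + s%:C * h) = (expR (a + s * u) * cos (b + s * v)) +i* (expR (a + s * u) * sin (b + s * v)).
  have re : complex.Re (z + s%:C * h) = a + s * u by rewrite /a /u; case: (z) (h) => ? ? [? ?] /=; ring.
  have im : complex.Im (z + s%:C * h) = b + s * v by rewrite /b /v; case: (z) (h) => ? ? [? ?] /=; ring.
  by rewrite /cexp re im; apply: eqC => /=; ring.
have D1 (x y s : R) : is_derive s 1 (fun s => x + s * y) y.
  by eapply is_derive_eq; [der|]; ring.
have d1 := @is_derive_comp _ (@expR R) (fun s => a + s * u) t _ _ (is_derive_expR _) (D1 a u t).
have d2 := @is_derive_comp _ (@cos R) (fun s => b + s * v) t _ _ (is_derive_cos _) (D1 b v t).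
have d3 := @is_derive_comp _ (@sin R) (fun s => b + s * v) t _ _ (is_derive_sin _) (D1 b v t).
rewrite E; split.
  under eq_fun do rewrite E; eapply is_derive_eq; first exact: (is_derive_mul d1 d2).
  by rewrite ReM /= -/u -/v; ring.
under eq_fun do rewrite E; eapply is_derive_eq; first exact: (is_derive_mul d1 d3).
by rewrite ImM /= -/u -/v; ring.
Qed.

Lemma cont_cexp z : cont_at cexp z.
Proof.
move=> e e0; have p0 : 0 < expR (complex.Re z + 1) by exact: expR_gt0.
exists (Num.min 1 (e / expR (complex.Re z + 1))) => [|h]; first by rewrite lt_min ltr01 divr_gt0.
rewrite lt_min ltr_pdivlMr // => /andP[h1 h2].
have := @cder_mvt _ (fun s => cexp (z + s%:C * h)) (fun s => cexp (z + s%:C * h) * h) e.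
rewrite mul1r !mul0r addr0; apply=> t /andP[t0 t1]; first exact: cder_cexp.
apply: le_trans (ltW h2); rewrite normcM mulrC ler_wpM2l ?normc_ge0 // normc_cexp ler_expR ReD lerD2l.
apply: le_trans (ler_norm _) _; apply: le_trans (Re_le_normc _) _; rewrite normcM normc_real ger0_norm //.
by rewrite -[1]mulr1; apply: ler_pM => //; rewrite ?normc_ge0 // ltW.
Qed.

Lemma cdiff_cexp z : cdiff cexp z (cexp z).
Proof.
move=> e e0; have [r r0 H] := cont_cexp z e0; exists r => // h hr.
have := @cder_mvt _ (fun s => cexp (z + s%:C * h) - s%:C * (cexp z * h)) (fun s => (cexp (z + s%:C * h) - cexp z) * h) (e * normc h).
rewrite mul1r !mul0r addr0 subr0 mul1r.
have -> : cexp (z + h) - cexp z - cexp z * h = cexp (z + h) - cexp z * h - cexp z by ring.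
apply=> t /andP[t0 t1].
  by rewrite mulrBl; apply: cder_id_affine_sub; exact: cder_cexp.
rewrite normcM ler_wpM2r ?normc_ge0 // H // normcM normc_real ger0_norm //.
by apply: le_lt_trans hr; rewrite ler_piMl ?normc_ge0.
Qed.

End ComplexExponential.

Section CauchyEstimate.
Context {R : realType}.
Local Notation C := R[i].
Implicit Types (phi : C -> C) (z w h d : C).

(* In the coordinate w = log (h), a primitive Psi of (phi (z0 + e^w) - phi z0) e^-w
   has Psi (w + 2 pi i) - Psi w constant; its limit as Re w -> -oo is 2 pi i phi'(z0). *)
Lemma cauchy_estimate phi z0 (r M : R) d : 0 < r ->
  (forall h, normc h <= r -> (exists d', cdiff phi (z0 + h) d') /\ normc (phi (z0 + h)) <= M) ->
  cdiff phi z0 d -> normc d * r <= 2 * M.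
Proof.
move=> r0 phiH phid.
pose psi h := phi (z0 + h) - phi z0.
have psiM h : normc h <= r -> normc (psi h) <= 2 * M.
  move=> hr; apply: le_trans (normcD _ _) _; rewrite normc_oppr.
  have [_ h1] := phiH _ hr; have [|_] := phiH 0; first by rewrite normc0 ltW.
  by rewrite addr0; lra.
have psid h : normc h <= r -> exists d', cdiff psi h d'.
  move=> hr; have [[d' fd'] _] := phiH _ hr; exists d'.
  rewrite -[d']subr0; apply: cdiffB; last exact: cdiff_cst.
  by under eq_fun do rewrite addrC; apply: cdiff_translate; rewrite addrC.
suff H (rho e : R) : 0 < rho < r -> 0 < e -> normc d <= 2 * M / rho + e.
  apply/ler_addgt0Pr => e e0.
  have H2 rho : 0 < rho < r -> normc d * rho <= 2 * M.
    move=> /[dup] rr /andP[rho0 _]; rewrite -ler_pdivlMr //.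
    by apply/ler_addgt0Pr => e' e'0; exact: H.
  have d1 : 0 < normc d + 1 by rewrite ltr_wpDl ?normc_ge0.
  (* Close enough to r for |d| (r - rho) <= e. *)
  pose rho := Num.max (r / 2) (r - e / (normc d + 1)).
  have rr : 0 < rho < r.
    by rewrite lt_max divr_gt0 //= gt_max ltr_pdivrMr // ltr_pMr // ltr1n ltrBlDr ltrDl divr_gt0.
  have := H2 _ rr; have : r - e / (normc d + 1) <= rho by rewrite /rho le_max lexx orbT.
  have : normc d * (e / (normc d + 1)) <= e.
    by rewrite mulrA ler_pdivrMr // mulrDr mulr1 [e * _]mulrC lerDl ltW.
  by have := normc_ge0 d; nra.
move=> /andP[rho0 rhor] e0.
have [delta delta0 Hd] := phid e e0.
(* On the circle of radius m < delta the quotient psi h / h differs from d by at most e; on that of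
   radius rho it is at most 2 M / rho. *)
pose m := Num.min rho delta / 2.
have m0 : 0 < m by rewrite divr_gt0 // lt_min rho0 delta0.
have mrho : m < rho.
  by rewrite /m ltr_pdivrMr //; apply: le_lt_trans (_ : rho < _); rewrite ?ge_min ?lexx // ltr_pMr // ltr1n.
have mdelta : m < delta.
  by rewrite /m ltr_pdivrMr //; apply: le_lt_trans (_ : delta < _); rewrite ?ge_min ?lexx ?orbT // ltr_pMr // ltr1n.
pose X := ln m; pose Y := ln rho; pose L := ln r; pose T : R := pi *+ 2.
have T0 : 0 < T by rewrite /T pmulrn_lgt0 // pi_gt0.
have XY : X < Y by rewrite ltr_ln ?posrE.
have YL : Y < L by rewrite ltr_ln ?posrE.
pose chi w := psi (cexp w) * cexp (- w).
(* [primitive] differentiates only inside the rectangle, hence the margins around X <= Re w <= Y, 0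
   <= Im w <= T. The side Re w = log r keeps e^w in the disc. *)
have chid w : crect (X - 1) L (-1) (T + 1) w -> exists d', cdiff chi w d'.
  move=> /andP[/andP[_ wL] _].
  have [|d' fd'] := psid (cexp w).
    by rewrite normc_cexp -[r](@lnK _ r) ?posrE // ler_expR.
  exists (d' * cexp w * cexp (- w) + psi (cexp w) * (cexp (- w) * -1)).
  apply: cdiffM; first by apply: cdiff_comp => //; exact: cdiff_cexp.
  apply: (@cdiff_comp _ cexp (fun w => - w)); first exact: cdiff_cexp.
  by apply: cdiffN; exact: cdiff_id.
have [Psi HPsi] := primitive chid.
have PsiI (x t : R) : X <= x <= Y -> 0 <= t <= T -> cdiff Psi (x +i* t) (chi (x +i* t)).
  by move=> /andP[? ?] /andP[? ?]; apply: HPsi => /=; apply/andP; split; lra.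
have segr (x y t : R) : seg (x%:C) (y%:C) t = (x + t * (y - x))%:C by rewrite /seg rcD rcM rcB.
(* chi has the period 2 pi i, so Psi (w + 2 pi i) - Psi w has derivative 0: the integrals over both
   circles agree. *)
have E1 : Psi (Y +i* T) - Psi Y%:C = Psi (X +i* T) - Psi X%:C.
  pose f u := Psi (u + 0 +i* T) - Psi u.
  have sI t : 0 <= t <= 1 -> X <= X + t * (Y - X) <= Y by move=> /andP[? ?]; apply/andP; split; nra.
  have := @cdiff_mvt _ f (fun u => chi (u + 0 +i* T) - chi u) X%:C Y%:C 0 0.
  rewrite !mul0r subr0 => K.
  have : normc (f Y%:C - f X%:C) <= 0.
    apply: K => t t01; rewrite segr.
      apply: cdiffB; last by apply: PsiI; [exact: sI|rewrite lexx ltW].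
      apply: cdiff_translate; rewrite (_ : _ + _ = (X + t * (Y - X)) +i* T); last by apply: eqC => /=; ring.
      by apply: PsiI; [exact: sI|rewrite lexx ltW].
    rewrite /chi opprD !cexp_periodic subr0.
    suff -> : cexp (- (X + t * (Y - X))%:C - 0 +i* T) = cexp (- (X + t * (Y - X))%:C) by rewrite subrr normc0.
    by rewrite -[LHS]cexp_periodic -/T; congr cexp; apply: eqC => /=; ring.
  rewrite le_eqVlt ltNge normc_ge0 orbF normc_eq0 subr_eq0 /f => /eqP.
  have a0 (x : R) : x%:C + 0 +i* T = x +i* T by apply: eqC => /=; ring.
  by rewrite !a0.
have segi (x t : R) : seg (x%:C) (x +i* T) t = x +i* (t * T) by apply: eqC => /=; ring.
have TT (x : R) : x +i* T - x%:C = 0 +i* T by apply: eqC => /=; ring.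
have nT : normc (0 +i* T) = T by rewrite /= expr0n add0r sqrtr_sqr ger0_norm // ltW.
have tT t : 0 <= t <= 1 -> 0 <= t * T <= T by move=> /andP[? ?]; apply/andP; split; nra.
have B1 : normc (Psi (Y +i* T) - Psi Y%:C) <= 2 * M / rho * T.
  have := @cdiff_mvt _ Psi chi Y%:C (Y +i* T) 0 (2 * M / rho); rewrite mul0r subr0 TT nT; apply=> t t01.
    by rewrite segi; apply: PsiI; [rewrite lexx ltW|exact: tT].
  rewrite segi subr0 normcM; apply: ler_pM; rewrite ?normc_ge0 //.
    by apply: psiM; rewrite normc_cexp /= lnK ?posrE // ltW.
  by rewrite normc_cexp ReN /= expRN lnK ?posrE.
have B2 : normc (Psi (X +i* T) - Psi X%:C - d * (0 +i* T)) <= e * T.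
  have := @cdiff_mvt _ Psi chi X%:C (X +i* T) d e; rewrite TT nT; apply=> t t01.
    by rewrite segi; apply: PsiI; [rewrite lexx ltW|exact: tT].
  rewrite segi; set w := X +i* _.
  have -> : chi w - d = (psi (cexp w) - d * cexp w) * cexp (- w).
    by rewrite mulrBl -mulrA cexpN mulr1.
  have ne : normc (cexp w) = m by rewrite normc_cexp /= lnK ?posrE.
  have := Hd (cexp w); rewrite ne => /(_ mdelta) h1.
  rewrite normcM normc_cexp ReN /= expRN lnK ?posrE //.
  by rewrite ler_pdivrMr.
have : normc (d * (0 +i* T)) <= 2 * M / rho * T + e * T.
  rewrite E1 in B1; rewrite normcB in B2.
  have := normcD (d * (0 +i* T) - (Psi (X +i* T) - Psi X%:C)) (Psi (X +i* T) - Psi X%:C).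
  by rewrite subrK => /le_trans; apply; rewrite [X in _ <= X]addrC; exact: lerD B2 B1.
by rewrite normcM nT -mulrDl ler_pM2r.
Qed.

End CauchyEstimate.

(** * Square-summable sequences and holomorphic maps into them *)

Section SquareSummable.
Context {R : realType}.
Local Notation C := R[i].
Implicit Types (u v w : nat -> C) (c : C) (N : nat) (a b : nat -> R).

Definition psum v N : R := \sum_(k < N) normc (v k) ^+ 2.

Lemma psumE v : series (fun k => normc (v k) ^+ 2) = psum v.
Proof. by apply/funext => N; rewrite /series /= big_mkord. Qed.

Lemma psum_nd v : nondecreasing_seq (psum v).
Proof.
by apply/nondecreasing_seqP => N; rewrite /psum big_ord_recr /= lerDl sqr_ge0.
Qed.

Lemma psum_ge0 v N : 0 <= psum v N.
Proof. by apply: sumr_ge0 => k _; rewrite sqr_ge0. Qed.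

Lemma psum_le v N : l2 v -> psum v N <= l2normsq v.
Proof. by rewrite /l2 /l2normsq psumE => cv; exact: nondecreasing_cvgn_le (@psum_nd v) cv N. Qed.

Lemma l2_bounded v (B : R) : (forall N, psum v N <= B) -> l2 v /\ l2normsq v <= B.
Proof.
move=> vB; have cv : cvgn (psum v).
  apply: nondecreasing_is_cvgn; first exact: psum_nd.
  by exists B => _ [N _ <-].
rewrite /l2 /l2normsq psumE; split=> //.
by apply: limr_le => //; exact: nearW.
Qed.

Lemma l2normsq_ge0 v : l2 v -> 0 <= l2normsq v.
Proof. by move=> /(psum_le 0); rewrite /psum big_ord0. Qed.

Definition summ a : Prop := cvgn (series a).
Definition rsum a : R := limn (series a).

Lemma summD a b : summ a -> summ b -> summ (fun k => a k + b k).
Proof. exact: is_cvg_seriesD. Qed.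
Lemma summZ (x : R) a : summ a -> summ (fun k => x * a k).
Proof. exact: is_cvg_seriesZ. Qed.
Lemma rsumD a b : summ a -> summ b -> rsum (fun k => a k + b k) = rsum a + rsum b.
Proof. exact: lim_seriesD. Qed.
Lemma rsumZ (x : R) a : summ a -> rsum (fun k => x * a k) = x * rsum a.
Proof. exact: lim_seriesZ. Qed.
Lemma summ_abs a b : (forall k, `|a k| <= b k) -> summ b -> summ a.
Proof.
move=> ab sb; apply: normed_cvg; apply: series_le_cvg sb => k //=.
exact: le_trans (normr_ge0 _) (ab k).
Qed.
Lemma summ0 : summ (fun=> 0).
Proof.
rewrite /summ; have -> : series (fun=> 0) = cst 0 :> (nat -> R) by apply/funext => N; rewrite /series /= big1.
exact: is_cvg_cst.
Qed.
Lemma rsum0 : rsum (fun=> 0) = 0.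
Proof.
rewrite /rsum; have -> : series (fun=> 0) = cst 0 :> (nat -> R) by apply/funext => N; rewrite /series /= big1.
exact: lim_cst.
Qed.

Definition ip u v : C := rsum (fun k => complex.Re (u k * (v k)^*)) +i* rsum (fun k => complex.Im (u k * (v k)^*)).

Lemma ip_bound u v k : normc (u k * (v k)^*) <= normc (u k) ^+ 2 + normc (v k) ^+ 2.
Proof.
rewrite normcM normc_conj; have := normc_ge0 (u k); have := normc_ge0 (v k).
by have := sqr_ge0 (normc (u k) - normc (v k)); nra.
Qed.

Lemma ip_summ u v : l2 u -> l2 v -> summ (fun k => complex.Re (u k * (v k)^*)) /\ summ (fun k => complex.Im (u k * (v k)^*)).
Proof.
move=> lu lv; split.
  apply: summ_abs (summD lu lv) => k; exact: le_trans (Re_le_normc _) (ip_bound _ _ _).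
apply: summ_abs (summD lu lv) => k; exact: le_trans (Im_le_normc _) (ip_bound _ _ _).
Qed.

Lemma l2D u v : l2 u -> l2 v -> l2 (fun k => u k + v k).
Proof.
move=> lu lv; have h := @summZ 2 _ (summD lu lv).
apply: summ_abs h => k; rewrite ger0_norm ?sqr_ge0 //.
apply: le_trans (_ : (normc (u k) + normc (v k)) ^+ 2 <= _).
  by rewrite ler_pXn2r ?nnegrE ?addr_ge0 ?normc_ge0 // normcD.
by have := sqr_ge0 (normc (u k) - normc (v k)); nra.
Qed.

Lemma l2Z c u : l2 u -> l2 (fun k => c * u k).
Proof.
move=> lu; rewrite /l2; have -> : (fun k => normc (c * u k) ^+ 2) = (fun k => normc c ^+ 2 * normc (u k) ^+ 2).
  by apply/funext => k; rewrite normcM exprMn.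
exact: summZ.
Qed.

Lemma l2N u : l2 u -> l2 (fun k => - u k).
Proof. by move=> lu; have := @l2Z (-1) u lu; under eq_fun do rewrite mulN1r. Qed.

Lemma l2B u v : l2 u -> l2 v -> l2 (fun k => u k - v k).
Proof. by move=> lu lv; apply: l2D => //; exact: l2N. Qed.

Lemma l2_0 : l2 (fun=> 0 : C).
Proof. by rewrite /l2; under eq_fun do rewrite normc0 expr0n; exact: summ0. Qed.

Lemma l2_sum (I : Type) (r : seq I) (F : I -> nat -> C) : (forall i, l2 (F i)) ->
  l2 (fun k => \sum_(i <- r) F i k).
Proof.
move=> lF; elim: r => [|i r IH]; first by under eq_fun do rewrite big_nil; exact: l2_0.
by under eq_fun do rewrite big_cons; exact: l2D.
Qed.

Lemma ipDl u v w : l2 u -> l2 v -> l2 w -> ip (fun k => u k + v k) w = ip u w + ip v w.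
Proof.
move=> lu lv lw; have [u1 u2] := ip_summ lu lw; have [v1 v2] := ip_summ lv lw.
apply: eqC => /=; rewrite -rsumD //; congr rsum; apply/funext => k; by rewrite mulrDl ?ReD ?ImD.
Qed.

Lemma ipZl c u w : l2 u -> l2 w -> ip (fun k => c * u k) w = c * ip u w.
Proof.
move=> lu lw; have [u1 u2] := ip_summ lu lw.
case: c => a b; apply: eqC => /=.
  rewrite -mulNr -(rsumZ a u1) -(rsumZ (- b) u2) -rsumD; [|exact: summZ|exact: summZ].
  congr rsum; apply/funext => k; case: (u k) (w k) => ? ? [? ?] /=; ring.
rewrite -(rsumZ a u2) -(rsumZ b u1) -rsumD; [|exact: summZ|exact: summZ].

congr rsum; apply/funext => k; case: (u k) (w k) => ? ? [? ?] /=; ring.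
Qed.

Lemma ipC u v : l2 u -> l2 v -> ip v u = (ip u v)^*.
Proof.
move=> lu lv; have [u1 u2] := ip_summ lu lv.
have J (a b : R) : (a +i* b)^* = a +i* (- b) by [].
rewrite J; apply: eqC => /=.
  by congr rsum; apply/funext => k; case: (u k) (v k) => ? ? [? ?] /=; ring.
rewrite -mulN1r -rsumZ //; congr rsum; apply/funext => k; case: (u k) (v k) => ? ? [? ?] /=; ring.
Qed.

Lemma ip_sq u : l2 u -> ip u u = (l2normsq u)%:C.
Proof.
move=> lu; have E k : u k * (u k)^* = (normc (u k) ^+ 2)%:C by rewrite normc_sqrC.
apply: eqC => /=; first by congr rsum; apply/funext => k; rewrite E.
by rewrite -[RHS]rsum0; congr rsum; apply/funext => k; rewrite E.
Qed.

Lemma ipDr u v w : l2 u -> l2 v -> l2 w -> ip w (fun k => u k + v k) = ip w u + ip w v.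
Proof. by move=> lu lv lw; rewrite ipC ?ipDl ?cjD -?ipC //; exact: l2D. Qed.

Lemma ipZr c u w : l2 u -> l2 w -> ip w (fun k => c * u k) = c^* * ip w u.
Proof. by move=> lu lw; rewrite ipC ?ipZl ?cjM -?ipC //; exact: l2Z. Qed.

Definition nrm u : R := Num.sqrt (l2normsq u).

Lemma nrm_ge0 u : 0 <= nrm u. Proof. exact: sqrtr_ge0. Qed.
Lemma nrm_sq u : l2 u -> nrm u ^+ 2 = l2normsq u.
Proof. by move=> /l2normsq_ge0; exact: sqr_sqrtr. Qed.

Lemma nrm_le u (B : R) : l2 u -> 0 <= B -> (nrm u <= B) = (l2normsq u <= B ^+ 2).
Proof. by move=> lu B0; rewrite -nrm_sq // ler_pXn2r ?nnegrE ?nrm_ge0. Qed.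

Lemma nrm_coord u k : l2 u -> normc (u k) <= nrm u.
Proof.
move=> lu; rewrite -(@ler_pXn2r _ 2) ?nnegrE ?normc_ge0 ?nrm_ge0 // nrm_sq //.
by apply: le_trans (psum_le k.+1 lu); rewrite /psum big_ord_recr /= lerDr psum_ge0.
Qed.

Lemma l2_eq0 u : l2 u -> l2normsq u <= 0 -> u = fun=> 0.
Proof.
move=> lu u0; apply/funext => k; apply/eqP; rewrite -normc_eq0 eq_le normc_ge0 andbT.
apply: le_trans (nrm_coord k lu) _; rewrite /nrm; by rewrite ler0_sqrtr.
Qed.

Lemma l2normsq_lin c u v : l2 u -> l2 v ->
  (l2normsq (fun k => u k + c * v k))%:C = (l2normsq u)%:C + c * (ip u v)^* + c^* * ip u v + c * c^* * (l2normsq v)%:C.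
Proof.
move=> lu lv; have lc := @l2Z c _ lv; rewrite -!ip_sq //; last exact: l2D.
rewrite ipDl ?ipDr ?ipZl ?ipZr //; try exact: l2D.
rewrite -(ipC lu lv); move: (ip u u) (ip v u) (ip u v) (ip v v) => *; ring.
Qed.

Lemma cauchy_schwarz u v : l2 u -> l2 v -> normc (ip u v) <= nrm u * nrm v.
Proof.
move=> lu lv; have [v0|v0] := leP (l2normsq v) 0.
  have -> : ip u v = 0.
    rewrite (l2_eq0 lv v0) -[X in ip u X](_ : (fun k => 0 * u k) = _); last by apply/funext => k; rewrite mul0r.
    by rewrite ipZr // rmorph0 mul0r.
  by rewrite normc0 mulr_ge0 ?nrm_ge0.
(* The coefficient that minimizes |u + c v|. *)
pose V := l2normsq v; pose c : C := - (ip u v / V%:C).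
have lc : l2 (fun k => u k + c * v k) by apply: l2D => //; exact: l2Z.
have H : 0 <= l2normsq (fun k => u k + c * v k) := l2normsq_ge0 lc.
have E : l2normsq (fun k => u k + c * v k) = l2normsq u - normc (ip u v) ^+ 2 / V.
  apply/(@complexI R); rewrite l2normsq_lin // rcB rcM rcV normc_sqrC /c cjN cjM cjV conjRC -/V.
  have : V%:C != 0 :> C by rewrite rc_eq0 gt_eqF.
  by move: (ip u v)^* (ip u v) V%:C => *; field.
rewrite E subr_ge0 ler_pdivrMr // /V -(nrm_sq lu) -(nrm_sq lv) -exprMn in H.
by rewrite -(@ler_pXn2r _ 2) ?nnegrE ?normc_ge0 ?mulr_ge0 ?nrm_ge0.
Qed.

Lemma nrmD u v : l2 u -> l2 v -> nrm (fun k => u k + v k) <= nrm u + nrm v.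
Proof.
move=> lu lv; rewrite nrm_le ?addr_ge0 ?nrm_ge0 //; last exact: l2D.
have := l2normsq_lin 1 lu lv; have -> : (fun k => u k + 1 * v k) = (fun k => u k + v k) by apply/funext => k; rewrite mul1r.
rewrite conjC1 !mul1r; move: (cauchy_schwarz lu lv); move: (ip u v) => q cs E.
have := congr1 (@complex.Re R) E.
have RC (x : R) : complex.Re (x%:C) = x by [].
rewrite !ReD ReJ !RC => ->; have := le_trans (ler_norm _) (le_trans (Re_le_normc q) cs).
by rewrite -(nrm_sq lu) -(nrm_sq lv); move: (complex.Re q) (nrm u) (nrm v) => *; lra.
Qed.

Lemma nrmZ c u : l2 u -> nrm (fun k => c * u k) = normc c * nrm u.
Proof.
move=> lu; rewrite /nrm.
have -> : l2normsq (fun k => c * u k) = normc c ^+ 2 * l2normsq u.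
  rewrite -[RHS]rsumZ //; congr rsum; apply/funext => k; by rewrite normcM exprMn.
by rewrite sqrtrM ?sqr_ge0 // sqrtr_sqr ger0_norm // normc_ge0.
Qed.

(** Testing with l = u. This is how estimates for scalar linear combinations become estimates in l^2
    that are uniform in N. *)
Lemma nrm_le_dual u N (B : R) : 0 <= B ->
  (forall l : nat -> C, normc (\sum_(k < N) (l k)^* * u k) <= B * Num.sqrt (psum l N)) -> psum u N <= B ^+ 2.
Proof.
move=> B0 /(_ u); have -> : \sum_(k < N) (u k)^* * u k = (psum u N)%:C.
  by rewrite /psum rc_sum; apply: eq_bigr => k _; rewrite normc_sqrC mulrC.
rewrite normc_real ger0_norm ?psum_ge0 //; set s := psum u N => H.
have s0 : 0 <= s := psum_ge0 u N.
have [->|sn] := eqVneq s 0; first by rewrite sqr_ge0.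
have q0 : 0 < Num.sqrt s by rewrite sqrtr_gt0 lt0r sn.
have qB : Num.sqrt s <= B by rewrite -(ler_pM2r q0) -expr2 sqr_sqrtr.
by rewrite -(sqr_sqrtr s0) ler_pXn2r ?nnegrE // ltW.
Qed.

End SquareSummable.

(** Lagrange's identity: twice the difference of the two sides is a sum of squares. *)
Lemma finite_cauchy_schwarz {R : realFieldType} (I : finType) (a b : I -> R) :
  (\sum_i a i * b i) ^+ 2 <= (\sum_i a i ^+ 2) * (\sum_i b i ^+ 2).
Proof.
have : 0 <= \sum_i \sum_j (a i * b j - a j * b i) ^+ 2.
  by apply: sumr_ge0 => i _; apply: sumr_ge0 => j _; rewrite sqr_ge0.
have -> : \sum_i \sum_j (a i * b j - a j * b i) ^+ 2 =
  2 * ((\sum_i a i ^+ 2) * (\sum_i b i ^+ 2) - (\sum_i a i * b i) ^+ 2).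
  have E : 2 * ((\sum_i a i ^+ 2) * (\sum_i b i ^+ 2) - (\sum_i a i * b i) ^+ 2) =
   (\sum_i a i ^+ 2) * (\sum_j b j ^+ 2) + (\sum_i b i ^+ 2) * (\sum_j a j ^+ 2) - 2 * ((\sum_i a i * b i) * (\sum_j a j * b j)) by ring.
  rewrite E !big_distrlr /= mulr_sumr -big_split /= -sumrB; apply: eq_bigr => i _.
  rewrite mulr_sumr -big_split /= -sumrB; apply: eq_bigr => j _; ring.
by rewrite pmulr_rge0 // subr_ge0.
Qed.

Section ComplexSpaceNorm.
Context {R : realType} {n : nat}.
Local Notation C := R[i].
Local Notation Cn := 'rV[C]_n.
Implicit Types (h k z w v : Cn) (c : C) (j : 'I_n).

Definition nv h : R := Num.sqrt (sqnorm h).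

Lemma sqnorm_ge0 h : 0 <= sqnorm h.
Proof. by apply: sumr_ge0 => j _; rewrite sqr_ge0. Qed.
Lemma nv_ge0 h : 0 <= nv h. Proof. exact: sqrtr_ge0. Qed.
Lemma nv_sq h : nv h ^+ 2 = sqnorm h. Proof. by rewrite sqr_sqrtr // sqnorm_ge0. Qed.

Lemma nvZ c h : nv (c *: h) = normc c * nv h.
Proof.
rewrite /nv; have -> : sqnorm (c *: h) = normc c ^+ 2 * sqnorm h.
  by rewrite /sqnorm mulr_sumr; apply: eq_bigr => j _; rewrite mxE normcM exprMn.
by rewrite sqrtrM ?sqr_ge0 // sqrtr_sqr ger0_norm // normc_ge0.
Qed.

Lemma nvZr (t : R) h : 0 <= t -> nv (t%:C *: h) = t * nv h.
Proof. by move=> t0; rewrite nvZ normc_real ger0_norm. Qed.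

Lemma nv_seg k (t : R) : 0 <= t -> t <= 1 -> nv (t%:C *: k) <= nv k.
Proof. by move=> t0 t1; rewrite nvZr // ler_piMl // nv_ge0. Qed.

Lemma nv0 : nv (0 : Cn) = 0.
Proof. by rewrite -(scale0r (0 : Cn)) nvZ normc0 mul0r. Qed.

Lemma nvD h k : nv (h + k) <= nv h + nv k.
Proof.
rewrite -(@ler_pXn2r _ 2) ?nnegrE ?addr_ge0 ?nv_ge0 // nv_sq.
have cs : \sum_j normc (h 0 j) * normc (k 0 j) <= nv h * nv k.
  rewrite -(@ler_pXn2r _ 2) ?nnegrE ?mulr_ge0 ?nv_ge0 //; last first.
    by apply: sumr_ge0 => j _; rewrite mulr_ge0 ?normc_ge0.
  by rewrite exprMn !nv_sq; exact: finite_cauchy_schwarz.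
apply: le_trans (_ : sqnorm h + 2 * (\sum_j normc (h 0 j) * normc (k 0 j)) + sqnorm k <= _); last first.
  by rewrite -!nv_sq; move: cs; lra.
rewrite mulr_sumr -!big_split /=; apply: ler_sum => j _; rewrite mxE.
have := normcD (h 0 j) (k 0 j); have := normc_ge0 (h 0 j + k 0 j).
by have := normc_ge0 (h 0 j); have := normc_ge0 (k 0 j); nra.
Qed.

Lemma nv_coord h j : normc (h 0 j) <= nv h.
Proof.
rewrite -(@ler_pXn2r _ 2) ?nnegrE ?normc_ge0 ?nv_ge0 // nv_sq /sqnorm (bigD1 j) //= lerDl.
by apply: sumr_ge0 => i _; rewrite sqr_ge0.
Qed.

Lemma nv_eq0 h : nv h = 0 -> h = 0.
Proof.
move=> h0; apply/rowP => j; rewrite mxE; apply/eqP; rewrite -normc_eq0 eq_le normc_ge0 andbT.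
by rewrite -h0 nv_coord.
Qed.

Lemma nv_ebase j : nv (ebase j : Cn) = 1.
Proof.
rewrite /nv /sqnorm (bigD1 j) //= big1 => [|i ij].
  by rewrite ebaseE eqxx normc_real normr1 expr1n addr0 sqrtr1.
by rewrite ebaseE eq_sym (negPf ij) normc0 expr0n.
Qed.

Lemma nv_le_sum h : nv h <= \sum_j normc (h 0 j).
Proof.
rewrite -(@ler_pXn2r _ 2) ?nnegrE ?nv_ge0 //; last by apply: sumr_ge0 => j _; exact: normc_ge0.
rewrite nv_sq expr2 mulr_suml; apply: ler_sum => j _; rewrite expr2 ler_wpM2l ?normc_ge0 //.
by rewrite (bigD1 j) //= lerDl; apply: sumr_ge0 => i _; exact: normc_ge0.
Qed.

Lemma nbhs_nvP z (P : set Cn) : nbhs z P <-> exists2 t : R, 0 < t & forall h, nv h < t -> P (z + h).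
Proof.
rewrite nbhsCnP; split=> [[e e0 H]|[t t0 H]].
  exists e => // h ht; apply: H => j; rewrite !mxE addrAC subrr add0r.
  exact: le_lt_trans (nv_coord h j) ht.
(* Dividing by n + 1 keeps the sum of n coordinates strictly below t and makes sense for n = 0. *)
have n1 : 0 < (n.+1%:R : R) by rewrite ltr0n.
exists (t / n.+1%:R) => [|w H2]; first by rewrite divr_gt0.
rewrite -(subrK z w) addrC; apply: H; apply: le_lt_trans (nv_le_sum _) _.
apply: le_lt_trans (_ : \sum_(j < n) t / n.+1%:R < _).
  by apply: ler_sum => j _; rewrite !mxE ltW.
have -> : \sum_(j < n) t / n.+1%:R = t / n.+1%:R * n%:R by rewrite sumr_const card_ord mulr_natr.
by rewrite mulrAC ltr_pdivrMr // ltr_pM2l // ltr_nat.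
Qed.

Lemma open_nvP (U : set Cn) z : open U -> U z -> exists2 t : R, 0 < t & forall h, nv h < t -> U (z + h).
Proof. by rewrite openE => oU /oU /nbhs_nvP. Qed.

End ComplexSpaceNorm.

(** * Scalar holomorphic functions of several variables and their second derivatives *)

Section ScalarHolomorphic.
Context {R : realType} {n : nat}.
Local Notation C := R[i].
Local Notation Cn := 'rV[C]_n.
Implicit Types (h k z w v : Cn) (c : C) (j : 'I_n) (phi : Cn -> C) (d : 'I_n -> C).

Definition schol phi z d : Prop := forall e : R, 0 < e -> exists2 t : R, 0 < t &
  forall h, nv h < t -> normc (phi (z + h) - phi z - \sum_j h 0 j * d j) <= e * nv h.

Lemma scholB phi psi z d e : schol phi z d -> schol psi z e ->
  schol (fun w => phi w - psi w) z (fun j => d j - e j).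
Proof.
move=> Hp Hq e' e0; have [s s0 S] := Hp _ (divr_gt0 e0 (ltr0n _ 2)); have [t t0 T] := Hq _ (divr_gt0 e0 (ltr0n _ 2)).
exists (Num.min s t) => [|h]; first by rewrite lt_min s0 t0.
rewrite lt_min => /andP[hs ht]; have -> : \sum_j h 0 j * (d j - e j) = \sum_j h 0 j * d j - \sum_j h 0 j * e j.
  by rewrite -sumrB; apply: eq_bigr => j _; rewrite mulrBr.
have E (a b u v x y : C) : a - b - (u - v) - (x - y) = (a - u - x) - (b - v - y) by ring.
rewrite E; apply: le_trans (normcD _ _) _; rewrite normc_oppr [e']splitr mulrDl; apply: lerD; [exact: S|exact: T].
Qed.

Lemma scholZ phi z d c : schol phi z d -> schol (fun w => c * phi w) z (fun j => c * d j).
Proof.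
move=> Hp e e0; have c1 : 0 < normc c + 1 by rewrite ltr_wpDl ?normc_ge0.
have [s s0 S] := Hp _ (divr_gt0 e0 c1); exists s => // h /S H.
have -> : \sum_j h 0 j * (c * d j) = c * \sum_j h 0 j * d j.
  by rewrite mulr_sumr; apply: eq_bigr => j _; rewrite mulrCA.
rewrite -!mulrBr normcM; apply: le_trans (ler_wpM2l (normc_ge0 _) H) _.
by rewrite mulrA ler_wpM2r ?nv_ge0 // mulrA ler_pdivrMr // mulrC ler_wpM2l ?lerDl // ltW.
Qed.

Lemma schol_shift phi z k d : schol phi (z + k) d -> schol (fun w => phi (w + k)) z d.
Proof.
by move=> Hp e e0; have [s s0 S] := Hp e e0; exists s => // h /S; rewrite (addrAC z h k).
Qed.

Lemma schol_line phi z v (c : C) d : schol phi (z + c *: v) d ->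
  cdiff (fun t : C => phi (z + t *: v)) c (\sum_j v 0 j * d j).
Proof.
move=> Hp e e0; have v1 : 0 < nv v + 1 by rewrite ltr_wpDl ?nv_ge0.
have [s s0 S] := Hp _ (divr_gt0 e0 v1); exists (s / (nv v + 1)) => [|t]; first by rewrite divr_gt0.
rewrite ltr_pdivlMr // => ts; have tv : nv (t *: v) < s.
  by rewrite nvZ; apply: le_lt_trans ts; rewrite ler_wpM2l ?normc_ge0 // lerDl.
have := S _ tv; rewrite scalerDl addrA.
have -> : \sum_j (t *: v) 0 j * d j = (\sum_j v 0 j * d j) * t.
  by rewrite mulr_suml; apply: eq_bigr => j _; rewrite mxE; ring.
move=> /le_trans; apply; rewrite nvZ mulrCA mulrC ler_wpM2r ?normc_ge0 //.
by rewrite mulrAC ler_pdivrMr // ler_wpM2l ?lerDl // ltW.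
Qed.

Lemma schol_cder phi z k (t : R) d : schol phi (z + t%:C *: k) d ->
  cder (fun s : R => phi (z + s%:C *: k)) t (\sum_j k 0 j * d j).
Proof.
move=> /schol_line H; rewrite -[X in cder _ _ X]mulr1.
apply: (@cdiff_cder _ (fun c => phi (z + c *: k)) (fun s => s%:C)) => //.
by have := cder_affine 0 1 t; under eq_fun do rewrite add0r mulr1.
Qed.

(** [cauchy_estimate] on the complex line through z0 in direction v, where the parameter disc has
    radius r / |v|. *)
Lemma schol_estimate (phi : Cn -> C) (delta : Cn -> 'I_n -> C) z0 (r M : R) v : 0 < r ->
  (forall h, nv h <= r -> schol phi (z0 + h) (delta (z0 + h)) /\ normc (phi (z0 + h)) <= M) ->
  normc (\sum_j v 0 j * delta z0 j) * r <= 2 * M * nv v.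
Proof.
move=> r0 H; have [v0|v0] := eqVneq (nv v) 0.
  rewrite v0 mulr0 (nv_eq0 v0) big1 ?normc0 ?mul0r // => j _; by rewrite mxE mul0r.
have vp : 0 < nv v by rewrite lt0r v0 nv_ge0.
have [H0 _] : schol phi (z0 + 0) (delta (z0 + 0)) /\ normc (phi (z0 + 0)) <= M by apply: H; rewrite nv0 ltW.
rewrite addr0 in H0.
have K := @cauchy_estimate R (fun t : C => phi (z0 + t *: v)) 0 (r / nv v) M (\sum_j v 0 j * delta z0 j).
rewrite mulrA ler_pdivrMr // in K; apply: K; first by rewrite divr_gt0.
- move=> t; rewrite add0r ler_pdivlMr // -nvZ => tr; have [h1 h2] := H _ tr; split=> //.
  by exists (\sum_j v 0 j * delta (z0 + t *: v) j); exact: schol_line.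
- by apply: schol_line; rewrite scale0r addr0.
Qed.

Section Ball.
Variables (phi : Cn -> C) (delta : Cn -> 'I_n -> C) (z0 : Cn) (r M : R).
Hypothesis r_gt0 : 0 < r.
Hypothesis H : forall h, nv h <= 4 * r -> schol phi (z0 + h) (delta (z0 + h)) /\ normc (phi (z0 + h)) <= M.

Lemma schol_bound_ge0 : 0 <= M.
Proof. by have [|_] := @H 0; [rewrite nv0 mulr_ge0 // ltW|apply: le_trans; exact: normc_ge0]. Qed.

(** Each use of Cauchy's estimate costs one r of the radius: 4 r for phi, 3 r for its derivative, 2
    r for the Lipschitz bound of the derivative. *)
Lemma schol_deriv_bound h v : nv h <= 3 * r -> normc (\sum_j v 0 j * delta (z0 + h) j) * r <= 2 * M * nv v.
Proof.
move=> h3; apply: schol_estimate => // k kr; rewrite -addrA; apply: H.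
by apply: le_trans (nvD _ _) _; lra.
Qed.

Lemma schol_lip h k : nv h + nv k <= 3 * r -> normc (phi (z0 + h + k) - phi (z0 + h)) * r <= 2 * M * nv k.
Proof.
move=> hk; rewrite -ler_pdivlMr //.
have := @cder_mvt _ (fun s : R => phi (z0 + h + s%:C *: k)) (fun s : R => \sum_j k 0 j * delta (z0 + (h + s%:C *: k)) j) (2 * M * nv k / r).
rewrite scale1r scale0r addr0; apply=> t /andP[t0 t1].
  apply: schol_cder; rewrite -addrA; apply: (H _).1; apply: le_trans (nvD _ _) _.
  by have := nv_seg k t0 t1; have := nv_ge0 h; have := nv_ge0 k; lra.
rewrite ler_pdivlMr //; apply: schol_deriv_bound; apply: le_trans (nvD _ _) _.
by have := nv_seg k t0 t1; have := nv_ge0 h; have := nv_ge0 k; lra.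
Qed.

End Ball.

Section Ball2.
Variables (phi : Cn -> C) (delta : Cn -> 'I_n -> C) (z0 : Cn) (r M : R).
Hypothesis r_gt0 : 0 < r.
Hypothesis H : forall h, nv h <= 4 * r -> schol phi (z0 + h) (delta (z0 + h)) /\ normc (phi (z0 + h)) <= M.

(** The derivative bound, applied to the increment phi (w + k) - phi w, which [schol_lip] bounds by
    a multiple of |k|. *)
Lemma schol_deriv_lip h k v : nv h + nv k <= 2 * r ->
  normc (\sum_j v 0 j * (delta (z0 + h + k) j - delta (z0 + h) j)) * r ^+ 2 <= 4 * M * nv k * nv v.
Proof.
move=> hk.
have := @schol_estimate (fun w => phi (w + k) - phi w) (fun w j => delta (w + k) j - delta w j) (z0 + h) r (2 * M * nv k / r) v r_gt0.
have -> : 2 * (2 * M * nv k / r) * nv v = 4 * M * nv k * nv v / r by field; rewrite gt_eqF.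
move=> K; rewrite expr2 mulrA -ler_pdivlMr //; apply: K => l lr.
have b1 : nv (h + l + k) <= 4 * r.
  have t1 := nvD (h + l) k; have t2 := nvD h l.
  by move: r_gt0 hk lr t1 t2; move: (nv _) (nv _) (nv _) (nv _) (nv _); intros; lra.
have b2 : nv (h + l) + nv k <= 3 * r by have := nvD h l; lra.
have b3 : nv (h + l) <= 4 * r by have := r_gt0; have := nv_ge0 k; lra.
split.
  apply: scholB; last by rewrite -addrA; exact: (H b3).1.
  have E : z0 + h + l + k = z0 + (h + l + k) by rewrite !addrA.
  by apply: (@schol_shift _ _ _ (delta (z0 + h + l + k))); rewrite E; exact: (H b1).1.
by rewrite ler_pdivlMr // -(addrA z0 h l); exact: (schol_lip r_gt0 H).
Qed.

Lemma schol_taylor h k : nv h + nv k <= 2 * r ->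
  normc (phi (z0 + h + k) - phi (z0 + h) - \sum_j k 0 j * delta (z0 + h) j) * r ^+ 2 <= 4 * M * nv k ^+ 2.
Proof.
move=> hk; have r2 : 0 < r ^+ 2 by rewrite exprn_gt0.
rewrite -ler_pdivlMr //.
have := @cder_mvt _ (fun s : R => phi (z0 + h + s%:C *: k) - s%:C * \sum_j k 0 j * delta (z0 + h) j)
   (fun s : R => \sum_j k 0 j * (delta (z0 + h + s%:C *: k) j - delta (z0 + h) j)) (4 * M * nv k ^+ 2 / r ^+ 2).
rewrite scale1r scale0r addr0 mul1r mul0r subr0 addrAC; apply=> t /andP[t0 t1].
  have -> : \sum_j k 0 j * (delta (z0 + h + t%:C *: k) j - delta (z0 + h) j) =
    \sum_j k 0 j * delta (z0 + h + t%:C *: k) j - \sum_j k 0 j * delta (z0 + h) j.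
    by rewrite -sumrB; apply: eq_bigr => j _; rewrite mulrBr.
  apply: cder_id_affine_sub; apply: schol_cder; rewrite -addrA; apply: (H _).1; apply: le_trans (nvD _ _) _.
  by have := nv_seg k t0 t1; have := nv_ge0 h; have := nv_ge0 k; lra.
have M0 : 0 <= M := schol_bound_ge0 r_gt0 H.
rewrite ler_pdivlMr //; apply: le_trans (schol_deriv_lip _ _) _.
  by have := nv_seg k t0 t1; have := nv_ge0 h; have := nv_ge0 k; lra.
rewrite nvZr // expr2 [X in _ <= X]mulrA ler_wpM2r ?nv_ge0 // ler_wpM2l ?mulr_ge0 //.
by rewrite ler_piMl ?nv_ge0.
Qed.

End Ball2.

Section Ball3.
Variables (phi : Cn -> C) (delta : Cn -> 'I_n -> C) (z0 : Cn) (r M : R) (j : 'I_n).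
Hypothesis r_gt0 : 0 < r.
Hypothesis H : forall h, nv h <= 4 * r -> schol phi (z0 + h) (delta (z0 + h)) /\ normc (phi (z0 + h)) <= M.

(** The partial derivative is a uniform limit of difference quotients, which are holomorphic with
    derivative [dquot']. Its own differentiability thus follows from Cauchy's estimates without
    power series. *)
Definition dquot (e : R) w : C := (e^-1)%:C * (phi (w + e%:C *: ebase j) - phi w).
Definition dquot' (e : R) w i : C := (e^-1)%:C * (delta (w + e%:C *: ebase j) i - delta w i).

Let nve (e : R) : 0 < e -> nv (e%:C *: ebase j : Cn) = e.
Proof. by move=> e0; rewrite nvZr ?ltW // nv_ebase mulr1. Qed.

Lemma dquot_schol (e : R) h : 0 < e <= r -> nv h <= 2 * r ->
  schol (dquot e) (z0 + h) (dquot' e (z0 + h)) /\ normc (dquot e (z0 + h)) <= 2 * M / r.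
Proof.
move=> /andP[e0 er] h2; split.
  apply: scholZ; apply: scholB; last by apply: (H _).1; have := nv_ge0 h; lra.
  apply: schol_shift; rewrite -addrA; apply: (H _).1; apply: le_trans (nvD _ _) _; rewrite nve //; lra.
have hk : nv h + nv (e%:C *: ebase j : Cn) <= 3 * r by rewrite nve //; lra.
have := schol_lip r_gt0 H hk; rewrite nve // /dquot normcM normc_real ger0_norm; last by rewrite invr_ge0 ltW.
by move=> K; rewrite ler_pdivlMr // -mulrA mulrC ler_pdivrMr.
Qed.

Lemma dquot_near (e : R) h : 0 < e <= r -> nv h <= r ->
  normc (dquot e (z0 + h) - delta (z0 + h) j) <= 4 * M / r ^+ 2 * e.
Proof.
move=> /andP[e0 er] h2; have r2 : 0 < r ^+ 2 by rewrite exprn_gt0.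
have hk : nv h + nv (e%:C *: ebase j : Cn) <= 2 * r by rewrite nve //; lra.
have := schol_taylor r_gt0 H hk; rewrite nve // -ler_pdivlMr //.
have -> : \sum_i (e%:C *: ebase j : Cn) 0 i * delta (z0 + h) i = e%:C * delta (z0 + h) j.
  rewrite (bigD1 j) //= big1 => [|i ij]; first by rewrite mxE ebaseE eqxx mulr1 addr0.
  by rewrite mxE ebaseE eq_sym (negPf ij) mulr0 mul0r.
have -> : dquot e (z0 + h) - delta (z0 + h) j = (e^-1)%:C * (phi (z0 + h + e%:C *: ebase j) - phi (z0 + h) - e%:C * delta (z0 + h) j).
  rewrite /dquot rcV; have : e%:C != 0 :> C by rewrite rc_eq0 gt_eqF.
  by move: e%:C (phi _) (phi _) => *; field.
rewrite normcM normc_real ger0_norm => [K|]; last by rewrite invr_ge0 ltW.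
rewrite mulrC ler_pdivrMr //; apply: le_trans K _; rewrite le_eqVlt; apply/orP; left; apply/eqP.
by field; rewrite gt_eqF.
Qed.

Lemma partial_taylor (e : R) k : 0 < e <= r -> nv k <= r ->
  normc (delta (z0 + k) j - delta z0 j - \sum_i k 0 i * dquot' e z0 i) <= 32 * M / r ^+ 3 * nv k ^+ 2 + 8 * M / r ^+ 2 * e.
Proof.
move=> er kr.
have r2 : 0 < r / 2 by rewrite divr_gt0.
have H2 h : nv h <= 4 * (r / 2) -> schol (dquot e) (z0 + h) (dquot' e (z0 + h)) /\ normc (dquot e (z0 + h)) <= 2 * M / r.
  by move=> h2; apply: dquot_schol => //; lra.
have hk : nv (0 : Cn) + nv k <= 2 * (r / 2) by rewrite nv0; lra.
have := schol_taylor r2 H2 hk; rewrite addr0 -ler_pdivlMr ?exprn_gt0 //.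
have n1 := dquot_near er kr.
have n2 : normc (dquot e z0 - delta z0 j) <= 4 * M / r ^+ 2 * e.
  by have := @dquot_near e 0 er; rewrite addr0 nv0; apply; rewrite ltW.
have -> : 4 * (2 * M / r) * nv k ^+ 2 / (r / 2) ^+ 2 = 32 * M / r ^+ 3 * nv k ^+ 2 by field; rewrite gt_eqF.
have -> : delta (z0 + k) j - delta z0 j - \sum_i k 0 i * dquot' e z0 i =
  (dquot e (z0 + k) - dquot e z0 - \sum_i k 0 i * dquot' e z0 i) - ((dquot e (z0 + k) - delta (z0 + k) j) - (dquot e z0 - delta z0 j)) by ring.
move=> n3; apply: le_trans (normcD _ _) _; apply: lerD => //; rewrite normc_oppr.
apply: le_trans (normcD _ _) _; rewrite normc_oppr.
have -> : 8 * M / r ^+ 2 * e = 4 * M / r ^+ 2 * e + 4 * M / r ^+ 2 * e by ring.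
exact: lerD.
Qed.

(** Two difference quotients are within O(e + e') of the same partial derivative; Cauchy's estimate
    transfers this to their derivatives. *)
Lemma dquot'_cauchy (e e' : R) i : 0 < e <= r -> 0 < e' <= r ->
  normc (dquot' e z0 i - dquot' e' z0 i) <= 8 * M / r ^+ 3 * (e + e').
Proof.
move=> er er'.
have := @schol_estimate (fun w => dquot e w - dquot e' w) (fun w i => dquot' e w i - dquot' e' w i) z0 r
   (4 * M / r ^+ 2 * (e + e')) (ebase i) r_gt0.
rewrite nv_ebase mulr1 -ler_pdivlMr //.
have -> : \sum_l (ebase i : Cn) 0 l * (dquot' e z0 l - dquot' e' z0 l) = dquot' e z0 i - dquot' e' z0 i.
  rewrite (bigD1 i) //= big1 => [|l ij]; first by rewrite ebaseE eqxx mul1r addr0.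
  by rewrite ebaseE eq_sym (negPf ij) mul0r.
have -> : 2 * (4 * M / r ^+ 2 * (e + e')) / r = 8 * M / r ^+ 3 * (e + e') by field; rewrite gt_eqF.
apply=> h hr; split.
  by apply: scholB; apply: (dquot_schol _ _).1 => //; have := nv_ge0 h; lra.
have -> : dquot e (z0 + h) - dquot e' (z0 + h) = (dquot e (z0 + h) - delta (z0 + h) j) - (dquot e' (z0 + h) - delta (z0 + h) j).
  by move: (dquot e _) (dquot e' _) (delta _ _) => *; ring.
by apply: le_trans (normcD _ _) _; rewrite normc_oppr mulrDr; apply: lerD; exact: dquot_near.
Qed.

End Ball3.

Lemma complex_geometric_limit (x : nat -> C) (D : R) : (forall m, normc (x m.+1 - x m) <= D / 2 ^+ m) ->
  exists l : C, forall m, normc (x m - l) <= 4 * D / 2 ^+ m.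
Proof.
move=> H; have [l1 L1] : exists l : R, forall m, `|complex.Re (x m) - l| <= 2 * D / 2 ^+ m.
  by apply: geometric_limit => m; rewrite -ReN -ReD; apply: le_trans (Re_le_normc _) (H m).
have [l2 L2] : exists l : R, forall m, `|complex.Im (x m) - l| <= 2 * D / 2 ^+ m.
  by apply: geometric_limit => m; rewrite -ImN -ImD; apply: le_trans (Im_le_normc _) (H m).
exists (l1 +i* l2) => m; apply: le_trans (normc_le_ReIm _) _; rewrite ReD ImD ReN ImN /=.
have -> : 4 * D / 2 ^+ m = 2 * D / 2 ^+ m + 2 * D / 2 ^+ m by field; rewrite expf_neq0.
by apply: lerD.
Qed.

(** The limit d2 j i is the candidate for the second derivative. The dyadic rate is kept so that
    finitely many components can pass to the limit together in [partial_taylor]. *)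
Lemma partial_schol (phi : Cn -> C) (delta : Cn -> 'I_n -> C) z0 (r M : R) : 0 < r ->
  (forall h, nv h <= 4 * r -> schol phi (z0 + h) (delta (z0 + h)) /\ normc (phi (z0 + h)) <= M) ->
  exists d2 : 'I_n -> 'I_n -> C, forall i j m,
    normc (dquot' delta j (r / 2 ^+ m) z0 i - d2 j i) <= 64 * M / r ^+ 2 / 2 ^+ m.
Proof.
move=> r0 H.
have ex (j i : 'I_n) : exists l : C, forall m : nat, normc (dquot' delta j (r / 2 ^+ m) z0 i - l) <= 64 * M / r ^+ 2 / 2 ^+ m.
  have e0 (m : nat) : 0 < r / 2 ^+ m <= r.
    by rewrite divr_gt0 ?exprn_gt0 //= ler_pdivrMr ?exprn_gt0 // ler_pMr // exprn_ege1 // ler1n.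
  have st (m : nat) : normc (dquot' delta j (r / 2 ^+ m.+1) z0 i - dquot' delta j (r / 2 ^+ m) z0 i) <= 16 * M / r ^+ 2 / 2 ^+ m.
    apply: le_trans (dquot'_cauchy j r0 H i (e0 _) (e0 _)) _.
    have M0 := schol_bound_ge0 r0 H.
    have -> : 8 * M / r ^+ 3 * (r / 2 ^+ m.+1 + r / 2 ^+ m) = 12 * M / r ^+ 2 / 2 ^+ m.
      have p0 : (2 ^+ m : R) != 0 by rewrite expf_neq0.
      rewrite (exprS _ m); move: (2 ^+ m) p0 => x x0; field; by rewrite x0 gt_eqF.
    by rewrite 2?ler_pM2r ?invr_gt0 ?exprn_gt0 //; lra.
  have [l L] := complex_geometric_limit st; exists l => m; apply: le_trans (L m) _.
  have p0 : (2 ^+ m : R) != 0 by rewrite expf_neq0.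
  by rewrite le_eqVlt; apply/orP; left; apply/eqP; move: (2 ^+ m) p0 => x x0; field; rewrite x0 gt_eqF.
pose d2 j i := xget 0 [set l : C | forall m : nat, normc (dquot' delta j (r / 2 ^+ m) z0 i - l) <= 64 * M / r ^+ 2 / 2 ^+ m].
exists d2 => i j m; rewrite /d2; case: xgetP => [y _ /(_ m) //|].
by have [l L] := ex j i => /(_ l).
Qed.

End ScalarHolomorphic.

Section VectorHolomorphic.
Context {R : realType} {n : nat}.
Local Notation C := R[i].
Local Notation Cn := 'rV[C]_n.
Implicit Types (h z w v : Cn) (c : C) (f : Cn -> nat -> C) (V : set Cn).

Definition l2der f z (d : 'I_n -> nat -> C) : Prop :=
  (forall j, l2 (d j)) /\
  forall e : R, 0 < e -> exists2 t : R, 0 < t & forall h, nv h < t ->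
    l2 (f (z + h)) /\ nrm (fun k => f (z + h) k - f z k - \sum_j h 0 j * d j k) <= e * nv h.

Lemma l2_holomorphicP V f : open V -> l2_holomorphic V f <->
  (forall z, V z -> l2 (f z)) /\ forall z, V z -> exists d, l2der f z d.
Proof.
move=> oV; split=> -[lf H]; split=> // z Vz; have [d [ld D]] := H z Vz; exists d; split=> // e e0.
  have /nbhs_nvP[t t0 T] := D e e0; have [s s0 S] := open_nvP oV Vz.
  exists (Num.min t s) => [|h]; first by rewrite lt_min t0 s0.
  by rewrite lt_min => /andP[/T + /S/lf]; rewrite add0r.
have [t t0 T] := D e e0; apply/nbhs_nvP; exists t => // h /T[_]; by rewrite add0r.
Qed.

Lemma nrm_sum (I : Type) (r : seq I) (F : I -> nat -> C) : (forall i, l2 (F i)) ->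
  nrm (fun k => \sum_(i <- r) F i k) <= \sum_(i <- r) nrm (F i).
Proof.
move=> lF; elim: r => [|i r IH].
  have -> : (fun k : nat => \sum_(i <- [::]) F i k) = (fun k => 0 * (fun=> 0 : C) k).
    by apply/funext => k; rewrite big_nil mul0r.
  by rewrite nrmZ ?big_nil ?normc0 ?mul0r //; exact: l2_0.
have -> : (fun k => \sum_(i <- i :: r) F i k) = (fun k => F i k + \sum_(i <- r) F i k).
  by apply/funext => k; rewrite big_cons.
rewrite big_cons; have /le_trans := nrmD (lF i) (@l2_sum _ _ r _ lF); apply; exact: lerD.
Qed.

Lemma l2der_bound f z d : l2 (f z) -> l2der f z d -> exists r M : R,
  0 < r /\ forall h, nv h <= r -> l2 (f (z + h)) /\ nrm (f (z + h)) <= M.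
Proof.
move=> lf [ld /(_ 1 ltr01)[t t0 T]].
pose K := \sum_j nrm (d j); exists (Num.min (t / 2) 1), (nrm (f z) + K + 1).
split=> [|h]; first by rewrite lt_min divr_gt0 ?ltr01.
rewrite le_min => /andP[ht h1].
have [|lh H] := T h; first by apply: le_lt_trans ht _; rewrite ltr_pdivrMr // ltr_pMr // ltr1n.
split=> //.
have ls : l2 (fun k => \sum_j h 0 j * d j k) by apply: l2_sum => j; exact: l2Z.
have lr : l2 (fun k => f (z + h) k - f z k - \sum_j h 0 j * d j k) by do 2![apply: l2B => //].
have -> : f (z + h) = fun k => f z k + (\sum_j h 0 j * d j k + (f (z + h) k - f z k - \sum_j h 0 j * d j k)).
  by apply/funext => k; ring.
apply: le_trans (nrmD lf _) _; first exact: l2D.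
rewrite -addrA lerD2l; apply: le_trans (nrmD ls lr) _; apply: lerD; last first.
  by apply: le_trans H _; rewrite mul1r.
apply: le_trans (nrm_sum _ _) _ => [j|]; first exact: l2Z.
apply: ler_sum => j _; rewrite nrmZ // ler_piMl ?nrm_ge0 //.
by apply: le_trans (nv_coord h j) h1.
Qed.

Lemma finite_dual_bound (l x : nat -> C) N :
  normc (\sum_(k < N) (l k)^* * x k) <= Num.sqrt (psum l N) * Num.sqrt (psum x N).
Proof.
apply: le_trans (normc_sum _ _ _) _.
rewrite -(@ler_pXn2r _ 2) ?nnegrE ?mulr_ge0 ?sqrtr_ge0 //; last by apply: sumr_ge0 => k _; exact: normc_ge0.
rewrite exprMn !sqr_sqrtr ?psum_ge0 //.
under eq_bigr do rewrite normcM normc_conj.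
exact: finite_cauchy_schwarz.
Qed.

Lemma l2der_dual f z d (l : nat -> C) N : l2 (f z) -> l2der f z d ->
  schol (fun w => \sum_(k < N) (l k)^* * f w k) z (fun j => \sum_(k < N) (l k)^* * d j k).
Proof.
move=> lf [ld D] e e0; pose q := Num.sqrt (psum l N) + 1.
have q0 : 0 < q by rewrite ltr_wpDl ?sqrtr_ge0.
have [t t0 T] := D _ (divr_gt0 e0 q0); exists t => // h /T[lh H].
have ls : l2 (fun k => \sum_j h 0 j * d j k) by apply: l2_sum => j; exact: l2Z.
have lr : l2 (fun k => f (z + h) k - f z k - \sum_j h 0 j * d j k) by do 2![apply: l2B => //].
have -> : \sum_(k < N) (l k)^* * f (z + h) k - \sum_(k < N) (l k)^* * f z k -
    \sum_j h 0 j * (\sum_(k < N) (l k)^* * d j k) =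
  \sum_(k < N) (l k)^* * (f (z + h) k - f z k - \sum_j h 0 j * d j k).
  have -> : \sum_j h 0 j * (\sum_(k < N) (l k)^* * d j k) = \sum_(k < N) (l k)^* * \sum_j h 0 j * d j k.
    rewrite (eq_bigr (fun j => \sum_(k < N) (l k)^* * (h 0 j * d j k))).
      by rewrite exchange_big; apply: eq_bigr => k _; rewrite mulr_sumr.
    by move=> j _; rewrite mulr_sumr; apply: eq_bigr => k _; rewrite mulrCA.
  by rewrite -!sumrB; apply: eq_bigr => k _; rewrite !mulrBr.
apply: le_trans (finite_dual_bound l (fun k => f (z + h) k - f z k - \sum_j h 0 j * d j k) N) _.
apply: le_trans (_ : q * nrm (fun k => f (z + h) k - f z k - \sum_j h 0 j * d j k) <= _).
  apply: ler_pM; rewrite ?sqrtr_ge0 ?lerDl //.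
  by rewrite ler_sqrt ?psum_le // l2normsq_ge0.
apply: le_trans (ler_wpM2l (ltW q0) H) _.
by have -> : q * (e / q * nv h) = e * nv h by field; rewrite gt_eqF.
Qed.

Lemma l2der_coord f z d N : l2 (f z) -> l2der f z d -> schol (fun w => f w N) z (fun j => d j N).
Proof.
move=> lf [ld D] e e0; have [t t0 T] := D _ e0; exists t => // h /T[lh]; apply: le_trans.
have ls : l2 (fun k => \sum_j h 0 j * d j k) by apply: l2_sum => j; exact: l2Z.
have lr : l2 (fun k => f (z + h) k - f z k - \sum_j h 0 j * d j k) by do 2![apply: l2B => //].
exact: (nrm_coord N lr).
Qed.

Lemma le_geometric (a b c : R) : (forall m : nat, a <= b + c / 2 ^+ m) -> a <= b.
Proof.
move=> H; apply/ler_addgt0Pr => e e0; apply: le_trans (H (Num.bound (c / e))) _; rewrite lerD2l.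
by rewrite ler_pdivrMr ?exprn_gt0 // mulrC -ler_pdivrMr // ltW // upper_nthrootP.
Qed.

(** The second derivatives exist in each component. For a finite combination with coefficients l the
    Taylor estimate holds with the bound |l| M, and [nrm_le_dual] turns it into an estimate of the
    remainder in l^2. *)
Lemma l2_partial V f (D : Cn -> 'I_n -> nat -> C) j z0 : open V -> (forall z, V z -> l2 (f z)) ->
  (forall z, V z -> l2der f z (D z)) -> V z0 -> exists d2, l2der (fun w => D w j) z0 d2.
Proof.
move=> oV lf fD Vz0.
have [rb [M [rb0 Hb]]] := l2der_bound (lf _ Vz0) (fD _ Vz0).
have [t t0 Ht] := open_nvP oV Vz0.
pose r := Num.min rb (t / 2) / 4.
have r0 : 0 < r by rewrite divr_gt0 // lt_min rb0 divr_gt0.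
have r4 h : nv h <= 4 * r -> V (z0 + h) /\ nrm (f (z0 + h)) <= M.
  have -> : 4 * r = Num.min rb (t / 2) by rewrite /r mulrC divfK ?pnatr_eq0.
  rewrite le_min => /andP[h1 h2]; split; last exact: (Hb _ h1).2.
  by apply: Ht; apply: le_lt_trans h2 _; rewrite ltr_pdivrMr // ltr_pMr // ltr1n.
have M0 : 0 <= M by have [_] := Hb 0 (eq_ind_r (fun x => x <= rb) (ltW rb0) (@nv0 R n)); apply: le_trans; exact: nrm_ge0.
have Hk (k : nat) h : nv h <= 4 * r -> schol (fun w => f w k) (z0 + h) (fun i => D (z0 + h) i k) /\ normc (f (z0 + h) k) <= M.
  move=> /r4[Vh Mh]; split; first by apply: l2der_coord; [exact: lf|exact: fD].
  by apply: le_trans Mh; exact: nrm_coord (lf _ Vh).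
have [d2 Hd2] := choice (fun k => @partial_schol _ _ (fun w => f w k) (fun w i => D w i k) z0 r M r0 (Hk k)).
have Hl (l : nat -> C) N h : nv h <= 4 * r ->
    schol (fun w => \sum_(k < N) (l k)^* * f w k) (z0 + h) (fun i => \sum_(k < N) (l k)^* * D (z0 + h) i k) /\
    normc (\sum_(k < N) (l k)^* * f (z0 + h) k) <= Num.sqrt (psum l N) * M.
  move=> /r4[Vh Mh]; split; first by apply: l2der_dual; [exact: lf|exact: fD].
  apply: le_trans (finite_dual_bound _ _ _) _; rewrite ler_wpM2l ?sqrtr_ge0 //.
  by apply: le_trans Mh; rewrite ler_sqrt ?psum_le ?l2normsq_ge0 //; exact: lf.
pose rem h k := D (z0 + h) j k - D z0 j k - \sum_i h 0 i * d2 k j i.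
have e0 (m : nat) : 0 < r / 2 ^+ m <= r.
  by rewrite divr_gt0 ?exprn_gt0 //= ler_pdivrMr ?exprn_gt0 // ler_pMr // exprn_ege1 // ler1n.
have key (l : nat -> C) N h : nv h <= r ->
   normc (\sum_(k < N) (l k)^* * rem h k) <= 32 * M / r ^+ 3 * nv h ^+ 2 * Num.sqrt (psum l N).
  (* The constant c depends on l and N, but it is divided by 2^m; letting m grow replaces the
     derivatives of difference quotients by d2 and leaves a uniform bound. *)
  move=> hr; apply: (le_geometric (c := 8 * (Num.sqrt (psum l N) * M) / r +
     \sum_i \sum_(k < N) normc (h 0 i) * (normc (l k) * (64 * M / r ^+ 2)))) => m.
  have P := @partial_taylor _ _ (fun w => \sum_(k < N) (l k)^* * f w k) (fun w i => \sum_(k < N) (l k)^* * D w i k) z0 r _ j r0 (@Hl l N) _ _ (e0 m) hr.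
  pose Q i := \sum_(k < N) (l k)^* * (dquot' (fun w i => D w i k) j (r / 2 ^+ m) z0 i).
  have QE i : dquot' (fun w i => \sum_(k < N) (l k)^* * D w i k) j (r / 2 ^+ m) z0 i = Q i.
    rewrite /dquot' /Q -sumrB mulr_sumr; apply: eq_bigr => k _; rewrite -mulrBr; exact: mulrCA.
  rewrite (eq_bigr (fun i => h 0 i * Q i)) in P; last by move=> i _; rewrite QE.
  have -> : \sum_(k < N) (l k)^* * rem h k = (\sum_(k < N) (l k)^* * D (z0 + h) j k - \sum_(k < N) (l k)^* * D z0 j k - \sum_i h 0 i * Q i)
     + \sum_i \sum_(k < N) h 0 i * ((l k)^* * (dquot' (fun w i => D w i k) j (r / 2 ^+ m) z0 i - d2 k j i)).
    have -> : \sum_i \sum_(k < N) h 0 i * ((l k)^* * (dquot' (fun w i => D w i k) j (r / 2 ^+ m) z0 i - d2 k j i)) =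
      \sum_i h 0 i * Q i - \sum_(k < N) (l k)^* * \sum_i h 0 i * d2 k j i.
      have -> : \sum_(k < N) (l k)^* * (\sum_i h 0 i * d2 k j i) = \sum_i \sum_(k < N) h 0 i * ((l k)^* * d2 k j i).
        rewrite exchange_big; apply: eq_bigr => k _; rewrite mulr_sumr; apply: eq_bigr => i _; exact: mulrCA.
      rewrite -sumrB; apply: eq_bigr => i _; rewrite mulr_sumr -sumrB; apply: eq_bigr => k _.
      by rewrite -mulrBr -mulrBr.
    by rewrite addrA subrK -!sumrB; apply: eq_bigr => k _; rewrite /rem !mulrBr.
  apply: le_trans (normcD _ _) _; apply: le_trans (lerD P _) _.
    apply: le_trans (normc_sum _ _ _) _; apply: ler_sum => i _.
    apply: le_trans (normc_sum _ _ _) _; apply: ler_sum => k _.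
    rewrite normcM; apply: ler_wpM2l; first exact: normc_ge0.
    rewrite normcM normc_conj; apply: ler_wpM2l; first exact: normc_ge0.
    exact: Hd2.
  have -> : 32 * (Num.sqrt (psum l N) * M) / r ^+ 3 * nv h ^+ 2 + 8 * (Num.sqrt (psum l N) * M) / r ^+ 2 * (r / 2 ^+ m) =
     32 * M / r ^+ 3 * nv h ^+ 2 * Num.sqrt (psum l N) + 8 * (Num.sqrt (psum l N) * M) / r / 2 ^+ m.
    have p0 : (2 ^+ m : R) != 0 by rewrite expf_neq0.
    by move: (2 ^+ m) p0 (Num.sqrt _) (nv h) => x x0 q y; field; rewrite x0 gt_eqF.
  set S := \sum_i \sum_(k < N) _; set S' := \sum_i \sum_(k < N) normc (h 0 i) * (normc (l k) * (64 * M / r ^+ 2)).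
  have SS : S = S' / 2 ^+ m.
    rewrite /S /S' mulr_suml; apply: eq_bigr => i _; rewrite mulr_suml; apply: eq_bigr => k _; by rewrite !mulrA.
  by rewrite SS [(_ + S') / _]mulrDl addrA.
have B0 h : 0 <= 32 * M / r ^+ 3 * nv h ^+ 2 by rewrite !mulr_ge0 ?invr_ge0 ?exprn_ge0 ?nv_ge0 // ltW.
have lrem h : nv h <= r -> l2 (rem h) /\ nrm (rem h) <= 32 * M / r ^+ 3 * nv h ^+ 2.
  move=> hr; have H N := nrm_le_dual (B0 h) (fun l => key l N h hr).
  have [l1 l2'] := l2_bounded H; split=> //; by rewrite nrm_le.
have lD h : nv h <= 4 * r -> forall i, l2 (D (z0 + h) i) by move=> /r4[/fD[]].
have r41 : r <= 4 * r by move: r0; move: (r) => x x0; lra.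
(* At h = r e_i the remainder equals a difference of square-summable values of D minus r d2, and it
   is square-summable itself. *)
have ld2 i : l2 (fun k => d2 k j i).
  pose h : Cn := r%:C *: ebase i.
  have nh : nv h = r by rewrite nvZr ?ltW // nv_ebase mulr1.
  have [|lr _] := lrem h; first by rewrite nh.
  have -> : (fun k => d2 k j i) = (fun k => (r^-1)%:C * (D (z0 + h) j k - D z0 j k - rem h k)).
    apply/funext => k; rewrite /rem opprB addrC subrK (bigD1 i) //= big1 => [|i' ii].
      by rewrite mxE ebaseE eqxx mulr1 addr0 mulrA -rcM mulVf ?gt_eqF // rc1 mul1r.
    by rewrite mxE ebaseE eq_sym (negPf ii) mulr0 mul0r.
  apply: l2Z; do 2![apply: l2B => //]; last by have := lD 0 _ j; rewrite addr0; apply; rewrite nv0 mulr_ge0 ?ltW.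
  by apply: lD; rewrite nh.
exists (fun i k => d2 k j i); split=> // e epos.
pose K := 32 * M / r ^+ 3 + 1; have K0 : 0 < K by rewrite ltr_wpDl // !mulr_ge0 ?invr_ge0 ?exprn_ge0 // ltW.
exists (Num.min r (e / K)) => [|h]; first by rewrite lt_min r0 divr_gt0.
rewrite lt_min => /andP[/ltW hr he]; split.
  by apply: lD; apply: le_trans hr _.
apply: le_trans (lrem h hr).2 _; rewrite expr2 mulrA ler_wpM2r ?nv_ge0 //.
rewrite ltr_pdivlMr // in he; apply: le_trans (ltW he); rewrite mulrC ler_wpM2l ?nv_ge0 // /K.
by rewrite lerDl.
Qed.

End VectorHolomorphic.

(** * Real Frechet differentiability with Wirtinger derivatives as coefficients *)

Section FrechetWirtinger.
Context {R : realType} {n : nat}.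
Local Notation C := R[i].
Local Notation Cn := 'rV[C]_n.
Implicit Types (h z w v : Cn) (c : C) (f g : Cn -> C) (A B : 'I_n -> C) (j : 'I_n).

Definition wlin A B h : C := \sum_j (h 0 j * A j + (h 0 j)^* * B j).

(** A and B are the derivatives in z and zbar, so B = 0 is holomorphy. Unlike the directional
    derivatives of [wdiff], this notion composes with functions on C. *)
Definition fre f z A B : Prop := forall e : R, 0 < e -> exists2 t : R, 0 < t &
  forall h, nv h < t -> normc (f (z + h) - f z - wlin A B h) <= e * nv h.

Definition wnorm A B : R := \sum_j (normc (A j) + normc (B j)).

Lemma wnorm_ge0 A B : 0 <= wnorm A B.
Proof. by apply: sumr_ge0 => j _; rewrite addr_ge0 ?normc_ge0. Qed.

Lemma wlin_le A B h : normc (wlin A B h) <= wnorm A B * nv h.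
Proof.
apply: le_trans (normc_sum _ _ _) _; rewrite mulr_suml; apply: ler_sum => j _.
apply: le_trans (normcD _ _) _; rewrite !normcM normc_conj -mulrDr mulrC ler_wpM2l ?nv_coord //.
by rewrite addr_ge0 ?normc_ge0.
Qed.

Lemma wlinZr A B (t : R) h : wlin A B (t%:C *: h) = t%:C * wlin A B h.
Proof.
rewrite /wlin mulr_sumr; apply: eq_bigr => j _; rewrite mxE cjM conjRC.
by move: (h 0 j)^* => *; ring.
Qed.

Lemma fre_lip f z A B : fre f z A B -> exists2 t : R, 0 < t &
  forall h, nv h < t -> normc (f (z + h) - f z) <= (wnorm A B + 1) * nv h.
Proof.
move=> /(_ 1 ltr01)[t t0 H]; exists t => // h /H; rewrite mul1r => le1.
have -> : f (z + h) - f z = (f (z + h) - f z - wlin A B h) + wlin A B h by ring.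
by apply: le_trans (normcD _ _) _; rewrite mulrDl mul1r addrC lerD // wlin_le.
Qed.

Lemma frac_le (e a s : R) : 0 < e -> 0 <= a -> 0 <= s -> e / (a + 1) * (s * a) <= e * s.
Proof.
move=> e0 a0 s0; have a1 : 0 < a + 1 by rewrite ltr_wpDl.
rewrite mulrAC ler_pdivrMr //; have := mulr_ge0 (ltW e0) s0; nra.
Qed.

Lemma fre_rderive f z A B v : fre f z A B -> is_rderive v f z (wlin A B v).
Proof.
move=> H; apply/is_rderiveP => e e0; have v1 : 0 < nv v + 1 by rewrite ltr_wpDl ?nv_ge0.
have [t t0 T] := H _ (divr_gt0 e0 v1); exists (t / (nv v + 1)); first by rewrite divr_gt0.
move=> s; rewrite ltr_pdivlMr // => st.
have tv : nv (s%:C *: v) < t.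
  by rewrite nvZ normc_real; apply: le_lt_trans st; rewrite ler_wpM2l // lerDl.
have := T _ tv; rewrite wlinZr [s%:C * _]mulrC => /le_trans; apply.
by rewrite nvZ normc_real; apply: frac_le; rewrite ?nv_ge0.
Qed.

Let wlin_e A B j c : wlin A B (c *: ebase j) = c * A j + c^* * B j.
Proof.
rewrite /wlin (bigD1 j) //= big1 => [|i ij]; first by rewrite mxE ebaseE eqxx mulr1 addr0.
by rewrite mxE ebaseE eq_sym (negPf ij) mulr0 rmorph0 !mul0r addr0.
Qed.

Let ebase1 j : ebase j = 1 *: ebase j :> Cn. Proof. by rewrite scale1r. Qed.

Lemma fre_dz f z A B j : fre f z A B -> dz j f z = A j.
Proof.
move=> H; have h1 := fre_rderive (ebase j) H; have h2 := fre_rderive ('i%C *: ebase j) H.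
rewrite (is_dz h1 h2) wlin_e {1}ebase1 wlin_e rmorph1 !mul1r conjcI.
have ii : 'i%C * 'i%C = -1 :> C by rewrite -expr2 sqr_i.
have -> : A j + B j - 'i%C * ('i%C * A j + - 'i%C * B j) = A j + B j - 'i%C * 'i%C * A j + 'i%C * 'i%C * B j by ring.
by rewrite ii; move: (A j) (B j) => *; field.
Qed.

Lemma fre_dzb f z A B j : fre f z A B -> dzb j f z = B j.
Proof.
move=> H; have h1 := fre_rderive (ebase j) H; have h2 := fre_rderive ('i%C *: ebase j) H.
rewrite (is_dzb h1 h2) wlin_e {1}ebase1 wlin_e rmorph1 !mul1r conjcI.
have ii : 'i%C * 'i%C = -1 :> C by rewrite -expr2 sqr_i.
have -> : A j + B j + 'i%C * ('i%C * A j + - 'i%C * B j) = A j + B j + 'i%C * 'i%C * A j - 'i%C * 'i%C * B j by ring.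
by rewrite ii; move: (A j) (B j) => *; field.
Qed.

Lemma fre_cder f z k A B (t : R) : fre f (z + t%:C *: k) A B ->
  cder (fun s : R => f (z + s%:C *: k)) t (wlin A B k).
Proof.
move=> H; apply/cderP => e e0; have v1 : 0 < nv k + 1 by rewrite ltr_wpDl ?nv_ge0.
have [r r0 T] := H _ (divr_gt0 e0 v1); exists (r / (nv k + 1)); first by rewrite divr_gt0.
move=> s; rewrite ltr_pdivlMr // => st.
have tv : nv (s%:C *: k) < r.
  by rewrite nvZ normc_real; apply: le_lt_trans st; rewrite ler_wpM2l // lerDl.
have := T _ tv; rewrite wlinZr (rcD t s) scalerDl addrA => /le_trans; apply.
by rewrite nvZ normc_real; apply: frac_le; rewrite ?nv_ge0.
Qed.

Lemma fre_cst c z : fre (fun=> c) z (fun=> 0) (fun=> 0).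
Proof.
move=> e e0; exists 1 => // h _; rewrite /wlin big1 => [|j _]; last by rewrite !mulr0 addr0.
by rewrite subrr subr0 normc0 mulr_ge0 ?nv_ge0 // ltW.
Qed.

Lemma fre_coord j z : fre (fun w => w 0 j) z (fun i => (i == j)%:R) (fun=> 0).
Proof.
move=> e e0; exists 1 => // h _; rewrite /wlin (bigD1 j) //= big1 => [|i ij].
  by rewrite eqxx mulr1 mulr0 !addr0 mxE addrAC addrK subrr normc0 mulr_ge0 ?nv_ge0 // ltW.
by rewrite (negPf ij) !mulr0 addr0.
Qed.

Lemma fre_conj f z A B : fre f z A B -> fre (fun w => (f w)^*) z (fun j => (B j)^*) (fun j => (A j)^*).
Proof.
move=> H e e0; have [t t0 T] := H _ e0; exists t => // h /T.
have -> : wlin (fun j => (B j)^*) (fun j => (A j)^*) h = (wlin A B h)^*.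
  rewrite /wlin cj_sum; apply: eq_bigr => j _; rewrite cjD !cjM conjCK.
  by move: (h 0 j)^* (A j)^* (B j)^* => *; ring.
by rewrite -!cjB normc_conj.
Qed.

Lemma freD f g z A B A' B' : fre f z A B -> fre g z A' B' ->
  fre (fun w => f w + g w) z (fun j => A j + A' j) (fun j => B j + B' j).
Proof.
move=> fa gb e e0; have [s s0 H] := fa _ (divr_gt0 e0 (ltr0n _ 2)); have [t t0 K] := gb _ (divr_gt0 e0 (ltr0n _ 2)).
exists (Num.min s t) => [|h]; first by rewrite lt_min s0 t0.
rewrite lt_min => /andP[hs ht].
have -> : wlin (fun j => A j + A' j) (fun j => B j + B' j) h = wlin A B h + wlin A' B' h.
  rewrite /wlin -big_split; apply: eq_bigr => j _ /=; ring.
have -> : f (z + h) + g (z + h) - (f z + g z) - (wlin A B h + wlin A' B' h) =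
  (f (z + h) - f z - wlin A B h) + (g (z + h) - g z - wlin A' B' h) by ring.
apply: le_trans (normcD _ _) _; rewrite [e]splitr mulrDl; apply: lerD; [exact: H|exact: K].
Qed.

(** S restricts the increments on which phi must be differentiable: all of C for holomorphic phi,
    the reals for a real function of a real-valued f. *)
Lemma fre_comp_on (S : set C) (phi : C -> C) f z A B d : (forall h, S (f (z + h) - f z)) ->
  (forall e : R, 0 < e -> exists2 t : R, 0 < t & forall k : C, S k -> normc k < t ->
    normc (phi (f z + k) - phi (f z) - d * k) <= e * normc k) -> fre f z A B ->
  fre (fun w => phi (f w)) z (fun j => d * A j) (fun j => d * B j).
Proof.
move=> Sf fd H e e0.
pose K := normc d + (wnorm A B + 1); have K0 : 0 < K by rewrite /K addrA ltr_wpDl ?addr_ge0 ?normc_ge0 ?wnorm_ge0.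
have [q q0 eE] : exists2 q : R, 0 < q & e = q * K by exists (e / K); rewrite ?divr_gt0 // divfK // gt_eqF.
have [t1 t10 H1] := fd _ q0; have [t2 t20 H2] := H _ q0; have [t3 t30 H3] := fre_lip H.
have A1 : 0 < wnorm A B + 1 by rewrite ltr_wpDl ?wnorm_ge0.
exists (Num.min (Num.min t2 t3) (t1 / (wnorm A B + 1))) => [|h]; first by rewrite !lt_min t20 t30 divr_gt0.
rewrite !lt_min ltr_pdivlMr // => /andP[/andP[s2 s3] s1].
pose k := f (z + h) - f z; have kl : normc k <= (wnorm A B + 1) * nv h := H3 _ s3.
have kt : normc k < t1 by apply: le_lt_trans kl _; rewrite mulrC.
have -> : wlin (fun j => d * A j) (fun j => d * B j) h = d * wlin A B h.
  by rewrite /wlin mulr_sumr; apply: eq_bigr => j _; move: (h 0 j)^* => *; ring.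
have -> : phi (f (z + h)) - phi (f z) - d * wlin A B h = (phi (f z + k) - phi (f z) - d * k) + d * (f (z + h) - f z - wlin A B h).
  rewrite /k [f z + _]addrC subrK; move: (phi _) (phi _) => *; ring.
apply: le_trans (normcD _ _) _; rewrite normcM eE /K.
have := H1 _ (Sf h) kt; have := H2 _ s2; move: kl.
have := wnorm_ge0 A B; have := nv_ge0 h; have := normc_ge0 k; have := normc_ge0 d; rewrite -/k.
move: (normc (phi (f z + k) - phi (f z) - d * k)) (normc (k - _)) (normc k) (nv h) (wnorm A B) (normc d)
 => A' B' k' H' a' b' b0 k0 H0 a0 p1 p2 p3.
have i1 : q * k' <= q * ((a' + 1) * H') by rewrite ler_wpM2l // ltW.
have i2 : b' * B' <= b' * (q * H') by rewrite ler_wpM2l.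
nra.
Qed.

Lemma fre_holo (phi : C -> C) f z A B d : cdiff phi (f z) d -> fre f z A B ->
  fre (fun w => phi (f w)) z (fun j => d * A j) (fun j => d * B j).
Proof.
move=> fd; apply: (@fre_comp_on setT) => // e e0; have [t t0 T] := fd e e0.
by exists t => // k _; exact: T.
Qed.

Lemma fre_sqr f z A B : fre f z A B ->
  fre (fun w => f w * f w) z (fun j => 2 * f z * A j) (fun j => 2 * f z * B j).
Proof.
move=> H; apply: (@fre_holo (fun c => c * c)) => //.
have -> : 2 * f z = 1 * f z + f z * 1 by ring.
by apply: cdiffM; exact: cdiff_id.
Qed.

Lemma freZ f z A B c : fre f z A B -> fre (fun w => c * f w) z (fun j => c * A j) (fun j => c * B j).
Proof.
move=> H; apply: (@fre_holo (fun d => c * d)) => //.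
have {2}-> : c = 0 * f z + c * 1 by ring.
by apply: cdiffM; [exact: cdiff_cst|exact: cdiff_id].
Qed.

Lemma fre_eq f z A B A' B' : fre f z A B -> A =1 A' -> B =1 B' -> fre f z A' B'.
Proof. by move=> H /funext <- /funext <-. Qed.

Lemma freB f g z A B A' B' : fre f z A B -> fre g z A' B' ->
  fre (fun w => f w - g w) z (fun j => A j - A' j) (fun j => B j - B' j).
Proof.
move=> Hf /(freZ (-1)) Hg; have := freD Hf Hg; under eq_fun do rewrite mulN1r.
by move/fre_eq; apply=> j; rewrite mulN1r.
Qed.

Lemma freM f g z A B A' B' : fre f z A B -> fre g z A' B' ->
  fre (fun w => f w * g w) z (fun j => A j * g z + f z * A' j) (fun j => B j * g z + f z * B' j).
Proof.
move=> Hf Hg.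
(* Polarization reduces products to squares, which are compositions with a holomorphic function. *)
have -> : (fun w => f w * g w) = (fun w => 4^-1 * ((f w + g w) * (f w + g w) - (f w - g w) * (f w - g w))).
  by apply/funext => w; move: (f w) (g w) => *; field.
apply: fre_eq (freZ _ (freB (fre_sqr (freD Hf Hg)) (fre_sqr (freB Hf Hg)))) _ _ => j /=;
  by move: (f z) (g z) (A j) (B j) (A' j) (B' j) => *; field.
Qed.

Lemma cdiff_inv c : c != 0 -> cdiff (fun d => d^-1) c (- (c ^+ 2)^-1).
Proof.
move=> c0 e e0; pose q := normc c; have q0 : 0 < q by rewrite normc_gt0.
exists (Num.min (q / 2) (e * q ^+ 3 / 2)) => [|h]; first by rewrite lt_min !divr_gt0 // mulr_gt0 // exprn_gt0.
rewrite lt_min => /andP[h1 h2].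
have ch : q / 2 <= normc (c + h).
  by have := normcD (c + h) (- h); rewrite addrK normc_oppr -/q; lra.
have ch0 : c + h != 0 by rewrite -normc_gt0; apply: lt_le_trans ch; rewrite divr_gt0.
have -> : (c + h)^-1 - c^-1 - - (c ^+ 2)^-1 * h = h * (h * (c * c * (c + h))^-1) by field; rewrite ch0 c0.
rewrite normcM mulrC ler_wpM2r ?normc_ge0 // normcM.
have -> : normc (c * c * (c + h))^-1 = (q * q * normc (c + h))^-1.
  have nz : c * c * (c + h) != 0 by rewrite !mulf_neq0.
  apply: (mulfI (x := normc (c * c * (c + h)))); first by rewrite gt_eqF // normc_gt0.
  by rewrite -normcM divff // !normcM normc_real normr1 divff // !mulf_neq0 ?gt_eqF // normc_gt0.
rewrite ler_pdivrMr ?mulr_gt0 //; last by apply: lt_le_trans ch; rewrite divr_gt0.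
apply: le_trans (ltW h2) _; rewrite -!mulrA ler_wpM2l ?(ltW e0) //.
have := ler_wpM2l (mulr_ge0 (ltW q0) (ltW q0)) ch; rewrite -!mulrA; apply: le_trans.
by rewrite le_eqVlt; apply/orP; left; apply/eqP; ring.
Qed.

Lemma fre_inv f z A B : f z != 0 -> fre f z A B ->
  fre (fun w => (f w)^-1) z (fun j => - A j / f z ^+ 2) (fun j => - B j / f z ^+ 2).
Proof.
by move=> f0 H; apply: fre_eq (fre_holo (cdiff_inv f0) H) _ _ => j; rewrite !mulNr mulrC.
Qed.

Lemma fre_real (u : Cn -> R) (s : R -> R) z A B (ds : R) : fre (fun w => (u w)%:C) z A B ->
  is_derive (u z) 1 s ds -> fre (fun w => (s (u w))%:C) z (fun j => ds%:C * A j) (fun j => ds%:C * B j).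
Proof.
move=> Hu /is_derive1P Hs.
apply: (@fre_comp_on [set c : C | complex.Im c = 0] (fun c => (s (complex.Re c))%:C)) Hu => [h|e e0].
  by rewrite /= subrr.
have [t t0 T] := Hs e e0; exists t => // -[x y] yE; have {yE}-> : y = 0 by exact: yE.
have -> : x +i* 0 = x%:C by [].
have RC (a : R) : complex.Re (a%:C) = a by [].
rewrite normc_real -rcD !RC -rcM -!rcB normc_real; exact: T.
Qed.

End FrechetWirtinger.

Section InnerProduct.
Context {R : realType} {n : nat}.
Local Notation C := R[i].
Local Notation Cn := 'rV[C]_n.
Implicit Types (h z w v : Cn) (c : C) (F G : Cn -> nat -> C) (j : 'I_n) (V : set Cn) (d : 'I_n -> nat -> C).

Lemma ip_suml (I : Type) (r : seq I) (c : I -> C) (u : I -> nat -> C) (v : nat -> C) :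
  (forall i, l2 (u i)) -> l2 v -> ip (fun k => \sum_(i <- r) c i * u i k) v = \sum_(i <- r) c i * ip (u i) v.
Proof.
move=> lu lv; elim: r => [|i r IH].
  rewrite big_nil; have -> : (fun k : nat => \sum_(i <- [::]) c i * u i k) = (fun k => 0 * v k).
    by apply/funext => k; rewrite big_nil mul0r.
  by rewrite ipZl // mul0r.
have -> : (fun k => \sum_(i <- i :: r) c i * u i k) = (fun k => c i * u i k + \sum_(i <- r) c i * u i k).
  by apply/funext => k; rewrite big_cons.
rewrite big_cons -IH -ipZl //; apply: ipDl => //; first exact: l2Z.
by apply: l2_sum => i'; exact: l2Z.
Qed.

Lemma ip_sumr (I : Type) (r : seq I) (c : I -> C) (u : I -> nat -> C) (v : nat -> C) :
  (forall i, l2 (u i)) -> l2 v -> ip v (fun k => \sum_(i <- r) c i * u i k) = \sum_(i <- r) (c i)^* * ip v (u i).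
Proof.
move=> lu lv; rewrite ipC //; last by apply: l2_sum => i; exact: l2Z.
by rewrite ip_suml // cj_sum; apply: eq_bigr => i _; rewrite cjM -ipC.
Qed.

Lemma l2der_lip F z d : l2 (F z) -> l2der F z d -> exists2 t : R, 0 < t & forall h, nv h < t ->
  l2 (F (z + h)) /\ nrm (fun k => F (z + h) k - F z k) <= (\sum_j nrm (d j) + 1) * nv h.
Proof.
move=> lF [ld /(_ 1 ltr01)[t t0 T]]; exists t => // h /T[lh H]; split=> //.
have ls : l2 (fun k => \sum_j h 0 j * d j k) by apply: l2_sum => j; exact: l2Z.
have lr : l2 (fun k => F (z + h) k - F z k - \sum_j h 0 j * d j k) by do 2![apply: l2B => //].
have -> : (fun k => F (z + h) k - F z k) = (fun k => \sum_j h 0 j * d j k + (F (z + h) k - F z k - \sum_j h 0 j * d j k)).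
  by apply/funext => k; ring.
apply: le_trans (nrmD ls lr) _; rewrite mulrDl; apply: lerD => //.
apply: le_trans (nrm_sum _ _) _ => [j|]; first exact: l2Z.
rewrite mulr_suml; apply: ler_sum => j _; by rewrite nrmZ // mulrC ler_wpM2l ?nrm_ge0 // nv_coord.
Qed.

Lemma fre_ip F G z d d' : l2 (F z) -> l2 (G z) -> l2der F z d -> l2der G z d' ->
  fre (fun w => ip (F w) (G w)) z (fun j => ip (d j) (G z)) (fun j => ip (F z) (d' j)).
Proof.
move=> lF lG dF dG e e0.
have [rb [M [rb0 Hb]]] := l2der_bound lG dG.
have M0 : 0 <= M by have [|_] := Hb 0; [rewrite nv0 ltW|apply: le_trans; exact: nrm_ge0].
pose KF := \sum_j nrm (d j); pose KG := \sum_j nrm (d' j).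
have KF0 : 0 <= KF by apply: sumr_ge0 => j _; exact: nrm_ge0.
have KG0 : 0 <= KG by apply: sumr_ge0 => j _; exact: nrm_ge0.
(* After expansion three errors remain, at most q |h| times |F z|, KF and M respectively. *)
pose K := M + nrm (F z) + KF + 1.
have K0 : 0 < K by have := nrm_ge0 (F z); rewrite /K; lra.
have [q q0 eE] : exists2 q : R, 0 < q & e = q * K by exists (e / K); rewrite ?divr_gt0 // divfK // gt_eqF.
have [ld DF] := dF; have [ld' DG] := dG.
have [t1 t10 T1] := DF _ q0; have [t2 t20 T2] := DG _ q0; have [t3 t30 T3] := l2der_lip lG dG.
have KG1 : 0 < KG + 1 by lra.
(* The last bound makes the increment of G at most q, so its pairing with the linear part of F is an
   error term as well. *)
exists (Num.min (Num.min t1 t2) (Num.min (Num.min t3 rb) (q / (KG + 1)))) => [|h].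
  by rewrite !lt_min t10 t20 t30 rb0 divr_gt0.
rewrite !lt_min => /andP[/andP[h1 h2] /andP[/andP[h3 hb] hq]].
have [lFh rF] := T1 _ h1; have [lGh rG] := T2 _ h2; have [_ lip] := T3 _ h3; have [_ MG] := Hb _ (ltW hb).
set sF := fun k => \sum_j h 0 j * d j k in rF *; set sG := fun k => \sum_j h 0 j * d' j k in rG *.
have lsF : l2 sF by apply: l2_sum => j; exact: l2Z.
have lsG : l2 sG by apply: l2_sum => j; exact: l2Z.
set eF := (fun k => _) in rF; set eG := (fun k => _) in rG; set dGh := (fun k => _) in lip.
have leF : l2 eF by do 2![apply: l2B => //].
have leG : l2 eG by do 2![apply: l2B => //].
have ldG : l2 dGh by apply: l2B.
have E1 : ip (F (z + h)) (G (z + h)) = ip (F z) (G (z + h)) + ip sF (G (z + h)) + ip eF (G (z + h)).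
  rewrite -ipDl // -ipDl //; last exact: l2D.
  by congr ip; apply/funext => k; rewrite /eF -/(sF k); move: (F (z + h) k) (F z k) (sF k) => *; ring.
have E2 : ip (F z) (G (z + h)) = ip (F z) (G z) + ip (F z) sG + ip (F z) eG.
  rewrite -ipDr // -ipDr //; last exact: l2D.
  by congr ip; apply/funext => k; rewrite /eG /sG; ring.
have E3 : ip sF (G (z + h)) = ip sF (G z) + ip sF dGh.
  by rewrite -ipDr //; congr ip; apply/funext => k; rewrite /dGh; ring.
have -> : wlin (fun j => ip (d j) (G z)) (fun j => ip (F z) (d' j)) h = ip sF (G z) + ip (F z) sG.
  by rewrite /wlin big_split /= /sF /sG ip_suml // ip_sumr.
rewrite E1 E2 E3.
have -> : ip (F z) (G z) + ip (F z) sG + ip (F z) eG + (ip sF (G z) + ip sF dGh) + ip eF (G (z + h)) - ip (F z) (G z) -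
  (ip sF (G z) + ip (F z) sG) = ip (F z) eG + ip sF dGh + ip eF (G (z + h)) by ring.
apply: le_trans (normcD _ _) _; apply: le_trans (lerD (normcD _ _) (lexx _)) _.
have b1 : normc (ip (F z) eG) <= nrm (F z) * (q * nv h).
  by apply: le_trans (cauchy_schwarz lF leG) _; rewrite ler_wpM2l ?nrm_ge0.
have b2 : normc (ip sF dGh) <= KF * nv h * q.
  apply: le_trans (cauchy_schwarz lsF ldG) _; apply: ler_pM; rewrite ?nrm_ge0 //.
    apply: le_trans (nrm_sum _ _) _ => [j|]; first exact: l2Z.
    rewrite mulr_suml; apply: ler_sum => j _; by rewrite nrmZ // mulrC ler_wpM2l ?nrm_ge0 // nv_coord.
  by apply: le_trans lip _; rewrite mulrC -ler_pdivlMr // ltW.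
have b3 : normc (ip eF (G (z + h))) <= q * nv h * M.
  by apply: le_trans (cauchy_schwarz leF lGh) _; apply: ler_pM; rewrite ?nrm_ge0.
rewrite eE /K; have := mulr_ge0 (ltW q0) (nv_ge0 h); move: b1 b2 b3; move: (nrm (F z)) (nv h); intros; nra.
Qed.

End InnerProduct.

(** * Slices of projectively induced metrics *)

Section Potential.
Context {R : realType} {n : nat}.
Local Notation C := R[i].
Local Notation Cn := 'rV[C]_n.
Implicit Types (h z w v : Cn) (c : C) (j : 'I_n) (V : set Cn).

Lemma fre_near (f g : Cn -> C) z A B : (exists2 t : R, 0 < t & forall h, nv h < t -> f (z + h) = g (z + h)) ->
  fre g z A B -> fre f z A B.
Proof.
move=> [t t0 fg] H e e0; have [s s0 S] := H e e0.
exists (Num.min t s) => [|h]; first by rewrite lt_min t0 s0.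
rewrite lt_min => /andP[ht hs]; rewrite fg //; have := fg 0; rewrite nv0 addr0 => -> //.
exact: S.
Qed.

Lemma fre_open V (f g : Cn -> C) z A B : open V -> V z -> (forall w, V w -> f w = g w) ->
  fre g z A B -> fre f z A B.
Proof.
move=> oV Vz fg; apply: fre_near; have [t t0 T] := open_nvP oV Vz.
by exists t => // h /T; exact: fg.
Qed.

Section Lift.
Variables (V : set Cn) (f : Cn -> nat -> C) (D : Cn -> 'I_n -> nat -> C).
Hypotheses (oV : open V) (lf : forall z, V z -> l2 (f z)) (fD : forall z, V z -> l2der f z (D z)).
Hypothesis fN0 : forall z, V z -> f z <> fun=> 0.

Let lD z j : V z -> l2 (D z j). Proof. by move=> /fD[]. Qed.

Lemma lift_gt0 z : V z -> 0 < l2normsq (f z).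
Proof.
move=> Vz; rewrite ltNge; apply/negP => /(l2_eq0 (lf Vz)) f0; exact: fN0 Vz f0.
Qed.

Lemma fre_l2normsq z : V z -> fre (fun w => (l2normsq (f w))%:C) z
  (fun j => ip (D z j) (f z)) (fun j => ip (f z) (D z j)).
Proof.
move=> Vz; apply: (fre_open oV Vz (g := fun w => ip (f w) (f w))) => [w Vw|].
  by rewrite ip_sq //; exact: lf.
by apply: fre_ip; [exact: lf|exact: lf|exact: fD|exact: fD].
Qed.

(** Differentiating the pairing of f with D_j requires D_j to be differentiable, which is where
    [l2_partial] enters; being holomorphic and in the antilinear slot, D_j contributes nothing to
    the derivative in z_i. *)
Lemma dz_dzb_fubini_study i j z : V z ->
  dz i (dzb j (fun w => (fubini_study_potential (f w))%:C)) z =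
  (ip (f z) (f z) * ip (D z i) (D z j) - ip (D z i) (f z) * ip (f z) (D z j)) / ip (f z) (f z) ^+ 2.
Proof.
move=> Vz; have K0 := lift_gt0 Vz.
have E w : V w -> dzb j (fun w => (fubini_study_potential (f w))%:C) w = (ip (f w) (f w))^-1 * ip (f w) (D w j).
  move=> Vw; have Kw := lift_gt0 Vw.
  rewrite (fre_dzb _ (fre_real (fre_l2normsq Vw) (is_derive1_ln Kw))).
  by rewrite rcV ip_sq //; exact: lf.
rewrite (dz_open i oV Vz E).
have [d2 hd2] := l2_partial j oV lf fD Vz.
have nz : ip (f z) (f z) != 0 by rewrite ip_sq ?rc_eq0 ?gt_eqF //; exact: lf.
have F1 := fre_ip (lf Vz) (lf Vz) (fD Vz) (fD Vz).
have F2 := fre_ip (lf Vz) (@lD z j Vz) (fD Vz) hd2.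
rewrite (fre_dz _ (freM (fre_inv nz F1) F2)).
by move: (ip (f z) (f z)) nz (ip (D z i) (f z)) (ip (f z) (D z j)) (ip (D z i) (D z j)) => k k0 *; field.
Qed.

End Lift.

(** In one variable the only partial derivative is a map of the same type as f, so [l2_partial] can
    be iterated. *)
Lemma l2_derivatives (V : set 'rV[C]_1) (f : 'rV[C]_1 -> nat -> C) : open V -> l2_holomorphic V f ->
  exists F : nat -> 'rV[C]_1 -> nat -> C, [/\ F 0%N = f,
    forall m (z : 'rV[C]_1), V z -> l2 (F m z) & forall m (z : 'rV[C]_1), V z -> l2der (F m) z (fun=> F m.+1 z)].
Proof.
move=> oV /(l2_holomorphicP f oV)[lf fd].
pose hol (g : 'rV[C]_1 -> nat -> C) := (forall z : 'rV[C]_1, V z -> l2 (g z)) /\ forall z : 'rV[C]_1, V z -> exists d, l2der g z d.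
(* The implication inside the existential makes the choice function total. *)
have step (g : 'rV[C]_1 -> nat -> C) : exists g', hol g -> hol g' /\ forall z : 'rV[C]_1, V z -> l2der g z (fun=> g' z).
  have [[lg gd]|ng] := pselect (hol g); last by exists g.
  pose D (z : 'rV[C]_1) : 'I_1 -> nat -> C := xget (fun=> (fun=> 0)) [set d | l2der g z d].
  have HD (z : 'rV[C]_1) : V z -> l2der g z (D z).
    by move=> /gd[d hd]; rewrite /D; case: xgetP => [y _ //|/(_ d)].
  have E (z : 'rV[C]_1) : D z = fun=> D z 0 by apply/funext => i; rewrite (ord1 i).
  exists (fun z : 'rV[C]_1 => D z 0) => _; split; last by move=> z Vz; rewrite -E; exact: HD.
  split=> [z Vz|z Vz]; first by have [lD _] := HD z Vz.
  exact: (@l2_partial R 1 V g D _ z oV lg HD Vz).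
have [N HN] := choice step.
have hF m : hol (iter m N f) by elim: m => [//|m IH]; exact: (HN _ IH).1.
exists (fun m => iter m N f); split=> [//|m|m z Vz]; first exact: (hF m).1.
exact: (HN _ (hF m)).2.
Qed.

Lemma slice_l2der (f : Cn -> nat -> C) (p v : Cn) (z : 'rV[C]_1) d : l2 (f (p + z 0 0 *: v)) ->
  l2der f (p + z 0 0 *: v) d ->
  l2der (fun z : 'rV[C]_1 => f (p + z 0 0 *: v)) z (fun=> fun k => \sum_j v 0 j * d j k).
Proof.
move=> lf [ld H]; split=> [_|e e0]; first by apply: l2_sum => j; exact: l2Z.
have v1 : 0 < nv v + 1 by rewrite ltr_wpDl ?nv_ge0.
have [t t0 T] := H _ (divr_gt0 e0 v1); exists (t / (nv v + 1)) => [|h]; first by rewrite divr_gt0.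
rewrite (ltr_pdivlMr _ _ v1) => ht.
have hn : normc (h 0 0) <= nv h := nv_coord h 0.
have hv : nv (h 0 0 *: v) < t.
  rewrite nvZ; apply: le_lt_trans ht; apply: ler_pM; rewrite ?normc_ge0 ?nv_ge0 //.
  by rewrite lerDl.
have [lh N] := T _ hv.
have E : p + (z + h) 0 0 *: v = p + z 0 0 *: v + h 0 0 *: v by rewrite mxE scalerDl addrA.
rewrite E; split=> //.
have -> : (fun k => f (p + z 0 0 *: v + h 0 0 *: v) k - f (p + z 0 0 *: v) k - \sum_(j < 1) h 0 j * (\sum_j0 v 0 j0 * d j0 k)) =
  (fun k => f (p + z 0 0 *: v + h 0 0 *: v) k - f (p + z 0 0 *: v) k - \sum_j (h 0 0 *: v) 0 j * d j k).
  apply/funext => k; rewrite big_ord1; congr (_ - _); rewrite mulr_sumr; apply: eq_bigr => j _.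
  by rewrite mxE mulrA.
apply: le_trans N _; rewrite nvZ.
apply: le_trans (frac_le e0 (nv_ge0 v) (normc_ge0 _)) _.
by rewrite ler_wpM2l // ltW.
Qed.

Lemma open_slice V (p v : Cn) : open V -> open [set z : 'rV[C]_1 | V (p + z 0 0 *: v)].
Proof.
move=> oV; rewrite openE => z /= Vz; apply/nbhs_nvP; have [t t0 T] := open_nvP oV Vz.
have v1 : 0 < nv v + 1 by rewrite ltr_wpDl ?nv_ge0.
exists (t / (nv v + 1)) => [|h]; first by rewrite divr_gt0.
rewrite (ltr_pdivlMr _ _ v1) => ht.
rewrite /= mxE scalerDl addrA; apply: T; rewrite nvZ; apply: le_lt_trans ht.
by apply: ler_pM; rewrite ?normc_ge0 ?nv_ge0 ?nv_coord // lerDl.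
Qed.

End Potential.

(** * Power series of e^(kappa s) (1 + s)^-a and the signs of its coefficients *)

Section Recurrence.
Context {R : realType}.
Implicit Types (u w e : nat -> R) (m k : nat).

(** Coefficients of a product of power series; [sh] is multiplication by the variable s. [conv_mul]
    and [conv_deriv] are Leibniz's rule for s d/ds and d/ds. *)
Definition conv u e m : R := \sum_(i < m.+1) u i * e (m - i)%N.
Definition sh u k : R := if k is k'.+1 then u k' else 0.

Lemma convD u u' e m : conv (fun k => u k + u' k) e m = conv u e m + conv u' e m.
Proof. by rewrite /conv -big_split; apply: eq_bigr => i _; rewrite mulrDl. Qed.

Lemma convZ (c : R) u e m : conv (fun k => c * u k) e m = c * conv u e m.
Proof. by rewrite /conv mulr_sumr; apply: eq_bigr => i _; rewrite mulrA. Qed.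

Lemma convZr (c : R) u e m : conv u (fun k => c * e k) m = c * conv u e m.
Proof. by rewrite /conv mulr_sumr; apply: eq_bigr => i _; rewrite mulrCA. Qed.

Lemma conv_shl u e m : conv (sh u) e m = sh (conv u e) m.
Proof.
rewrite /conv big_ord_recl mul0r add0r; case: m => [|m]; first by rewrite big_ord0.
by apply: eq_bigr => i _ /=; rewrite /bump add1n.
Qed.

Lemma conv_shr u e m : conv u (sh e) m = sh (conv u e) m.
Proof.
rewrite /conv big_ord_recr /= subnn /= mulr0 addr0; case: m => [|m]; first by rewrite big_ord0.
by apply: eq_bigr => i _; rewrite subSn // -ltnS.
Qed.

Lemma conv_mul u e m : m%:R * conv u e m = conv (fun k => k%:R * u k) e m + conv u (fun k => k%:R * e k) m.
Proof.
rewrite /conv mulr_sumr -big_split; apply: eq_bigr => i _ /=.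
have im : (i <= m)%N by rewrite -ltnS.
by rewrite -{1}(subnKC im) natrD; ring.
Qed.

Lemma conv_deriv u e m : m.+1%:R * conv u e m.+1 =
  conv (fun k => k.+1%:R * u k.+1) e m + conv u (fun k => k.+1%:R * e k.+1) m.
Proof.
rewrite conv_mul; congr (_ + _).
  by rewrite /conv big_ord_recl !mul0r add0r; apply: eq_bigr => i _; rewrite /= /bump add1n subSS.
rewrite /conv big_ord_recr /= subnn mul0r mulr0 addr0; apply: eq_bigr => i _.
by rewrite subSn // -ltnS.
Qed.

(** The rate 8 serves below: 8^(m+1) = 2^m 2^(m+1) 2^(m+2), so it absorbs the factor (m+1) (m+2) and
    leaves 2^m. *)
Lemma geometric_decay u m0 : (forall m, 0 <= u m) -> (forall m, (m0 <= m)%N -> u m.+1 <= u m / 8) ->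
  exists c : R, forall m, u m <= c / 8 ^+ m.
Proof.
move=> u0 H; exists (\sum_(i < m0.+1) u i * 8 ^+ i) => m.
have p0 k : (0 : R) < 8 ^+ k by rewrite exprn_gt0.
have small k : (k <= m0)%N -> u k <= (\sum_(i < m0.+1) u i * 8 ^+ i) / 8 ^+ k.
  move=> km; rewrite ler_pdivlMr // (bigD1 (Ordinal (n := m0.+1) (m := k) km)) //= lerDl.
  by apply: sumr_ge0 => i _; rewrite mulr_ge0 // ltW.
have [/small//|mm] := leqP m m0.
elim: m mm => [//|m IH]; rewrite ltnS leq_eqVlt => /predU1P[E|mm].
  have le : (m0 <= m)%N by rewrite E.
  apply: le_trans (H _ le) _; rewrite exprSr invfM mulrA ler_pM2r ?invr_gt0 //.
  by apply: small; rewrite E.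
by apply: le_trans (H _ (ltnW mm)) _; rewrite exprSr invfM mulrA ler_pM2r ?invr_gt0 // IH.
Qed.

(* The generating function of w is e^(kappa s) (1 + s)^-a.  Nonnegative coefficients would decay
   superexponentially, and so would those of (1 + s)^-a = e^(- kappa s) e^(kappa s) (1 + s)^-a. *)
Lemma no_nonneg_coefficients (a kappa : R) w : 0 < a -> 0 < w 0%N -> (forall m, 0 <= w m) ->
  ~ (forall m, m.+1%:R * w m.+1 = (kappa - a - m%:R) * w m + kappa * sh w m).
Proof.
move=> a0 w00 w0 rec.
(* The coefficients of e^(- kappa s); the convolution q then satisfies the binomial recurrence of (1
   + s)^-a. *)
pose e k : R := (- kappa) ^+ k / k`!%:R.
have e1 k : k.+1%:R * e k.+1 = - kappa * e k.
  rewrite /e factS natrM exprS invfM; have : (k.+1%:R : R) != 0 by rewrite pnatr_eq0.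
  by move: (k.+1%:R) (k`!%:R)^-1 => x y x0; field.
have e2 k : k%:R * e k = - kappa * sh e k.
  by case: k => [|k]; rewrite ?mul0r ?mulr0 //; exact: e1.
pose q := conv w e.
have qrec m : m.+1%:R * q m.+1 = - (m%:R + a) * q m.
  rewrite /q conv_deriv.
  have -> : conv w (fun k => k.+1%:R * e k.+1) m = - kappa * conv w e m.
    by rewrite -convZr; apply: eq_bigr => i _; rewrite e1.
  have -> : conv (fun k => k.+1%:R * w k.+1) e m =
     (kappa - a) * conv w e m - conv (fun k => k%:R * w k) e m + kappa * conv (sh w) e m.
    rewrite -[- conv _ _ _]mulN1r -!convZ -!convD; apply: eq_bigr => i _; rewrite rec; ring.
  have -> : conv (fun k => k%:R * w k) e m = m%:R * conv w e m + kappa * sh (conv w e) m.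
    rewrite conv_mul; have -> : conv w (fun k => k%:R * e k) m = - kappa * sh (conv w e) m.
      by rewrite -conv_shr -convZr; apply: eq_bigr => i _; rewrite e2.
    ring.
  by rewrite conv_shl; ring.
have q0 : q 0%N = w 0%N by rewrite /q /conv big_ord1 /e expr0 fact0 divr1 mulr1.
(* The quantity (m+1) |q (m+1)| = (m + a) |q m| does not decrease, so q decays at most like 1 /
   m. *)
have qlow m : a * w 0%N <= m.+1%:R * `|q m.+1|.
  elim: m => [|m IH].
    by rewrite -[X in X * `| _ |]normr_nat -normrM qrec q0 add0r normrM normrN (gtr0_norm a0) (gtr0_norm w00).
  apply: le_trans IH _; rewrite -[X in _ <= X * _]normr_nat -normrM qrec normrM normrN ler_wpM2r //.
  have m1 : 0 <= m.+1%:R + a by rewrite addr_ge0 // ltW.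
  by rewrite (ger0_norm m1) lerDl ltW.
pose m0 := Num.bound (9 * `|kappa|).
have m0P m : (m0 <= m)%N -> 9 * `|kappa| <= m%:R.
  move=> mm; apply: le_trans (_ : m0%:R <= _); last by rewrite ler_nat.
  by apply: ltW; apply: le_lt_trans (ler_norm _) _; rewrite ger0_norm ?mulr_ge0 // archi_boundP // mulr_ge0.
have [c1 C1] : exists c : R, forall m, w m <= c / 8 ^+ m.
  (* Nonnegativity of w (m+2) gives (m + 1 + a - kappa) w (m+1) <= kappa w m; once m >= 9 |kappa|
     the ratio is at most 1 / 8. *)
  apply: (@geometric_decay w m0) => // m mm.
  have k9 := m0P _ mm; have r1 := rec m.+1; have p1 := w0 m.+2; rewrite /= in r1.
  have p2 := w0 m; have p3 := w0 m.+1; have kk := ler_norm kappa; have kk0 := normr_ge0 kappa.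
  have h1 : 0 <= m.+2%:R * w m.+2 by rewrite mulr_ge0.
  rewrite r1 -natr1 in h1; rewrite ler_pdivlMr //; move: k9 h1 p2 p3 kk kk0 a0.
  move: (w m.+1) (w m) (m%:R) `|kappa| => x y M K *.
  have i1 : kappa * y <= K * y by rewrite ler_wpM2r.
  have i2 : kappa * x <= K * x by rewrite ler_wpM2r.
  have i3 : 9 * K * x <= M * x by rewrite ler_wpM2r.
  have i4 : 0 <= a * x by rewrite mulr_ge0 // ltW.
  have i5 : K * (8 * x) + x <= K * y by lra.
  have [K0|K0] := leP K 0; first by nra.
  by rewrite mulrC -(ler_pM2l K0); lra.
have [c2 C2] : exists c : R, forall m, `|e m| <= c / 8 ^+ m.
  apply: (@geometric_decay (fun m => `|e m|) m0) => [//|m mm].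
  have k9 := m0P _ mm; rewrite ler_pdivlMr // -(@ler_pM2l _ m.+1%:R) // mulrA.
  rewrite -[X in X * `| _ |]normr_nat -normrM e1 normrM normrN -natr1.
  have := normr_ge0 (e m); have := normr_ge0 kappa; nra.
have c10 : 0 <= c1 by have := C1 0%N; rewrite expr0 divr1; apply: le_trans.
have c20 : 0 <= c2 by have := C2 0%N; rewrite expr0 divr1; apply: le_trans.
have qup m : `|q m| <= m.+1%:R * (c1 * c2 / 8 ^+ m).
  apply: le_trans (ler_norm_sum _ _ _) _.
  have -> : m.+1%:R * (c1 * c2 / 8 ^+ m) = \sum_(i < m.+1) c1 * c2 / 8 ^+ m.
    by rewrite sumr_const card_ord mulr_natl.
  apply: ler_sum => i _; rewrite normrM (ger0_norm (w0 _)).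
  have im : (i <= m)%N by rewrite -ltnS.
  apply: le_trans (ler_pM (w0 _) (normr_ge0 _) (C1 _) (C2 _)) _.
  have -> : (8 : R) ^+ m = 8 ^+ i * 8 ^+ (m - i) by rewrite -exprD subnKC.
  by rewrite invfM mulrACA.
have two k : (k%:R : R) <= 2 ^+ k by rewrite -natrX ler_nat ltnW // ltn_expl.
have main m : 2 ^+ m * (a * w 0%N) <= c1 * c2.
  have p2 : (0 : R) < 2 ^+ m by rewrite exprn_gt0.
  apply: le_trans (ler_wpM2l (ltW p2) (qlow m)) _.
  apply: le_trans (ler_wpM2l (ltW p2) (ler_wpM2l (ler0n _ _) (qup m.+1))) _.
  have c12 : 0 <= c1 * c2 by rewrite mulr_ge0.
  have t1 := two m.+1; have t2 := two m.+2.
  have p8 : (0 : R) < 8 ^+ m.+1 by rewrite exprn_gt0.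
  have e8 : (8 : R) ^+ m.+1 = 2 ^+ m * (2 ^+ m.+1 * 2 ^+ m.+2).
    have -> : (8 : R) = 2 ^+ 3 by ring.
    by rewrite -exprM -!exprD; congr (2 ^+ _); ring.
  have -> : 2 ^+ m * (m.+1%:R * (m.+2%:R * (c1 * c2 / 8 ^+ m.+1))) =
     c1 * c2 * ((2 ^+ m * (m.+1%:R * m.+2%:R)) / 8 ^+ m.+1).
    by move: (8 ^+ m.+1)^-1 (m.+1%:R) (m.+2%:R) => *; ring.
  rewrite -[leRHS]mulr1 ler_wpM2l // ler_pdivrMr // mul1r e8 (ler_pM2l p2).
  exact: ler_pM.
have := upper_nthrootP (leqnn (Num.bound (c1 * c2 / (a * w 0%N)))).
by rewrite ltr_pdivrMr ?mulr_gt0 // ltNge main.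
Qed.

End Recurrence.

Section Scaling.
Context {R : realType} {n : nat}.
Local Notation C := R[i].
Local Notation Cn := 'rV[C]_n.
Implicit Types (h z w v : Cn) (c : C) (F : Cn -> nat -> C) (E : Cn -> C) (j : 'I_n).

Lemma l2derM E F z (e : 'I_n -> C) d : l2 (F z) -> schol E z e -> l2der F z d ->
  l2der (fun w k => E w * F w k) z (fun j k => e j * F z k + E z * d j k).
Proof.
move=> lF HE HF; have [ld HFd] := HF.
split=> [j|eps eps0]; first by apply: l2D; exact: l2Z.
have [t1 t10 T1] := l2der_lip lF HF.
pose S := \sum_j nrm (d j); pose L := \sum_j normc (e j) + 1.
have S0 : 0 <= S by apply: sumr_ge0 => j _; exact: nrm_ge0.
have Se0 : 0 <= \sum_j normc (e j) by apply: sumr_ge0 => j _; exact: normc_ge0.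
pose M := normc (E z) + L + nrm (F z) + L * S + 1.
have M0 : 0 < M.
  have := normc_ge0 (E z); have := nrm_ge0 (F z); have : 0 <= L * S by rewrite mulr_ge0 // addr_ge0.
  rewrite /M /L; lra.
have q0 : 0 < eps / M by rewrite divr_gt0.
have [t2 t20 T2] := HE _ q0; have [t3 t30 T3] := HFd _ q0; have [t4 t40 T4] := HE _ ltr01.
exists (Num.min (Num.min t2 t3) (Num.min t4 (Num.min 1 (eps / M)))) => [|h].
  by rewrite !lt_min t20 t30 t40 ltr01 q0.
rewrite !lt_min => /andP[/andP[h2 h3] /andP[h4 /andP[h5 h6]]].
have [lh NF] := T3 _ h3; split; first exact: l2Z.
have lip : normc (E (z + h) - E z) <= L * nv h.
  have -> : E (z + h) - E z = (E (z + h) - E z - \sum_j h 0 j * e j) + \sum_j h 0 j * e j by ring.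
  apply: le_trans (normcD _ _) _; rewrite /L mulrDl addrC; apply: lerD; last exact: T4.
  apply: le_trans (normc_sum _ _ _) _; rewrite mulr_suml; apply: ler_sum => j _.
  by rewrite normcM mulrC ler_wpM2l ?normc_ge0 // nv_coord.
have Eh : normc (E (z + h)) <= normc (E z) + L.
  have -> : E (z + h) = E z + (E (z + h) - E z) by ring.
  apply: le_trans (normcD _ _) _; rewrite lerD2l; apply: le_trans lip _.
  by rewrite -[leRHS]mulr1 ler_wpM2l ?addr_ge0 // ltW.
have lsum : l2 (fun k => \sum_j h 0 j * d j k) by apply: l2_sum => j; exact: l2Z.
have nsum : nrm (fun k => \sum_j h 0 j * d j k) <= S * nv h.
  apply: le_trans (nrm_sum _ _) _ => [j|]; first exact: l2Z.
  rewrite mulr_suml; apply: ler_sum => j _; by rewrite nrmZ // mulrC ler_wpM2l ?nrm_ge0 // nv_coord.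
have -> : (fun k => E (z + h) * F (z + h) k - E z * F z k - \sum_j h 0 j * (e j * F z k + E z * d j k)) =
  (fun k => E (z + h) * (F (z + h) k - F z k - \sum_j h 0 j * d j k) +
    ((E (z + h) - E z - \sum_j h 0 j * e j) * F z k + (E (z + h) - E z) * \sum_j h 0 j * d j k)).
  apply/funext => k.
  have -> : \sum_j h 0 j * (e j * F z k + E z * d j k) = (\sum_j h 0 j * e j) * F z k + E z * \sum_j h 0 j * d j k.
    rewrite mulr_suml mulr_sumr -big_split; apply: eq_bigr => j _ /=.
    by rewrite mulrDr !mulrA (mulrC (E z)).
  by move: (\sum_j _) (\sum_j _) => *; ring.
have lr : l2 (fun k => F (z + h) k - F z k - \sum_j h 0 j * d j k) by do 2![apply: l2B => //].
have l1 := @l2Z R (E (z + h)) _ lr.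
have l2' := @l2Z R (E (z + h) - E z - \sum_j h 0 j * e j) _ lF.
have l3 := @l2Z R (E (z + h) - E z) _ lsum.
apply: le_trans (nrmD l1 (l2D l2' l3)) _.
apply: le_trans (lerD (lexx _) (nrmD l2' l3)) _.
rewrite !nrmZ //.
have nh := nv_ge0 h.
have b1 : normc (E (z + h)) * nrm (fun k => F (z + h) k - F z k - \sum_j h 0 j * d j k) <= (normc (E z) + L) * (eps / M * nv h).
  by apply: ler_pM; rewrite ?normc_ge0 ?nrm_ge0.
have b2 : normc (E (z + h) - E z - \sum_j h 0 j * e j) * nrm (F z) <= eps / M * nv h * nrm (F z).
  by rewrite ler_wpM2r ?nrm_ge0 // T2.
have b3 : normc (E (z + h) - E z) * nrm (fun k => \sum_j h 0 j * d j k) <= L * S * (eps / M * nv h).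
  apply: le_trans (ler_pM (normc_ge0 _) (nrm_ge0 _) lip nsum) _.
  rewrite mulrACA ler_wpM2l ?mulr_ge0 ?addr_ge0 // ler_wpM2r // ltW //.
apply: le_trans (lerD b1 (lerD b2 b3)) _.
have -> : eps * nv h = M * (eps / M * nv h) by rewrite mulrA mulrCA mulfV ?mulr1 // gt_eqF.
have p : 0 <= eps / M * nv h by rewrite mulr_ge0 // ltW.
rewrite /M; move: p; move: (eps / M * nv h) => p p0; nra.
Qed.

End Scaling.

Section RadialFamily.
Context {R : realType}.
Local Notation C := R[i].
Local Notation C1 := 'rV[C]_1.

Lemma nv1 (h : C1) : nv h = normc (h 0 0).
Proof. by rewrite /nv /sqnorm big_ord1 sqrtr_sqr ger0_norm ?normc_ge0. Qed.

Lemma sqnorm1 (h : C1) : (sqnorm h)%:C = h 0 0 * (h 0 0)^*.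
Proof. by rewrite sqnormC big_ord1. Qed.

Lemma open_ball0 (r : R) : open [set z : C1 | nv z < r].
Proof.
rewrite openE => z /= zr; apply/nbhs_nvP; exists (r - nv z); first by rewrite subr_gt0.
by move=> h hr /=; apply: le_lt_trans (nvD _ _) _; lra.
Qed.

Lemma schol_cdiff (phi : C -> C) (z : C1) d : cdiff phi (z 0 0) d -> schol (fun w : C1 => phi (w 0 0)) z (fun=> d).
Proof.
move=> H e /H[t t0 T]; exists t => // h; rewrite nv1 big_ord1 => /T.
by rewrite mxE mulrC.
Qed.

(* d dbar of |F|^2 = G_0 (|z|^2) is |F'|^2 = G_1 (|z|^2) + |z|^2 G_2 (|z|^2), which is again radial. *)
Lemma radial_family_ge0 (r : R) m : 0 < r -> forall (F : nat -> C1 -> nat -> C) (G : nat -> R -> R),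
  (forall k (z : C1), nv z < r -> l2 (F k z)) ->
  (forall k (z : C1), nv z < r -> l2der (F k) z (fun=> F k.+1 z)) ->
  (forall k (z : C1), nv z < r -> is_derive (sqnorm z) 1 (G k) (G k.+1 (sqnorm z))) ->
  (forall z : C1, nv z < r -> l2normsq (F 0%N z) = G 0%N (sqnorm z)) -> 0 <= G m 0.
Proof.
move=> r0; elim: m => [|m IH] F G lF dF dG FG.
  have b0 : nv (0 : C1) < r by rewrite nv0.
  have := FG _ b0; rewrite /sqnorm big_ord1 mxE normc0 expr0n /= => <-.
  by apply: l2normsq_ge0; exact: lF.
(* The k-th derivative of G_1 + t G_2; at t = 0 it is (k+1) G_(k+1). *)
pose G' k t := k.+1%:R * G k.+1 t + t * G k.+2 t.
have : 0 <= G' m 0.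
  apply: (IH (fun k => F k.+1) G') => [k z zr|k z zr|k z zr|z zr].
  - exact: lF.
  - exact: dF.
  - have D := is_derive_add (is_derive_mul (is_derive_const (sqnorm z) (k.+1%:R : R)) (dG k.+1 _ zr))
      (is_derive_mul (@is_derive_id R R (sqnorm z) 1) (dG k.+2 _ zr)).
    apply: (is_derive_eq D); rewrite /G' -[k.+2%:R]natr1.
    ring.
  - have oB := @open_ball0 r.
    have := @ddbar_radial R 1 _ (fun w => (l2normsq (F 0%N w))%:C) (G 0%N) (G 1%N) (G 2%N (sqnorm z)) 0 0 z oB zr.
    move=> H; have {H} := H (fun w wr => congr1 _ (FG w wr)) (fun w wr => dG 0%N w wr) (dG 1%N z zr).
    have E (w : C1) : nv w < r -> dzb 0 (fun w => (l2normsq (F 0%N w))%:C) w = ip (F 0%N w) (F 1%N w).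
      move=> wr; rewrite (dzb_open _ oB wr (g := fun w => ip (F 0%N w) (F 0%N w))).
        exact: (fre_dzb _ (fre_ip (lF _ _ wr) (lF _ _ wr) (dF _ _ wr) (dF _ _ wr))).
      by move=> u ur; rewrite ip_sq //; exact: lF.
    rewrite (dz_open _ oB zr E).
    rewrite (fre_dz _ (fre_ip (lF _ _ zr) (lF _ _ zr) (dF _ _ zr) (dF _ _ zr))) ip_sq; last exact: lF.
    rewrite /dlt eqxx mulr1 mulrC [_^* * _]mulrC -sqnorm1 -rcM -rcD /G' mul1r => H.
    have := congr1 (@complex.Re R) H; exact.
by rewrite /G' mul0r addr0 pmulr_rge0.
Qed.

End RadialFamily.

(* The derivatives of W (t) = k0 e^(c t) (x0 + t)^-a: since (x0 + t) W' = (c (x0 + t) - a) W, they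
   satisfy (x0 + t) W_(k+1) = (c (x0 + t) - a - k) W_k + c k W_(k-1). *)
Section PotentialChain.
Context {R : realType}.
Variables (c a x0 k0 : R).

Fixpoint chain2 k (t : R) : R * R :=
  if k is k'.+1 then
    let: (u, v) := chain2 k' t in (((c * (x0 + t) - a - k'%:R) * u + c * k'%:R * v) / (x0 + t), u)
  else (k0 * expR (c * t - a * ln (x0 + t)), 0).

Definition chain k t := (chain2 k t).1.

Lemma chain2E k t : chain2 k.+1 t = (chain k.+1 t, chain k t).
Proof. by rewrite /chain /=; case: (chain2 k t). Qed.

Lemma chainS k t : chain k.+2 t =
  ((c * (x0 + t) - a - k.+1%:R) * chain k.+1 t + c * k.+1%:R * chain k t) / (x0 + t).
Proof. by rewrite {1}/chain -[chain2 k.+2 t]/(let: (u, v) := chain2 k.+1 t in _) chain2E. Qed.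

Lemma chain1 t : chain 1 t = (c * (x0 + t) - a) * chain 0 t / (x0 + t).
Proof. by rewrite /chain /= subr0 !mulr0 addr0. Qed.

Lemma is_derive_shift (t : R) : is_derive t 1 (fun s : R => x0 + s) (1 : R).
Proof.
by apply: is_derive_eq (is_derive_add (is_derive_const t x0) (@is_derive_id R R t 1)) _; rewrite add0r.
Qed.

Lemma is_derive_chain k t : 0 < x0 + t -> is_derive t 1 (chain k) (chain k.+1 t).
Proof.
move=> xt; have x_neq0 : x0 + t != 0 by rewrite gt_eqF.
have dX := is_derive_shift t.
have dV : is_derive t 1 (fun s => (x0 + s)^-1) (- 1 / (x0 + t) ^+ 2) by exact: is_derive_inv.
have d0 : is_derive t 1 (chain 0) (chain 1 t).
  have dln : is_derive t 1 (fun s => ln (x0 + s)) ((x0 + t)^-1 * 1).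
    exact: (is_derive_comp (is_derive1_ln xt) dX).
  have din := is_derive_add (is_derive_mul (is_derive_const t c) (@is_derive_id R R t 1))
     (is_derive_opp (is_derive_mul (is_derive_const t a) dln)).
  have D := is_derive_mul (is_derive_const t k0) (is_derive_comp (is_derive_expR _) din).
  apply: (is_derive_eq D); rewrite chain1 /chain /=; move: (expR _) => e; by field.
suff H : is_derive t 1 (chain k) (chain k.+1 t) /\ is_derive t 1 (chain k.+1) (chain k.+2 t) by case: H.
elim: k => [|k [IH1 IH2]]; split=> //.
- have D := is_derive_mul (is_derive_mul (is_derive_add (is_derive_mul (is_derive_const t c) dX) (is_derive_const t (- a))) d0) dV.
  have -> : chain 1 = fun s => (c * (x0 + s) - a) * chain 0 s * (x0 + s)^-1 by apply/funext => s; rewrite chain1.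
  apply: (is_derive_eq D); rewrite chainS chain1; move: (chain 0 t) => u; by field.
- have D := is_derive_mul (is_derive_add
    (is_derive_mul (is_derive_add (is_derive_mul (is_derive_const t c) dX) (is_derive_const t (- a - k.+1%:R))) IH2)
    (is_derive_mul (is_derive_const t (c * k.+1%:R)) IH1)) dV.
  have -> : chain k.+2 = fun s => ((c * (x0 + s) + (- a - k.+1%:R)) * chain k.+1 s + c * k.+1%:R * chain k s) * (x0 + s)^-1.
    by apply/funext => s; rewrite chainS addrA.
  apply: (is_derive_eq D); rewrite [in RHS]chainS chainS -[k.+2%:R]natr1.
  move: (k.+1%:R) (chain k t) (chain k.+1 t) => m u v; by field.
Qed.

(** With t = x0 s the function becomes a multiple of e^(kappa s) (1 + s)^-a, kappa = c x0. Its
    Taylor coefficients chain m 0 * x0^m / m! satisfy the recurrence of [no_nonneg_coefficients]. *)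
Lemma chain_sign : 0 < a -> 0 < x0 -> 0 < k0 -> exists m, chain m 0 < 0.
Proof.
move=> a0 xp kp; apply/not_existsP => H.
have chain_ge0 m : 0 <= chain m 0 by rewrite leNgt; apply/negP; exact: H.
apply: (@no_nonneg_coefficients R a (c * x0) (fun m => chain m 0 * x0 ^+ m / m`!%:R) a0).
- by rewrite expr0 fact0 divr1 mulr1 /chain /= mulr_gt0 ?expR_gt0.
- by move=> m; rewrite mulr_ge0 ?invr_ge0 ?ler0n // mulr_ge0 // exprn_ge0 // ltW.
have xN : x0 != 0 by rewrite gt_eqF.
case=> [|m].
  by rewrite /= mulr0 addr0 expr0 fact0 !divr1 mulr1 chain1 addr0 expr1; field.
rewrite /= chainS addr0 !factS !natrM !exprS !invfM.
have f0 : (m`!%:R : R) != 0 by rewrite pnatr_eq0 -lt0n fact_gt0.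
have m1 : (m.+1%:R : R) != 0 by rewrite pnatr_eq0.
have m2 : (m.+2%:R : R) != 0 by rewrite pnatr_eq0.
move: f0 m1 m2; move: (m`!%:R) (m.+1%:R) (m.+2%:R) (chain m 0) (chain m.+1 0) (x0 ^+ m) => *; field.
by apply/and4P.
Qed.

End PotentialChain.

Section Slice.
Context {R : realType}.
Local Notation C := R[i].
Local Notation C1 := 'rV[C]_1.

Definition cv (t : C) : C1 := const_mx t.

Lemma cvE t i j : cv t i j = t. Proof. by rewrite mxE. Qed.
Lemma cv_row (z : C1) : cv (z 0 0) = z.
Proof. by apply/rowP => j; rewrite cvE (ord1 j). Qed.
Lemma cvD s t : cv (s + t) = cv s + cv t.
Proof. by apply/rowP => j; rewrite !mxE. Qed.
Lemma nv_cv t : nv (cv t) = normc t. Proof. by rewrite nv1 cvE. Qed.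

Lemma fre_cdiff (f : C1 -> C) t A : fre f (cv t) A (fun=> 0) -> cdiff (fun s => f (cv s)) t (A 0).
Proof.
move=> H e /H[d d0 D]; exists d => // h hd.
have := D (cv h); rewrite nv_cv cvD => /(_ hd).
by rewrite /wlin big_ord1 mulr0 addr0 cvE mulrC.
Qed.

Lemma fre_constant (f : C1 -> C) (r : R) : (forall z : C1, nv z < r -> fre f z (fun=> 0) (fun=> 0)) ->
  forall z : C1, nv z < r -> f z = f 0.
Proof.
move=> H z zr.
have D (t : R) : 0 <= t <= 1 -> cder (fun s : R => f (0 + s%:C *: z)) t 0.
  move=> /andP[t0 t1].
  have -> : (0 : C) = wlin (fun=> 0) (fun=> 0) z by rewrite /wlin big1 // => j _; rewrite !mulr0 addr0.
  apply: fre_cder; apply: H; rewrite add0r; exact: le_lt_trans (nv_seg _ t0 t1) zr.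
have N0 : normc (0 : C) <= 0 by rewrite normc0.
have := @cder_mvt R (fun s => f (0 + s%:C *: z)) (fun=> 0) 0 D (fun _ _ => N0).
rewrite !add0r scale1r scale0r.
by rewrite le_eqVlt ltNge normc_ge0 orbF normc_eq0 subr_eq0 => /eqP.
Qed.

Lemma fre_sqnorm1 (z : C1) : fre (fun w => (sqnorm w)%:C) z (fun=> (z 0 0)^*) (fun=> z 0 0).
Proof.
have -> : (fun w : C1 => (sqnorm w)%:C) = (fun w => w 0 0 * (w 0 0)^*).
  by apply/funext => w; rewrite sqnorm1.
apply: fre_eq (freM (fre_coord 0 z) (fre_conj (fre_coord 0 z))) _ _ => j;
  rewrite (ord1 j) eqxx ?rmorph1 ?rmorph0; ring.
Qed.

(* On a line orthogonal to p the metric has a primitive c - a x0 / (x0 + s)^2, s = |z|^2, so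
   log |F|^2 - (c s - a log (x0 + s)) is harmonic; it is removed by a holomorphic factor of F. *)
Lemma slice_contradiction (c a x0 r : R) (F : nat -> C1 -> nat -> C) : 0 < a -> 0 < x0 -> 0 < r ->
  (forall k (z : C1), nv z < r -> l2 (F k z)) ->
  (forall k (z : C1), nv z < r -> l2der (F k) z (fun=> F k.+1 z)) ->
  (forall z : C1, nv z < r -> 0 < l2normsq (F 0%N z)) ->
  ~ (forall z : C1, nv z < r ->
    (ip (F 0%N z) (F 0%N z) * ip (F 1%N z) (F 1%N z) - ip (F 1%N z) (F 0%N z) * ip (F 0%N z) (F 1%N z)) / ip (F 0%N z) (F 0%N z) ^+ 2
    = (c - a * x0 / (x0 + sqnorm z) ^+ 2)%:C).
Proof.
move=> a0 x00 r0 lF dF KF HF.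
pose K z := ip (F 0%N z) (F 0%N z); pose P z := ip (F 1%N z) (F 0%N z).
pose P' z := ip (F 0%N z) (F 1%N z).
have PJ z : nv z < r -> (P z)^* = P' z by move=> zr; rewrite /P /P' -ipC //; exact: lF.
have KE z : nv z < r -> K z = (l2normsq (F 0%N z))%:C by move=> zr; rewrite /K ip_sq //; exact: lF.
have KJ z : nv z < r -> (K z)^* = K z by move=> zr; rewrite KE // conjRC.
have K0 z : nv z < r -> K z != 0 by move=> zr; rewrite KE // rc_eq0 gt_eqF // KF.
have HK z : nv z < r -> fre K z (fun=> P z) (fun=> P' z).
  by move=> zr; apply: fre_ip; [exact: lF|exact: lF|exact: dF|exact: dF].
have HP z : nv z < r -> fre P z (fun=> ip (F 2%N z) (F 0%N z)) (fun=> ip (F 1%N z) (F 1%N z)).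
  by move=> zr; apply: fre_ip; [exact: lF|exact: lF|exact: dF|exact: dF].
have X0 (z : C1) : 0 < x0 + sqnorm z by rewrite ltr_wpDr // sqnorm_ge0.
(* The derivative of c s - a log (x0 + s) with respect to s. *)
pose U (z : C1) := (c - a / (x0 + sqnorm z))%:C.
have HU (z : C1) : fre U z (fun=> (a / (x0 + sqnorm z) ^+ 2)%:C * (z 0 0)^*) (fun=> (a / (x0 + sqnorm z) ^+ 2)%:C * z 0 0).
  apply: (@fre_real R 1 (@sqnorm R 1) (fun t => c - a / (x0 + t))); first exact: fre_sqnorm1.
  have xn : x0 + sqnorm z != 0 by rewrite gt_eqF.
  have D := is_derive_add (is_derive_const (sqnorm z) c) (is_derive_opp (is_derive_mul (is_derive_const _ a) (is_derive_inv xn (is_derive_shift x0 _)))).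
  by apply: (is_derive_eq D); field.
(* The z-derivative of log |F|^2 - (c s - a log (x0 + s)); the hypothesis on the metric says that it
   is holomorphic. *)
pose eta (z : C1) := P z * (K z)^-1 - U z * (z 0 0)^*.
have etaJ z : nv z < r -> (eta z)^* = P' z * (K z)^-1 - U z * z 0 0.
  by move=> zr; rewrite /eta cjB !cjM cjV PJ // KJ // conjRC conjCK.
have Heta z : nv z < r -> exists A, fre eta z A (fun=> 0).
  move=> zr; exists (fun j => ip (F 2%N z) (F 0%N z) * (K z)^-1 + P z * (- P z / K z ^+ 2) -
    ((a / (x0 + sqnorm z) ^+ 2)%:C * (z 0 0)^* * (z 0 0)^* + U z * 0)).
  have H := freB (freM (HP z zr) (fre_inv (K0 z zr) (HK z zr))) (freM (HU z) (fre_conj (fre_coord 0 z))).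
  apply: (fre_eq H) => j; first by rewrite rmorph0.
  rewrite (ord1 j) eqxx rmorph1.
  have := HF z zr; rewrite -/(K z) -/(P z) -/(P' z).
  have -> : c - a * x0 / (x0 + sqnorm z) ^+ 2 = (c - a / (x0 + sqnorm z)) + a / (x0 + sqnorm z) ^+ 2 * sqnorm z.
    have := X0 z; move: (sqnorm z) => s s0; have sn : x0 + s != 0 by rewrite gt_eqF.
    by field.
  rewrite rcD rcM sqnorm1 -/(U z) => H1.
  have -> : ip (F 1%N z) (F 1%N z) / K z + P z * (- P' z / K z ^+ 2) =
      (K z * ip (F 1%N z) (F 1%N z) - P z * P' z) / K z ^+ 2.
    move: (K0 z zr); move: (K z) (P z) (P' z) (ip _ _) => *; by field.
  rewrite H1; move: (U z) ((a / _)%:C) (z 0 0) ((z 0 0)^*) => *; ring.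
have cet t : normc t < r -> exists d, cdiff (fun s => eta (cv s)) t d.
  by rewrite -nv_cv => /Heta[A /fre_cdiff HA]; exists (A 0).
(* The square of half side q lies in the disc of radius r, since |t| <= |Re t| + |Im t| <= 2 q <
   r. *)
pose q := r / 3; have q0 : 0 < q by rewrite divr_gt0.
have [h Hh] : exists h : C -> C, forall t, - q < complex.Re t < q -> - q < complex.Im t < q -> cdiff h t (eta (cv t)).
  apply: (@primitive R (- q) q (- q) q (fun s => eta (cv s))) => t /andP[].
  rewrite -!ler_norml => t1 t2; apply: cet; apply: le_lt_trans (normc_le_ReIm t) _.
  by apply: le_lt_trans (lerD t1 t2) _; rewrite /q; lra.
have qr : q < r by rewrite /q; lra.
have Hh' (z : C1) : nv z < q -> cdiff h (z 0 0) (eta z).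
  rewrite nv1 => zq; rewrite -{2}(cv_row z); apply: Hh.
    by rewrite -ltr_norml; apply: le_lt_trans (Re_le_normc _) zq.
  by rewrite -ltr_norml; apply: le_lt_trans (Im_le_normc _) zq.
pose E t := cexp (- h t).
have HE (z : C1) : nv z < q -> cdiff E (z 0 0) (- (eta z * E (z 0 0))).
  move=> zq; have := @cdiff_comp R cexp (fun t => - h t) _ _ _ (cdiff_cexp (- h (z 0 0))) (cdiffN (Hh' z zq)).
  by rewrite /E mulrN [eta z * _]mulrC.
pose lex t := expR (- (c * t - a * ln (x0 + t))).
(* |E F|^2 divided by e^(c s) (x0 + s)^-a. As E has the logarithmic derivative - eta, both Wirtinger
   derivatives of T vanish, so E F is a lift with exactly radial norm. *)
pose T (z : C1) := E (z 0 0) * (E (z 0 0))^* * K z * (lex (sqnorm z))%:C.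
have HT (z : C1) : nv z < q -> fre T z (fun=> 0) (fun=> 0).
  move=> zq; have zr := lt_trans zq qr.
  have FE : fre (fun w : C1 => E (w 0 0)) z (fun=> - (eta z * E (z 0 0))) (fun=> 0).
    apply: fre_eq (fre_holo (HE z zq) (fre_coord 0 z)) _ _ => j; rewrite ?mulr0 //.
    by rewrite (ord1 j) eqxx mulr1.
  have FL : fre (fun w => (lex (sqnorm w))%:C) z (fun=> (- (c - a / (x0 + sqnorm z)) * lex (sqnorm z))%:C * (z 0 0)^*)
      (fun=> (- (c - a / (x0 + sqnorm z)) * lex (sqnorm z))%:C * z 0 0).
    apply: fre_real; first exact: fre_sqnorm1.
    have dln := is_derive_comp (is_derive1_ln (X0 z)) (is_derive_shift x0 (sqnorm z)).
    have din := is_derive_opp (is_derive_add (is_derive_mul (is_derive_const (sqnorm z) c) (@is_derive_id R R (sqnorm z) 1))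
      (is_derive_opp (is_derive_mul (is_derive_const (sqnorm z) a) dln))).
    have D := is_derive_comp (is_derive_expR _) din.
    by apply: (is_derive_eq D); rewrite /lex; move: (expR _) (_^-1) => *; ring.
  have H := freM (freM (freM FE (fre_conj FE)) (HK z zr)) FL.
  rewrite rcM rcN -/(U z) in H.
  apply: (fre_eq H) => j; [rewrite rmorph0 /eta|rewrite cjN cjM etaJ //].
    move: (K0 z zr); move: (K z) (P z) (P' z) (U z) ((lex _)%:C) (z 0 0) ((z 0 0)^*) (E (z 0 0)) ((E (z 0 0))^*) => *.
    by field.
  move: (K0 z zr); move: (K z) (P z) (P' z) (U z) ((lex _)%:C) (z 0 0) ((z 0 0)^*) (E (z 0 0)) ((E (z 0 0))^*) => *.
  by field.
have Tc := fre_constant HT.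
pose G (z : C1) k := E (z 0 0) * F 0%N z k.
have lG (z : C1) : nv z < q -> l2 (G z) by move=> zq; apply: l2Z; apply: lF; exact: lt_trans qr.
have GN (z : C1) : nv z < q -> (l2normsq (G z))%:C = E (z 0 0) * (E (z 0 0))^* * K z.
  move=> zq; have zr := lt_trans zq qr; have l0 := lF 0%N z zr.
  by rewrite -ip_sq; [rewrite ipZl // ?ipZr // ?mulrA //; exact: l2Z|exact: lG].
have z0q : nv (0 : C1) < q by rewrite nv0.
pose k0 := l2normsq (G 0) * lex 0.
have s0 : sqnorm (0 : C1) = 0 by rewrite /sqnorm big_ord1 mxE normc0 expr0n.
have k00 : 0 < k0.
  rewrite mulr_gt0 ?expR_gt0 //; have : (0 : C) < (l2normsq (G 0))%:C.
    rewrite GN // KE; last exact: lt_trans qr.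
    rewrite -normc_sqrC -rcM ltcR.
    apply: mulr_gt0; last by apply: KF; exact: lt_trans qr.
    by apply: exprn_gt0; rewrite normc_gt0; exact: cexp_neq0.
  by rewrite ltcR.
have GE (z : C1) : nv z < q -> l2normsq (G z) = chain c a x0 k0 0 (sqnorm z).
  move=> zq; have := Tc z zq; rewrite /T -!GN // s0 -!rcM => H.
  have {}H : l2normsq (G z) * lex (sqnorm z) = k0 := congr1 (@complex.Re R) H.
  rewrite /chain /= -H -mulrA /lex expRN mulVf ?mulr1 // gt_eqF ?expR_gt0 //.
have hG : l2_holomorphic [set z : C1 | nv z < q] G.
  apply/l2_holomorphicP; first exact: open_ball0.
  split=> [z /= zq|z /= zq]; first exact: lG.
  have zr := lt_trans zq qr.
  exists (fun j k => - (eta z * E (z 0 0)) * F 0%N z k + E (z 0 0) * F 1%N z k).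
  have := l2derM (lF 0%N z zr) (schol_cdiff (HE z zq)) (dF 0%N z zr); exact.
have [GF [GF0 lGF dGF]] := l2_derivatives (@open_ball0 R q) hG.
have [m] := @chain_sign R c a x0 k0 a0 x00 k00; rewrite ltNge => /negP; apply.
apply: (@radial_family_ge0 R q m q0 GF (chain c a x0 k0)) => //.
- by move=> k z zq; apply: is_derive_chain.
- by move=> z zq; rewrite GF0 // GE.
Qed.

End Slice.

Section OrthogonalSlice.
Context {R : realType} {n : nat}.
Local Notation C := R[i].
Local Notation Cn := 'rV[C]_n.

(** As v is a unit vector orthogonal to p, |p + zeta v|^2 = x0 + s with x0 = |p|^2 and s = |zeta|^2.
    The metric on the slice is then c - a / (x0 + s) + a s / (x0 + s)^2 = c - a x0 / (x0 + s)^2. *)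
Lemma no_positive_mass (W : set Cn) (f : Cn -> nat -> C) (p v : Cn) (c a : R) : open W -> W p ->
  l2_holomorphic W f -> (forall z, W z -> f z <> fun=> 0) ->
  (forall z i j, W z -> dz i (dzb j (fun w => (fubini_study_potential (f w))%:C)) z =
    (c - a / sqnorm z)%:C * dlt i j + (a / sqnorm z ^+ 2)%:C * ((z 0 i)^* * z 0 j)) ->
  0 < sqnorm p -> sqnorm v = 1 -> \sum_j v 0 j * (p 0 j)^* = 0 -> ~ 0 < a.
Proof.
move=> oW Wp hf fN0 Hg p0 v1 vp a0.
have [lf exD] := (l2_holomorphicP f oW).1 hf.
pose D z : 'I_n -> nat -> C := xget (fun=> (fun=> 0)) [set d | l2der f z d].
have HD z : W z -> l2der f z (D z).
  by move=> /exD[d hd]; rewrite /D; case: xgetP => [y _ //|/(_ d)].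
pose l (z : 'rV[C]_1) : Cn := p + z 0 0 *: v.
pose S : set 'rV[C]_1 := [set z | W (l z)].
have oS : open S by exact: open_slice.
have S0 : S 0 by rewrite /S /l /= mxE scale0r addr0.
have [r r0 Sr] := open_nvP oS S0.
have {}Sr (z : 'rV[C]_1) : nv z < r -> S z by move=> /Sr; rewrite add0r.
pose D' (z : 'rV[C]_1) (i : 'I_1) k := \sum_j v 0 j * D (l z) j k.
have HD' (z : 'rV[C]_1) : S z -> l2der (fun z => f (l z)) z (D' z).
  by move=> Sz; exact: slice_l2der (lf _ Sz) (HD _ Sz).
have hS : l2_holomorphic S (fun z => f (l z)).
  apply/l2_holomorphicP => //; split=> [z|z Sz]; first exact: lf.
  by exists (D' z); exact: HD'.
have [F [F0 lF dF]] := l2_derivatives oS hS.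
have FN0 (z : 'rV[C]_1) : S z -> F 0%N z <> fun=> 0 by rewrite F0; exact: fN0.
have K0 (z : 'rV[C]_1) : S z -> 0 < l2normsq (F 0%N z).
  by move=> Sz; exact: (@lift_gt0 R 1 S (F 0%N) (lF 0%N) FN0).
apply: (@slice_contradiction R c a (sqnorm p) r F) => // [k z /Sr|k z /Sr|z /Sr|z /Sr Sz].
- exact: lF.
- exact: dF.
- exact: K0.
rewrite -(@dz_dzb_fubini_study R 1 S (F 0%N) (fun z _ => F 1%N z) oS (lF 0%N) (dF 0%N) FN0 0 0 z Sz).
rewrite F0 (@dz_dzb_fubini_study R 1 S (fun z => f (l z)) D' oS _ HD' _ 0 0 z Sz); last 2 first.
- by move=> u /lf.
- by move=> u /fN0.
have [ld _] := HD _ Sz; have lz := lf _ Sz.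
have lD' : l2 (D' z 0) by apply: l2_sum => j; exact: l2Z.
have E1 u : l2 u -> ip (D' z 0) u = \sum_j v 0 j * ip (D (l z) j) u by move=> lu; rewrite ip_suml.
have E2 u : l2 u -> ip u (D' z 0) = \sum_j (v 0 j)^* * ip u (D (l z) j) by move=> lu; rewrite ip_sumr.
rewrite E1 // E1 // E2 //.
have -> : \sum_j v 0 j * ip (D (l z) j) (D' z 0) = \sum_i \sum_j v 0 i * (v 0 j)^* * ip (D (l z) i) (D (l z) j).
  apply: eq_bigr => i _; rewrite E2 // mulr_sumr; apply: eq_bigr => j _; by rewrite mulrA.
have -> : (\sum_i v 0 i * ip (D (l z) i) (f (l z))) * (\sum_j (v 0 j)^* * ip (f (l z)) (D (l z) j)) =
    \sum_i \sum_j v 0 i * (v 0 j)^* * (ip (D (l z) i) (f (l z)) * ip (f (l z)) (D (l z) j)).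
  rewrite mulr_suml; apply: eq_bigr => i _; rewrite mulr_sumr; apply: eq_bigr => j _; by rewrite mulrACA.
rewrite mulr_sumr -sumrB mulr_suml.
have T i : (ip (f (l z)) (f (l z)) * (\sum_j v 0 i * (v 0 j)^* * ip (D (l z) i) (D (l z) j)) -
    \sum_j v 0 i * (v 0 j)^* * (ip (D (l z) i) (f (l z)) * ip (f (l z)) (D (l z) j))) / ip (f (l z)) (f (l z)) ^+ 2 =
    \sum_j v 0 i * (v 0 j)^* * ((c - a / sqnorm (l z))%:C * dlt i j + (a / sqnorm (l z) ^+ 2)%:C * ((l z 0 i)^* * l z 0 j)).
  rewrite mulr_sumr -sumrB mulr_suml; apply: eq_bigr => j _.
  rewrite -(Hg _ i j Sz) (dz_dzb_fubini_study oW lf HD fN0) //.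
  move: ((ip (f (l z)) (f (l z)) ^+ 2)^-1) (ip (f (l z)) (f (l z))) (ip _ _) (ip _ _) (ip _ _) => *.
  move: (v 0 i) ((v 0 j)^*) => *; ring.
rewrite (eq_bigr _ (fun i _ => T i)).
have vv : \sum_j v 0 j * (v 0 j)^* = 1 by rewrite -sqnormC v1.
have lv : \sum_i v 0 i * (l z 0 i)^* = (z 0 0)^*.
  have -> : \sum_i v 0 i * (l z 0 i)^* = \sum_i v 0 i * (p 0 i)^* + (z 0 0)^* * \sum_i v 0 i * (v 0 i)^*.
    rewrite mulr_sumr -big_split; apply: eq_bigr => i _ /=; rewrite !mxE cjD cjM.
    move: (v 0 i) ((p 0 i)^*) ((z 0 0)^*) ((v 0 i)^*) => *; ring.
  by rewrite vp vv mulr1 add0r.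
have lz2 : sqnorm (l z) = sqnorm p + sqnorm z.
  have H : (sqnorm (l z))%:C = (sqnorm p + sqnorm z)%:C.
    rewrite rcD !sqnormC.
    have -> : \sum_j l z 0 j * (l z 0 j)^* = \sum_j p 0 j * (p 0 j)^* +
       ((z 0 0) * (\sum_j v 0 j * (p 0 j)^*) + (z 0 0)^* * (\sum_j v 0 j * (p 0 j)^*)^* + z 0 0 * (z 0 0)^* * \sum_j v 0 j * (v 0 j)^*).
      rewrite cj_sum !mulr_sumr -!big_split; apply: eq_bigr => i _ /=; rewrite !mxE !(cjD, cjM) conjCK.
      move: (v 0 i) ((p 0 i)^*) (p 0 i) (z 0 0) ((z 0 0)^*) ((v 0 i)^*) => *; ring.
    by rewrite vp vv rmorph0 !mulr0 !add0r mulr1 big_ord1.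
  exact: (congr1 (@complex.Re R) H).
have -> : \sum_i \sum_j v 0 i * (v 0 j)^* * ((c - a / sqnorm (l z))%:C * dlt i j + (a / sqnorm (l z) ^+ 2)%:C * ((l z 0 i)^* * l z 0 j))
  = (c - a / sqnorm (l z))%:C * (\sum_i v 0 i * (v 0 i)^*) +
    (a / sqnorm (l z) ^+ 2)%:C * ((\sum_i v 0 i * (l z 0 i)^*) * (\sum_i v 0 i * (l z 0 i)^*)^*).
  rewrite cj_sum mulr_suml !mulr_sumr -big_split; apply: eq_bigr => i _ /=.
  rewrite -(sum_delta i (fun j => v 0 i * (v 0 j)^*)) !mulr_sumr -big_split; apply: eq_bigr => j _ /=.
  rewrite cjM conjCK; move: (v 0 i) ((v 0 j)^*) (dlt i j) ((l z 0 i)^*) (l z 0 j) (_%:C) ((_ / _)%:C) => *; ring.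
rewrite vv lv conjCK [_^* * _]mulrC -sqnorm1 mulr1 -rcM -rcD lz2; congr (_%:C).
have : 0 < sqnorm p + sqnorm z by rewrite ltr_wpDr // sqnorm_ge0.
move: (sqnorm p) (sqnorm z) => s t /lt0r_neq0 st; by field.
Qed.

End OrthogonalSlice.

(** * The profile of a radial metric *)

Section RealSmooth.
Context {R : realType}.
Implicit Types (D E : set R) (f g u : R -> R) (m : nat) (t : R).

Definition ropen D : Prop := forall t, D t -> exists2 r : R, 0 < r & forall h : R, `|h| < r -> D (t + h).

(** The derivative is existential at each order, so the closure rules may exhibit any function that
    agrees with it on D. *)
Fixpoint rsm m D f : Prop :=
  if m is m'.+1 then exists f', (forall t, D t -> is_derive t 1 f (f' t)) /\ rsm m' D f' else True.

Lemma rsm_eq m D f g : ropen D -> (forall t, D t -> f t = g t) -> rsm m D g -> rsm m D f.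
Proof.
case: m => [//|m] oD fg [g' [dg H]]; exists g'; split=> // t Dt.
by have [r r0 Dr] := oD t Dt; apply: is_derive_near (dg t Dt); exists r => // h /Dr /fg.
Qed.

Lemma rsm_le m D f : rsm m.+1 D f -> rsm m D f.
Proof. by elim: m f => [//|m IH] f [f' [df /IH H]]; exists f'. Qed.

Lemma rsm_cst m D (a : R) : rsm m D (fun=> a).
Proof. by elim: m a => [//|m IH] a; exists (fun=> 0); split=> [t _|]; [exact: is_derive_const|exact: IH]. Qed.

Lemma rsm_id m D : rsm m D id.
Proof. by case: m => [//|m]; exists (fun=> 1); split=> [t _|]; [exact: is_derive_id|exact: rsm_cst]. Qed.

Lemma rsmD m D f g : rsm m D f -> rsm m D g -> rsm m D (fun t => f t + g t).
Proof.
elim: m f g => [//|m IH] f g [f' [df Hf]] [g' [dg Hg]]; exists (fun t => f' t + g' t).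
by split=> [t Dt|]; [apply: is_derive_add; [exact: df|exact: dg]|exact: IH].
Qed.

Lemma rsmM m D f g : rsm m D f -> rsm m D g -> rsm m D (fun t => f t * g t).
Proof.
elim: m f g => [//|m IH] f g Hf Hg; have := rsm_le Hf; have := rsm_le Hg => Hg0 Hf0.
move: Hf Hg => [f' [df Hf]] [g' [dg Hg]]; exists (fun t => f' t * g t + f t * g' t).
by split=> [t Dt|]; [apply: is_derive_mul; [exact: df|exact: dg]|apply: rsmD; exact: IH].
Qed.

Lemma rsm_inv m D f : (forall t, D t -> f t != 0) -> rsm m D f -> rsm m D (fun t => (f t)^-1).
Proof.
move=> f0; elim: m => [//|m IH] Hf; have H := IH (rsm_le Hf).
case: Hf => f' [df Hf]; exists (fun t => -1 * f' t * ((f t)^-1 * (f t)^-1)); split=> [t Dt|].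
  apply: (is_derive_eq (is_derive_inv (f0 t Dt) (df t Dt))); have := f0 t Dt.
  by move: (f t) (f' t) => *; field.
by apply: rsmM; [apply: rsmM => //; exact: rsm_cst|exact: rsmM].
Qed.

Lemma rsm_comp m D E f u : (forall t, D t -> E (u t)) -> rsm m E f -> rsm m D u -> rsm m D (fun t => f (u t)).
Proof.
move=> DE; elim: m f => [//|m IH] f [f' [df Hf]] Hu; have Hu0 := rsm_le Hu.
case: Hu => u' [du Hu]; exists (fun t => f' (u t) * u' t); split=> [t Dt|].
  by apply: is_derive_comp; [apply: df; exact: DE|exact: du].
by apply: rsmM => //; exact: IH.
Qed.

Lemma rsm_sqrt m D : (forall t, D t -> 0 < t) -> rsm m D Num.sqrt.
Proof.
move=> D0; elim: m => [//|m IH]; exists (fun t => (2 * Num.sqrt t)^-1); split=> [t Dt|].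
  exact: is_derive1_sqrt (D0 _ Dt).
apply: rsm_inv => [t /D0 t0|]; first by rewrite mulf_neq0 // gt_eqF // sqrtr_gt0.
by apply: rsmM => //; exact: rsm_cst.
Qed.

Lemma is_derive_derive1 f t (d : R) : is_derive t 1 f d -> is_derive t 1 f (derive1 f t).
Proof. by move=> H; apply: (is_derive_eq H); have [_ <-] := H; rewrite derive1E. Qed.

Lemma rsm_derive1 m D f : ropen D -> rsm m.+1 D f -> rsm m D (derive1 f).
Proof.
move=> oD [f' [df H]]; apply: (rsm_eq oD _ H) => t Dt.
exact: is_derive_unique (is_derive_derive1 (df t Dt)) (df t Dt).
Qed.

(** Local derivatives glue because they all agree with the canonical [derive1 f]. *)
Lemma rsm_local m D f : (forall t, D t -> exists E, [/\ ropen E, E t & rsm m E f]) -> rsm m D f.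
Proof.
elim: m f => [//|m IH] f H; exists (derive1 f); split=> [t Dt|].
  have [E [oE Et [f' [df _]]]] := H t Dt; exact: is_derive_derive1 (df t Et).
apply: IH => t Dt; have [E [oE Et HE]] := H t Dt; exists E; split=> //; exact: rsm_derive1.
Qed.

Definition rsmooth D f := forall m, rsm m D f.

Lemma rsmooth_derive1 D f : ropen D -> rsmooth D f ->
  rsmooth D (derive1 f) /\ forall t, D t -> is_derive t 1 f (derive1 f t).
Proof.
move=> oD H; split=> [m|t Dt]; first exact: rsm_derive1.
by have [f' [df _]] := H 1%N; exact: is_derive_derive1 (df t Dt).
Qed.

Lemma ropen_ball t (e : R) : ropen [set s | `|s - t| < e].
Proof.
move=> s /= st; exists (e - `|s - t|) => [|h hr]; first by rewrite subr_gt0.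
by have := ler_normD (s - t) h; rewrite /= addrAC; move: hr st; move: (`|_|) (`|_|) (`|_|) => *; lra.
Qed.

Lemma interval_mvt D f (f' : R -> R) a b : is_interval D -> (forall t, D t -> is_derive t 1 f (f' t)) ->
  D a -> D b -> a < b -> exists2 c, D c & f b - f a = f' c * (b - a).
Proof.
move=> iD df Da Db ab.
have Dab x : a <= x <= b -> D x by move=> xab; exact: iD Da Db _ xab.
have [c] : exists2 c : R, c \in `]a, b[%R & f b - f a = f' c * (b - a).
  apply: (@MVT _ f f' a b ab) => [x|].
    by rewrite in_itv /= => /andP[/ltW xa /ltW xb]; apply: df; apply: Dab; rewrite xa xb.
  by apply: derivable_within_continuous => x; rewrite in_itv /= => /Dab/df[].
by rewrite in_itv /= => /andP[/ltW ca /ltW cb] E; exists c => //; apply: Dab; rewrite ca cb.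
Qed.

Lemma interval_constant D f a b : is_interval D -> (forall t, D t -> is_derive t 1 f 0) ->
  D a -> D b -> f a = f b.
Proof.
move=> iD df; wlog ab : a b / a < b.
  move=> H Da Db; have [/H->//|/H->//|->//] := ltgtP a b.
move=> Da Db; have [c _] := @interval_mvt D f (fun=> 0) a b iD df Da Db ab.
by rewrite mul0r => /eqP; rewrite subr_eq0 => /eqP.
Qed.

End RealSmooth.

Section RadialProfile.
Context {R : realType} {n : nat}.
Local Notation C := R[i].
Local Notation Cn := 'rV[C]_n.
Variables (U : set Cn) (oU : open U).

Definition radii : set R := [set t | 0 < t /\ exists2 z, U z & sqnorm z = t].

Lemma sqnormZr (s : R) (z : Cn) : sqnorm (s%:C *: z) = s ^+ 2 * sqnorm z.
Proof.
rewrite /sqnorm mulr_sumr; apply: eq_bigr => j _.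
by rewrite mxE normcM normc_real exprMn real_normK ?num_real.
Qed.

Lemma sqrt_sub1_le (s : R) : 0 <= s -> `|Num.sqrt s - 1| <= `|s - 1|.
Proof.
move=> s0; have -> : s - 1 = (Num.sqrt s - 1) * (Num.sqrt s + 1).
  by rewrite -{1}(sqr_sqrtr s0); ring.
have q0 := sqrtr_ge0 s; rewrite normrM -[leLHS]mulr1 ler_wpM2l //.
by rewrite ger0_norm ?addr_ge0 // lerDr.
Qed.

Lemma radii_ray z0 : U z0 -> 0 < sqnorm z0 -> exists2 d : R, 0 < d & forall s : R, `|s| < d -> U (z0 + s%:C *: z0).
Proof.
move=> Uz z00; have [t t0 T] := open_nvP oU Uz.
have n0 : 0 < nv z0 by rewrite sqrtr_gt0.
exists (t / nv z0) => [|s]; first by rewrite divr_gt0.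
by rewrite ltr_pdivlMr // => H; apply: T; rewrite nvZ normc_real.
Qed.

(** The parameter at which the ray z0 + s z0, with |z0|^2 = t0, has squared norm t. *)
Let u (t0 t : R) := Num.sqrt (t * t0^-1) - 1.

Lemma radii_u (t0 t d : R) : 0 < t0 -> 0 < d -> `|t - t0| < Num.min t0 (d * t0) -> 0 < t /\ `|u t0 t| < d.
Proof.
move=> t00 d0; rewrite lt_min => /andP[h1 h2].
have t_gt0 : 0 < t by move: h1; rewrite ltr_norml => /andP[]; lra.
split=> //; apply: le_lt_trans (sqrt_sub1_le _) _; first by rewrite ltW // divr_gt0.
have -> : t * t0^-1 - 1 = (t - t0) / t0 by field; rewrite gt_eqF.
by rewrite normrM (gtr0_norm (x := t0^-1)) ?invr_gt0 // ltr_pdivrMr.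
Qed.

Lemma sqnorm_u (z0 : Cn) (t : R) : 0 < sqnorm z0 -> 0 < t -> sqnorm (z0 + (u (sqnorm z0) t)%:C *: z0) = t.
Proof.
move=> z00 t0; have -> : z0 + (u (sqnorm z0) t)%:C *: z0 = (Num.sqrt (t * (sqnorm z0)^-1))%:C *: z0.
  by rewrite /u rcB scalerBl scale1r addrC subrK.
rewrite sqnormZr sqr_sqrtr; last by rewrite ltW // divr_gt0.
by rewrite mulfVK // gt_eqF.
Qed.

Lemma radii_near z0 : U z0 -> 0 < sqnorm z0 -> exists2 d : R, 0 < d &
  forall t, `|t - sqnorm z0| < d -> 0 < t /\ U (z0 + (u (sqnorm z0) t)%:C *: z0).
Proof.
move=> Uz z00; have [d d0 dU] := radii_ray Uz z00.
exists (Num.min (sqnorm z0) (d * sqnorm z0)) => [|t]; first by rewrite lt_min z00 mulr_gt0.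
by move=> /(radii_u z00 d0)[t0 /dU].
Qed.

Lemma radii_open : ropen radii.
Proof.
move=> t0 [t00 [z0 Uz E]]; rewrite -E in t00 *.
have [d d0 H] := radii_near Uz t00; exists d => // h hd.
have [|h0 Uh] := H (sqnorm z0 + h); first by rewrite addrAC subrr add0r.
by split=> //; exists (z0 + (u (sqnorm z0) (sqnorm z0 + h))%:C *: z0) => //; exact: sqnorm_u.
Qed.

Lemma continuous_sqnorm : continuous (@sqnorm R n).
Proof.
move=> z; apply/continuousCn_sqP => e e0.
have [d d0 H] := csm_continuous (csm_sqnorm 0 openT) (I : setT z) e0.
by exists d => // w /H; rewrite -rcB normc_real.
Qed.

Lemma radii_interval : connected U -> is_interval radii.
Proof.
move=> cU a b [a0 Ha] [b0 Hb] t /andP[at_ tb].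
have /connected_intervalP/(_ a b Ha Hb t) : connected [set sqnorm z | z in U].
  by apply: connected_continuous_connected => //; apply: continuous_subspaceT; exact: continuous_sqnorm.
by rewrite at_ tb => /(_ isT) Ht; split=> //; exact: lt_le_trans a0 at_.
Qed.

Lemma is_rderive_line (f : Cn -> C) (z v : Cn) (s : R) : rderivable v f (z + s%:C *: v) ->
  is_derive s 1 (fun t => complex.Re (f (z + t%:C *: v))) (complex.Re (rderive v f (z + s%:C *: v))).
Proof.
move=> /rderivableP[H _].
have dsh : is_derive s 1 (fun t : R => t + - s) (1 + 0).
  exact: is_derive_add (@is_derive_id R R s 1) (is_derive_const s (- s)).
have H0 : is_derive (s + - s) 1 (fun t : R => complex.Re (f (z + s%:C *: v + t%:C *: v)))
    (complex.Re (rderive v f (z + s%:C *: v))) by rewrite subrr.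
have := @is_derive_comp R _ (fun t : R => t + - s) s _ _ H0 dsh; rewrite addr0 mulr1.
have -> // : (fun t : R => complex.Re (f (z + s%:C *: v + (t + - s)%:C *: v))) = (fun t => complex.Re (f (z + t%:C *: v))).
by apply/funext => t; rewrite -addrA -scalerDl -rcD [s + _]addrC subrK.
Qed.

(** phi is given as an arbitrary function. Near t0 it equals Phi along the ray through a point z0 of
    squared norm t0, reparametrized by [u]; the derivatives of Phi along the ray are iterated
    directional derivatives. *)
Lemma profile_smooth (Phi : Cn -> R) (phi : R -> R) : smooth_on U (fun z => (Phi z)%:C) ->
  (forall z, U z -> Phi z = phi (sqnorm z)) -> rsmooth radii phi.
Proof.
move=> sP EP m; apply: rsm_local => t0 [t00 [z0 Uz E]]; rewrite -E in t00 *.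
have [d d0 H] := radii_near Uz t00.
pose B := [set t | `|t - sqnorm z0| < d].
have oB : ropen B by exact: ropen_ball.
exists B; split=> //; first by rewrite /B /= subrr normr0.
pose f k (s : R) := complex.Re (foldr rderive (fun z => (Phi z)%:C) (nseq k z0) (z0 + s%:C *: z0)).
pose J := [set s : R | U (z0 + s%:C *: z0)].
have Hf j k : rsm j J (f k).
  elim: j k => [k|j IH k]; first exact: I.
  exists (f k.+1); split; last exact: IH.
  move=> s Js; exact: (is_rderive_line ((sP (nseq k z0) _ Js).2 z0)).
apply: (@rsm_eq _ _ _ _ (fun t => f 0%N (u (sqnorm z0) t))) => // [t Bt|].
  have [tp Ut] := H _ Bt; rewrite /f /= EP // sqnorm_u //.
apply: (@rsm_comp _ _ _ J) => // [t /H[]//|].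
apply: rsmD; last exact: rsm_cst.
apply: (@rsm_comp _ _ _ [set t | 0 < t]) => [t /H[tp _]||].
- by rewrite /= divr_gt0.
- exact: rsm_sqrt.
- by apply: rsmM; [exact: rsm_id|exact: rsm_cst].
Qed.

End RadialProfile.

Section FirstIntegrals.
Context {R : realType}.
Variables (n : nat) (D : set R) (y chi chi1 M M1 : R -> R).
Hypothesis n_gt0 : (0 < n)%N.
Hypothesis D_itv : is_interval D.
Hypothesis y_gt0 : forall t, D t -> 0 < y t.
Hypothesis dy : forall t, D t -> is_derive t 1 y (psi y chi t / t).
Hypothesis dchi : forall t, D t -> is_derive t 1 chi (chi1 t * psi y chi t / t).
Hypothesis dM : forall t, D t -> is_derive t 1 M (M1 t * psi y chi t / t).
Hypothesis ME : forall t, D t -> M t = - ((n%:R - 1) * chi t / y t + chi1 t).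
Hypothesis scal0 : forall t, D t -> (n%:R - 1) * M t / y t + M1 t = 0.

Lemma d_yX k t : D t -> is_derive t 1 (fun t => y t ^+ k) (k%:R * y t ^+ k / y t * (psi y chi t / t)).
Proof.
move=> Dt; have yt : y t != 0 by rewrite gt_eqF // y_gt0.
elim: k => [|k IH].
  by apply: is_derive_eq (is_derive_const t (1 : R)) _; rewrite !mul0r.
have -> : (fun t => y t ^+ k.+1) = (fun t => y t * y t ^+ k) by apply/funext => s; rewrite exprS.
apply: is_derive_eq (is_derive_mul (dy Dt) IH) _; rewrite exprS -natr1.
move: (psi y chi t / t) => q; by field.
Qed.

Lemma scalar_flat_profile : exists A B : R, forall t, D t -> chi t = sfchi n A B y t.
Proof.
have [[t0 Dt0]|D0] := pselect (exists t, D t); last by exists 0, 0 => t Dt; case: D0; exists t.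
have nE : (n%:R : R) = n.-1%:R + 1 by rewrite natr1 prednK.
(* The first integral: the y-derivative of y^(n-1) M is y^(n-1) rho. *)
have c1 t : D t -> y t ^+ n.-1 * M t = y t0 ^+ n.-1 * M t0.
  move=> Dt; apply: (@interval_constant _ D (fun t => y t ^+ n.-1 * M t)) => // s Ds.
  have ys : y s != 0 by rewrite gt_eqF // y_gt0.
  apply: is_derive_eq (is_derive_mul (d_yX n.-1 Ds) (dM Ds)) _.
  have -> : M1 s = - (n.-1%:R * M s / y s) by have := scal0 Ds; rewrite nE addrK => /eqP; rewrite addrC addr_eq0 => /eqP.
  by move: (psi y chi s) (y s ^+ _) => *; ring.
pose A := - (y t0 ^+ n.-1 * M t0).
(* The second one: the y-derivative of y^(n-1) chi is - y^(n-1) M = A. The constant is B. *)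
have c2 t : D t -> y t ^+ n.-1 * chi t - A * y t = y t0 ^+ n.-1 * chi t0 - A * y t0.
  move=> Dt; apply: (@interval_constant _ D (fun t => y t ^+ n.-1 * chi t - A * y t)) => // s Ds.
  have ys : y s != 0 by rewrite gt_eqF // y_gt0.
  apply: is_derive_eq (is_derive_add (is_derive_mul (d_yX n.-1 Ds) (dchi Ds)) (is_derive_opp (is_derive_mul (is_derive_const s A) (dy Ds)))) _.
  have := c1 s Ds; rewrite ME // -[y t0 ^+ _ * _]opprK -/A nE addrK => H.
  have -> : A = y s ^+ n.-1 * (n.-1%:R * chi s / y s + chi1 s) by rewrite -[LHS]opprK -H mulrN opprK.
  move: ys; move: (psi y chi s) (chi s) (chi1 s) (s^-1) (n.-1%:R) (y s) (y s ^+ n.-1) => *; by field.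
exists A, (y t0 ^+ n.-1 * chi t0 - A * y t0) => t Dt.
have yt : y t != 0 by rewrite gt_eqF // y_gt0.
have yn : y t ^+ n.-1 != 0 by rewrite expf_neq0.
have yE : y t ^+ n = y t * y t ^+ n.-1 by rewrite -exprS prednK.
rewrite /sfchi /Yn yE -(c2 t Dt).
by move: (y t) (y t ^+ _) yt yn => *; field; apply/andP.
Qed.

End FirstIntegrals.

(** * Consequences of a_3 = 0 for the constants A and B *)

Section VanishingCoefficients.
Context {R : realType}.

Lemma poly_infinitely_many_roots (p : {poly R}) :
  (forall N, exists rs : seq R, [/\ size rs = N, uniq rs & all (root p) rs]) -> p = 0.
Proof.
move=> H; apply/eqP; apply/negP => /negP p0; have [rs [sz ur ar]] := H (size p).
by have := max_poly_roots p0 ar ur; rewrite sz ltnn.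
Qed.

(** Multiplying by q^(3 n + 3) gives a polynomial P with infinitely many roots. Its constant term is
    a positive multiple of B^3. *)
Lemma sfTYZ3_eq0 (n : nat) (A B : R) (Q : set R) : (1 < n)%N -> (forall q, Q q -> 0 < q) ->
  (forall N, exists rs : seq R, [/\ size rs = N, uniq rs & forall q, q \in rs -> Q q]) ->
  (forall q, Q q -> sfTYZ3 n A B q (q ^+ n)^-1 = 0) -> B = 0 /\ (A = 0 \/ n = 2%N).
Proof.
move=> n1 Q0 Qinf H.
have n0 : (0 < n)%N by exact: ltnW.
have N2 : (2 : R) <= n%:R by rewrite ler_nat.
pose N : R := n%:R.
pose P : {poly R} := 'X^n * ((2 * N ^+ 2 * (N - 1) * (N + 1) * (N - 2) * (N + 2) * A ^+ 2)%:P * 'X^2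
    + (4 * N ^+ 2 * (N - 1) * (N + 1) ^+ 2 * (N + 2) * A * B)%:P * 'X
    + (2 * N * (N - 1) * (N + 1) ^+ 2 * (N + 2) * (N + 3) * B ^+ 2)%:P)
  + ((2 * N ^+ 2 * (N - 1) * (N + 1) * (N - 2) * (2 * N + 1) * A ^+ 3)%:P * 'X^3
    + (6 * N ^+ 3 * (N - 1) * (N + 1) * (2 * N + 1) * A ^+ 2 * B)%:P * 'X^2
    + (6 * N * (N - 1) * (N + 1) ^+ 2 * (2 * N ^+ 2 + 3 * N + 2) * A * B ^+ 2)%:P * 'X
    + (2 * N * (N - 1) * (N + 1) ^+ 2 * (N + 2) * (2 * N + 3) * B ^+ 3)%:P).
have PE q : q != 0 -> P.[q] = (q ^+ n) ^+ 3 * q ^+ 3 * sfTYZ3 n A B q (q ^+ n)^-1.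
  move=> q0; rewrite /P !(hornerD, hornerM, hornerC, hornerX, hornerXn) /sfTYZ3 -/N.
  have qn : q ^+ n != 0 by rewrite expf_neq0.
  by move: (q ^+ n) qn => qn' qn0; field; apply/andP.
have PQ q : Q q -> P.[q] = 0 by move=> Qq; rewrite PE ?H ?mulr0 // gt_eqF // Q0.
have P0 : P = 0.
  apply: poly_infinitely_many_roots => m; have [rs [sz ur ar]] := Qinf m; exists rs; split=> //.
  by apply/allP => q /ar /PQ /eqP.
have B0 : B = 0.
  have := congr1 (fun p => p.[0]) P0; rewrite horner0 /P !(hornerD, hornerM, hornerC, hornerX, hornerXn).
  have z0 : (0 : R) ^+ n = 0 by rewrite expr0n eqn0Ngt n0.
  rewrite z0 => H0.
  have : 2 * N * (N - 1) * (N + 1) ^+ 2 * (N + 2) * (2 * N + 3) * B ^+ 3 = 0 by rewrite -[RHS]H0; ring.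
  move/eqP.
  have N2' : 2 <= N by exact: N2.
  have kp : 0 < 2 * N * (N - 1) * (N + 1) ^+ 2 * (N + 2) * (2 * N + 3).
    by clear -N2'; do ?[apply: mulr_gt0]; rewrite ?exprn_gt0 //; lra.
  by rewrite mulf_eq0 (gt_eqF kp) /= expf_eq0 /= => /eqP.
split=> //; have [->|A0] := eqVneq A 0; [by left|right].
have [n2|n2] := eqVneq n 2%N; first exact: n2.
have n3 : (2 < n)%N by rewrite ltn_neqAle eq_sym n2.
have [rs [sz + Qs]] := Qinf 2%N.
case: rs sz Qs => [//|q1 [//|q2 [|//]]] _ Qs /=.
rewrite inE andbT => q12.
have Q1 : Q q1 by apply: Qs; rewrite inE eqxx.
have Q2 : Q q2 by apply: Qs; rewrite !inE eqxx orbT.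
have N3 : (3 : R) <= N by rewrite ler_nat.
(* With B = 0, A not 0 and n > 2, P has a single nontrivial factor, which determines q^(n-1); two
   distinct values of q contradict this. *)
have E q : Q q -> q ^+ n.-1 * (N + 2) = - ((2 * N + 1) * A).
  move=> Qq; have q0 : q != 0 by rewrite gt_eqF // Q0.
  have := PQ q Qq; rewrite /P !(hornerD, hornerM, hornerC, hornerX, hornerXn) B0 -{1}(prednK n0) exprS.
  move=> H0.
  have : (2 * N ^+ 2 * (N - 1) * (N + 1) * (N - 2) * A ^+ 2 * q ^+ 3) * (q ^+ n.-1 * (N + 2) + (2 * N + 1) * A) = 0.
    by rewrite -[RHS]H0; move: (q ^+ n.-1) => *; ring.
  move/eqP; rewrite mulf_eq0 addr_eq0 => /orP[|/eqP//].
  have kp : 0 < 2 * N ^+ 2 * (N - 1) * (N + 1) * (N - 2).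
    by clear -N3; do ?[apply: mulr_gt0]; rewrite ?exprn_gt0 //; lra.
  by rewrite -mulrA mulf_eq0 (gt_eqF kp) /= mulf_eq0 !expf_eq0 /= (negPf A0) (negPf q0).
have Np : N + 2 != 0 by apply/eqP; lra.
have : q1 ^+ n.-1 = q2 ^+ n.-1 by apply: (mulIf Np); rewrite !E.
have n1' : (0 < n.-1)%N by rewrite -ltnS prednK.
move/eqP; rewrite (eqrXn2 n1') ?(ltW (Q0 _ _)) // => /eqP q12e.
by rewrite q12e eqxx in q12.
Qed.

Lemma infinitely_many_values (D : set R) (y : R -> R) t0 : ropen D -> D t0 ->
  (forall a b, D a -> D b -> a < b -> y a < y b) ->
  forall N, exists rs : seq R, [/\ size rs = N, uniq rs & forall q, q \in rs -> exists2 t, D t & y t = q].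
Proof.
move=> oD Dt0 inc N; have [r r0 Dr] := oD t0 Dt0.
have Nr : (0 : R) < N.+1%:R by [].
pose s k : R := t0 + r * (k%:R / N.+1%:R).
have Ds k : (k < N)%N -> D (s k).
  move=> kN; apply: Dr; rewrite ger0_norm; last by rewrite mulr_ge0 ?divr_ge0 // ltW.
  by rewrite gtr_pMr // ltr_pdivrMr // mul1r ltr_nat ltnW.
exists (mkseq (fun k => y (s k)) N); split; first by rewrite size_mkseq.
- apply/mkseq_uniqP => i j; rewrite !inE => iN jN E.
  have lt_s a b : (a < b)%N -> s a < s b.
    by move=> ab; rewrite ltrD2l ltr_pM2l // ltr_pM2r ?invr_gt0 // ltr_nat.
  have [ij|ij|//] := ltngtP i j.
    by have := inc _ _ (Ds _ iN) (Ds _ jN) (lt_s _ _ ij); rewrite E ltxx.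
  by have := inc _ _ (Ds _ jN) (Ds _ iN) (lt_s _ _ ij); rewrite E ltxx.
by move=> q /mapP[k]; rewrite mem_iota add0n => /andP[_ kN] ->; exists (s k) => //; exact: Ds.
Qed.

End VanishingCoefficients.

Section OrthogonalVector.
Context {R : realType} {n : nat}.
Local Notation C := R[i].
Local Notation Cn := 'rV[C]_n.

Lemma qform_radial (G : 'M[C]_n) (z v : Cn) (a b : R) :
  (forall i j, G i j = a%:C * dlt i j + b%:C * ((z 0 i)^* * z 0 j)) ->
  (v *m G *m (v ^t Num.conj)%sesqui) 0 0 = (a * sqnorm v + b * normc (\sum_i v 0 i * (z 0 i)^*) ^+ 2)%:C.
Proof.
move=> GE; rewrite mxE rcD [(a * _)%:C]rcM [(b * _)%:C]rcM sqnormC normc_sqrC cj_sum.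
under eq_bigr => j _ do rewrite !mxE.
have -> : \sum_i (\sum_j v 0 j * G j i) * (v 0 i)^* =
    \sum_i (a%:C * (v 0 i * (v 0 i)^*) + b%:C * ((\sum_j v 0 j * (z 0 j)^*) * (v 0 i * (z 0 i)^*)^*)).
  apply: eq_bigr => i _.
  have -> : \sum_j v 0 j * G j i = a%:C * v 0 i + b%:C * (\sum_j v 0 j * (z 0 j)^*) * z 0 i.
    rewrite -(sum_delta i (fun j => v 0 j)) mulr_sumr mulr_sumr mulr_suml -big_split; apply: eq_bigr => j _ /=.
    rewrite GE dltC; move: (v 0 j) (dlt i j) ((z 0 j)^*) (z 0 i) a%:C b%:C => *; ring.
  rewrite cjM conjCK; move: (\sum_j _) (v 0 i) (z 0 i) ((v 0 i)^*) a%:C b%:C => *; ring.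
by rewrite big_split /= !mulr_sumr.
Qed.

Lemma sqnorm_gt0 (v : Cn) : (0 < sqnorm v) = (v != 0).
Proof.
have [->|v0] := eqVneq v 0; first by rewrite /sqnorm big1 ?ltxx // => j _; rewrite mxE normc0 expr0n.
rewrite lt_neqAle sqnorm_ge0 andbT eq_sym; apply/eqP => H.
by move/eqP: v0; apply; apply: nv_eq0; rewrite /nv H sqrtr0.
Qed.

Lemma orth_vector (p : Cn) : (1 < n)%N -> exists v : Cn, sqnorm v = 1 /\ \sum_j v 0 j * (p 0 j)^* = 0.
Proof.
move=> n1; pose i0 : 'I_n := Ordinal (ltnW n1); pose i1 : 'I_n := Ordinal n1.
suff [v v0 vp] : exists2 v : Cn, v != 0 & \sum_j v 0 j * (p 0 j)^* = 0.
  have v1 : 0 < nv v by rewrite sqrtr_gt0 sqnorm_gt0.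
  exists ((nv v)^-1%:C *: v); split; first by rewrite sqnormZr exprVn nv_sq mulVf // gt_eqF // sqnorm_gt0.
  transitivity ((nv v)^-1%:C * \sum_j v 0 j * (p 0 j)^*); last by rewrite vp mulr0.
  rewrite mulr_sumr; apply: eq_bigr => j _; by rewrite mxE mulrA.
have sume (c : C) (i : 'I_n) (u : 'I_n -> C) : \sum_j (c *: ebase i : Cn) 0 j * u j = c * u i.
  rewrite (bigD1 i) //= big1 => [|j ji]; first by rewrite mxE ebaseE eqxx mulr1 addr0.
  by rewrite mxE ebaseE eq_sym (negPf ji) mulr0 mul0r.
have [p0|p0] := eqVneq (p 0 i0) 0.
  exists (1 *: ebase i0); last by rewrite sume p0 rmorph0 mulr0.
  apply/eqP => /rowP/(_ i0); rewrite !mxE !eqxx mulr1 => /eqP; by rewrite oner_eq0.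
exists ((p 0 i1)^* *: ebase i0 - (p 0 i0)^* *: ebase i1).
  apply/eqP => /rowP/(_ i1); rewrite !mxE !eqxx /= mulr0 mulr1 sub0r => /eqP.
  by rewrite oppr_eq0 fmorph_eq0 (negPf p0).
under eq_bigr => j _ do rewrite mxE mulrDl.
rewrite big_split /= sume.
under eq_bigr => j _ do rewrite mxE mulNr.
by rewrite sumrN sume mulrC subrr.
Qed.

End OrthogonalVector.

Section Classification.
Context {R : realType} {n : nat}.
Local Notation C := R[i].
Local Notation Cn := 'rV[C]_n.
Variables (U : set Cn) (g : Cn -> 'M[C]_n).
Hypotheses (n_gt1 : (1 < n)%N) (oU : open U) (cU : connected U).
Hypotheses (kg : kahler_metric U g) (rg : radial U g).
Hypotheses (a1 : forall z, U z -> TYZ1 g z = 0) (a3 : forall z, U z -> TYZ3 g z = 0).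

Lemma punctured_open : open [set w | U w /\ 0 < sqnorm w].
Proof.
apply: openI oU _; have := @open_comp _ _ (@sqnorm R n) [set t | 0 < t] (fun z _ => @continuous_sqnorm R n z) (@open_gt R 0).
exact.
Qed.

Lemma radial_profile : exists c A : R, [/\ 0 < c, A = 0 \/ n = 2%N &
  forall w i j, U w -> 0 < sqnorm w ->
    g w i j = (c - A / sqnorm w)%:C * dlt i j + (A / sqnorm w ^+ 2)%:C * ((w 0 i)^* * w 0 j)].
Proof.
have [Phi [sP [phi EP] gP]] := rg.
have n_gt0 : (0 < n)%N by exact: ltnW.
pose D := radii U.
(* Without positive radii the formula is vacuous, and any c > 0 will do. *)
have [[t1 Dt1]|D0] := pselect (exists t, D t); last first.
  exists 1, 0; split=> [//||w i j Uw w0]; first by left.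
  by case: D0; exists (sqnorm w); split=> //; exists w.
have oD : ropen D by exact: radii_open.
have iD : is_interval D by exact: radii_interval.
have D_gt0 t : D t -> 0 < t by case.
pose W := [set w | U w /\ 0 < sqnorm w].
have oW : open W by exact: punctured_open.
have WD w : W w -> D (sqnorm w) by move=> [Uw w0]; split=> //; exists w.
have [s1 d0] := rsmooth_derive1 oD (profile_smooth oU sP EP).
have [s2 d1] := rsmooth_derive1 oD s1.
pose y t := t * derive1 phi t; pose chi t := t * t * derive1 (derive1 phi) t.
have sy : rsmooth D y by move=> m; apply: rsmM; [exact: rsm_id|exact: s1].
have schi : rsmooth D chi by move=> m; do 2?[apply: rsmM]; [exact: rsm_id|exact: rsm_id|exact: s2].
have dy t : D t -> is_derive t 1 y (psi y chi t / t).
  move=> Dt; apply: is_derive_eq (is_derive_mul (@is_derive_id R R t 1) (d1 t Dt)) _.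
  by rewrite /psi /y /chi; field; rewrite gt_eqF // D_gt0.
have gE w (i j : 'I_n) : W w -> g w i j = (pfa y (sqnorm w))%:C * dlt i j + (pfb chi (sqnorm w))%:C * ((w 0 i)^* * w 0 j).
  move=> Ww; have [Uw w0] := Ww; have wn : sqnorm w != 0 by rewrite gt_eqF.
  have E1 u : W u -> (Phi u)%:C = (phi (sqnorm u))%:C by move=> [Uu _]; rewrite EP.
  have H := @ddbar_radial R n W (fun w => (Phi w)%:C) phi (derive1 phi) _ i j w oW Ww E1 (fun u Wu => d0 _ (WD u Wu)) (d1 _ (WD _ Ww)).
  rewrite gP // mxE H; congr (_%:C * _ + _%:C * _); rewrite /pfa /pfb /y /chi; by field.
(* Positivity of the metric on the vector w itself. *)
have psi_gt0 t : D t -> 0 < psi y chi t.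
  move=> Dt; have [t0 [w Uw E]] := Dt; have tn : t != 0 by rewrite gt_eqF.
  have Ww : W w by split=> //; rewrite E.
  have w0 : w != 0 by rewrite -sqnorm_gt0 E.
  have [_ _ /(_ w w Uw w0) + _] := kg; rewrite (qform_radial w (fun i j => gE w i j Ww)) ltcR E.
  have -> : \sum_i w 0 i * (w 0 i)^* = t%:C by rewrite -sqnormC E.
  rewrite normc_real real_normK ?num_real //.
  by congr (_ < _); rewrite /pfa /pfb /psi; field.
(* Positivity on a vector orthogonal to w, which exists because n > 1. *)
have y_gt0 t : D t -> 0 < y t.
  move=> Dt; have [t0 [w Uw E]] := Dt; have tn : t != 0 by rewrite gt_eqF.
  have Ww : W w by split=> //; rewrite E.
  have [v [v1 vw]] := orth_vector w n_gt1.
  have v0 : v != 0 by rewrite -sqnorm_gt0 v1.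
  have [_ _ /(_ w v Uw v0) + _] := kg; rewrite (qform_radial v (fun i j => gE w i j Ww)) ltcR E v1 vw normc0.
  by rewrite expr0n mulr0 addr0 mulr1 /pfa pmulr_lgt0 // invr_gt0.
(* The derivative of F with respect to y. *)
pose theta (F : R -> R) t := derive1 F t * t * (psi y chi t)^-1.
have spsi : rsmooth D (psi y chi) by move=> m; apply: rsmD; [exact: sy|exact: schi].
have thetaP F : rsmooth D F -> rsmooth D (theta F) /\ forall t, D t -> is_derive t 1 F (theta F t * psi y chi t / t).
  move=> /(rsmooth_derive1 oD)[sF dF]; split=> [m|t Dt].
    apply: rsmM; first by apply: rsmM; [exact: sF|exact: rsm_id].
    by apply: rsm_inv; [move=> t /psi_gt0 /lt0r_neq0|exact: spsi].
  apply: is_derive_eq (dF t Dt) _; rewrite /theta; field.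
  by rewrite (lt0r_neq0 (D_gt0 t Dt)) (lt0r_neq0 (psi_gt0 t Dt)).
have [schi1 dchi] := thetaP chi schi; have [schi2 dchi1] := thetaP _ schi1.
pose M t := - ((n%:R - 1) * chi t / y t + theta chi t).
have sM : rsmooth D M.
  move=> m; apply: (@rsm_eq _ _ _ _ (fun t => -1 * ((n%:R - 1) * chi t * (y t)^-1 + theta chi t))) => // [t Dt|].
    by rewrite mulN1r.
  apply: rsmM; first exact: rsm_cst.
  apply: rsmD; last exact: schi1.
  apply: rsmM; first by apply: rsmM; [exact: rsm_cst|exact: schi].
  by apply: rsm_inv; [move=> t /y_gt0 /lt0r_neq0|exact: sy].
have [sM1 dM] := thetaP M sM; have [sM2 dM1] := thetaP _ sM1; have [_ dM2] := thetaP _ sM2.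
have ME t : D t -> M t = - ((n%:R - 1) * chi t / y t + theta chi t) by [].
have scal0 t : D t -> (n%:R - 1) * M t / y t + theta M t = 0.
  move=> Dt; have [t0 [w Uw E]] := Dt; have Ww : W w by split=> //; rewrite E.
  have := a1 Uw; rewrite /TYZ1 (metric_scal D_gt0 y_gt0 psi_gt0 dy dchi dchi1 dM dM1 dM2 n_gt0 oW WD gE ME Ww) E.
  by move/eqP; rewrite mulf_eq0 invr_eq0 pnatr_eq0 /= rc_eq0 => /eqP.
have [A [B chiE]] := scalar_flat_profile n_gt0 iD y_gt0 dy dchi dM ME scal0.
have psiE t : D t -> psi y chi t = psi y (sfchi n A B y) t by move=> Dt; rewrite /psi chiE.
have psi_gt0' t : D t -> 0 < psi y (sfchi n A B y) t by move=> Dt; rewrite -psiE // psi_gt0.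
have dy' t : D t -> is_derive t 1 y (psi y (sfchi n A B y) t / t) by move=> Dt; rewrite -psiE //; exact: dy.
have gE' w (i j : 'I_n) : W w -> g w i j = (pfa y (sqnorm w))%:C * dlt i j + (pfb (sfchi n A B y) (sqnorm w))%:C * ((w 0 i)^* * w 0 j).
  by move=> Ww; rewrite gE // /pfb chiE //; exact: WD.
have T3 t : D t -> sfTYZ3 n A B (y t) (Yn n y t) = 0.
  move=> Dt; have [t0 [w Uw E]] := Dt; have Ww : W w by split=> //; rewrite E.
  have := a3 Uw; rewrite (scalar_flat_TYZ3 n_gt0 D_gt0 y_gt0 psi_gt0' dy' oW WD gE' Ww) E.
  by move/eqP; rewrite rc_eq0 mulf_eq0 invr_eq0 pnatr_eq0 /= => /eqP.
(* Strict monotonicity gives the infinitely many values of y that the polynomial argument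
   requires. *)
have y_inc a b : D a -> D b -> a < b -> y a < y b.
  move=> Da Db ab; have [s Ds E] := interval_mvt iD dy Da Db ab.
  rewrite -subr_gt0 E mulr_gt0 ?subr_gt0 // divr_gt0 ?psi_gt0 ?D_gt0 //.
have [B0 A0] : B = 0 /\ (A = 0 \/ n = 2%N).
  apply: (@sfTYZ3_eq0 R n A B [set q | exists2 t, D t & y t = q]) => //.
  - by move=> q [t Dt <-]; exact: y_gt0.
  - exact: (infinitely_many_values oD Dt1 y_inc).
  - by move=> q [t Dt <-]; exact: T3.
have chiA t : D t -> chi t = A.
  move=> Dt; rewrite chiE // /sfchi /Yn B0 !mul0r addr0.
  have yt : y t != 0 by rewrite gt_eqF // y_gt0.
  by case: A0 => [->|->]; rewrite ?mul0r // mulfK // expf_neq0.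
(* With chi = A the profile satisfies t y' = y + A, so (y + A) / t is constant. *)
pose c := (y t1 + A) / t1.
have cE t : D t -> (y t + A) / t = c.
  move=> Dt; apply: (@interval_constant _ D (fun t => (y t + A) * t^-1)) => // s Ds.
  have sn : s != 0 by rewrite gt_eqF // D_gt0.
  have D1 := is_derive_mul (is_derive_add (dy s Ds) (is_derive_const s A)) (is_derive_inv sn (@is_derive_id R R s 1)).
  by apply: is_derive_eq D1 _; rewrite /psi chiA //; field.
exists c, A; split=> //.
  by rewrite /c divr_gt0 ?(D_gt0 _ Dt1) // -(chiA _ Dt1); exact: psi_gt0.
move=> w i j Uw w0; have Ww : W w by [].
have wn : sqnorm w != 0 by rewrite gt_eqF.
rewrite gE // /pfb chiA; last exact: WD.
congr (_%:C * _ + _); rewrite -(cE _ (WD _ Ww)) /pfa; by field.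
Qed.

End Classification.

(** * The converse *)

Section LocallyConstant.
Context {R : realType} {n : nat}.
Local Notation C := R[i].
Local Notation Cn := 'rV[C]_n.

Lemma riem_locally_constant (V : set Cn) (g : Cn -> 'M[C]_n) (G : 'M[C]_n) (z : Cn) (i j k l : 'I_n) : open V -> V z ->
  (forall w, V w -> g w = G) -> riem g i j k l z = 0.
Proof.
move=> oV Vz gG.
have d0 a b w : V w -> dzb j (fun w => g w a b) w = 0.
  by move=> Vw; rewrite (dzb_open _ oV Vw (g := fun=> G a b)) ?dzb_cst // => u Vu; rewrite gG.
have d1 a b : dz k (fun w => g w a b) z = 0.
  by rewrite (dz_open _ oV Vz (g := fun=> G a b)) ?dz_cst // => u Vu; rewrite gG.
rewrite /riem (dz_open _ oV Vz (fun w Vw => d0 i l w Vw)) dz_cst sub0r big1 ?oppr0 // => q _.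
by rewrite big1 // => p _; rewrite d1 mulr0 mul0r.
Qed.

(** The formula for g holds off the origin only; its value at 0 is approached along the coordinate
    axes. *)
Lemma near0_axis (U : set Cn) : open U -> U 0 -> exists2 d : R, 0 < d &
  forall (s : R) (k : 'I_n), 0 < s < d -> U (s%:C *: ebase k) /\ sqnorm (s%:C *: ebase k : Cn) = s ^+ 2.
Proof.
move=> oU U0; have [d d0 H] := open_nvP oU U0; exists d => // s k /andP[s0 sd].
have nE : nv (s%:C *: ebase k : Cn) = s by rewrite nvZr ?ltW // nv_ebase mulr1.
split; last by rewrite -[in RHS]nE nv_sq.
by rewrite -[_ *: _]add0r; apply: H; rewrite nE.
Qed.

Lemma econt0_axis (f : Cn -> C) (e : R) : econt f 0 -> 0 < e -> exists2 d : R, 0 < d &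
  forall (s : R) (k : 'I_n), 0 < s < d -> normc (f (s%:C *: ebase k) - f 0) < e.
Proof.
move=> cf e0; have [d d0 H] := cf e e0; exists d => // s k /andP[s0 sd]; apply: H => j.
rewrite !mxE subr0 normcM normc_real gtr0_norm //; apply: le_lt_trans sd.
rewrite -[leRHS]mulr1 ler_wpM2l ?(ltW s0) //.
have n1 : normc (1 : C) = 1 by rewrite -[1]/((1 : R)%:C) normc_real normr1.
by case: (_ && _); rewrite ?normc0 // n1.
Qed.

End LocallyConstant.

Section ComplexCurve.
Context {R : realType}.
Local Notation C := R[i].
Local Notation C1 := 'rV[C]_1.
Variables (U : set C1) (g : C1 -> 'M[C]_1).
Hypotheses (oU : open U) (kg : kahler_metric U g) (a1 : forall z, U z -> TYZ1 g z = 0).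

(** In dimension one the only curvature component is g times d dbar log g, that is - g Ric, and rho
    = Ric / g. *)
Lemma curve_flat : flat_on g U.
Proof.
have [sg _ pg _] := kg.
pose G z := g z 0 0.
have G0 (z : C1) : U z -> 0 < G z.
  move=> Uz; have v0 : (const_mx 1 : C1) != 0.
    by apply/eqP => /rowP/(_ 0); rewrite !mxE => /eqP; rewrite oner_eq0.
  by have := pg z _ Uz v0; rewrite mxE big_ord1 mxE big_ord1 !mxE rmorph1 mulr1 mul1r.
pose u (z : C1) := complex.Re (G z).
have uE (z : C1) : U z -> G z = (u z)%:C.
  by move=> /G0; rewrite ltcE /= => /andP[/eqP I0 _]; rewrite /u; case: (G z) I0 => a b /= ->.
have u0 (z : C1) : U z -> 0 < u z by move=> Uz; have := G0 z Uz; rewrite uE // ltcR.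
have wu (z : C1) : U z -> wdiff (fun w => (u w)%:C) z.
  move=> Uz; apply: (wdiff_open oU Uz (g := G)) => [w Uw|]; first by rewrite uE.
  exact: (smooth_wdiff (sg 0 0) Uz).
have ginvE (z : C1) : U z -> ginv g z 0 0 = (G z)^-1.
  move=> Uz; have Gn : G z != 0 by rewrite gt_eqF // G0.
  have gu : g z \in unitmx by rewrite unitmxE det_mx11 unitfE.
  have := congr1 (fun M : 'M[C]_1 => M 0 0) (mulVmx gu); rewrite mxE big_ord1 mxE eqxx => H.
  by rewrite /ginv mxE; apply: (mulIf Gn); rewrite mulVf.
have dl (w : C1) : U w -> dzb 0 (logdet g) w = ((u w)^-1)%:C * dzb 0 G w.
  move=> Uw; rewrite (dzb_open _ oU Uw (g := fun w => (ln (u w))%:C)); last first.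
    by move=> v Uv; rewrite /logdet det_mx11.
  rewrite (dzb_comp _ (wu w Uw) (is_derive1_ln (u0 w Uw))); congr (_ * _).
  by apply: (dzb_open _ oU Uw) => v Uv; rewrite uE.
have sd : smooth_on U G by exact: sg.
have wd (z : C1) : U z -> wdiff (dzb 0 G) z.
  move=> Uz; apply: wdiffM; first exact: wdiff_cst.
  apply: wdiffD; first exact: smooth_wdiff (smooth_rderive _ sd) Uz.
  by apply: wdiffM; [exact: wdiff_cst|exact: smooth_wdiff (smooth_rderive _ sd) Uz].
move=> z Uz i j k l; rewrite (ord1 i) (ord1 j) (ord1 k) (ord1 l).
have Gn : G z != 0 by rewrite gt_eqF // G0.
have ric0 : ric g 0 0 z = 0.
  have := a1 Uz; rewrite /TYZ1 /scal !big_ord1 ginvE // => /eqP.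
  by rewrite !mulf_eq0 !invr_eq0 (negPf Gn) pnatr_eq0 /= => /eqP.
move: ric0; rewrite /ric (dz_open _ oU Uz dl) dzM; last first.
- exact: wd.
- exact: wdiff_comp (wu z Uz) (is_derive_inv (lt0r_neq0 (u0 z Uz)) (@is_derive_id R R _ 1)).
rewrite (dz_comp _ (wu z Uz) (is_derive_inv (lt0r_neq0 (u0 z Uz)) (@is_derive_id R R (u z) 1))).
have -> : dz 0 (fun w => (u w)%:C) z = dz 0 G z by apply: (dz_open _ oU Uz) => v Uv; rewrite uE.
rewrite rcM rcN !rcV rcX -uE // rc1 /riem !big_ord1 ginvE //.
move: (dz 0 (dzb 0 G) z) (dz 0 G z) (dzb 0 G z) (G z) Gn => a b c d d0 H.
have -> : a - d^-1 * b * c = - d * - (-1 * (d ^+ 2)^-1 * b * c + d^-1 * a) by field.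
by rewrite H mulr0.
Qed.

End ComplexCurve.

Section Simanca.
Context {R : realType} {n : nat}.
Local Notation C := R[i].
Local Notation Cn := 'rV[C]_n.

Lemma simanca_metricE (z : Cn) i j : 0 < sqnorm z ->
  simanca_metric z i j = (1 + (sqnorm z)^-1)%:C * dlt i j + (- (sqnorm z ^+ 2)^-1)%:C * ((z 0 i)^* * z 0 j).
Proof.
move=> z0; rewrite /simanca_metric mxE.
have oW := @punctured_open R n setT openT.
apply: (@ddbar_radial R n _ (fun w => (sqnorm w + ln (sqnorm w))%:C) (fun t => t + ln t) (fun t => 1 + t^-1) _ i j z oW) => //.
- by move=> w [_ w0]; exact: (is_derive_add (@is_derive_id R R _ 1) (is_derive1_ln w0)).
apply: is_derive_eq (is_derive_add (is_derive_const _ 1) (is_derive_inv (lt0r_neq0 z0) (@is_derive_id R R _ 1))) _.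
by rewrite add0r mulN1r.
Qed.

Lemma pullback_scale (al : R) (h : Cn -> 'M[C]_n) (z : Cn) i j :
  pullback (fun w => al%:C *: w) h z i j = (al ^+ 2)%:C * h (al%:C *: z) i j.
Proof.
have d a b : dz a (fun w : Cn => (al%:C *: w) 0 b) z = al%:C * dlt a b.
  have -> : (fun w : Cn => (al%:C *: w) 0 b) = (fun w => al%:C * w 0 b) by apply/funext => w; rewrite mxE.
  by rewrite dzZ ?dz_coord //; exact: wdiff_coord.
rewrite mxE.
have E k : \sum_l dz i (fun w : Cn => (al%:C *: w) 0 k) z * (dz j (fun w : Cn => (al%:C *: w) 0 l) z)^* * h (al%:C *: z) k l
  = dlt i k * ((al ^+ 2)%:C * h (al%:C *: z) k j).
  rewrite -(sum_delta j (fun l => (al ^+ 2)%:C * h (al%:C *: z) k l)) mulr_sumr; apply: eq_bigr => l _.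
  rewrite !d cjM conjRC dltJ (dltC l) rcX; move: (dlt i k) (dlt j l) (h _ _ _) => *; ring.
by rewrite (eq_bigr _ (fun k _ => E k)) (sum_delta i (fun k => (al ^+ 2)%:C * h (al%:C *: z) k j)).
Qed.

End Simanca.

Section Converse.
Context {R : realType} {n : nat}.
Local Notation C := R[i].
Local Notation Cn := 'rV[C]_n.
Variables (U : set Cn) (g : Cn -> 'M[C]_n).
Hypotheses (n_gt1 : (1 < n)%N) (oU : open U) (kg : kahler_metric U g).
Variables (c A : R).
Hypothesis c_gt0 : 0 < c.
Hypothesis gE : forall w i j, U w -> 0 < sqnorm w ->
    g w i j = (c - A / sqnorm w)%:C * dlt i j + (A / sqnorm w ^+ 2)%:C * ((w 0 i)^* * w 0 j).

Let i0 : 'I_n := Ordinal (ltnW n_gt1).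
Let i1 : 'I_n := Ordinal n_gt1.

Let g_cont i j : U 0 -> econt (fun z => g z i j) 0.
Proof. by move=> U0; apply/continuousCnP; have [sg _ _ _] := kg; exact: (sg i j [::] _ U0).1. Qed.

Lemma profile_flat : A = 0 -> flat_on g U.
Proof.
move=> A0.
have gc w i j : U w -> 0 < sqnorm w -> g w i j = c%:C * dlt i j.
  by move=> Uw w0; rewrite gE // A0 !mul0r subr0 addr0.
have gc' w : U w -> g w = \matrix_(i, j) (c%:C * dlt i j).
  (* At the origin the value is forced by continuity, since g is constant on a punctured axis
     nearby. *)
  move=> Uw; apply/matrixP => i j; rewrite mxE; have [wE|w0] := eqVneq w 0; last by rewrite gc // sqnorm_gt0.
  rewrite wE in Uw *; apply/eqP; rewrite eq_sym -subr_eq0 -normc_eq0; apply/eqP/le_anti; rewrite normc_ge0 andbT leNgt.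
  apply/negP => d0; have [d1 d10 H1] := econt0_axis (g_cont i j Uw) d0.
  have [d2 d20 H2] := near0_axis oU Uw; pose s := Num.min d1 d2 / 2.
  have m0 : 0 < Num.min d1 d2 by rewrite lt_min d10.
  have m1 : Num.min d1 d2 <= d1 by rewrite ge_min lexx.
  have m2 : Num.min d1 d2 <= d2 by rewrite ge_min lexx orbT.
  have sm : s < Num.min d1 d2 by rewrite /s; lra.
  have s0 : 0 < s by rewrite divr_gt0.
  have [|Us Es] := H2 s i; first by rewrite s0 (lt_le_trans sm).
  have := H1 s i; rewrite s0 (lt_le_trans sm m1) gc ?ltxx //; first by move=> /(_ isT).
  by rewrite Es exprn_gt0.
move=> z Uz i j k l; exact: riem_locally_constant oU Uz gc'.
Qed.

(** On the second axis the (0, 0) entry of g is c - A / s^2, which is unbounded near 0. *)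
Lemma profile_singular : A != 0 -> ~ U 0.
Proof.
move=> A0 U0; have [d1 d10 H1] := econt0_axis (g_cont i0 i0 U0) ltr01.
have [d2 d20 H2] := near0_axis oU U0.
have Ap : 0 < `|A| by rewrite normr_gt0.
(* The values at s and s / 2 differ by 3 |A| / s^2, but by less than 2 if g is continuous at 0; s <
   1 and s < |A| make this impossible. *)
pose m := Num.min (Num.min d1 d2) (Num.min 1 `|A|).
have m0 : 0 < m by rewrite !lt_min d10 d20 ltr01 Ap.
have [m1 m2 m3 m4] : [/\ m <= d1, m <= d2, m <= 1 & m <= `|A|].
  by rewrite !ge_min !lexx ?orbT.
have val s : 0 < s < m -> normc ((c - A / s ^+ 2)%:C - g 0 i0 i0) < 1.
  move=> /andP[s0 sm]; have [|Us Es] := H2 s i1; first by rewrite s0 (lt_le_trans sm).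
  have := H1 s i1; rewrite s0 (lt_le_trans sm m1) gE //; last by rewrite Es exprn_gt0.
  have -> : (s%:C *: ebase i1 : Cn) 0 i0 = 0 by rewrite !mxE mulr0.
  by rewrite mulr0 mulr0 addr0 /dlt eqxx mulr1 Es => /(_ isT).
pose s := m / 2; have s0 : 0 < s by rewrite divr_gt0.
have s2 : 0 < s / 2 by rewrite divr_gt0.
have sm : s < m by rewrite /s; lra.
have v1 : normc ((c - A / s ^+ 2)%:C - g 0 i0 i0) < 1 by apply: val; rewrite s0.
have v2 : normc ((c - A / (s / 2) ^+ 2)%:C - g 0 i0 i0) < 1 by apply: val; rewrite s2 /=; lra.
have : normc ((3 * A / s ^+ 2)%:C : C) < 2.
  have -> : (3 * A / s ^+ 2)%:C = (c - A / s ^+ 2)%:C - g 0 i0 i0 - ((c - A / (s / 2) ^+ 2)%:C - g 0 i0 i0).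
    have -> : 3 * A / s ^+ 2 = (c - A / s ^+ 2) - (c - A / (s / 2) ^+ 2) by field; rewrite gt_eqF.
    by rewrite [in LHS]rcB; move: (_%:C) (_%:C) (g _ _ _) => *; ring.
  by apply: le_lt_trans (normcD _ _) _; rewrite normc_oppr; lra.
rewrite normc_real normrM normrM (ger0_norm (x := 3)) // (gtr0_norm (x := (s ^+ 2)^-1)) ?invr_gt0 ?exprn_gt0 //.
rewrite ltr_pdivrMr ?exprn_gt0 // => H.
have : s ^+ 2 <= s by rewrite expr2 -[leRHS]mulr1 ler_wpM2l ?ltW //; lra.
lra.
Qed.

Lemma profile_converse : A = 0 \/ n = 2%N -> projectively_induced U g ->
  flat_on g U \/ [/\ n = 2%N, ~ U 0 & exists k al : R, [/\ 0 < k, 0 < al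
    & forall z, U z -> k%:C *: g z = pullback (fun w => al%:C *: w) simanca_metric z]].
Proof.
move=> An [N [F [_ imm]]].
have [A0|A0] := eqVneq A 0; first by left; exact: profile_flat.
case: An => [/eqP|n2]; first by rewrite (negPf A0).
have [Uz|Uz] := pselect (exists p, U p); last by left => z Uz'; case: Uz; exists z.
have U0 := profile_singular A0.
have pos z : U z -> 0 < sqnorm z by move=> Uz'; rewrite sqnorm_gt0; apply/eqP => z0; apply: U0; rewrite -z0.
have An : A < 0.
  (* Only here is the immersion used: a local lift near any point contradicts A > 0. *)
  rewrite lt_neqAle A0 leNgt; apply/negP => Ap.
  have [p Up] := Uz; have [V [f [oV Vp VU [lif hol] gV]]] := imm p Up.
  have [v [v1 vp]] := orth_vector p n_gt1.
  apply: (@no_positive_mass R n V f p v c A oV Vp hol _ _ (pos p Up) v1 vp Ap).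
    by move=> z /lif[].
  by move=> z i j Vz; rewrite -gE ?gV ?mxE //; [exact: VU|exact: pos (VU _ Vz)].
(* Comparison of (c - A / x) / (- A) = c / (- A) + 1 / x with the coefficient alpha^2 + 1 / x of the
   pull-back. *)
right; split=> //; exists (- A)^-1, (Num.sqrt (c / - A)).
have Ap : 0 < - A by rewrite oppr_gt0.
have q0 : 0 < c / - A by rewrite divr_gt0.
split; [by rewrite invr_gt0|by rewrite sqrtr_gt0|].
move=> z Uz'; apply/matrixP => i j; have z0 := pos z Uz'.
rewrite pullback_scale mxE gE // simanca_metricE sqnormZr sqr_sqrtr ?(ltW q0) //; last by rewrite mulr_gt0.
have -> : (((Num.sqrt (c / - A))%:C *: z) 0 i)^* * ((Num.sqrt (c / - A))%:C *: z) 0 j = (c / - A)%:C * ((z 0 i)^* * z 0 j).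
  rewrite !mxE cjM conjRC mulrACA -rcM -expr2 sqr_sqrtr //; exact: ltW.
rewrite !mulrDr !mulrA -!rcM; congr (_%:C * _ + _%:C * _ * _).
all: have := lt0r_neq0 z0; have := lt0r_neq0 Ap; have := lt0r_neq0 c_gt0.
all: move: (sqnorm z) => x c0 AN x0; have AN' : A != 0 by rewrite -oppr_eq0.
all: by field; rewrite ?c0 ?AN' ?x0.
Qed.

End Converse.

(** * The flat metric and the Simanca metric *)

Section BoundedHolomorphic.
Context {R : realType} {n : nat}.
Local Notation C := R[i].
Local Notation Cn := 'rV[C]_n.
Implicit Types (z h w v : Cn) (j : 'I_n) (k N : nat).

Lemma fre_schol (phi : Cn -> C) z d : fre phi z d (fun=> 0) -> schol phi z d.
Proof.
move=> H e /H[t t0 T]; exists t => // h /T; rewrite /wlin.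
by under [X in normc (_ - X)]eq_bigr => j _ do rewrite mulr0 addr0.
Qed.

Lemma fre_dual (f : Cn -> nat -> C) (D : nat -> 'I_n -> C) z (l : nat -> C) N :
  (forall k, fre (fun w => f w k) z (D k) (fun=> 0)) ->
  fre (fun w => \sum_(k < N) l k * f w k) z (fun j => \sum_(k < N) l k * D k j) (fun=> 0).
Proof.
move=> H; elim: N => [|N IH].
  under [fun w : Cn => _]eq_fun do rewrite big_ord0.
  by apply: fre_eq (fre_cst 0 z) _ _ => j; rewrite ?big_ord0.
under [fun w : Cn => _]eq_fun do rewrite big_ord_recr.
apply: fre_eq (freD IH (freZ (l N) (H N))) _ _ => j; rewrite ?big_ord_recr //.
by rewrite mulr0 addr0.
Qed.

(* Cauchy's estimates, applied to the finite linear combinations of the components of f, are uniform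
   in the combination. *)
Lemma l2_holomorphic_components (f : Cn -> nat -> C) : (forall z, l2 (f z)) ->
  (forall z k, exists d, fre (fun w => f w k) z d (fun=> 0)) ->
  (forall z, exists2 M : R, 0 <= M & forall h, nv h <= 4 -> nrm (f (z + h)) <= M) -> l2_holomorphic setT f.
Proof.
move=> lf fd bd; apply/l2_holomorphicP; first exact: openT.
split=> [z _|z _]; first exact: lf.
have [D HD] : exists D : Cn -> nat -> 'I_n -> C, forall w k, fre (fun w => f w k) w (D w k) (fun=> 0).
  have [D' HD'] := choice (fun p : Cn * nat => fd p.1 p.2).
  by exists (fun w k => D' (w, k)) => w k; exact: (HD' (w, k)).
have [M M0 HM] := bd z.
pose phi (l : nat -> C) N w := \sum_(k < N) (l k)^* * f w k.
pose dphi (l : nat -> C) N w j := \sum_(k < N) (l k)^* * D w k j.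
(* The Cauchy estimates above are used with r = 1 on the ball of radius 4. *)
have Hphi l N h : nv h <= 4 * 1 -> schol (phi l N) (z + h) (dphi l N (z + h)) /\
    normc (phi l N (z + h)) <= M * Num.sqrt (psum l N).
  rewrite mulr1 => h4; split; first by apply: fre_schol; exact: (fre_dual (fun k => (l k)^*) N (HD (z + h))).
  apply: le_trans (finite_dual_bound _ _ _) _; rewrite mulrC ler_wpM2r ?sqrtr_ge0 //.
  apply: le_trans (HM _ h4); rewrite ler_sqrt ?psum_le //; exact: l2normsq_ge0.
have ld j : l2 (fun k => D z k j).
  apply: (l2_bounded (B := (2 * M) ^+ 2) _).1 => N; apply: nrm_le_dual => [|l]; first by rewrite mulr_ge0.
  have := @schol_deriv_bound R n (phi l N) (dphi l N) z 1 (M * Num.sqrt (psum l N)) ltr01 (@Hphi l N) 0 (ebase j).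
  rewrite nv0 addr0 nv_ebase !mulr1 => /(_ _); rewrite mulrA.
  have -> : \sum_j0 (ebase j : Cn) 0 j0 * dphi l N z j0 = \sum_(k < N) (l k)^* * D z k j.
    rewrite (bigD1 j) //= big1 => [|i ij]; first by rewrite ebaseE eqxx mul1r addr0.
    by rewrite ebaseE eq_sym (negPf ij) mul0r.
  by apply.
exists (fun j k => D z k j); split=> // e e0.
have M1 : 0 < 4 * M + 1 by rewrite ltr_wpDl // mulr_ge0.
exists (Num.min 2 (e / (4 * M + 1))) => [|h]; first by rewrite lt_min ltr0n divr_gt0.
rewrite lt_min => /andP[h2 h3]; split; first exact: lf.
have nh := nv_ge0 h; have nh2 : 0 <= nv h ^+ 2 by rewrite sqr_ge0.
have lr : l2 (fun k => f (z + h) k - f z k - \sum_j h 0 j * D z k j).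
  by apply: l2B; [exact: l2B|apply: l2_sum => j; exact: l2Z].
have B0 : 0 <= 4 * M * nv h ^+ 2 by rewrite !mulr_ge0.
apply: le_trans (_ : 4 * M * nv h ^+ 2 <= _); last first.
  rewrite expr2 mulrA ler_wpM2r //; move: h3; rewrite ltr_pdivlMr // mulrDr mulr1; nra.
rewrite nrm_le //; apply: (l2_bounded _).2 => N; apply: nrm_le_dual => [//|l].
have := @schol_taylor R n (phi l N) (dphi l N) z 1 (M * Num.sqrt (psum l N)) ltr01 (@Hphi l N) 0 h.
rewrite nv0 add0r addr0 expr1n !mulr1 => /(_ (ltW h2)).
have -> : phi l N (z + h) - phi l N z - \sum_j h 0 j * dphi l N z j =
    \sum_(k < N) (l k)^* * (f (z + h) k - f z k - \sum_j h 0 j * D z k j).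
  have -> : \sum_j h 0 j * dphi l N z j = \sum_(k < N) (l k)^* * \sum_j h 0 j * D z k j.
    rewrite (eq_bigr (fun j => \sum_(k < N) (l k)^* * (h 0 j * D z k j))).
      by rewrite exchange_big; apply: eq_bigr => k _; rewrite mulr_sumr.
    by move=> j _; rewrite mulr_sumr; apply: eq_bigr => k _; rewrite mulrCA.
  by rewrite /phi -!sumrB; apply: eq_bigr => k _; rewrite !mulrBr.
by move/le_trans; apply; rewrite mulrA [X in _ <= X]mulrAC.
Qed.

End BoundedHolomorphic.

Section WordSeries.
Context {R : realType} {n : nat}.
Local Notation C := R[i].
Local Notation Cn := 'rV[C]_n.
Variables (c : nat -> R) (E : R -> R).
Hypothesis c_ge0 : forall m, 0 <= c m.
Hypothesis cE : forall x : R, 0 <= x -> series (fun m => c m * x ^+ m) @ \oo --> E x.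
Implicit Types (z : Cn) (w : seq 'I_n).

(** Coordinates are indexed by words rather than multi-indices: |z|^(2 m) is the sum over all words
    of length m of |z_w|^2, without multinomial coefficients. Numbers that encode no word give the
    coordinate 0. *)
Definition wordmap z (k : nat) : C :=
  if (pickle_inv k : option (seq 'I_n)) is Some w then (Num.sqrt (c (size w)))%:C * \prod_(i <- w) z 0 i else 0.

Definition wterm z w : R := c (size w) * \prod_(i <- w) normc (z 0 i) ^+ 2.

Lemma wterm_ge0 z w : 0 <= wterm z w.
Proof. by rewrite mulr_ge0 // prodr_ge0 // => i _; rewrite sqr_ge0. Qed.

Lemma normc_wordmap z k : normc (wordmap z k) ^+ 2 = oapp (wterm z) 0 (pickle_inv k).
Proof.
rewrite /wordmap; case: (pickle_inv k) => [w|]; last by rewrite normc0 expr0n.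
rewrite /= normcM exprMn normc_real (ger0_norm (sqrtr_ge0 _)) sqr_sqrtr // /wterm; congr (_ * _).
elim: w => [|i w IH]; last by rewrite !big_cons normcM exprMn IH.
by rewrite !big_nil -[1]/((1 : R)%:C) normc_real normr1 expr1n.
Qed.

Definition codes K : seq (seq 'I_n) := pmap (fun k => pickle_inv k) (iota 0 K).

Lemma psum_wordmap z K : psum (wordmap z) K = \sum_(w <- codes K) wterm z w.
Proof.
elim: K => [|K IH]; first by rewrite /psum big_ord0 big_nil.
have -> : codes K.+1 = codes K ++ pmap (fun k => pickle_inv k) [:: K].
  by rewrite /codes -pmap_cat -[K.+1]addn1 iotaD.
rewrite /psum big_ord_recr -/(psum _ K) IH big_cat /= normc_wordmap.
by case: (pickle_inv K) => [w|] /=; rewrite ?big_seq1 ?big_nil.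
Qed.

Fixpoint words m : seq (seq 'I_n) :=
  if m is m'.+1 then [seq i :: w | i <- enum 'I_n, w <- words m'] else [:: [::]].

Lemma mem_words m w : (w \in words m) = (size w == m).
Proof.
elim: m w => [|m IH] [|i w] //=.
  by apply/negP => /allpairsP[[j u] [_ _]].
rewrite eqSS -IH; apply/allpairsP/idP => [[[j u] /= [_ ju [_ ->]]]//|Hw].
by exists (i, w); rewrite /= mem_enum.
Qed.

Lemma words_uniq m : uniq (words m).
Proof.
elim: m => [//|m IH] /=; apply: allpairs_uniq => //; first exact: enum_uniq.
by move=> [i w] [j u] _ _ [-> ->].
Qed.

Lemma sum_words z m : \sum_(w <- words m) wterm z w = c m * sqnorm z ^+ m.
Proof.
have -> : \sum_(w <- words m) wterm z w = c m * \sum_(w <- words m) \prod_(i <- w) normc (z 0 i) ^+ 2.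
  rewrite mulr_sumr big_seq [RHS]big_seq; apply: eq_bigr => w.
  by rewrite mem_words => /eqP sw; rewrite /wterm sw.
congr (_ * _); elim: m => [|m IH]; first by rewrite big_seq1 big_nil.
rewrite /= big_allpairs_dep /= exprS -IH /sqnorm mulr_suml -big_enum /=; apply: eq_bigr => i _.
by rewrite mulr_sumr; apply: eq_bigr => w _; rewrite big_cons.
Qed.

Fixpoint short M : seq (seq 'I_n) := if M is M'.+1 then short M' ++ words M' else [::].

Lemma mem_short M w : (w \in short M) = (size w < M)%N.
Proof. by elim: M => [//|M IH]; rewrite /= mem_cat IH mem_words ltnS [in RHS]leq_eqVlt orbC. Qed.

Lemma short_uniq M : uniq (short M).
Proof.
elim: M => [//|M IH] /=; rewrite cat_uniq IH words_uniq andbT /=.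
by apply/hasPn => w; rewrite mem_words mem_short => /eqP->; rewrite ltnn.
Qed.

Lemma sum_short z M : \sum_(w <- short M) wterm z w = series (fun m => c m * sqnorm z ^+ m) M.
Proof.
elim: M => [|M IH]; first by rewrite big_nil /series /= big_geq.
by rewrite /= big_cat /= IH sum_words /series /= big_nat_recr.
Qed.

Lemma le_sum_uniq (T : eqType) (s1 s2 : seq T) (F : T -> R) : (forall x, 0 <= F x) -> uniq s1 ->
  {subset s1 <= s2} -> \sum_(x <- s1) F x <= \sum_(x <- s2) F x.
Proof.
move=> F0; elim: s1 s2 => [|a s IH] s2 /=; first by rewrite big_nil => _ _; rewrite sumr_ge0.
move=> /andP[as_ us] sub; have a2 : a \in s2 by apply: sub; rewrite inE eqxx.
rewrite big_cons (perm_big _ (perm_to_rem a2)) big_cons lerD2l; apply: IH => // x xs.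
have := sub x; rewrite inE xs orbT (perm_mem (perm_to_rem a2)) inE => /(_ isT)/predU1P[xa|//].
by rewrite -xa xs in as_.
Qed.

(** All terms are nonnegative, so partial sums in the order of the codes and partial sums by length
    bound each other through inclusion of finite sets of words. *)
Lemma l2_wordmap z : l2 (wordmap z) /\ l2normsq (wordmap z) = E (sqnorm z).
Proof.
have cvx := cE (sqnorm_ge0 z).
have nd : nondecreasing_seq (series (fun m => c m * sqnorm z ^+ m)).
  apply/nondecreasing_seqP => m; rewrite /series /= big_nat_recr // lerDl; by rewrite mulr_ge0 // exprn_ge0 // sqnorm_ge0.
have limE : limn (series (fun m => c m * sqnorm z ^+ m)) = E (sqnorm z) by exact: cvg_lim cvx.
have up K : psum (wordmap z) K <= E (sqnorm z).
  rewrite psum_wordmap -limE.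
  apply: le_trans (nondecreasing_cvgn_le nd (cvgP _ cvx) (\max_(w <- codes K) size w).+1).
  rewrite -sum_short; apply: le_sum_uniq => [w||w wK]; first exact: wterm_ge0.
    by apply: (pmap_uniq (g := pickle)); [exact: pickle_invK|exact: iota_uniq].
  by rewrite mem_short ltnS; exact: (leq_bigmax_seq _ wK).
have [lz le1] := l2_bounded up; split=> //; apply/le_anti; rewrite le1 /= -limE.
apply: limr_le; first exact: cvgP cvx.
apply: nearW => M; rewrite -sum_short.
apply: le_trans (psum_le (\max_(w <- short M) pickle w).+1 lz).
rewrite psum_wordmap; apply: le_sum_uniq => [w||w wM]; [exact: wterm_ge0|exact: short_uniq|].
rewrite mem_pmap -(pickleK_inv w); apply: map_f; rewrite mem_iota add0n ltnS /=.
exact: (leq_bigmax_seq _ wM).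
Qed.

Lemma wordmap_fre z k : exists d, fre (fun u : Cn => wordmap u k) z d (fun=> 0).
Proof.
rewrite /wordmap; case: (pickle_inv k) => [w|]; last by exists (fun=> 0); exact: fre_cst.
have [d Hd] : exists d, fre (fun u : Cn => \prod_(i <- w) u 0 i) z d (fun=> 0).
  elim: w => [|i w [d Hd]].
    exists (fun=> 0); under [fun u : Cn => _]eq_fun do rewrite big_nil.
    exact: fre_cst.
  eexists; under [fun u : Cn => _]eq_fun do rewrite big_cons.
  apply: fre_eq (freM (fre_coord i z) Hd) _ _ => j; first by reflexivity.
  by rewrite mul0r mulr0 addr0.
by eexists; apply: fre_eq (freZ _ Hd) _ _ => j; [reflexivity|rewrite mulr0].
Qed.

Lemma wordmap_holomorphic : l2_holomorphic setT wordmap.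
Proof.
apply: l2_holomorphic_components => [z|z k|z]; [exact: (l2_wordmap z).1|exact: wordmap_fre|].
exists (Num.sqrt (E ((nv z + 4) ^+ 2))) => [|h h4]; first exact: sqrtr_ge0.
rewrite /nrm (l2_wordmap _).2 ler_wsqrtr //.
have z4 : nv (z + h) <= nv z + 4 by apply: le_trans (nvD _ _) _; rewrite lerD2l.
rewrite -(cvg_lim _ (cE (sqnorm_ge0 (z + h)))) // -(cvg_lim _ (cE (sqr_ge0 (nv z + 4)))) //.
apply: lim_series_le => [||m]; [exact: cvgP (cE (sqnorm_ge0 _))|exact: cvgP (cE (sqr_ge0 _))|].
rewrite ler_wpM2l // -nv_sq lerXn2r // ?nnegrE ?sqr_ge0 // lerXn2r ?nnegrE ?nv_ge0 //.
by rewrite addr_ge0 ?nv_ge0.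
Qed.

Lemma word_immersion (U : set Cn) (g : Cn -> 'M[C]_n) : open U -> (forall z, U z -> 0 < E (sqnorm z)) ->
  (forall z, U z -> g z = potential_metric (fun u : Cn => ln (E (sqnorm u))) z) -> projectively_induced U g.
Proof.
move=> oU E0 gE; exists None, (fun z => cline (wordmap z)).
have N0 z : U z -> wordmap z <> fun=> 0.
  move=> Uz w0; have := E0 z Uz; rewrite -(l2_wordmap z).2 w0.
  have -> : l2normsq (fun=> 0 : C) = 0 by apply/le_anti; rewrite l2normsq_ge0 ?andbT //; last exact: l2_0; apply: (l2_bounded _).2 => N; rewrite /psum big1 // => k _; rewrite normc0 expr0n.
  by rewrite ltxx.
split=> [z Uz|p Up]; first by exists (wordmap z); split=> //; [split=> //; exact: (l2_wordmap z).1|exact: N0].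
exists U, wordmap; split; [exact: oU|exact: Up|by move=> z| |].
  split=> [z Uz|]; first by split=> //; [split=> //; exact: (l2_wordmap z).1|exact: N0].
  by have [h1 h2] := wordmap_holomorphic; split=> z _; [exact: h1|exact: h2].
have PE : (fun u : Cn => fubini_study_potential (wordmap u)) = (fun u => ln (E (sqnorm u))).
  by apply/funext => u; rewrite /fubini_study_potential (l2_wordmap u).2.
by move=> z Uz; rewrite PE; exact: gE.
Qed.

End WordSeries.

Section ConstantMetric.
Context {R : realType} {n : nat}.
Local Notation C := R[i].
Local Notation Cn := 'rV[C]_n.
Local Notation g := (fun _ : Cn => 1%:M : 'M[C]_n).

(** The flat metric includes the origin, where the formulas in terms of a positive |z|^2 do not
    apply; its invariants are computed directly. *)
Lemma const_riem i j k l : riem g i j k l = fun=> 0.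
Proof. by apply/funext => z; exact: (riem_locally_constant (V := setT) (G := 1%:M)) openT I _. Qed.

Lemma const_ric i j : ric g i j = fun=> 0.
Proof.
apply/funext => z; rewrite /ric; have -> : dzb j (logdet g) = fun=> 0.
  by apply/funext => w; exact: dzb_cst.
by rewrite dz_cst oppr0.
Qed.

Lemma const_scal : scal g = fun=> 0.
Proof.
apply/funext => z; rewrite /scal big1 // => i _; rewrite big1 // => j _.
by rewrite const_ric mulr0.
Qed.

Lemma const_dric i j k : dric g i j k = fun=> 0.
Proof.
apply/funext => z; rewrite /dric !const_ric dz_cst sub0r big1 ?oppr0 // => p _.
by rewrite const_ric mulr0.
Qed.

Lemma lap_cst (g' : Cn -> 'M[C]_n) (a : C) : lap g' (fun=> a) = fun=> 0.
Proof.
apply/funext => z; rewrite /lap big1 // => i _; rewrite big1 // => j _.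
have -> : dzb j (fun _ : Cn => a) = fun=> 0 by apply/funext => w; rewrite dzb_cst.
by rewrite dz_cst mulr0.
Qed.

Lemma const_mixed i j z : ric_mixed g z i j = 0.
Proof. by rewrite /ric_mixed /mixed2 big1 // => a _; rewrite const_ric mulr0. Qed.

Lemma const_riem_mixed i j k l z : riem_mixed g z i j k l = 0.
Proof.
rewrite /riem_mixed /mixed4 big1 // => a _; rewrite big1 // => b _.
by rewrite const_riem mulr0.
Qed.

Lemma const_TYZ1 z : TYZ1 g z = 0.
Proof. by rewrite /TYZ1 const_scal mulr0. Qed.

Lemma const_TYZ3 z : TYZ3 g z = 0.
Proof.
have riem2 w : riem_normsq g w = 0.
  do 8![apply: big1 => ? _]; by rewrite !const_riem mul0r mulr0.
have ric2 w : ric_normsq g w = 0.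
  do 4![apply: big1 => ? _]; by rewrite !const_ric mul0r mulr0.
have dscal2 : dscal_normsq g z = 0.
  do 2![apply: big1 => ? _]; by rewrite const_scal dz_cst mul0r mulr0.
have dric2 : dric_normsq g z = 0.
  do 6![apply: big1 => ? _]; by rewrite !const_dric mul0r mulr0.
have s3 : sigma3 g z = 0 by do 3![apply: big1 => ? _]; rewrite !const_mixed !mulr0.
have RR : R_Ric_Ric g z = 0 by do 4![apply: big1 => ? _]; rewrite !const_mixed !mulr0.
have RRR : Ric_R_R g z = 0 by do 5![apply: big1 => ? _]; rewrite !const_mixed !mul0r.
have hess : ric_hess_scal g z = 0 by do 2![apply: big1 => ? _]; rewrite const_mixed mul0r.
have ddr : \sum_i \sum_j \sum_k \sum_l ddric_mixed g z i j k l * riem_mixed g z j i l k = 0.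
  by do 4![apply: big1 => ? _]; rewrite const_riem_mixed mulr0.
rewrite /TYZ3 /divdiv_R_Ric /divdiv_scal_Ric hess dric2 dscal2 RR s3 RRR ddr ric2 riem2 const_scal !lap_cst.
have -> : (fun w => riem_normsq g w - 4 * ric_normsq g w + 8 * 0 ^+ 2) = fun=> 0.
  by apply/funext => w; rewrite riem2 ric2; ring.
by rewrite lap_cst; ring.
Qed.

End ConstantMetric.

Section Flat.
Context {R : realType} {n : nat}.
Local Notation C := R[i].
Local Notation Cn := 'rV[C]_n.

Lemma flat_metricE : (flat_metric : Cn -> 'M[C]_n) = fun=> 1%:M.
Proof.
apply/funext => z; apply/matrixP => i j; rewrite /flat_metric !mxE.
have -> : dzb j (fun w : Cn => (sqnorm w)%:C) = fun w => w 0 j by apply/funext => w; rewrite dzb_sqnorm.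
by rewrite dz_coord.
Qed.

Lemma hermsymmx_entries (M : 'M[C]_n) : (forall i j, (M i j)^* = M j i) -> M \is hermsymmx.
Proof.
move=> H; apply/is_hermitianmxP; rewrite expr0 scale1r; apply/matrixP => i j.
by rewrite !mxE H.
Qed.

Lemma flat_kahler : kahler_metric setT (flat_metric : Cn -> 'M[C]_n).
Proof.
rewrite flat_metricE; split.
- by move=> i j; apply: csm_smooth => m; exact: csm_cst.
- by move=> z _; apply: hermsymmx_entries => i j; rewrite !mxE eq_sym cj_nat.
- move=> z v _ v0; rewrite (@qform_radial R n _ 0 v 1 0) => [|i j].
    by rewrite ltcR mul0r addr0 mul1r sqnorm_gt0.
  by rewrite !mxE mul1r mul0r addr0.
- by move=> i j k z _; rewrite !dz_cst.
Qed.

Lemma flat_radial : radial setT (flat_metric : Cn -> 'M[C]_n).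
Proof.
exists (@sqnorm R n); split=> //; last by exists id.
by apply: csm_smooth => m; exact: csm_sqnorm openT.
Qed.

Lemma exp_series (x : R) : series (fun m => m`!%:R^-1 * x ^+ m) @ \oo --> expR x.
Proof.
have -> : (fun m => m`!%:R^-1 * x ^+ m) = exp_coeff x.
  by apply/funext => m; rewrite /exp_coeff /= mulrC.
exact: is_cvg_series_exp_coeff.
Qed.

Lemma flat_projectively_induced : projectively_induced setT (flat_metric : Cn -> 'M[C]_n).
Proof.
apply: (@word_immersion R n (fun m => m`!%:R^-1) expR) => [m|x _||z _|z _].
- by rewrite invr_ge0.
- exact: exp_series.
- exact: openT.
- exact: expR_gt0.
rewrite /flat_metric; congr (potential_metric _ z); apply/funext => w; by rewrite expRK.
Qed.

End Flat.

Section SimancaMetric.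
Context {R : realType}.
Local Notation C := R[i].
Local Notation C2 := 'rV[C]_2.
Local Notation U := (~` [set 0] : set C2).

Let pos (z : C2) : U z -> 0 < sqnorm z.
Proof. by move=> z0; rewrite sqnorm_gt0; exact/eqP. Qed.

Let oU : open U.
Proof.
have -> : U = [set w | setT w /\ 0 < sqnorm w]; last exact: punctured_open openT.
apply/seteqP; split=> z /=; first by move=> z0; split=> //; exact: pos.
by move=> [_]; rewrite sqnorm_gt0 => /eqP.
Qed.

Let csm_sq m : csm m U (fun w => (sqnorm w)%:C).
Proof. exact: csm_sqnorm. Qed.

Let dpos (t : R) : [set t | 0 < t] t -> is_derive t 1 (fun s : R => 1 + s^-1) (- (t ^+ 2)^-1).
Proof.
move=> t0; apply: is_derive_eq (is_derive_add (is_derive_const _ 1) (is_derive_inv (lt0r_neq0 t0) (@is_derive_id R R _ 1))) _.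
by rewrite add0r mulN1r.
Qed.

Lemma simanca_kahler : kahler_metric U (simanca_metric : C2 -> 'M[C]_2).
Proof.
have gE (z : C2) i j : U z -> simanca_metric z i j = (1 + (sqnorm z)^-1)%:C * dlt i j + (- (sqnorm z ^+ 2)^-1)%:C * ((z 0 i)^* * z 0 j).
  by move=> /pos; exact: simanca_metricE.
have sq0 (z : C2) : U z -> (sqnorm z)%:C != 0 :> C by move=> /pos/lt0r_neq0; rewrite rc_eq0.
split.
- move=> i j; apply: csm_smooth => m.
  apply: (csm_open oU (g := fun z => (1 + ((sqnorm z)%:C)^-1) * dlt i j + (-1 * (((sqnorm z)%:C)^-1 * ((sqnorm z)%:C)^-1)) * ((z 0 i)^* * z 0 j))).
    by move=> z Uz; rewrite gE // rcD rcN !rcV rcX expr2 invfM mulN1r.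
  have ci : csm m U (fun z => ((sqnorm z)%:C)^-1) by apply: csm_inv.
  apply: csmD => //.
    by apply: csmM => //; [apply: csmD => //; exact: csm_cst|exact: csm_cst].
  apply: csmM => //; first by apply: csmM => //; [exact: csm_cst|exact: csmM].
  by apply: csmM => //; [apply: csmJ => //; exact: csm_coord|exact: csm_coord].
- move=> z Uz; apply: hermsymmx_entries => i j; rewrite !gE // cjD !cjM !conjRC conjCK dltJ.
  by congr (_ + _ * _); rewrite mulrC.
- move=> z v Uz v0; have z0 := pos Uz; rewrite (qform_radial v (fun i j => gE z i j Uz)) ltcR.
  have v1 : 0 < sqnorm v by rewrite sqnorm_gt0.
  (* By Cauchy-Schwarz the negative part of the metric is dominated by the potential term 1 /
     |z|^2. *)
  have cs : normc (\sum_i v 0 i * (z 0 i)^*) ^+ 2 <= sqnorm v * sqnorm z.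
    apply: le_trans (_ : (\sum_i normc (v 0 i) * normc (z 0 i)) ^+ 2 <= _); last exact: finite_cauchy_schwarz.
    rewrite lerXn2r ?nnegrE ?normc_ge0 ?sumr_ge0 // => [i _|]; first by rewrite mulr_ge0 ?normc_ge0.
    apply: le_trans (normc_sum _ _ _) _; apply: ler_sum => i _; by rewrite normcM normc_conj.
  have -> : (1 + (sqnorm z)^-1) * sqnorm v + - (sqnorm z ^+ 2)^-1 * normc (\sum_i v 0 i * (z 0 i)^*) ^+ 2 =
     sqnorm v + (sqnorm v * sqnorm z - normc (\sum_i v 0 i * (z 0 i)^*) ^+ 2) / sqnorm z ^+ 2.
    by field; rewrite gt_eqF.
  by rewrite ltr_pwDl // divr_ge0 ?sqr_ge0 // subr_ge0.
- move=> i j k z Uz; have z0 := pos Uz.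
  rewrite (dz_open _ oU Uz (fun w Uw => gE w i j Uw)) (dz_open _ oU Uz (fun w Uw => gE w k j Uw)).
  have d2 : is_derive (sqnorm z) 1 (fun t : R => - (t ^+ 2)^-1) (2 / sqnorm z ^+ 3).
    have -> : (fun t : R => - (t ^+ 2)^-1) = (fun t => - (t * t)^-1) by apply/funext => t; rewrite expr2.
    have zz : sqnorm z * sqnorm z != 0 by rewrite mulf_neq0 // gt_eqF.
    have H := is_derive_opp (@is_derive_inv R (fun t => t * t) _ _ zz (is_derive_mul (@is_derive_id R R (sqnorm z) 1) (@is_derive_id R R (sqnorm z) 1))).
    by apply: is_derive_eq H _; field; rewrite gt_eqF.
  rewrite !(dz_rad2s _ _ _ (dpos z0) d2) /rad3.
  move: ((z 0 k)^*) ((z 0 i)^*) (z 0 j) (dlt i j) (dlt k j) (_%:C) (_%:C) => *; ring.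
Qed.

Lemma simanca_radial : radial U (simanca_metric : C2 -> 'M[C]_2).
Proof.
exists (fun z => sqnorm z + ln (sqnorm z)); split=> //; last by exists (fun t => t + ln t).
apply: csm_smooth => m; apply: (csm_open oU (g := fun z => (sqnorm z)%:C + (ln (sqnorm z))%:C)).
  by move=> w _; rewrite rcD.
by apply: csmD => //; exact: csm_ln.
Qed.

Lemma simanca_projectively_induced : projectively_induced U (simanca_metric : C2 -> 'M[C]_2).
Proof.
apply: (@word_immersion R 2 (fun m => if m is m'.+1 then m'`!%:R^-1 else 0) (fun x => x * expR x)) => [m|x x0||z Uz|z Uz].
- by case: m => [//|m]; rewrite invr_ge0.
- rewrite -cvg_shiftS.
  have -> : (fun m => series (fun m => (if m is m'.+1 then m'`!%:R^-1 else 0) * x ^+ m) m.+1) =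
     (fun m => x * series (fun m => m`!%:R^-1 * x ^+ m) m).
    apply/funext => m; rewrite /series /= big_nat_recl // mul0r add0r mulr_sumr; apply: eq_bigr => i _.
    by rewrite exprS mulrCA.
  by apply: cvgMr; exact: exp_series.
- exact: oU.
- by rewrite mulr_gt0 ?expR_gt0 ?pos.
rewrite /simanca_metric; congr (potential_metric _ z); apply/funext => w.
(* The potentials are compared as functions on all of C^2; at the origin both are 0 because [ln] is
   0 there. *)
have [->|w0] := eqVneq w 0.
  have -> : sqnorm (0 : C2) = 0 by rewrite /sqnorm big1 // => j _; rewrite mxE normc0 expr0n.
  by rewrite mul0r ln0 // addr0.
by rewrite lnM ?posrE ?expR_gt0 ?sqnorm_gt0 // expRK addrC.
Qed.

(** The profile y = c x - A of the Simanca metric, with c = 1 and A = - 1. *)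
Let A : R := -1.
Let y (t : R) := t + 1.
Let D : set R := [set t | 0 < t].

Lemma simanca_TYZ (z : C2) : U z -> TYZ1 simanca_metric z = 0 /\ TYZ3 simanca_metric z = 0.
Proof.
move=> Uz.
have D_gt0 (t : R) : D t -> 0 < t by [].
have y_gt0 (t : R) : D t -> 0 < y t by move=> t0; rewrite ltr_wpDr // ltW.
have chiE (t : R) : D t -> sfchi 2 A 0 y t = -1.
  move=> /y_gt0 t0; rewrite /sfchi /Yn /A !mul0r addr0 mulfK //.
  by rewrite expf_neq0 // gt_eqF.
have psiE (t : R) : D t -> psi y (sfchi 2 A 0 y) t = t by move=> Dt; rewrite /psi chiE // /y addrK.
have psi_gt0 (t : R) : D t -> 0 < psi y (sfchi 2 A 0 y) t by move=> Dt; rewrite psiE.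
have dy (t : R) : D t -> is_derive t 1 y (psi y (sfchi 2 A 0 y) t / t).
  move=> Dt; rewrite psiE //; apply: is_derive_eq (is_derive_add (@is_derive_id R R t 1) (is_derive_const t 1)) _.
  by rewrite addr0 divff // gt_eqF // D_gt0.
have UD (w : C2) : U w -> D (sqnorm w) by exact: pos.
have gE (w : C2) (i j : 'I_2) : U w -> simanca_metric w i j =
    (pfa y (sqnorm w))%:C * dlt i j + (pfb (sfchi 2 A 0 y) (sqnorm w))%:C * ((w 0 i)^* * w 0 j).
  move=> Uw; have w0 : sqnorm w != 0 by rewrite gt_eqF // pos.
  rewrite simanca_metricE ?pos // /pfa /pfb chiE; last exact: UD.
  by congr (_%:C * _ + _%:C * _); rewrite /y; field.
split; first exact: (scalar_flat_TYZ1 (isT : (0 < 2)%N) D_gt0 y_gt0 psi_gt0 dy oU UD gE Uz).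
rewrite (scalar_flat_TYZ3 (isT : (0 < 2)%N) D_gt0 y_gt0 psi_gt0 dy oU UD gE Uz) /sfTYZ3.
(* With B = 0 every remaining term of a_3 carries the factor n - 2. *)
have -> : (2%N%:R : R) - 2 = 0 by rewrite subrr.
rewrite /A; move: (y _)^-1 (Yn _ _ _) => *; rewrite -rc0; congr (_%:C); ring.
Qed.

End SimancaMetric.

Theorem corollary1p2 (R : realType) :
  (* (i) *)
  (forall n : nat, (0 < n)%N ->
     let g : 'rV[R[i]]_n -> 'M[R[i]]_n := flat_metric in
     [/\ kahler_metric setT g, radial setT g, projectively_induced setT g
       & forall z, TYZ1 g z = 0 /\ TYZ3 g z = 0]) /\
  (let U : set 'rV[R[i]]_2 := ~` [set 0] in
   let g : 'rV[R[i]]_2 -> 'M[R[i]]_2 := simanca_metric in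
   [/\ kahler_metric U g, radial U g, projectively_induced U g
     & forall z, U z -> TYZ1 g z = 0 /\ TYZ3 g z = 0]) /\
  (* (ii) *)
  (forall (n : nat) (U : set 'rV[R[i]]_n) (g : 'rV[R[i]]_n -> 'M[R[i]]_n),
     (0 < n)%N -> open U -> connected U ->
     kahler_metric U g -> radial U g -> projectively_induced U g ->
     (forall z, U z -> TYZ1 g z = 0) ->
     (forall z, U z -> TYZ3 g z = 0) ->
     flat_on g U \/
     [/\ n = 2%N, ~ U 0
       & exists c alpha : R, [/\ 0 < c, 0 < alpha
         & forall z, U z ->
             c%:C *: g z =
             pullback (fun w => alpha%:C *: w) simanca_metric z]]).
Proof.
split=> [n n0 g|].
  split; rewrite /g; [exact: flat_kahler|exact: flat_radial|exact: flat_projectively_induced|].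
  by move=> z; rewrite flat_metricE const_TYZ1 const_TYZ3.
split=> [U g|n U g n0 oU cU kg rg pg a1 a3].
  split; [exact: simanca_kahler|exact: simanca_radial|exact: simanca_projectively_induced|].
  exact: simanca_TYZ.
have [n1|n1] := ltnP 1 n.
  have [c [A [c0 An gE]]] := radial_profile n1 oU cU kg rg a1 a3.
  exact: (profile_converse n1 oU kg c0 gE An pg).
have nE : n = 1%N by apply/eqP; rewrite eqn_leq n1.
by subst n; left; exact: curve_flat oU kg a1.
Qed.
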